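(* Let $\overline\theta$ be the static Néel wall phase, and let $\mathcal L,\mathcal L_\infty:L^2\to L^2$ be the operators with common domain $H^2$ given by $$\mathcal L u=-\partial_x^2u+\sin\overline\theta\,(1+(-\Delta)^{1/2})(u\sin\overline\theta)-c_\theta u,\qquad \mathcal L_\infty u=-\partial_x^2u+(1+(-\Delta)^{1/2})u,$$ where $c_\theta=\cos\overline\theta\,(1+(-\Delta)^{1/2})\cos\overline\theta$. Then $\mathcal L$ is a relatively compact perturbation of $\mathcal L_\infty$, and $\mathcal L$ and $\mathcal L_\infty$ have the same essential spectrum.
   Context: $L^2$ and $H^k$ denote $L^2(\mathbb R,\mathbb C)$ and $H^k(\mathbb R,\mathbb C)$. The half-Laplacian is $(-\Delta)^{1/2}u=(|\xi|\hat u)^\vee$ and $\|u\|_{\dot H^{1/2}}=\||\xi|^{1/2}\hat u\|_{L^2}$ (unitary Fourier transform). The static Néel wall phase $\overline\theta:\mathbb R\to(-\pi/2,\pi/2)$ is the minimizer of $\mathcal E(\theta)=\frac12\big(\|\theta'\|_{L^2}^2+\|\cos\theta\|_{\dot H^{1/2}}^2+\|\cos\theta\|_{L^2}^2\big)$ among $\theta:\mathbb R\to(-\pi/2,\pi/2)$ with $\theta(\pm\infty)=\pm\pi/2$, normalized by $\overline\theta(0)=0$. It is known (earlier work) that $\overline\theta$ exists, that minimizers are unique up to translation, that $\overline\theta$ is smooth, $\partial_x\overline\theta>0$ on $\mathbb R$, $\partial_x\overline\theta\in H^2$, and $\partial_x^2\overline\theta+\sin\overline\theta\,(1+(-\Delta)^{1/2})\cos\overline\theta=0$.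 For linear operators $\mathcal P,\mathcal S$ on a Banach space $X$, $\mathcal S$ is a relatively compact perturbation of $\mathcal P$ if for some $\lambda$ in the resolvent set $\rho(\mathcal P)$ the operator $(\mathcal P-\mathcal S)(\lambda I-\mathcal P)^{-1}:X\to X$ is compact. The essential spectrum of a closed operator $\mathcal P$ is the set of $\lambda\in\mathbb C$ such that $\mathcal P-\lambda$ is either not Fredholm or is Fredholm with index different from zero. *)

(* Defs.v *)
From HB Require Import structures.
From mathcomp Require Import all_boot all_order all_algebra.
From mathcomp Require Import generic_quotient ring_quotient complex.
From mathcomp Require Import all_classical all_reals all_analysis.
From mathcomp Require Import measurable_realfun.

Set Implicit Arguments.
Unset Strict Implicit.
Unset Printing Implicit Defensive.

Import Order.TTheory GRing.Theory Num.Theory.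
Import numFieldNormedType.Exports.
Import ComplexField.Normc.

Local Open Scope classical_set_scope.
Local Open Scope ring_scope.
Local Open Scope complex_scope.

(* [op_fun] is a total function; only its values on [op_dom] are meaningful. *)
Record operator (X : Type) := Operator {
  op_dom : set X;
  op_fun : X -> X
}.

Section Operators.
Variables (K : numFieldType) (X : normedModType K).
Implicit Types (P S : operator X) (V : set X) (T : X -> X).

Definition resolvent_set P : set K := [set lambda |
  (forall v, exists! u, op_dom P u /\ lambda *: u - op_fun P u = v) /\
  (exists M : K, forall u, op_dom P u ->
     `|u| <= M * `|lambda *: u - op_fun P u|)].

Definition resolvent P (lambda : K) : X -> X := fun v =>
  xget 0 [set u | op_dom P u /\ lambda *: u - op_fun P u = v].

Definition compact_operator T :=
  linear T /\ forall A : set X, bounded_set A -> precompact (T @` A).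

(* S is the perturbation, P the reference operator. The inclusion of the
   domains makes (P - S)(lambda - P)^-1 everywhere defined. *)
Definition relatively_compact_perturbation P S :=
  op_dom P `<=` op_dom S /\
  exists2 lambda, resolvent_set P lambda &
    compact_operator (fun v =>
      op_fun P (resolvent P lambda v) - op_fun S (resolvent P lambda v)).

Definition has_dim V (n : nat) := exists e : 'I_n -> X,
  (forall a : 'I_n -> K, \sum_i a i *: e i = 0 -> forall i, a i = 0) /\
  V = range (fun a : 'I_n -> K => \sum_i a i *: e i).

(* The classes of the e_i form a basis of X / V. *)
Definition has_codim V (n : nat) := exists e : 'I_n -> X,
  (forall a : 'I_n -> K, V (\sum_i a i *: e i) -> forall i, a i = 0) /\
  (forall x, exists a : 'I_n -> K, V (x - \sum_i a i *: e i)).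

Definition op_ker P : set X := [set u | op_dom P u /\ op_fun P u = 0].

Definition op_range P : set X := op_fun P @` op_dom P.

Definition fredholm_of_index P (k : int) :=
  closed (op_range P) /\
  exists n m : nat,
    [/\ has_dim (op_ker P) n, has_codim (op_range P) m & k = n%:Z - m%:Z].

Definition fredholm P := exists k, fredholm_of_index P k.

Definition op_shift P (lambda : K) : operator X :=
  Operator (op_dom P) (fun u => op_fun P u - lambda *: u).

Definition essential_spectrum P : set K := [set lambda |
  ~ fredholm (op_shift P lambda) \/
  exists2 k, fredholm_of_index (op_shift P lambda) k & k != 0].

End Operators.

Section L2.
Variable R : realType.
Local Notation mu := (@lebesgue_measure R).
Implicit Types f g : R -> R[i].

Definition cmeasurable f :=
  measurable_fun [set: R] (@complex.Re R \o f) /\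
  measurable_fun [set: R] (@complex.Im R \o f).

Definition L2norm f : \bar R := 'N[mu]_2%:E[EFin \o (@normc R \o f)]%E.

Definition is_L2 f := cmeasurable f /\ (L2norm f < +oo)%E.

Lemma cmeasurable0 : cmeasurable 0.
Proof. by split; exact: measurable_cst. Qed.

Lemma cmeasurable_lin (a : R[i]) f g :
  cmeasurable f -> cmeasurable g -> cmeasurable (a *: f + g).
Proof.
case: a => a b [f1 f2] [g1 g2]; split.
- rewrite (_ : _ \o _ = (fun x => a * complex.Re (f x) - b * complex.Im (f x)
      + complex.Re (g x))); last first.
    apply/funext => x /=; rewrite /GRing.add/= /GRing.scale/=.
    by case: (f x) => ? ?; case: (g x).
  by apply: measurable_funD => //; apply: measurable_funB;
    apply: measurable_funM.
- rewrite (_ : _ \o _ = (fun x => a * complex.Im (f x) + b * complex.Re (f x)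
      + complex.Im (g x))); last first.
    apply/funext => x /=; rewrite /GRing.add/= /GRing.scale/=.
    by case: (f x) => ? ?; case: (g x).
  by apply: measurable_funD => //; apply: measurable_funD;
    apply: measurable_funM.
Qed.

Lemma measurable_normc f :
  cmeasurable f -> measurable_fun [set: R] (@normc R \o f).
Proof.
move=> [f1 f2].
rewrite (_ : _ \o _ = @Num.sqrt R \o (fun x => complex.Re (f x) ^+ 2 +
    complex.Im (f x) ^+ 2)); last by apply/funext => x /=; case: (f x).
apply: measurableT_comp.
  by apply: continuous_measurable_fun; exact: sqrt_continuous.
by apply: measurable_funD; apply: measurable_funX.
Qed.

Lemma normc_ge0 (z : R[i]) : 0 <= normc z.
Proof. by case: z => a b; exact: sqrtr_ge0. Qed.

Lemma L2norm_ge0 f : (0 <= L2norm f)%E.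
Proof. exact: Lnorm_ge0. Qed.

Lemma L2norm0 : L2norm 0 = 0%E.
Proof.
rewrite /L2norm (_ : _ \o _ = cst 0%E) ?Lnorm0 ?eqe//.
by apply/funext => x; exact: (congr1 EFin (@normc0 R)).
Qed.

Lemma L2norm_le f (g : R -> R) : cmeasurable f -> measurable_fun [set: R] g ->
  (forall x, normc (f x) <= g x) -> (L2norm f <= 'N[mu]_2%:E[EFin \o g])%E.
Proof.
move=> mf mg fg.
have g0 x : 0 <= g x by exact: le_trans (normc_ge0 _) (fg x).
rewrite /L2norm unlock; apply: gt0_ler_poweR.
- by rewrite invr_ge0.
- by rewrite in_itv/= leey andbT integral_ge0// => x _; rewrite poweR_ge0.
- by rewrite in_itv/= leey andbT integral_ge0// => x _; rewrite poweR_ge0.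
apply: ge0_le_integral => //=.
- by apply/measurable_EFinP; apply: (measurableT_comp (measurable_powR 2));
    apply: measurableT_comp => //; exact: measurable_normc.
- by apply/measurable_EFinP; apply: (measurableT_comp (measurable_powR 2));
    apply: measurableT_comp.
- move=> x _; rewrite lee_fin; apply: ge0_ler_powR; rewrite ?nnegrE//.
  by rewrite !ger0_norm ?normc_ge0.
Qed.

Lemma L2normD f g : cmeasurable f -> cmeasurable g ->
  (L2norm (f + g)%R <= L2norm f + L2norm g)%E.
Proof.
move=> mf mg.
have := minkowski_EFin mu (measurable_normc mf) (measurable_normc mg)
  (ler1n _ 2).
apply: le_trans; apply: L2norm_le.
- by rewrite -[f]scale1r; exact: cmeasurable_lin.
- by apply: measurable_funD; exact: measurable_normc.
- by move=> x; exact: le_normcD.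
Qed.

Lemma L2normZ (a : R[i]) f : cmeasurable f ->
  L2norm (a *: f) = ((normc a)%:E * L2norm f)%E.
Proof.
move=> mf; rewrite /L2norm unlock.
under eq_integral => x _.
  rewrite /= [normc _]normcM normrM powRM ?EFinM//; over.
have mN : measurable_fun [set: R] (fun x => `|normc (f x)| `^ 2).
  by apply: (measurableT_comp (measurable_powR 2)); apply: measurableT_comp => //;
    exact: measurable_normc.
rewrite ge0_integralZl//=; last first.
  exact/measurable_EFinP.
rewrite poweRM ?lee_fin ?powR_ge0//; last by rewrite integral_ge0.
congr (_ * _)%E.
by rewrite poweR_EFin -powRrM mulfV ?powRr1 ?ger0_norm ?normc_ge0.
Qed.

Lemma L2norm_ae f g : cmeasurable f -> cmeasurable g ->
  (\forall x \ae mu, f x = g x) -> L2norm f = L2norm g.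
Proof.
move=> mf mg fg; rewrite /L2norm unlock; congr (_ `^ _)%E.
apply: ge0_ae_eq_integral => //=.
- by apply/measurable_EFinP; apply: (measurableT_comp (measurable_powR 2));
    apply: measurableT_comp => //; exact: measurable_normc.
- by apply/measurable_EFinP; apply: (measurableT_comp (measurable_powR 2));
    apply: measurableT_comp => //; exact: measurable_normc.
- by apply: (@filterS _ _ (ae_filter_ringOfSetsType mu) _ _ _ fg) => x fgx _ /=; rewrite fgx.
Qed.

Lemma L2norm_eq0 f : cmeasurable f -> L2norm f = 0%E ->
  \forall x \ae mu, f x = 0.
Proof.
move=> mf f0.
have mN : measurable_fun [set: measurableTypeR R] (EFin \o (@normc R \o f)).
  by apply/measurable_EFinP; exact: measurable_normc.
have two_gt0 : (0 < 2%:E :> \bar R)%E by rewrite lte_fin.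
have := @Lnorm_eq0_eq0 _ _ _ mu _ _ mN two_gt0 f0.
apply: (@filterS _ _ (ae_filter_ringOfSetsType mu)) => x /= /(_ I) [].
exact: eq0_normc.
Qed.

Definition L2_pred : {pred R -> R[i]} := fun f => `[< is_L2 f >].

Lemma L2_submod_closed : submod_closed L2_pred.
Proof.
split; first by apply/asboolP; split; [exact: cmeasurable0|rewrite L2norm0].
move=> a f g /asboolP[mf lf] /asboolP[mg lg]; apply/asboolP; split.
  exact: cmeasurable_lin.
have maf : cmeasurable (a *: f).
  by rewrite -[_ *: _]addr0; apply: cmeasurable_lin => //; exact: cmeasurable0.
apply: (le_lt_trans (L2normD maf mg)); rewrite lte_add_pinfty// L2normZ//.
by rewrite lte_mul_pinfty ?lee_fin ?normc_ge0.
Qed.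

HB.instance Definition _ :=
  GRing.isSubmodClosed.Build R[i] (R -> R[i]) L2_pred L2_submod_closed.

Record L2fun := MkL2fun { L2fun_val :> R -> R[i]; _ : L2fun_val \in L2_pred }.

HB.instance Definition _ := [isSub for L2fun_val].
HB.instance Definition _ := [Choice of L2fun by <:].
HB.instance Definition _ := [SubChoice_isSubLmodule of L2fun by <:].

Lemma L2funP (f : L2fun) : is_L2 f.
Proof. by case: f => f /= /asboolP. Qed.

Definition L2_null : {pred L2fun} :=
  fun u : L2fun => `[< \forall x \ae mu, u x = 0 >].

Lemma L2_null_zmod_closed : zmod_closed L2_null.
Proof.
split.
  by apply/asboolP; apply: (@nearW _ _ _ (ae_filter_ringOfSetsType mu)).
move=> u v /asboolP u0 /asboolP v0; apply/asboolP.
apply: (@filterS2 _ _ (ae_filter_ringOfSetsType mu) _ _ _ _ u0 v0) => x ux vx.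
by rewrite [LHS]/= /GRing.add/= /GRing.opp/= ux vx subr0.
Qed.

HB.instance Definition _ := GRing.isZmodClosed.Build L2fun L2_null
  L2_null_zmod_closed.

Definition L2space := Quotient.quot L2_null.

HB.instance Definition _ := GRing.Zmodule.on L2space.
HB.instance Definition _ := EqQuotient.on L2space.

Local Open Scope quotient_scope.

Definition L2repr (u : L2space) : R -> R[i] := repr u.

Definition L2class f : L2space :=
  if insub f is Some u then \pi_L2space (u : L2fun) else 0.

Lemma L2reprP (u : L2space) : is_L2 (L2repr u).
Proof. exact: L2funP. Qed.

Lemma L2_piP (u v : L2fun) :
  \pi_L2space u = \pi_L2space v <-> (\forall x \ae mu, u x = v x).
Proof.
have -> : (\pi_L2space u = \pi_L2space v) <-> (u - v \in L2_null).
  by rewrite Quotient.idealrBE; split => [/eqP|/eqP].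
have E x : ((u - v : L2fun) x = 0) = (u x = v x).
  rewrite (_ : (u - v : L2fun) x = u x - v x)//; apply/propext.
  by split => [/eqP|->]; [rewrite subr_eq0 => /eqP|rewrite subrr].
split => [/asboolP|uv]; last apply/asboolP.
  by apply: (@filterS _ _ (ae_filter_ringOfSetsType mu)) => x; rewrite E.
by move: uv; apply: (@filterS _ _ (ae_filter_ringOfSetsType mu)) => x; rewrite E.
Qed.

Lemma L2repr_pi (u : L2fun) :
  \forall x \ae mu, L2repr (\pi_L2space u) x = u x.
Proof. by apply/L2_piP; rewrite reprK. Qed.

Lemma L2classK f : is_L2 f -> \forall x \ae mu, L2repr (L2class f) x = f x.
Proof.
move=> f2; rewrite /L2class insubT; first exact/asboolP.
by move=> f2'; exact: L2repr_pi.
Qed.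

Definition L2scale (a : R[i]) (u : L2space) : L2space :=
  \pi_L2space (a *: repr u).

Lemma L2scale_pi a (u : L2fun) :
  L2scale a (\pi_L2space u) = \pi_L2space (a *: u).
Proof.
apply/L2_piP; have := L2repr_pi u.
apply: (@filterS _ _ (ae_filter_ringOfSetsType mu)) => x E.
exact: (congr1 (fun z => a * z) E).
Qed.

Lemma L2scaleA a b (u : L2space) : L2scale a (L2scale b u) = L2scale (a * b) u.
Proof. by elim/quotW: u => u; rewrite (L2scale_pi b) 2!L2scale_pi scalerA. Qed.

Lemma L2scale1 : left_id 1 L2scale.
Proof. by elim/quotW => u; rewrite L2scale_pi scale1r. Qed.

Lemma L2scaleDr : right_distributive L2scale +%R.
Proof.
move=> a; elim/quotW => u; elim/quotW => v.
rewrite (L2scale_pi a u) (L2scale_pi a v) -[in LHS]raddfD.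
rewrite (L2scale_pi a (u + v)) scalerDr; exact: raddfD.
Qed.

Lemma L2scaleDl u : {morph L2scale^~ u : a b / a + b}.
Proof.
elim/quotW: u => u a b;
  rewrite (L2scale_pi a u) (L2scale_pi b u) L2scale_pi scalerDl; exact: raddfD.
Qed.

HB.instance Definition _ := GRing.Zmodule_isLmodule.Build R[i] L2space
  L2scaleA L2scale1 L2scaleDr L2scaleDl.

Definition L2space_norm (u : L2space) : R[i] := (fine (L2norm (L2repr u)))%:C.


Lemma L2norm_fin (u : L2space) : L2norm (L2repr u) \is a fin_num.
Proof. by rewrite ge0_fin_numE ?L2norm_ge0//; case: (L2reprP u). Qed.

Lemma ler_L2space_normD u v :
  L2space_norm (u + v) <= L2space_norm u + L2space_norm v.
Proof.
have [mu_ mv] := ((L2reprP u).1, (L2reprP v).1).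
rewrite /L2space_norm -raddfD lecR -fineD ?L2norm_fin//.
apply: fine_le; rewrite ?fin_numD ?L2norm_fin//.
apply: le_trans (L2normD mu_ mv).
rewrite (@L2norm_ae _ (L2repr u + L2repr v)%R)//.
- exact: (L2reprP _).1.
- by rewrite -[L2repr u]scale1r; exact: cmeasurable_lin.
have -> : u + v = \pi_L2space (repr u + repr v).
  have -> := @raddfD _ _ \pi_L2space (repr u) (repr v).
  by congr (_ + _); exact: (esym (reprK _)).
exact: L2repr_pi.
Qed.

Lemma L2space_normZ (a : R[i]) u :
  L2space_norm (a *: u) = `|a| * L2space_norm u.
Proof.
have mu_ := (L2reprP u).1.
rewrite /L2space_norm.
rewrite (@L2norm_ae _ (a *: L2repr u)%R).
- by rewrite L2normZ// fineM ?L2norm_fin// rmorphM.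
- exact: (L2reprP _).1.
- rewrite -[_ *: _]addr0; apply: cmeasurable_lin => //; exact: cmeasurable0.
exact: L2repr_pi.
Qed.

Lemma L2space_norm0_eq0 u : L2space_norm u = 0 -> u = 0.
Proof.
move=> /complexI /eqP u0.
have {}u0 : L2norm (L2repr u) = 0%E.
  by rewrite -[LHS]fineK ?L2norm_fin// (eqP u0).
rewrite -[u]reprK -[0](raddf0 \pi_L2space); apply/L2_piP.
exact: L2norm_eq0 (L2reprP u).1 u0.
Qed.

HB.instance Definition _ := Lmodule_isNormed.Build R[i] L2space
  ler_L2space_normD L2space_normZ L2space_norm0_eq0.

End L2.

Section FourierSobolev.
Variable R : realType.
Local Notation mu := (@lebesgue_measure R).
Implicit Types (f g u v : R -> R[i]) (phi : R -> R) (t x xi : R).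

Definition cexpi t : R[i] := cos t +i* sin t.

Definition cintegral (D : set R) f : R[i] :=
  (\int[mu]_(x in D) complex.Re (f x)) +i* (\int[mu]_(x in D) complex.Im (f x)).

Definition truncated_fourier (n : nat) f : R -> R[i] := fun xi =>
  ((Num.sqrt (2 * pi))^-1)%:C *
  cintegral `[- n%:R, n%:R] (fun x => cexpi (- (x * xi)) * f x).

(* The unitary Fourier transform on L^2, as the L^2-limit of the transforms of
   the truncations of f. *)
Definition is_fourier f g :=
  [/\ is_L2 f, is_L2 g &
      L2norm (truncated_fourier n f - g) @[n --> \oo] --> 0%E].

(* [fourier], [half_laplacian] and [weak_derivative] choose a representative of
   an object that is unique up to equality a.e., and return 0 if there is
   none. *)
Definition fourier f : R -> R[i] := xget 0 [set g | is_fourier f g].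

Definition half_laplacian u : R -> R[i] :=
  xget 0 [set v | is_fourier v (fun xi => `|xi|%:C * fourier u xi)].

Definition dotH_half_norm u : \bar R :=
  L2norm (fun xi => (Num.sqrt `|xi|)%:C * fourier u xi).

Definition locally_integrableC f :=
  locally_integrable [set: R] (@complex.Re R \o f) /\
  locally_integrable [set: R] (@complex.Im R \o f).

Definition test_function phi :=
  [/\ forall x, derivable phi x 1, continuous (derive1 phi)
    & exists M : R, forall x, M < `|x| -> phi x = 0].

(* Testing against C^1_c or C^oo_c functions is equivalent, by mollification. *)
Definition is_weak_derivative u v :=
  [/\ locally_integrableC u, locally_integrableC v &
      forall phi, test_function phi ->
        cintegral [set: R] (fun x => u x * (derive1 phi x)%:C) =
        - cintegral [set: R] (fun x => v x * (phi x)%:C)].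

Definition weak_derivative u : R -> R[i] :=
  xget 0 [set v | is_weak_derivative u v].

Fixpoint sobolev (k : nat) u : Prop :=
  is_L2 u /\
  if k is k'.+1 then exists2 v, is_weak_derivative u v & sobolev k' v else True.

End FourierSobolev.

Section NeelWall.
Variable R : realType.
Implicit Types theta : R -> R.

Definition cosC theta : R -> R[i] := fun x => (cos (theta x))%:C.

Definition sinC theta : R -> R[i] := fun x => (sin (theta x))%:C.

Definition phase_derivative theta : R -> R[i] :=
  weak_derivative (fun x => (theta x)%:C).

(* If cos theta is not in L^2 the last term is +oo, so that the Fourier
   transform matters only when it is defined. *)
Definition energy theta : \bar R :=
  ((2^-1)%:E * (L2norm (phase_derivative theta) ^+ 2 +
                dotH_half_norm (cosC theta) ^+ 2 +
                L2norm (cosC theta) ^+ 2))%E.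

(* Continuity selects the representative of the weakly differentiable function
   theta, which gives a meaning to its point values and limits. *)
Definition admissible_phase theta :=
  [/\ forall x, - (pi / 2) < theta x < pi / 2,
      continuous theta,
      exists v, is_weak_derivative (fun x => (theta x)%:C) v,
      theta @ -oo --> - (pi / 2) & theta @ +oo --> pi / 2].

Definition static_neel_wall theta :=
  [/\ admissible_phase theta,
      (energy theta < +oo)%E,
      forall phi, admissible_phase phi -> (energy theta <= energy phi)%E &
      theta 0 = 0].

Definition one_plus_half_laplacian (u : R -> R[i]) : R -> R[i] :=
  u + half_laplacian u.

Definition H2_domain : set (L2space R) := [set u | sobolev 2 (L2repr u)].

Definition c_coef theta : R -> R[i] :=
  cosC theta * one_plus_half_laplacian (cosC theta).

Definition op_L theta : operator (L2space R) :=
  Operator H2_domain (fun U => let u := L2repr U in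
    L2class (- weak_derivative (weak_derivative u)
             + sinC theta * one_plus_half_laplacian (u * sinC theta)
             - c_coef theta * u)).

Definition op_Linfty : operator (L2space R) :=
  Operator H2_domain (fun U => let u := L2repr U in
    L2class (- weak_derivative (weak_derivative u)
             + one_plus_half_laplacian u)).

End NeelWall.

Arguments op_Linfty : clear implicits.

(* Main.v *)
From HB Require Import structures.
From mathcomp Require Import all_boot all_order all_algebra complex.
From mathcomp Require Import all_classical all_reals all_analysis.
From mathcomp Require Import measurable_realfun ring lra.
Set Implicit Arguments.
Unset Strict Implicit.
Unset Printing Implicit Defensive.
Import Order.TTheory GRing.Theory Num.Theory.
Import numFieldNormedType.Exports.
Import ComplexField.Normc.
Require Import Defs.
Local Open Scope classical_set_scope.
Local Open Scope ring_scope.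
Local Open Scope complex_scope.

(** The two operators are compared after composition with the resolvent. On the
    Fourier side [op_Linfty] is the multiplication by [1 + |xi| + xi^2];
    hence 0 is in its resolvent set, and [resolvent0 = (0 - L_infty)^-1], a
    Fourier multiplier, maps L2 bijectively onto the common domain H2. Write
    [c] and [s] for [cos theta] and [sin theta], and [Lam] for the
    half-Laplacian. From [c^2 + s^2 = 1] one gets, up to parentheses,

    [(L_infty - L) resolvent0 = c^2 (1 + Lam) resolvent0 - s [Lam, s] resolvent0
    + c_coef resolvent0].

    The right-hand side is a limit of finite rank operators in operator norm
    ([Linfty_sub_L_approx_finrank]). Finite energy enters through three
    consequences: [cos theta], [c_coef theta] and the derivative of [theta]
    are square integrable.

    The first and the last term multiply by a square integrable function after a
    Fourier multiplier with square integrable symbol, as [(1 + |xi|) / (1 +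
    |xi| + xi^2)] is in L2. Such operators are of Hilbert-Schmidt type:
    truncated in [x] and [xi] they are uniformly close to operators that
    freeze [x] on the cells of a subdivision, which have finite rank
    ([window_op_approx]).

    The commutator has on the Fourier side the kernel [(|xi| - |eta|) (hat s)(xi
    - eta) r(eta)], bounded by [|xi - eta| |hat s|(xi - eta) |r(eta)|],
    where [r] is the symbol of the resolvent. This is square integrable
    because the derivative of [s] is in L2 ([comm_int_approx]). As [s]
    itself is not in L2, it is first multiplied by slowly varying cutoffs;
    the commutators of the cut functions form a Cauchy sequence in operator
    norm ([commutator_limit]).

    A limit of finite rank operators is compact ([approx_finrank_compact]),
    which gives the relative compactness. Its subtraction also preserves
    Fredholm operators of index 0 ([fredholm0_sub_approx_finrank]): such an
    operator is [J - N] with [J] bijective and [N] of finite rank, a small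
    perturbation of [J] is absorbed by a Neumann series, and the identity
    minus a finite rank operator is settled by linear algebra. A point
    [lambda] is outside the essential spectrum of [L] exactly when [(L -
    lambda) resolvent0] is Fredholm of index 0
    ([essential_spectrum_index0]), so the two essential spectra agree.

    The Fourier analysis rests on window integrals, the integrals over [z, z +
    h] as functions of [z]. They give Plancherel's identity from the Fejer
    weight ([plancherel_L1L2]), and they characterize weak derivatives
    without smooth mollifiers: increments of a function are the window
    integrals of its weak derivative ([weak_derivative_window]), whence the
    Fourier description of Sobolev functions and of the operators
    ([sobolev2P], [half_laplacian_hat]). *)

(** * Identities in abelian groups *)

Lemma inj_surj_bijective (A B : Type) (f : A -> B) : injective f ->
  (forall y, exists x, f x = y) -> bijective f.
Proof. by move=> fI /choice[g fg]; exists g => // x; apply: fI. Qed.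

(** Reified expressions in abelian groups. An identity holds in all of them as
    soon as the integer coefficients of each variable agree, which is decided
    by computation. *)
Inductive zexpr := ZVar of nat | ZAdd of zexpr & zexpr | ZOpp of zexpr | ZZero.

Fixpoint zeval (V : zmodType) (e : seq V) (x : zexpr) : V :=
  match x with
  | ZVar n => e`_n | ZAdd a b => zeval e a + zeval e b
  | ZOpp a => - zeval e a | ZZero => 0
  end.

Fixpoint zcoef (x : zexpr) (i : nat) : int :=
  match x with
  | ZVar n => (i == n)%:Z | ZAdd a b => zcoef a i + zcoef b i
  | ZOpp a => - zcoef a i | ZZero => 0
  end.

Lemma zevalE (V : zmodType) (e : seq V) (x : zexpr) :
  zeval e x = \sum_(i < size e) e`_i *~ zcoef x i.
Proof.
elim: x => [n|a IHa b IHb|a IHa|] /=.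
- have [ne|en] := ltnP n (size e).
    rewrite (bigD1 (Ordinal ne))//= eqxx mulr1z big1 ?addr0// => i /eqP ni.
    by case: eqP => [h|]; [case: ni; exact: val_inj|rewrite mulr0z].
  rewrite nth_default// big1// => i _.
  by rewrite ltn_eqF ?mulr0z// (leq_trans (ltn_ord i)).
- by rewrite IHa IHb -big_split; apply: eq_bigr => i _; rewrite mulrzDr.
- by rewrite IHa -sumrN; apply: eq_bigr => i _; rewrite mulrNz.
- by rewrite big1// => i _; rewrite mulr0z.
Qed.

Lemma zeval_eq (V : zmodType) (e : seq V) (x y : zexpr) :
  all (fun i => zcoef x i == zcoef y i) (iota 0 (size e)) ->
  zeval e x = zeval e y.
Proof.
move=> /allP h; rewrite !zevalE; apply: eq_bigr => i _; congr (_ *~ _).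
by apply/eqP/h; rewrite mem_iota add0n /=.
Qed.

Ltac zmem a l :=
  lazymatch l with
  | nil => constr:(false)
  | cons a _ => constr:(true)
  | cons _ ?t => zmem a t
  end.
Ltac zidx a l :=
  lazymatch l with
  | cons a _ => constr:(O)
  | cons _ ?t => let n := zidx a t in constr:(S n)
  end.
Ltac zvars t l :=
  lazymatch t with
  | @GRing.add _ ?a ?b => let l1 := zvars a l in zvars b l1
  | @GRing.opp _ ?a => zvars a l
  | @GRing.zero _ => l
  | _ => let b := zmem t l in
    lazymatch b with true => l | false => constr:(cons t l) end
  end.
Ltac zreify t l :=
  lazymatch t with
  | @GRing.add _ ?a ?b => let x := zreify a l in let y := zreify b l in constr:(ZAdd x y)
  | @GRing.opp _ ?a => let x := zreify a l in constr:(ZOpp x)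
  | @GRing.zero _ => constr:(ZZero)
  | _ => let n := zidx t l in constr:(ZVar n)
  end.

Ltac zmodule :=
  match goal with |- @eq ?T ?a ?b =>
    let l0 := zvars a (@nil T) in let l := zvars b l0 in
    let x := zreify a l in let y := zreify b l in
    change (zeval l x = zeval l y); apply: zeval_eq; reflexivity
  end.

(** * Operators approximable by finite rank operators *)

Section RealNorm.
Context {R : realType} {X : normedModType R[i]}.
Implicit Types (x y : X) (T S J N : X -> X) (phi : X -> R[i]).

(** The norm of a complex normed space has its values in [R[i]]; [nrm] is the
    real number behind it, on which the order is total. *)
Definition nrm x : R := complex.Re `|x|.

Lemma nrmE x : `|x| = (nrm x)%:C.
Proof.
have := normr_ge0 x; rewrite lecE /= => /andP[/eqP h _].
by rewrite /nrm; case: `|x| h => a b /= ->.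
Qed.

Lemma nrm_ge0 x : 0 <= nrm x.
Proof. by have := normr_ge0 x; rewrite nrmE ler0c. Qed.

Lemma nrmD x y : nrm (x + y) <= nrm x + nrm y.
Proof. by have := ler_normD x y; rewrite !nrmE -raddfD lecR. Qed.

Lemma nrmN x : nrm (- x) = nrm x.
Proof. by rewrite /nrm normrN. Qed.

Lemma nrmB x y : nrm (x - y) = nrm (y - x).
Proof. by rewrite -nrmN opprB. Qed.

Lemma nrmBD x y : nrm (x - y) <= nrm x + nrm y.
Proof. by rewrite -[nrm y]nrmN nrmD. Qed.

Lemma nrm_tri y x z : nrm (x - z) <= nrm (x - y) + nrm (y - z).
Proof. by have := nrmD (x - y) (y - z); rewrite addrA subrK. Qed.

Lemma nrmZ (a : R[i]) x : nrm (a *: x) = normc a * nrm x.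
Proof.
have := normrZ a x; rewrite !nrmE -[`|a|]/((normc a)%:C) -rmorphM.
exact: complexI.
Qed.

Lemma nrm0 : nrm 0 = 0.
Proof. by rewrite /nrm normr0. Qed.

Lemma nrm_eq0 x : nrm x <= 0 -> x = 0.
Proof.
move=> h; apply/eqP; rewrite -normr_eq0 nrmE.
by have /eqP -> : nrm x == 0 by rewrite eq_le h nrm_ge0.
Qed.

Lemma nrm_sum n (F : 'I_n -> X) : nrm (\sum_i F i) <= \sum_i nrm (F i).
Proof.
elim/big_rec2: _ => [|i a b _ h]; first by rewrite nrm0.
by apply: (le_trans (nrmD _ _)); rewrite lerD2l.
Qed.

Lemma normcR (a : R) : normc (a%:C) = `|a|.
Proof. by rewrite /normc /= expr0n /= addr0 sqrtr_sqr. Qed.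

Definition lin T := forall (a : R[i]) x y, T (a *: x + y) = a *: T x + T y.

Definition blin T := lin T /\ exists2 M : R, 0 <= M & forall x, nrm (T x) <= M * nrm x.

Definition bfun phi :=
  (forall (a : R[i]) x y, phi (a *: x + y) = a * phi x + phi y) /\
  exists2 M : R, 0 <= M & forall x, normc (phi x) <= M * nrm x.

Lemma lin0 T : lin T -> T 0 = 0.
Proof. by move=> h; have := h (-1) 0 0; rewrite !scaleN1r addr0 addNr oppr0. Qed.
Lemma linZ T (h : lin T) a x : T (a *: x) = a *: T x.
Proof. by rewrite -[a *: x]addr0 h (lin0 h) addr0. Qed.
Lemma linD T (h : lin T) x y : T (x + y) = T x + T y.
Proof. by rewrite -[x]scale1r h !scale1r. Qed.
Lemma linN T (h : lin T) x : T (- x) = - T x.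
Proof. by rewrite -scaleN1r (linZ h) scaleN1r. Qed.
Lemma linB T (h : lin T) x y : T (x - y) = T x - T y.
Proof. by rewrite (linD h) (linN h). Qed.
Lemma lin_sum T (h : lin T) n (F : 'I_n -> X) : T (\sum_i F i) = \sum_i T (F i).
Proof.
elim/big_rec2: _ => [|i a b _ <-]; first exact: lin0.
exact: linD.
Qed.

Lemma bfun0 phi : bfun phi -> phi 0 = 0.
Proof. by move=> [h _]; have := h (-1) 0 0; rewrite scaleN1r addr0 mulN1r addNr oppr0. Qed.
Lemma bfunZ phi (h : bfun phi) a x : phi (a *: x) = a * phi x.
Proof. by rewrite -[a *: x]addr0 h.1 (bfun0 h) addr0. Qed.
Lemma bfunD phi (h : bfun phi) x y : phi (x + y) = phi x + phi y.
Proof. by rewrite -[x]scale1r h.1 scale1r mul1r. Qed.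
Lemma bfunB phi (h : bfun phi) x y : phi (x - y) = phi x - phi y.
Proof. by rewrite (bfunD h) -scaleN1r (bfunZ h) mulN1r. Qed.
Lemma bfun_sum phi (h : bfun phi) n (F : 'I_n -> X) : phi (\sum_i F i) = \sum_i phi (F i).
Proof.
elim/big_rec2: _ => [|i a b _ <-]; first exact: bfun0.
exact: bfunD.
Qed.

Definition finrank N := exists n (phi : 'I_n -> X -> R[i]) (f : 'I_n -> X),
  (forall i, bfun (phi i)) /\ forall x, N x = \sum_i phi i x *: f i.

(** Limits of finite rank operators in operator norm. On a Hilbert space these
    are the compact operators, and in this form compactness acts directly on
    the Fredholm index. *)
Definition approx_finrank T := lin T /\ forall eps : R, 0 < eps ->
  exists2 N, finrank N & forall x, nrm (T x - N x) <= eps * nrm x.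

Lemma bfun_comp phi T : bfun phi -> blin T -> bfun (phi \o T).
Proof.
move=> hphi [lT [M M0 hM]]; split.
  by move=> a x y /=; rewrite lT hphi.1.
have [_ [K K0 hK]] := hphi; exists (K * M); first exact: mulr_ge0.
by move=> x /=; rewrite (le_trans (hK _))// -mulrA ler_wpM2l.
Qed.

Lemma finrank_blin N : finrank N -> blin N.
Proof.
move=> [n [phi [f [hphi NE]]]]; split.
  move=> a x y; rewrite !NE scaler_sumr -big_split/=; apply: eq_bigr => i _.
  by rewrite (hphi i).1 scalerDl scalerA.
have /choice[M hM] : forall i, exists M : R, 0 <= M /\ forall x, normc (phi i x) <= M * nrm x.
  by move=> i; have [_ [M M0 hM]] := hphi i; exists M.
exists (\sum_i M i * nrm (f i)).
  by apply: sumr_ge0 => i _; rewrite mulr_ge0 ?nrm_ge0//; case: (hM i).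
move=> x; rewrite NE (le_trans (nrm_sum _))// mulr_suml; apply: ler_sum => i _.
by rewrite nrmZ mulrAC ler_wpM2r ?nrm_ge0//; case: (hM i).
Qed.

Lemma finrank_compr N S : finrank N -> blin S -> finrank (N \o S).
Proof.
move=> [n [phi [f [hphi NE]]]] hS; exists n, (fun i => phi i \o S), f; split.
  by move=> i; exact: bfun_comp.
by move=> x /=; rewrite NE.
Qed.

Lemma finrank_compl N S : finrank N -> lin S -> finrank (S \o N).
Proof.
move=> [n [phi [f [hphi NE]]]] hS; exists n, phi, (S \o f); split => //.
by move=> x /=; rewrite NE (lin_sum hS); apply: eq_bigr => i _; rewrite (linZ hS).
Qed.

Lemma finrankD N S : finrank N -> finrank S -> finrank (fun x => N x + S x).
Proof.
move=> [n [phi [f [hphi NE]]]] [m [psi [g [hpsi SE]]]].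
exists (n + m)%N, (fun i x => match fintype.split i with inl j => phi j x | inr j => psi j x end),
  (fun i => match fintype.split i with inl j => f j | inr j => g j end); split.
  by move=> i; case: (fintype.split i).
move=> x; rewrite NE SE big_split_ord/=; congr (_ + _); apply: eq_bigr => i _.
  by rewrite (unsplitK (inl i)).
by rewrite (unsplitK (inr i)).
Qed.

Lemma blin_id : blin id.
Proof. by split => //; exists 1 => // x; rewrite mul1r. Qed.

Lemma blinD S T : blin S -> blin T -> blin (fun x => S x + T x).
Proof.
move=> [lS [A A0 hA]] [lT [B B0 hB]]; split.
  by move=> a x y; rewrite lS lT scalerDr addrACA.
exists (A + B); first exact: addr_ge0.
by move=> x; rewrite (le_trans (nrmD _ _))// mulrDl lerD.
Qed.

Lemma blinZ (c : R[i]) T : blin T -> blin (fun x => c *: T x).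
Proof.
move=> [lT [A A0 hA]]; split.
  by move=> a x y; rewrite lT scalerDr !scalerA mulrC.
exists (normc c * A); first by rewrite mulr_ge0 ?normc_ge0.
by move=> x; rewrite nrmZ -mulrA ler_wpM2l ?normc_ge0.
Qed.

Lemma blinN T : blin T -> blin (fun x => - T x).
Proof.
by move=> /(blinZ (-1)); congr blin; apply/funext => x; rewrite scaleN1r.
Qed.

Lemma blinB S T : blin S -> blin T -> blin (fun x => S x - T x).
Proof. by move=> hS /blinN; exact: blinD. Qed.

Lemma blin_comp S T : blin S -> blin T -> blin (S \o T).
Proof.
move=> [lS [A A0 hA]] [lT [B B0 hB]]; split.
  by move=> a x y /=; rewrite lT lS.
exists (A * B); first exact: mulr_ge0.
by move=> x /=; rewrite (le_trans (hA _))// -mulrA ler_wpM2l.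
Qed.

Lemma approx_finrank_blin T : approx_finrank T -> blin T.
Proof.
move=> [lT h]; split => //.
have [N /finrank_blin[_ [M M0 hM]] hN] := h 1 ltr01.
exists (1 + M); first exact: addr_ge0.
move=> x; rewrite -[T x](subrK (N x)) (le_trans (nrmD _ _))// mulrDl lerD//.
Qed.

Lemma approx_finrankD S T :
  approx_finrank S -> approx_finrank T -> approx_finrank (fun x => S x + T x).
Proof.
move=> [lS hS] [lT hT]; split.
  by move=> a x y; rewrite lS lT scalerDr addrACA.
move=> eps e0; have e2 : 0 < eps / 2 by rewrite divr_gt0.
have [N nN hN] := hS _ e2; have [P nP hP] := hT _ e2.
exists (fun x => N x + P x); first exact: finrankD.
move=> x; rewrite opprD addrACA (le_trans (nrmD _ _))//.
by rewrite [eps]splitr mulrDl lerD.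
Qed.

Lemma approx_finrank_compl S T :
  blin S -> approx_finrank T -> approx_finrank (S \o T).
Proof.
move=> [lS [M M0 hM]] [lT h]; split; first by move=> a x y /=; rewrite lT lS.
move=> eps e0; have M1 : 0 < M + 1 by rewrite ltr_wpDl.
have [N nN hN] := h _ (divr_gt0 e0 M1).
exists (S \o N); first exact: finrank_compl.
move=> x /=; rewrite -(linB lS) (le_trans (hM _))//.
apply: (le_trans (ler_wpM2l M0 (hN x))).
rewrite mulrA ler_wpM2r ?nrm_ge0// mulrCA -[leRHS]mulr1 ler_wpM2l ?(ltW e0)//.
by rewrite ler_pdivrMr// mul1r lerDl.
Qed.

Lemma approx_finrank_compr S T :
  blin S -> approx_finrank T -> approx_finrank (T \o S).
Proof.
move=> bS [lT h]; split; first by move=> a x y /=; rewrite bS.1 lT.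
have [lS [M M0 hM]] := bS.
move=> eps e0; have M1 : 0 < M + 1 by rewrite ltr_wpDl.
have [N nN hN] := h _ (divr_gt0 e0 M1).
exists (N \o S); first exact: finrank_compr.
move=> x /=; rewrite (le_trans (hN _))// -mulrA ler_wpM2l ?(ltW e0)//.
rewrite mulrC ler_pdivrMr// mulrC (le_trans (hM _))// ler_wpM2r ?nrm_ge0//.
by rewrite lerDl.
Qed.

Lemma approx_finrankZ c T : approx_finrank T -> approx_finrank (fun x => c *: T x).
Proof. exact: (approx_finrank_compl (blinZ c blin_id)). Qed.

Lemma approx_finrankN T : approx_finrank T -> approx_finrank (fun x => - T x).
Proof.
move=> /(approx_finrankZ (-1)); congr approx_finrank.
by apply/funext => x; rewrite scaleN1r.
Qed.

Lemma approx_finrankB S T :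
  approx_finrank S -> approx_finrank T -> approx_finrank (fun x => S x - T x).
Proof. by move=> hS /approx_finrankN; exact: approx_finrankD. Qed.

Lemma approx_finrank_closed T : lin T ->
  (forall eps : R, 0 < eps -> exists2 S, approx_finrank S &
     forall x, nrm (T x - S x) <= eps * nrm x) -> approx_finrank T.
Proof.
move=> lT h; split => // eps e0; have e2 : 0 < eps / 2 by rewrite divr_gt0.
have [S [lS hS] hTS] := h _ e2; have [N nN hN] := hS _ e2.
exists N => // x; rewrite (le_trans (nrm_tri (S x) _ _))// [eps]splitr mulrDl.
by rewrite lerD.
Qed.

Definition totally_bounded (A : set X) := forall eps : R, 0 < eps ->
  exists s : seq X, forall x, A x -> exists2 y, y \in s & nrm (x - y) <= eps.

Lemma totally_boundedD (A B : set X) : totally_bounded A -> totally_bounded B ->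
  totally_bounded [set z | exists x y, [/\ A x, B y & z = x + y]].
Proof.
move=> hA hB eps e0; have e2 : 0 < eps / 2 by rewrite divr_gt0.
have [s hs] := hA _ e2; have [t ht] := hB _ e2.
exists [seq x + y | x <- s, y <- t] => z [x [y [Ax By ->]]].
have [x' x's hx] := hs _ Ax; have [y' y't hy] := ht _ By.
exists (x' + y'); first by apply/allpairsP; exists (x', y').
by rewrite opprD addrACA (le_trans (nrmD _ _))// [eps]splitr lerD.
Qed.

Lemma normc_ReIm (a : R[i]) : normc a <= `|complex.Re a| + `|complex.Im a|.
Proof.
case: a => a b /=; rewrite -[X in _ <= X]ger0_norm ?addr_ge0// -sqrtr_sqr.
apply: ler_wsqrtr; rewrite sqrrD !real_normK ?num_real//.
by rewrite -addrA [_ *+ 2 + _]addrC addrA lerDl mulrn_wge0// mulr_ge0.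
Qed.

Lemma Re_le_normc (a : R[i]) : `|complex.Re a| <= normc a.
Proof. by case: a => a b /=; rewrite -sqrtr_sqr ler_wsqrtr// lerDl sqr_ge0. Qed.

Lemma Im_le_normc (a : R[i]) : `|complex.Im a| <= normc a.
Proof. by case: a => a b /=; rewrite -sqrtr_sqr ler_wsqrtr// lerDr sqr_ge0. Qed.

Lemma real_net (M eps : R) : 0 < eps -> exists s : seq R,
  forall t, `|t| <= M -> exists2 c, c \in s & `|t - c| <= eps.
Proof.
move=> e0; exists [seq k%:R * eps - M | k <- iota 0 (Num.truncn ((M + M) / eps)).+1].
move=> t tM; have [tl tu] : - M <= t /\ t <= M by apply/andP; rewrite -ler_norml.
pose k := Num.truncn ((t + M) / eps).
have p0 : 0 <= (t + M) / eps by rewrite divr_ge0 ?(ltW e0)//; lra.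
have /andP[kl ku] := truncn_itv p0.
exists (k%:R * eps - M).
  apply/mapP; exists k => //; rewrite mem_iota add0n /= ltnS.
  by apply: le_truncn; rewrite ler_pM2r ?invr_gt0//; lra.
move: kl ku; rewrite -/k ler_pdivlMr// ltr_pdivrMr//.
have -> : (k.+1%:R : R) = k%:R + 1 by rewrite natr1.
by rewrite mulrDl mul1r => kl ku; rewrite ler_norml; apply/andP; split; lra.
Qed.

Lemma totally_bounded_line (f : X) (M : R) :
  totally_bounded [set x | exists2 a : R[i], normc a <= M & x = a *: f].
Proof.
move=> eps e0; pose K := 2 * (nrm f + 1).
have K0 : 0 < K by rewrite mulr_gt0// ltr_wpDl ?nrm_ge0.
have [s hs] := real_net M (divr_gt0 e0 K0).
exists [seq (c +i* d) *: f | c <- s, d <- s] => x [a aM ->].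
have [c cs hc] := hs _ (le_trans (Re_le_normc a) aM).
have [d ds hd] := hs _ (le_trans (Im_le_normc a) aM).
exists ((c +i* d) *: f); first by apply/allpairsP; exists (c, d).
rewrite -scalerBl nrmZ.
have h : normc (a - (c +i* d)) <= 2 * (eps / K).
  rewrite (le_trans (normc_ReIm _))//; case: a hc hd {aM} => p q /= hc hd; lra.
apply: (le_trans (ler_wpM2r (nrm_ge0 _) h)).
have -> : 2 * (eps / K) * nrm f = eps * (nrm f / (nrm f + 1)).
  by rewrite /K; field; apply/eqP; have := nrm_ge0 f; lra.
rewrite -[leRHS]mulr1 ler_wpM2l ?(ltW e0)// ler_pdivrMr ?ltr_wpDl ?nrm_ge0//.
by rewrite mul1r lerDl.
Qed.

Lemma totally_bounded_span n (f : 'I_n -> X) (M : R) :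
  totally_bounded [set x | exists2 a : 'I_n -> R[i], (forall i, normc (a i) <= M) &
                         x = \sum_i a i *: f i].
Proof.
elim: n f => [f eps e0|n IH f].
  exists [:: 0] => x [a _ ->]; exists 0; first by rewrite mem_head.
  by rewrite big_ord0 subrr nrm0 ltW.
have := totally_boundedD (@totally_bounded_line (f ord0) M) (IH (fun i => f (lift ord0 i))).
move=> h eps e0; have [s hs] := h eps e0; exists s => x [a aM ->]; apply: hs.
exists (a ord0 *: f ord0), (\sum_i a (lift ord0 i) *: f (lift ord0 i)).
split; [by exists (a ord0)| |by rewrite big_ord_recl].
by exists (fun i => a (lift ord0 i)).
Qed.

(** A finite rank operator maps a bounded set into a bounded part of the span
    of finitely many vectors, where finite nets come from nets of intervals. *)
Lemma approx_finrank_totally_bounded T (A : set X) (M : R) : approx_finrank T ->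
  (forall x, A x -> nrm x <= M) -> totally_bounded (T @` A).
Proof.
move=> [lT h] AM eps e0.
pose K := 2 * (`|M| + 1).
have K0 : 0 < K by rewrite mulr_gt0// ltr_wpDl.
have [N [n [phi [f [hphi NE]]]] hN] := h _ (divr_gt0 e0 K0).
have /choice[B hB] : forall i, exists B : R, 0 <= B /\ forall x, normc (phi i x) <= B * nrm x.
  by move=> i; have [_ [B B0 hB]] := hphi i; exists B.
have [s hs] := @totally_bounded_span n f (\sum_i B i * `|M|) _ (divr_gt0 e0 (ltr0n _ 2)).
exists s => _ [x Ax <-].
have xM : nrm x <= `|M| by rewrite (le_trans (AM _ Ax))// ler_norm.
have [|y ys hy] := hs (N x).
  exists (phi^~ x) => // i; apply: (le_trans ((hB i).2 x)).
  apply: (@le_trans _ _ (B i * `|M|)); first by rewrite ler_wpM2l//; exact: (hB i).1.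
  rewrite (bigD1 i)//= lerDl sumr_ge0// => j _; rewrite mulr_ge0//; exact: (hB j).1.
exists y => //; apply: (le_trans (nrm_tri (N x) _ _)).
rewrite [leRHS]splitr lerD//; apply: (le_trans (hN x)).
rewrite mulrAC ler_pdivrMr// /K mulrA divfK// ler_wpM2l ?(ltW e0)//.
by rewrite (le_trans xM)// lerDl.
Qed.

Lemma nbhs_nrm x (A : set X) : nbhs x A <->
  exists2 e : R, 0 < e & forall y, nrm (x - y) < e -> A y.
Proof.
split.
  move=> /nbhs_normP[e /=]; case: e => a b; rewrite ltcE/= => /andP[/eqP b0 a0] h.
  exists a => // y hy; apply: h => /=; rewrite nrmE b0; by rewrite ltcR.
move=> [e e0 h]; apply/nbhs_normP; exists (e%:C); first by rewrite /= ltcR.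
by move=> y /=; rewrite nrmE ltcR; exact: h.
Qed.

Lemma closed_nrm_ball y (r : R) : closed [set x | nrm (x - y) <= r].
Proof.
rewrite -openC openE => x /= /negP; rewrite -ltNge => h.
apply/nbhs_nrm; exists (nrm (x - y) - r); first by rewrite subr_gt0.
by move=> z hz /= hr; have := nrm_tri z x y; lra.
Qed.

End RealNorm.

(** * The open mapping theorem and Neumann series *)

Section Complete.
Context {R : realType} {X : normedModType R[i]}.
Implicit Types (x y : X) (T S J N : X -> X) (phi : X -> R[i]).

(** Completeness for the sequences that the arguments below produce: it is
    stated with [nrm] and without filters, together with the rate that the sum
    of a geometric series gives. *)
Definition rapidly_complete := forall (K : R) (u : nat -> X), 0 <= K ->
  (forall n, nrm (u n.+1 - u n) <= K * 2^-1 ^+ n) ->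
  exists l, forall n, nrm (u n - l) <= 2 * K * 2^-1 ^+ n.

Context (Xc : rapidly_complete).

Lemma half_exp_lt (K e : R) : 0 <= K -> 0 < e -> exists n, K * 2^-1 ^+ n < e.
Proof.
move=> K0 e0; have K1 : 0 < K + 1 by rewrite ltr_wpDl.
have := @cvg_geometric R (K + 1) 2^-1.
have -> : `|2^-1 : R| < 1 by rewrite ger0_norm ?invr_ge0// invf_lt1// ltr1n.
move=> /(_ isT)/cvgrPdist_lt/(_ _ e0)[n _ /(_ n (leqnn n))].
rewrite /= sub0r normrN => h; exists n; apply: le_lt_trans h.
by rewrite ger0_norm ?mulr_ge0 ?exprn_ge0 ?(ltW K1)// ler_wpM2r ?exprn_ge0// lerDl.
Qed.

Lemma le_half_exp (a K b : R) : 0 <= K ->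
  (forall n, a <= b + K * 2^-1 ^+ n) -> a <= b.
Proof.
move=> K0 h; apply/ler_addgt0Pr => e e0.
by have [n hn] := half_exp_lt K0 e0; rewrite (le_trans (h n))// lerD2l ltW.
Qed.

(** An ultrafilter on the closure of [A] contains a closed ball of every
    radius. Centers for the radii [4^-1 * 2^-n] form a rapidly converging
    sequence, and the ultrafilter converges to its limit. *)
Lemma totally_bounded_precompact (A : set X) : totally_bounded A -> precompact A.
Proof.
move=> tbA; rewrite precompactE compact_ultra => F FU FA.
have pF : ProperFilter F by exact: ultra_proper.
have net (eps : R) : 0 < eps -> exists y, F [set x | nrm (x - y) <= eps].
  move=> e0; have [s hs] := tbA _ e0.
  (* finitely many closed balls around a net of A cover the closure of A *)
  have cl : closure A `<=` \big[setU/set0]_(y <- s) [set x | nrm (x - y) <= eps].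
    have -> : \big[setU/set0]_(y <- s) [set x | nrm (x - y) <= eps] =
              closure (\big[setU/set0]_(y <- s) [set x | nrm (x - y) <= eps]).
      apply/closure_id; elim/big_rec: _ => [|y B _ cB]; first exact: closed0.
      by apply: closedU => //; exact: closed_nrm_ball.
    apply: closureS => x Ax; have [y ys hy] := hs _ Ax.
    by rewrite -bigcup_seq; exists y.
  have {cl} : F (\big[setU/set0]_(y <- s) [set x | nrm (x - y) <= eps]).
    exact: filterS cl FA.
  elim: s {hs} => [|y s IH]; first by rewrite big_nil => /filter_not_empty.
  rewrite big_cons => FB.
  have [|nF] := in_ultra_setVsetC [set x | nrm (x - y) <= eps] FU; first by exists y.
  apply: IH; apply: filterS (filterI FB nF) => x [[]//].
pose e n : R := 4^-1 * 2^-1 ^+ n.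
have e0 n : 0 < e n by rewrite mulr_gt0// ?exprn_gt0// invr_gt0.
have /choice[u hu] : forall n, exists y, F [set x | nrm (x - y) <= e n].
  by move=> n; exact: net.
have [||l hl] := Xc (K := 1) (u := u); first by [].
  move=> n; have [x [/= x1 x2]] := filter_ex (filterI (hu n.+1) (hu n)).
  rewrite (le_trans (nrm_tri x _ _))// nrmB mul1r.
  apply: (le_trans (lerD x1 x2)); rewrite /e exprS.
  have : 0 <= (2^-1 : R) ^+ n by exact: exprn_ge0.
  set q := _ ^+ n; lra.
have Fl : F --> l.
  move=> B /nbhs_nrm[d d0 hB].
  have [|n hn] := @half_exp_lt (2 + 4^-1) d _ d0; first by lra.
  apply: filterS (hu n) => x /= hx; apply: hB.
  rewrite nrmB (le_lt_trans (nrm_tri (u n) _ _))//.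
  apply: le_lt_trans (lerD hx (hl n)) _; apply: le_lt_trans hn.
  rewrite /e; set q := _ ^+ n; lra.
exists l; split => //.
have := @closed_closure _ A; rewrite closure_id => ->.
move=> B /Fl FB; have [z []] := filter_ex (filterI FA FB); by exists z.
Qed.

Lemma approx_finrank_compact T : approx_finrank T -> compact_operator T.
Proof.
move=> hT; split; first exact: hT.1.
move=> A [M0 [_ /(_ (M0 + 1))]]; rewrite ltrDl ltr01 => /(_ isT) hA.
apply: totally_bounded_precompact.
apply: (@approx_finrank_totally_bounded _ _ _ _ (complex.Re (M0 + 1)) hT) => x Ax.
by have := hA _ Ax; rewrite /= lecE => /andP[].
Qed.

(** Otherwise, nested balls that avoid up to a positive distance the images of
    the balls of radius [n], for one [n] after the other, shrink to a point
    outside the range of [J]. *)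
Lemma Baire_image_ball J : lin J -> (forall y, exists x, J x = y) ->
  exists (n : nat) y0 (r : R), 0 < r /\ forall y, nrm (y - y0) <= r ->
    forall d : R, 0 < d -> exists2 x, nrm x <= n%:R & nrm (J x - y) <= d.
Proof.
move=> lJ sJ; apply: contrapT => hno.
have step : forall a : nat * (X * {posnum R}), exists b : X * {posnum R},
   nrm (b.1 - a.2.1) <= a.2.2%:num /\
   forall x, nrm x <= a.1%:R -> nrm (J x - b.1) > b.2%:num.
  move=> [n [y0 r]] /=; apply: contrapT => hn; apply: hno; exists n, y0, r%:num.
  split => // y yr d d0; apply: contrapT => hx; apply: hn.
  exists (y, PosNum d0); split => //= x xn; rewrite ltNge; apply/negP => h.
  by apply: hx; exists x.
have [g hg] := choice step.
have q0 : 0 < (4^-1 : R) by rewrite invr_gt0.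
have shr (r d : {posnum R}) : 0 < Num.min (r%:num / 4) (d%:num / 4) :> R.
  by rewrite lt_min !divr_gt0.
(* dividing both radii by 4 keeps the limit of the centers well inside every
   ball *)
pose shrink (r d : {posnum R}) : {posnum R} := PosNum (shr r d).
pose one : {posnum R} := PosNum ltr01.
pose fix w n : X * {posnum R} := if n is m.+1 then
   ((g (m, w m)).1, shrink (w m).2 (g (m, w m)).2) else (0, one).
pose y n := (w n).1; pose r n := (w n).2%:num.
have r4 n : r n.+1 <= r n / 4 by rewrite /r /= ge_min lexx.
have rd n : r n.+1 <= (g (n, w n)).2%:num / 4 by rewrite /r /= ge_min lexx orbT.
have r0 n : 0 <= r n by rewrite /r.
have yr n : nrm (y n.+1 - y n) <= r n by have [] := hg (n, w n).
have rle n : r n <= 2^-1 ^+ n.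
  elim: n => [|n IH]; first by rewrite expr0.
  by rewrite (le_trans (r4 n))// exprS; have := r0 n; set q := _ ^+ n in IH *; lra.
have [||l hl] := Xc (K := 1) (u := y) => //.
  by move=> n; rewrite mul1r (le_trans (yr n)).
have ym n m : nrm (y (m + n)%N - y n) <= 2 * r n - 2 * r (m + n)%N.
  elim: m => [|m IH]; first by rewrite add0n !subrr nrm0.
  apply: (le_trans (nrm_tri (y (m + n)%N) _ _)).
  apply: (le_trans (lerD (yr _) IH)); have := r4 (m + n)%N; have := r0 (m + n)%N; rewrite addSn; lra.
have yl n : nrm (y n - l) <= 2 * r n.
  apply: (@le_half_exp _ 2 _); first by [].
  move=> m; rewrite (le_trans (nrm_tri (y (m + n)%N) _ _))// lerD//.
    by rewrite nrmB (le_trans (ym n m))//; have := r0 (m + n)%N; lra.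
  rewrite (le_trans (hl _))// mulr1 ler_wpM2l// exprD ler_piMr ?exprn_ge0//.
  by rewrite exprn_ile1// invf_le1// ler1n.
have [x Jx] := sJ l.
pose n := (Num.truncn (nrm x)).+1.
have xn : nrm x <= n%:R by rewrite ltW// truncnS_gt.
have [_ /(_ x xn)] := hg (n, w n); apply/negP; rewrite -leNgt Jx nrmB.
apply: (le_trans (yl n.+1)); have := rd n; have : 0 < ((g (n, w n)).2)%:num :> R by [].
set d := (g _).2%:num; lra.
Qed.

(** Differences of the preimages given by [Baire_image_ball] yield preimages
    [g y] of controlled norm up to an error of at most half the norm of [y].
    Applying [g] to the successive errors and summing gives exact preimages. *)
Theorem open_mapping J : blin J -> bijective J ->
  exists2 M : R, 0 < M & forall x, nrm x <= M * nrm (J x).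
Proof.
move=> [lJ [B B0 hB]] [Ji JK KJ].
have [|n [y0 [r [r0 H]]]] := Baire_image_ball lJ; first by move=> y; exists (Ji y).
pose C := 2 * n%:R / r.
have C0 : 0 <= C by rewrite divr_ge0 ?mulr_ge0// ltW.
have H1 y : exists x, nrm x <= C * nrm y /\ nrm (J x - y) <= nrm y / 2.
  have [->|y0'] := eqVneq y 0.
    by exists 0; rewrite (lin0 lJ) subrr !nrm0 mulr0 mul0r.
  have ny : 0 < nrm y by rewrite lt_neqAle nrm_ge0 andbT eq_sym; apply: contra y0' => /eqP h;
    apply/eqP/nrm_eq0; rewrite h.
  pose t : R := r / nrm y; have t0 : 0 < t by rewrite divr_gt0.
  have d0 : 0 < r / 4 by rewrite divr_gt0.
  have [|x1 x1n h1] := H (y0 + t%:C *: y) _ _ d0.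
    by rewrite addrAC subrr add0r nrmZ normcR gtr0_norm// /t divfK ?gt_eqF.
  have [|x2 x2n h2] := H y0 _ _ d0; first by rewrite subrr nrm0 ltW.
  have tc : t%:C != 0 by rewrite eq_complex/= gt_eqF.
  exists ((t^-1)%:C *: (x1 - x2)); rewrite nrmZ normcR gtr0_norm ?invr_gt0//; split.
    have -> : C * nrm y = t^-1 * (2 * n%:R) by rewrite /C /t invf_div; ring.
    rewrite ler_wpM2l ?invr_ge0 ?(ltW t0)//.
    by rewrite (le_trans (nrmBD _ _))// mulr_natl mulr2n lerD.
  have -> : J ((t^-1)%:C *: (x1 - x2)) - y =
    (t^-1)%:C *: ((J x1 - (y0 + t%:C *: y)) - (J x2 - y0)).
    have -> : J x1 - (y0 + t%:C *: y) - (J x2 - y0) = (J x1 - J x2) - t%:C *: y by zmodule.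
    by rewrite (linZ lJ) (linB lJ) [in RHS]scalerBr scalerA fmorphV mulVf// scale1r.
  rewrite nrmZ normcR gtr0_norm ?invr_gt0// /t invf_div mulrAC ler_pdivrMr// -mulrA.
  rewrite ler_wpM2l ?nrm_ge0// (le_trans (nrmBD _ _))//; lra.
clearbody C; have [g hg] := choice H1.
exists (2 * C + 1); first by rewrite ltr_wpDl// mulr_ge0.
move=> x; pose y := J x.
pose fix w k : X * X := if k is m.+1 then ((w m).1 + g (w m).2, (w m).2 - J (g (w m).2)) else (0, y).
have w2 k : nrm (w k).2 <= nrm y * 2^-1 ^+ k.
  elim: k => [|k IH]; first by rewrite expr0 mulr1.
  rewrite /= nrmB (le_trans (hg _).2)// exprS mulrCA [leRHS]mulrC ler_wpM2r// invr_ge0//.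
have w1 k : J (w k).1 + (w k).2 = y.
  by elim: k => [|k IH] /=; [rewrite (lin0 lJ) add0r|rewrite (linD lJ) -[RHS]IH; zmodule].
have [||l hl] := Xc (K := C * nrm y) (u := fun k => (w k).1).
- by rewrite mulr_ge0 ?nrm_ge0.
- move=> k; have -> : (w k.+1).1 - (w k).1 = g (w k).2 by rewrite /=; zmodule.
  by rewrite (le_trans (hg _).1)// -mulrA ler_wpM2l.
have Jl : J l = y.
  apply/eqP; rewrite -subr_eq0; apply/eqP/nrm_eq0.
  apply: (@le_half_exp _ (B * (2 * (C * nrm y)) + nrm y)).
    by rewrite addr_ge0 ?mulr_ge0 ?nrm_ge0.
  move=> k; rewrite add0r.
  have -> : J l - y = J (l - (w k).1) - (w k).2.
    by rewrite (linB lJ) -[X in _ - X = _](w1 k); zmodule.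
  rewrite mulrDl (le_trans (nrmBD _ _))// lerD//.
  by rewrite (le_trans (hB _))// -mulrA ler_wpM2l// nrmB.
have -> : x = l by apply: (can_inj JK); rewrite Jl.
have := hl 0%N; rewrite expr0 mulr1 /= sub0r nrmN => /le_trans; apply.
by rewrite Jl [leRHS]mulrDl mul1r -mulrA lerDl nrm_ge0.
Qed.

(** [J - S = J (1 - J^-1 S)], where [J^-1 S] contracts by [2^-1]; the preimage
    of [y] is the fixed point of the map sending [x] to [J^-1 (y + S x)]. *)
Lemma Neumann J S (M e : R) : lin J -> bijective J -> lin S -> 0 <= M ->
  (forall x, nrm x <= M * nrm (J x)) -> (forall x, nrm (S x) <= e * nrm x) ->
  M * e <= 2^-1 -> bijective (fun x => J x - S x) /\
  forall x, nrm x <= 2 * M * nrm (J x - S x).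
Proof.
move=> lJ [Ji JK KJ] lS M0 hM he Me.
have hS x : nrm (Ji (S x)) <= 2^-1 * nrm x.
  apply: (le_trans (hM _)); rewrite KJ (le_trans (ler_wpM2l M0 (he x)))// mulrA.
  by rewrite ler_wpM2r ?nrm_ge0.
have lJi : lin Ji.
  by move=> a x y; apply: (can_inj JK); rewrite KJ lJ !KJ.
have bnd x : nrm x <= 2 * M * nrm (J x - S x).
  have h : nrm x <= M * nrm (J x - S x) + 2^-1 * nrm x.
    rewrite -[X in nrm X <= _](JK x) -[X in nrm (Ji X) <= _](subrK (S x)) (linD lJi) (le_trans (nrmD _ _))// lerD//.
    by rewrite (le_trans (hM _))// KJ.
  by rewrite -mulrA; lra.
split => //; apply: inj_surj_bijective.
  move=> x y /= xy; apply/eqP; rewrite -subr_eq0; apply/eqP/nrm_eq0.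
  rewrite (le_trans (bnd _))//.
  have -> : J (x - y) - S (x - y) = (J x - S x) - (J y - S y).
    by rewrite (linB lJ) (linB lS); zmodule.
  by rewrite xy subrr nrm0 mulr0.
move=> y; pose fix w k : X := if k is m.+1 then Ji (y + S (w m)) else 0.
have [||l hl] := Xc (K := nrm (Ji y)) (u := w); first exact: nrm_ge0.
  elim=> [|k IH] /=; first by rewrite (lin0 lS) addr0 subr0 expr0 mulr1.
  rewrite -(linB lJi) opprD addrACA subrr add0r -(linB lS) (le_trans (hS _))//.
  by rewrite exprS mulrCA ler_wpM2l.
exists l; apply: (can_inj KJ) => //.
have E : Ji y = l - Ji (S l).
  apply/eqP; rewrite -subr_eq0; apply/eqP/nrm_eq0.
  apply: (@le_half_exp _ (4 * nrm (Ji y))); first by rewrite mulr_ge0 ?nrm_ge0.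
  move=> k; rewrite add0r.
  have -> : Ji y - (l - Ji (S l)) = (w k.+1 - l) - Ji (S (w k - l)).
    by rewrite /= (linB lS) (linB lJi) (linD lJi); zmodule.
  rewrite (le_trans (nrmBD _ _))// (le_trans (lerD (hl _) (hS _)))//.
  have := hl k; rewrite exprS; set q := _ ^+ k; set a := nrm (Ji y) => h.
  have : 0 <= a * q by rewrite mulr_ge0 ?nrm_ge0// /q exprn_ge0.
  lra.
by rewrite (linB lJi) JK E.
Qed.

End Complete.

(** * Finite rank perturbations of the identity *)

Section FredholmAlgebra.
Context {R : realType} {X : normedModType R[i]}.
Implicit Types (x y : X) (T S J N F : X -> X) (phi : X -> R[i]).
Local Notation C := R[i].

Definition lincomb n (e : 'I_n -> X) (a : 'rV[C]_n) : X := \sum_i a 0 i *: e i.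

Lemma lincomb_row n (e : 'I_n -> X) (a : 'I_n -> C) :
  lincomb e (\row_i a i) = \sum_i a i *: e i.
Proof. by apply: eq_bigr => i _; rewrite mxE. Qed.

Lemma lincomb_mul m n (e : 'I_n -> X) (a : 'rV[C]_m) (A : 'M[C]_(m, n)) :
  lincomb e (a *m A) = lincomb (fun i => lincomb e (row i A)) a.
Proof.
rewrite /lincomb; under eq_bigr do rewrite mxE scaler_suml.
rewrite exchange_big/=; apply: eq_bigr => i _; rewrite scaler_sumr.
by apply: eq_bigr => j _; rewrite scalerA !mxE.
Qed.

Lemma lincomb0 n (e : 'I_n -> X) : lincomb e 0 = 0.
Proof. by rewrite /lincomb big1// => i _; rewrite mxE scale0r. Qed.

(** A linear relation between the rows of coordinates of the [e j] along the
    [f i] is a relation between the [e j] modulo [V], so these rows are free.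
    The trivial [V] compares two bases of a kernel, and the range of an
    operator compares two bases of its cokernel. *)
Lemma independent_card (V : set X) m n (e : 'I_n -> X) (f : 'I_m -> X) :
  (forall a : 'I_n -> C, V (\sum_i a i *: e i) -> forall i, a i = 0) ->
  V 0 -> (forall x y, V x -> V y -> V (x + y)) -> (forall (c : C) x, V x -> V (c *: x)) ->
  (forall j, exists a : 'I_m -> C, V (e j - \sum_i a i *: f i)) ->
  (n <= m)%N.
Proof.
move=> ind V0 VD VZ /choice[A hA].
pose M : 'M[C]_(n, m) := \matrix_(j, i) A j i.
have Vs k (g : 'I_k -> X) : (forall i, V (g i)) -> V (\sum_i g i).
  by move=> h; elim/big_ind: _ => // x y; exact: VD.
suff : row_free M by rewrite -row_leq_rank => /leq_trans; apply; exact: rank_leq_col.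
rewrite -kermx_eq0; apply/eqP/row_matrixP => i; rewrite row0.
have h : row i (kermx M) *m M = 0 by rewrite -row_mul mulmx_ker row0.
apply/rowP => j; rewrite [RHS]mxE.
apply: (ind (fun j => row i (kermx M) 0 j)).
set a := row i (kermx M) in h *.
have -> : \sum_j a 0 j *: e j = \sum_j a 0 j *: (e j - lincomb f (row j M)).
  under [RHS]eq_bigr do rewrite scalerBr.
  rewrite sumrB -[X in _ - X]/(lincomb _ a) -lincomb_mul h lincomb0 subr0.
  by [].
apply: Vs => k; apply: VZ; have := hA k; congr (V (_ - _)).
by apply: eq_bigr => l _; rewrite !mxE.
Qed.

Lemma has_dim_unique (V : set X) m n : has_dim V m -> has_dim V n -> m = n.
Proof.
move=> [e [ie Ve]] [f [jf Vf]].
have sp k l (g : 'I_k -> X) (h : 'I_l -> X) (W : set X) :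
    (forall a : 'I_k -> C, \sum_i a i *: g i = 0 -> forall i, a i = 0) ->
    W = range (fun a : 'I_k -> C => \sum_i a i *: g i) ->
    W = range (fun a : 'I_l -> C => \sum_i a i *: h i) -> (k <= l)%N.
  move=> ig Wg Wh; apply: (@independent_card [set 0] l k g h) => //=.
  - by move=> x y -> ->; rewrite addr0.
  - by move=> c x ->; rewrite scaler0.
  - move=> j; have : W (g j).
      rewrite Wg; exists (fun i => (i == j)%:R) => //.
      rewrite (bigD1 j)//= eqxx scale1r big1 ?addr0// => i /negbTE ->.
      by rewrite scale0r.
    by rewrite Wh => -[a _ <-]; exists a; rewrite subrr.
by apply/eqP; rewrite eqn_leq (sp _ _ e f V)// (sp _ _ f e V).
Qed.

Lemma has_codim_unique (V : set X) m n : V 0 ->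
  (forall x y, V x -> V y -> V (x + y)) -> (forall (c : C) x, V x -> V (c *: x)) ->
  has_codim V m -> has_codim V n -> m = n.
Proof.
move=> V0 VD VZ [e [ie Ve]] [f [jf Vf]].
by apply/eqP; rewrite eqn_leq (independent_card ie (f := f))//
  (independent_card jf (f := e)).
Qed.

Lemma fredholm_index_unique F k l : lin F ->
  fredholm_of_index (Operator setT F) k -> fredholm_of_index (Operator setT F) l ->
  k = l.
Proof.
move=> lF [_ [n [m [hn hm ->]]]] [_ [n' [m' [hn' hm' ->]]]].
rewrite (has_dim_unique hn hn') (has_codim_unique _ _ _ hm hm')//.
- by exists 0 => //=; rewrite lin0.
- by move=> x y [u _ <-] [v _ <-]; exists (u + v) => //=; rewrite (linD lF).
- by move=> c x [u _ <-]; exists (c *: u) => //=; rewrite (linZ lF).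
Qed.

Definition coefs n (phi : 'I_n -> X -> C) x : 'rV[C]_n := \row_i phi i x.

Lemma coefs_lincomb n (phi : 'I_n -> X -> C) (e : 'I_n -> X) a : (forall i, bfun (phi i)) ->
  coefs phi (lincomb e a) = a *m (\matrix_(i, j) phi j (e i)).
Proof.
move=> h; apply/rowP => j; rewrite !mxE /lincomb (bfun_sum (h j)).
by apply: eq_bigr => i _; rewrite (bfunZ (h j)) !mxE.
Qed.

Lemma coefsB n (phi : 'I_n -> X -> C) x y : (forall i, bfun (phi i)) ->
  coefs phi (x - y) = coefs phi x - coefs phi y.
Proof. by move=> h; apply/rowP => j; rewrite !mxE (bfunB (h j)). Qed.

Lemma bfun_mulmx n m (phi : 'I_n -> X -> C) (A : 'M[C]_(n, m)) j :
  (forall i, bfun (phi i)) -> bfun (fun x => (coefs phi x *m A) 0 j).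
Proof.
move=> h; split.
  move=> a x y; rewrite !mxE mulr_sumr -big_split/=; apply: eq_bigr => i _.
  by rewrite !mxE (h i).1 mulrDl mulrA.
have /choice[M hM] : forall i, exists M : R, 0 <= M /\ forall x, normc (phi i x) <= M * nrm x.
  by move=> i; have [_ [M M0 hM]] := h i; exists M.
exists (\sum_i M i * normc (A i j)).
  by apply: sumr_ge0 => i _; rewrite mulr_ge0 ?normc_ge0//; case: (hM i).
move=> x; rewrite !mxE mulr_suml.
apply: (@le_trans _ _ (\sum_i normc (phi i x * A i j))).
  under eq_bigr do rewrite mxE.
  elim/big_rec2: _ => [|i a b _ H]; first by rewrite normc0.
  by apply: (le_trans (le_normcD _ _)); rewrite lerD2l.
apply: ler_sum => i _; rewrite normcM mulrAC ler_wpM2r ?normc_ge0//.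
by case: (hM i).
Qed.

Lemma bfun_ker_closed phi : bfun phi -> closed [set x | phi x = 0].
Proof.
move=> h; have [_ [M M0 hM]] := h.
rewrite -openC openE => x /= px; apply/nbhs_nrm.
have M1 : 0 < M + 1 by rewrite ltr_wpDl.
have n0 : 0 < normc (phi x).
  by rewrite lt_neqAle normc_ge0 andbT eq_sym; apply/eqP => /eq0_normc.
exists (normc (phi x) / (M + 1)); first by rewrite divr_gt0.
move=> y hy py; have := hM (x - y); rewrite (bfunB h) py subr0 leNgt.
apply/negP; rewrite negbK; apply: (@le_lt_trans _ _ ((M + 1) * nrm (x - y))).
  by rewrite ler_wpM2r ?nrm_ge0// lerDl.
by rewrite mulrC -ltr_pdivlMr.
Qed.

Lemma closed_forall_ker n (phi : 'I_n -> X -> C) : (forall i, bfun (phi i)) ->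
  closed [set x | forall i, phi i x = 0].
Proof.
move=> h; rewrite (_ : mkset _ = \bigcap_(i in [set: 'I_n]) [set x | phi i x = 0]).
  by apply: closed_bigI => i _; exact: bfun_ker_closed.
by apply/seteqP; split => [x hx i _|x hx i]; exact: hx.
Qed.

(** For [N x = \sum_i phi i x *: f i], taking coefficients [phi i x]
    identifies the kernel and the cokernel of [1 - N] with those of the square
    matrix [M = 1 - (phi j (f i))], which have the same dimension. *)
Lemma fredholm_id_sub_finrank N : finrank N ->
  fredholm_of_index (Operator setT (fun x => x - N x)) 0.
Proof.
move=> [n [phi [f [hphi NE]]]].
pose P : 'M[C]_n := \matrix_(i, j) phi j (f i).
pose M : 'M[C]_n := 1%:M - P.
have NE' x : N x = lincomb f (coefs phi x).
  by rewrite NE; apply: eq_bigr => i _; rewrite mxE.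
have cl a : coefs phi (lincomb f a) = a *m P by exact: coefs_lincomb.
have cE x : coefs phi (x - N x) = coefs phi x *m M.
  by rewrite coefsB// NE' cl mulmxBr mulmx1.
have MP : M + P = 1%:M by rewrite subrK.
clearbody M P.
have rangeE : op_range (Operator setT (fun x => x - N x)) =
    [set y | coefs phi y *m cokermx M = 0].
  apply/seteqP; split => [_ [x _ <-]/=|y /= hy].
    by rewrite cE -mulmxA mulmx_coker mulmx0.
  have : (coefs phi y <= M)%MS by rewrite submxE hy.
  move=> /submxP[a ha]; exists (y + lincomb f a) => //=.
  have ca : coefs phi (y + lincomb f a) = a.
    rewrite -[lincomb f a]opprK coefsB//.
    have -> : coefs phi (- lincomb f a) = - (a *m P).
      by rewrite -[- lincomb f a]sub0r coefsB// cl; apply/rowP => i; rewrite !mxE (bfun0 (hphi i)) sub0r.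
    by rewrite opprK ha -mulmxDr MP mulmx1.
  by rewrite NE' ca addrK.
pose r := \rank M.
pose K := row_base (kermx M).
have Kr : \rank (kermx M) = (n - r)%N by rewrite mxrank_ker.
split.
  rewrite rangeE (_ : mkset _ = [set x | forall i, (coefs phi x *m cokermx M) 0 i = 0]).
    by apply: closed_forall_ker => i; exact: bfun_mulmx.
  apply/seteqP; split => [x /= -> i|x /= h]; first by rewrite mxE.
  by apply/rowP => i; rewrite h mxE.
exists (n - r)%N, (n - r)%N; split; last by rewrite subrr.
- rewrite -Kr; exists (fun i => lincomb f (row i K)).
  have KM (a : 'rV_(\rank (kermx M))) : a *m K *m M = 0.
    by apply/sub_kermxP; rewrite (submx_trans (submxMl _ _))// eq_row_base.
  have cK (a : 'rV_(\rank (kermx M))) : coefs phi (lincomb f (a *m K)) = a *m K.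
    by rewrite cl -[RHS]mulmx1 -MP mulmxDr KM add0r.
  split.
    move=> a ha i; rewrite -lincomb_row -lincomb_mul in ha.
    have : (\row_i a i) *m K = 0 by rewrite -cK ha; apply/rowP => j; rewrite !mxE (bfun0 (hphi j)).
    move=> /eqP; rewrite mulmx_free_eq0 ?row_base_free// => /eqP/rowP/(_ i).
    by rewrite !mxE.
  apply/seteqP; split.
    move=> x [_ /= hx]; have xN : x = N x by apply/eqP; rewrite -subr_eq0 hx.
    have : (coefs phi x <= kermx M)%MS.
      by apply/sub_kermxP; rewrite -cE hx; apply/rowP => j; rewrite !mxE (bfun0 (hphi j)).
    rewrite -(eq_row_base (kermx M)) => /submxP[a ha].
    by exists (fun i => a 0 i) => //; rewrite -[LHS]/(lincomb _ a) -lincomb_mul -ha -NE'.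
  move=> _ [a _ <-]; rewrite -lincomb_row -lincomb_mul; split => //=.
  by rewrite NE' cK subrr.
- pose Q := row_base (M^C)%MS.
  have Qr : \rank (M^C)%MS = (n - r)%N by rewrite mxrank_compl.
  rewrite -Qr; exists (fun i => lincomb f (row i Q)).
  have cP (a : 'rV_n) : coefs phi (lincomb f a) *m cokermx M = a *m cokermx M.
    have E1 : a *m M *m cokermx M = 0 by rewrite -mulmxA mulmx_coker mulmx0.
    have E2 : (a *m M + a *m P) *m cokermx M = a *m cokermx M by rewrite -mulmxDr MP mulmx1.
    by rewrite cl; move: E2; rewrite mulmxDl E1 add0r.
  split.
    move=> a; rewrite rangeE /= -lincomb_row -lincomb_mul cP => h.
    have h1 : ((\row_i a i) *m Q <= M)%MS by rewrite submxE h.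
    have h2 : ((\row_i a i) *m Q <= M^C)%MS.
      by rewrite (submx_trans (submxMl _ _))// eq_row_base.
    have : ((\row_i a i) *m Q <= M :&: M^C)%MS by rewrite sub_capmx h1.
    rewrite capmx_compl submx0 mulmx_free_eq0 ?row_base_free// => /eqP/rowP h0 i.
    by have := h0 i; rewrite !mxE.
  move=> x; have : (coefs phi x <= M + M^C)%MS.
    by apply: submx_full; exact: addsmx_compl_full.
  move=> /sub_addsmxP[[u v] /= hx].
  have : (v *m (M^C)%MS <= Q)%MS by rewrite eq_row_base submxMl.
  move=> /submxP[a ha]; exists (fun i => a 0 i).
  rewrite -[X in x - X]/(lincomb _ a) -lincomb_mul rangeE /= coefsB// mulmxBl cP.
  by rewrite hx -ha mulmxDl -mulmxA mulmx_coker mulmx0 add0r subrr.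
Qed.

End FredholmAlgebra.

(** * Stability of the Fredholm index zero *)

Section FredholmStability.
Context {R : realType} {X : normedModType R[i]}.
Implicit Types (x y : X) (T S J N F : X -> X) (phi : X -> R[i]).
Local Notation C := R[i].
Context (Xc : @rapidly_complete R X).
(* functionals dual to a basis of the kernel, as the Hahn-Banach theorem
   provides them *)
Context (dual : forall n (e : 'I_n -> X),
  (forall a : 'I_n -> C, \sum_i a i *: e i = 0 -> forall i, a i = 0) ->
  exists phi : 'I_n -> X -> C, (forall i, bfun (phi i)) /\
    forall i j, phi i (e j) = (i == j)%:R).

(** A bijection bounded from below carries closed sets, kernels and cokernels
    over. *)
Lemma fredholm_index_comp J G : blin J -> bijective J -> lin G ->
  (exists2 M : R, 0 < M & forall x, nrm x <= M * nrm (J x)) ->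
  fredholm_of_index (Operator setT G) 0 ->
  fredholm_of_index (Operator setT (J \o G)) 0.
Proof.
move=> [lJ [B B0 hB]] [Ji JK KJ] lG [M M0 hM] [cG [n [m [[e [ie Ke]] [f [jf Vf]] nm]]]].
have lJi : lin Ji by move=> a x y; apply: (can_inj JK); rewrite KJ lJ !KJ.
have rE : op_range (Operator setT (J \o G)) = [set y | op_range (Operator setT G) (Ji y)].
  apply/seteqP; split => [_ [x _ <-] /=|y [x _ /= h]]; first by exists x => //=; rewrite JK.
  by exists x => //=; rewrite h KJ.
split.
  rewrite rE -openC openE => y /= Vy.
  have : open (~` op_range (Operator setT G)) by rewrite openC.
  rewrite openE => /(_ _ Vy) /nbhs_nrm[d d0 hd].
  apply/nbhs_nrm; exists (d / M); first by rewrite divr_gt0.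
  move=> z hz; apply: hd; rewrite -(linB lJi) (le_lt_trans (hM _))// KJ.
  by rewrite mulrC -ltr_pdivlMr.
exists n, m; split => //.
- exists e; split => //; rewrite -Ke; apply/seteqP; split => x [_ /= h]; split => //=.
    by apply: (can_inj JK); rewrite h (lin0 lJ).
  by rewrite h (lin0 lJ).
- exists (J \o f); rewrite rE; split.
    move=> a /=; rewrite (lin_sum lJi); under eq_bigr do rewrite (linZ lJi) JK.
    exact: jf.
  move=> x; have [a ha] := Vf (Ji x); exists a => /=.
  rewrite (linB lJi) (lin_sum lJi).
  by under eq_bigr do rewrite (linZ lJi) JK.
Qed.

(** [J - N = J (1 - J^-1 N)]. *)
Lemma fredholm_bijective_sub_finrank J N : blin J -> bijective J -> finrank N ->
  fredholm_of_index (Operator setT (fun x => J x - N x)) 0.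
Proof.
move=> bJ jJ nN; have [M M0 hM] := open_mapping Xc bJ jJ.
have [Ji JK KJ] := jJ.
have lJi : lin Ji by move=> a x y; apply: (can_inj JK); rewrite KJ bJ.1 !KJ.
have nJN : finrank (Ji \o N) by exact: finrank_compl.
have := @fredholm_index_comp J _ bJ jJ (blinB blin_id (finrank_blin nJN)).1.
move=> /(_ (ex_intro2 _ _ M M0 hM) (fredholm_id_sub_finrank nJN)).
by congr (fredholm_of_index (Operator _ _) _); apply/funext => x /=;
  rewrite (linB bJ.1) KJ.
Qed.

(** Kernel and cokernel have the same dimension, so that a finite rank
    operator [N] can map a basis of the kernel onto a basis of a complement of
    the range; then [F + N] is bijective. *)
Lemma fredholm0_decomposition F : blin F -> fredholm_of_index (Operator setT F) 0 ->
  exists J N, [/\ blin J, bijective J, finrank N & forall x, F x = J x - N x].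
Proof.
move=> bF [_ [n [m [[e [ie Ke]] [f [jf Vf]] /esym/eqP]]]].
rewrite subr_eq0 eqz_nat => /eqP nm; subst m.
have [phi [hphi pe]] := dual ie.
pose N x := \sum_i phi i x *: f i.
have nN : finrank N by exists n, phi, f.
have Fe (a : 'I_n -> C) : F (\sum_i a i *: e i) = 0.
  have : op_ker (Operator setT F) (\sum_i a i *: e i) by rewrite Ke; exists a.
  by case.
have pa (a : 'I_n -> C) i : phi i (\sum_j a j *: e j) = a i.
  rewrite (bfun_sum (hphi i)) (bigD1 i)//= (bfunZ (hphi i)) pe eqxx mulr1.
  rewrite big1 ?addr0// => j ji; rewrite (bfunZ (hphi i)) pe eq_sym.
  by rewrite (negbTE ji) mulr0.
exists (fun x => F x + N x), N; split => //.
- by apply: blinD => //; exact: finrank_blin.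
- have lFN : lin (fun x => F x + N x) by exact: (blinD bF (finrank_blin nN)).1.
  apply: inj_surj_bijective.
    move=> x y xy; apply/eqP; rewrite -subr_eq0; apply/eqP; move: (x - y) (linB lFN x y) => z.
    rewrite xy subrr => hz.
    have pz i : phi i z = 0.
      apply: (jf (phi^~ z)); exists (- z) => //=; rewrite (linN bF.1).
      by apply/eqP; rewrite -[X in _ == X]/(N z) -subr_eq0 -opprD oppr_eq0 hz.
    have Nz : N z = 0 by rewrite /N big1// => i _; rewrite pz scale0r.
    have : op_ker (Operator setT F) z by split => //=; rewrite Nz addr0 in hz.
    rewrite Ke => -[a _ az]; rewrite -az big1// => i _.
    by rewrite -(pa a) az pz scale0r.
  move=> y; have [a [x _ /= hx]] := Vf y.
  exists (x + \sum_i (a i - phi i x) *: e i).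
  rewrite (linD bF.1) Fe addr0 hx /N.
  under [X in _ + X]eq_bigr => i _ do rewrite (bfunD (hphi i)) (pa (fun i => a i - phi i x)) subrKC.
  by rewrite subrK.
- by move=> x; rewrite addrK.
Qed.

(** If [F = J - N] and [P] is a finite rank operator close to [T], then [F - T
    = (J - (T - P)) - (N + P)], where [J - (T - P)] is bijective by the
    Neumann series. *)
Theorem fredholm0_sub_approx_finrank F T : blin F -> approx_finrank T ->
  fredholm_of_index (Operator setT F) 0 ->
  fredholm_of_index (Operator setT (fun x => F x - T x)) 0.
Proof.
move=> bF aT /(fredholm0_decomposition bF)[J [N [bJ jJ nN FE]]].
have [M M0 hM] := open_mapping Xc bJ jJ.
have e0 : 0 < (2 * M)^-1 by rewrite invr_gt0 mulr_gt0.
have [P nP hP] := aT.2 _ e0.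
have bS : blin (fun x => T x - P x).
  exact: blinB (approx_finrank_blin aT) (finrank_blin nP).
have [|jJS _] := Neumann Xc bJ.1 jJ bS.1 (ltW M0) hM hP.
  by rewrite invfM mulrCA mulfV ?mulr1// gt_eqF.
have := fredholm_bijective_sub_finrank (blinB bJ bS) jJS (finrankD nN nP).
by congr (fredholm_of_index (Operator _ _) _); apply/funext => x; rewrite FE; zmodule.
Qed.

End FredholmStability.

(** * Essential spectra of operators on a parametrized domain *)

Section UnboundedTransfer.
Context {R : realType} {X : normedModType R[i]}.
Implicit Types (x y : X) (P : operator X) (G : X -> X).

(** A linear parametrization [G] of the domain turns an unbounded operator
    into one that is defined everywhere, with the same range and an isomorphic
    kernel. *)
Lemma fredholm_of_index_transfer P G k : lin G -> injective G -> op_dom P = range G ->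
  fredholm_of_index P k <-> fredholm_of_index (Operator setT (op_fun P \o G)) k.
Proof.
move=> lG iG dE.
have rE : op_range P = op_range (Operator setT (op_fun P \o G)).
  rewrite /op_range dE; apply/seteqP; split => [_ [_ [x _ <-] <-]|_ [x _ <-]] /=.
    by exists x.
  by exists (G x) => //; exists x.
have kE : op_ker P = G @` op_ker (Operator setT (op_fun P \o G)).
  rewrite /op_ker dE; apply/seteqP; split => [_ /= [[x _ <-] h]|_ /= [x [_ h] <-]].
    by exists x.
  by split => //; exists x.
have dimE n : has_dim (op_ker P) n <-> has_dim (op_ker (Operator setT (op_fun P \o G))) n.
  rewrite kE; set V := op_ker _; split => [[e [ie Ve]]|[e [ie Ve]]].
    have /choice[g hg] : forall i, exists x, V x /\ G x = e i.
      move=> i; have : (G @` V) (e i).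
        rewrite Ve; exists (fun j => (j == i)%:R) => //.
        rewrite (bigD1 i)//= eqxx scale1r big1 ?addr0// => j /negbTE ->.
        by rewrite scale0r.
      by case=> x Vx <-; exists x.
    have gE (a : 'I_n -> R[i]) : G (\sum_i a i *: g i) = \sum_i a i *: e i.
      by rewrite (lin_sum lG); apply: eq_bigr => i _; rewrite (linZ lG) (hg i).2.
    exists g; split.
      by move=> a ha; apply: ie; rewrite -gE ha (lin0 lG).
    apply/seteqP; split => [x Vx|_ [a _ <-]].
      have : (G @` V) (G x) by exists x.
      by rewrite Ve => -[a _]; rewrite -gE => /iG <-; exists a.
    have : (G @` V) (\sum_i a i *: e i) by rewrite Ve; exists a.
    by rewrite -gE => -[x Vx /iG <-].
  have gE (a : 'I_n -> R[i]) : G (\sum_i a i *: e i) = \sum_i a i *: G (e i).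
    by rewrite (lin_sum lG); apply: eq_bigr => i _; rewrite (linZ lG).
  exists (G \o e); split.
    by move=> a h; apply: (ie a); apply: iG; rewrite gE (lin0 lG) -[RHS]h.
  rewrite Ve; apply/seteqP; split => [_ [_ [a _ <-] <-]|_ [a _ <-]] /=.
    by exists a => //; rewrite gE.
  by exists (\sum_i a i *: e i); [exists a|rewrite gE].
split => -[c [n [m [hn hm ke]]]]; (split; first by rewrite ?rE// -rE);
  exists n, m; split => //; try (by apply/dimE); by rewrite ?rE// -rE.
Qed.

Lemma essential_spectrum_index0 P G lambda : lin G -> injective G -> op_dom P = range G ->
  lin (op_fun (op_shift P lambda) \o G) ->
  ~ essential_spectrum P lambda <->
  fredholm_of_index (Operator setT (op_fun (op_shift P lambda) \o G)) 0.
Proof.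
move=> lG iG dE lF; have tr := @fredholm_of_index_transfer (op_shift P lambda) G _ lG iG dE.
rewrite -tr; split.
  move=> /not_orP[/contrapT[k hk] h2].
  by have [<-//|k0] := eqVneq k 0; case: h2; exists k.
move=> h0 [|[k hk /eqP k0]]; first by apply; exists 0.
by apply: k0; apply: (fredholm_index_unique lF); apply/tr.
Qed.

End UnboundedTransfer.

(** * Complex Lebesgue integrals *)

Section ComplexIntegral.
Context {R : realType}.
Local Notation mu := (@lebesgue_measure R).
Local Notation C := R[i].
Implicit Types (f g : R -> C) (h : R -> R).

Lemma aeP (P Q : R -> Prop) : (forall x, P x -> Q x) ->
  (\forall x \ae mu, P x) -> \forall x \ae mu, Q x.
Proof. by move=> PQ; apply: (@filterS _ _ (ae_filter_ringOfSetsType mu)). Qed.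

Lemma aeP2 (P Q S : R -> Prop) : (forall x, P x -> Q x -> S x) ->
  (\forall x \ae mu, P x) -> (\forall x \ae mu, Q x) -> \forall x \ae mu, S x.
Proof. by move=> PQ; apply: (@filterS2 _ _ (ae_filter_ringOfSetsType mu)). Qed.

Lemma aeW (P : R -> Prop) : (forall x, P x) -> \forall x \ae mu, P x.
Proof. by move=> h; apply: (@nearW _ _ _ (ae_filter_ringOfSetsType mu)). Qed.

Lemma ReD (a b : C) : complex.Re (a + b) = complex.Re a + complex.Re b.
Proof. by case: a; case: b. Qed.
Lemma ImD (a b : C) : complex.Im (a + b) = complex.Im a + complex.Im b.
Proof. by case: a; case: b. Qed.
Lemma ReM (a b : C) :
  complex.Re (a * b) = complex.Re a * complex.Re b - complex.Im a * complex.Im b.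
Proof. by case: a; case: b. Qed.
Lemma ImM (a b : C) :
  complex.Im (a * b) = complex.Re a * complex.Im b + complex.Im a * complex.Re b.
Proof. by case: a => ? ?; case: b => ? ?. Qed.
Lemma ReN (a : C) : complex.Re (- a) = - complex.Re a.
Proof. by case: a. Qed.
Lemma ImN (a : C) : complex.Im (- a) = - complex.Im a.
Proof. by case: a. Qed.
(** Complex conjugation, given by components so that real and imaginary parts
    compute. *)
Definition cj (a : C) : C := complex.Re a +i* - complex.Im a.

Lemma ReJ (a : C) : complex.Re (cj a) = complex.Re a.
Proof. by case: a. Qed.
Lemma ImJ (a : C) : complex.Im (cj a) = - complex.Im a.
Proof. by case: a. Qed.

Lemma complex_ext (a b : C) :
  complex.Re a = complex.Re b -> complex.Im a = complex.Im b -> a = b.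
Proof. by case: a b => a1 a2 [b1 b2] /= -> ->. Qed.

Lemma normc_sqr (a : C) : normc a ^+ 2 = complex.Re a ^+ 2 + complex.Im a ^+ 2.
Proof. by case: a => a b /=; rewrite sqr_sqrtr// addr_ge0 ?sqr_ge0. Qed.

Lemma conjD (a b : C) : cj (a + b) = cj a + cj b.
Proof. by case: a b => ? ? [? ?]; rewrite /cj /= opprD. Qed.
Lemma conjN (a : C) : cj (- a) = - cj a.
Proof. by rewrite /cj ReN ImN. Qed.
Lemma conjM (a b : C) : cj (a * b) = cj a * cj b.
Proof.
by apply: complex_ext; rewrite ?(ReM, ImM, ReJ, ImJ); ring.
Qed.
Lemma conjK (a : C) : cj (cj a) = a.
Proof. by case: a => ? ?; rewrite /cj /= opprK. Qed.
Lemma conjR (a : R) : cj (a%:C) = a%:C.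
Proof. by rewrite /cj /= oppr0. Qed.
Lemma conj0 : cj (0 : C) = 0.
Proof. by rewrite /cj /= oppr0. Qed.

Lemma normcJ (a : C) : normc (cj a) = normc a.
Proof. by case: a => a b /=; rewrite sqrrN. Qed.

Lemma normc_sqr_conj (a : C) : (normc a ^+ 2)%:C = a * cj a.
Proof.
apply: complex_ext; rewrite ?ReM ?ImM ReJ ImJ /= ?normc_sqr; first by ring.
by rewrite mulrN mulrC addNr.
Qed.

Lemma normc_opp (a : C) : normc (- a) = normc a.
Proof. by case: a => a b /=; rewrite !sqrrN. Qed.

Lemma normcBC (a b : C) : normc (a - b) = normc (b - a).
Proof. by rewrite -normc_opp opprB. Qed.

Lemma cmeasurableD f g : cmeasurable f -> cmeasurable g -> cmeasurable (fun x => f x + g x).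
Proof.
move=> mf mg; have := cmeasurable_lin 1 mf mg.
by congr cmeasurable; apply/funext => x; rewrite scale1r.
Qed.

Lemma cmeasurableM f g : cmeasurable f -> cmeasurable g -> cmeasurable (fun x => f x * g x).
Proof.
move=> [f1 f2] [g1 g2]; split.
- rewrite (_ : _ \o _ = (fun x => complex.Re (f x) * complex.Re (g x) -
      complex.Im (f x) * complex.Im (g x))); last by apply/funext => x /=; rewrite ReM.
  by apply: measurable_funB; apply: measurable_funM.
- rewrite (_ : _ \o _ = (fun x => complex.Re (f x) * complex.Im (g x) +
      complex.Im (f x) * complex.Re (g x))); last by apply/funext => x /=; rewrite ImM.
  by apply: measurable_funD; apply: measurable_funM.
Qed.

Lemma cmeasurable_cst (c : C) : cmeasurable (fun _ : R => c).
Proof. by split; exact: measurable_cst. Qed.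

Lemma cmeasurableN f : cmeasurable f -> cmeasurable (fun x => - f x).
Proof.
move=> mf; have := cmeasurableM (cmeasurable_cst (-1)) mf.
by congr cmeasurable; apply/funext => x; rewrite mulN1r.
Qed.

Lemma cmeasurableB f g : cmeasurable f -> cmeasurable g -> cmeasurable (fun x => f x - g x).
Proof. by move=> mf mg; apply: cmeasurableD => //; exact: cmeasurableN. Qed.

Lemma cmeasurableJ f : cmeasurable f -> cmeasurable (fun x => cj (f x)).
Proof.
move=> [f1 f2]; split.
  by rewrite (_ : _ \o _ = @complex.Re R \o f)//; apply/funext => x /=; rewrite ReJ.
rewrite (_ : _ \o _ = (fun x => - complex.Im (f x)))//.
exact: measurable_funN.
Qed.

Lemma cmeasurable_real h : measurable_fun [set: R] h -> cmeasurable (fun x => (h x)%:C).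
Proof. by move=> mh; split => //; exact: measurable_cst. Qed.

Lemma cmeasurable_comp f h : cmeasurable f -> measurable_fun [set: R] h ->
  cmeasurable (f \o h).
Proof. by move=> [f1 f2] mh; split; [exact: (measurableT_comp f1 mh)|exact: (measurableT_comp f2 mh)]. Qed.

Lemma measurable_normc2 f : cmeasurable f ->
  measurable_fun [set: R] (fun x => (normc (f x) ^+ 2)%:E : \bar R).
Proof.
by move=> mf; apply/measurable_EFinP; apply: measurable_funX; exact: measurable_normc.
Qed.

(** The square of the L2 norm, for which no root of an extended real has to be
    taken. *)
Definition sqn f : \bar R := (\int[mu]_x (normc (f x) ^+ 2)%:E)%E.

Lemma sqn_ge0 f : (0 <= sqn f)%E.
Proof. by apply: integral_ge0 => x _; rewrite lee_fin sqr_ge0. Qed.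

Lemma L2norm_sqn f : (L2norm f `^ 2 = sqn f)%E.
Proof.
rewrite /L2norm poweR_Lnorm//; apply: eq_integral => x _ /=.
by rewrite ger0_norm ?normc_ge0// powR_mulrn ?normc_ge0.
Qed.

Lemma L2norm_def f : L2norm f = (sqn f `^ 2^-1)%E.
Proof. by rewrite -L2norm_sqn -poweRrM ?divff ?poweRe1 ?L2norm_ge0. Qed.

Lemma is_L2P f : is_L2 f <-> cmeasurable f /\ (sqn f < +oo)%E.
Proof.
split=> -[mf h]; split => //.
  by rewrite -L2norm_sqn; apply: poweR_lty.
by rewrite L2norm_def; apply: poweR_lty.
Qed.

Lemma sqn_ae f g : cmeasurable f -> cmeasurable g ->
  (\forall x \ae mu, f x = g x) -> sqn f = sqn g.
Proof. by move=> mf mg fg; rewrite -!L2norm_sqn (L2norm_ae mf mg fg). Qed.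

Lemma is_L2_ae f g : cmeasurable g -> (\forall x \ae mu, f x = g x) -> is_L2 f -> is_L2 g.
Proof.
move=> mg fg /is_L2P[mf lf]; apply/is_L2P; split => //.
by rewrite -(sqn_ae mf mg fg).
Qed.

Lemma sqn_le f g : cmeasurable f -> cmeasurable g ->
  (forall x, normc (f x) <= normc (g x)) -> (sqn f <= sqn g)%E.
Proof.
move=> mf mg fg; apply: ge0_le_integral => //.
- by move=> x _; rewrite lee_fin sqr_ge0.
- exact: measurable_normc2.
- exact: measurable_normc2.
- by move=> x _; rewrite lee_fin lerXn2r ?nnegrE ?normc_ge0.
Qed.

Lemma is_L2_le f g : cmeasurable f -> is_L2 g ->
  (forall x, normc (f x) <= normc (g x)) -> is_L2 f.
Proof.
move=> mf /is_L2P[mg lg] fg; apply/is_L2P; split => //.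
by apply: le_lt_trans lg; exact: sqn_le.
Qed.

Lemma sqnZ (c : C) f : cmeasurable f -> sqn (fun x => c * f x) = ((normc c ^+ 2)%:E * sqn f)%E.
Proof.
move=> mf; rewrite /sqn -ge0_integralZl//.
- by apply: eq_integral => x _; rewrite normcM exprMn EFinM.
- exact: measurable_normc2.
- by move=> x _; rewrite lee_fin sqr_ge0.
- by rewrite lee_fin sqr_ge0.
Qed.

Lemma is_L2Z (c : C) f : is_L2 f -> is_L2 (fun x => c * f x).
Proof.
move=> /is_L2P[mf lf]; apply/is_L2P; split.
  exact: cmeasurableM (cmeasurable_cst c) mf.
by rewrite sqnZ// lte_mul_pinfty// lee_fin sqr_ge0.
Qed.

Lemma is_L2_lin (c : C) f g : is_L2 f -> is_L2 g -> is_L2 (c *: f + g).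
Proof.
move=> hf hg; apply/asboolP.
have [_ h] := @L2_submod_closed R; apply: h; exact/asboolP.
Qed.

Lemma is_L2D f g : is_L2 f -> is_L2 g -> is_L2 (fun x => f x + g x).
Proof.
move=> hf hg; have := is_L2_lin 1 hf hg.
by congr is_L2; apply/funext => x; rewrite scale1r.
Qed.

Lemma is_L2N f : is_L2 f -> is_L2 (fun x => - f x).
Proof.
move=> /(is_L2Z (-1)); congr is_L2.
by apply/funext => x; rewrite mulN1r.
Qed.

Lemma is_L2B f g : is_L2 f -> is_L2 g -> is_L2 (fun x => f x - g x).
Proof. by move=> hf hg; apply: is_L2D => //; exact: is_L2N. Qed.

Lemma is_L2J f : is_L2 f -> is_L2 (fun x => cj (f x)).
Proof.
move=> hf; apply: (is_L2_le _ hf); first exact: cmeasurableJ hf.1.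
by move=> x; rewrite normcJ.
Qed.

Lemma is_L2_0 : is_L2 (fun _ : R => 0 : C).
Proof. by split; [exact: cmeasurable0|rewrite [L2norm _]L2norm0]. Qed.

Lemma is_L2_bound f g (M : R) : cmeasurable f -> is_L2 g ->
  (forall x, normc (f x) <= M) -> is_L2 (fun x => f x * g x).
Proof.
move=> mf hg fM; apply: (@is_L2_le _ (fun x => M%:C * g x)).
- exact: cmeasurableM mf hg.1.
- exact: is_L2Z.
move=> x; rewrite !normcM ler_wpM2r ?normc_ge0//.
by rewrite normcR (le_trans (fM x))// ler_norm.
Qed.

Definition cintegrable f := mu.-integrable setT (EFin \o (@complex.Re R \o f)) /\
  mu.-integrable setT (EFin \o (@complex.Im R \o f)).

Local Notation cint := (@cintegral R setT).

Lemma cintegrableP f : cintegrable f <->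
  cmeasurable f /\ (\int[mu]_x (normc (f x))%:E < +oo)%E.
Proof.
split.
  move=> [/integrableP[f1 i1] /integrableP[f2 i2]].
  have mf : cmeasurable f by split; exact/measurable_EFinP.
  split => //.
  apply: (@le_lt_trans _ _ (\int[mu]_x (`|(complex.Re (f x))%:E| + `|(complex.Im (f x))%:E|))%E).
    apply: ge0_le_integral => //.
    - by move=> x _; rewrite lee_fin normc_ge0.
    - by apply/measurable_EFinP; exact: measurable_normc.
    - by apply: emeasurable_funD; apply: measurableT_comp.
    - by move=> x _; rewrite !abse_EFin -EFinD lee_fin normc_ReIm.
  rewrite ge0_integralD//; first exact: lte_add_pinfty.
  - by apply: measurableT_comp.
  - by apply: measurableT_comp.
move=> [mf lf]; have mn := measurable_normc mf.
have key (h : R -> R) : measurable_fun [set: R] h -> (forall x, `|h x| <= normc (f x)) ->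
    mu.-integrable setT (EFin \o h).
  move=> mh hf; apply/integrableP; split; first exact/measurable_EFinP.
  apply: (le_lt_trans _ lf); apply: ge0_le_integral => //=.
  - by apply/measurable_EFinP; exact: measurableT_comp.
  - by apply/measurable_EFinP.
  - by move=> x _; rewrite lee_fin.
split; apply: key.
- exact: mf.1.
- by move=> x; exact: Re_le_normc.
- exact: mf.2.
- by move=> x; exact: Im_le_normc.
Qed.

Lemma cintegrable_normc f : cintegrable f -> mu.-integrable setT (fun x => (normc (f x))%:E).
Proof.
move=> /cintegrableP[mf lf]; apply/integrableP; split.
  by apply/measurable_EFinP; exact: measurable_normc.
by under eq_integral do rewrite abse_EFin ger0_norm ?normc_ge0//.
Qed.

Lemma cintegrable_le f h : cmeasurable f -> mu.-integrable setT (EFin \o h) ->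
  (forall x, normc (f x) <= h x) -> cintegrable f.
Proof.
move=> mf /integrableP[mh ih] fh; apply/cintegrableP; split => //.
apply: le_lt_trans ih; apply: ge0_le_integral => //=.
- by move=> x _; rewrite lee_fin normc_ge0.
- by apply/measurable_EFinP; exact: measurable_normc.
- by apply/measurable_EFinP; apply: measurableT_comp => //; exact/measurable_EFinP.
- by move=> x _; rewrite lee_fin (le_trans (fh x))// ler_norm.
Qed.

Lemma cintegrable_bound f g (M : R) : cmeasurable f -> cintegrable g ->
  (forall x, normc (f x) <= M) -> cintegrable (fun x => f x * g x).
Proof.
move=> mf ig fM; apply: (@cintegrable_le _ (fun x => M * normc (g x))).
- by apply: cmeasurableM => //; move/cintegrableP: ig => [].
- have := integrableZl measurableT M (cintegrable_normc ig).
  by congr (_.-integrable _ _).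
- by move=> x; rewrite normcM ler_wpM2r ?normc_ge0.
Qed.

Lemma cintegrableZ (c : C) f : cintegrable f -> cintegrable (fun x => c * f x).
Proof. by move=> h; apply: (cintegrable_bound (cmeasurable_cst c) h). Qed.

Lemma cintegrableD f g : cintegrable f -> cintegrable g -> cintegrable (fun x => f x + g x).
Proof.
move=> [f1 f2] [g1 g2]; split.
  by have := integrableD measurableT f1 g1; congr (_.-integrable _ _); apply/funext => x /=;
    rewrite ReD EFinD.
by have := integrableD measurableT f2 g2; congr (_.-integrable _ _); apply/funext => x /=;
    rewrite ImD EFinD.
Qed.

Lemma cintegrableN f : cintegrable f -> cintegrable (fun x => - f x).
Proof.
move=> /(cintegrableZ (-1)); congr cintegrable.
by apply/funext => x; rewrite mulN1r.
Qed.

Lemma cintegrableB f g : cintegrable f -> cintegrable g -> cintegrable (fun x => f x - g x).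
Proof. by move=> hf hg; apply: cintegrableD => //; exact: cintegrableN. Qed.

Lemma cintegrableJ f : cintegrable f -> cintegrable (fun x => cj (f x)).
Proof.
move=> /cintegrableP[mf lf]; apply/cintegrableP; split; first exact: cmeasurableJ.
by under eq_integral do rewrite normcJ.
Qed.

Lemma cintD f g : cintegrable f -> cintegrable g ->
  cint (fun x => f x + g x) = cint f + cint g.
Proof.
move=> [f1 f2] [g1 g2]; rewrite /cintegral; apply: complex_ext; rewrite ?ReD ?ImD /=.
  rewrite -RintegralD//; apply: eq_Rintegral => x _; exact: ReD.
rewrite -RintegralD//; apply: eq_Rintegral => x _; exact: ImD.
Qed.

Lemma cintZ (c : C) f : cintegrable f -> cint (fun x => c * f x) = c * cint f.
Proof.
move=> [f1 f2]; rewrite /cintegral; apply: complex_ext; rewrite ?ReM ?ImM /=.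
  have iR a : mu.-integrable setT (EFin \o (fun x => a * complex.Re (f x))).
    by have := integrableZl measurableT a f1; congr (_.-integrable _ _).
  have iI a : mu.-integrable setT (EFin \o (fun x => a * complex.Im (f x))).
    by have := integrableZl measurableT a f2; congr (_.-integrable _ _).
  rewrite -!RintegralZl// -RintegralB//; apply: eq_Rintegral => x _; exact: ReM.
have iR a : mu.-integrable setT (EFin \o (fun x => a * complex.Re (f x))).
  by have := integrableZl measurableT a f1; congr (_.-integrable _ _).
have iI a : mu.-integrable setT (EFin \o (fun x => a * complex.Im (f x))).
  by have := integrableZl measurableT a f2; congr (_.-integrable _ _).
rewrite -!RintegralZl// -RintegralD//; apply: eq_Rintegral => x _; exact: ImM.
Qed.

Lemma eq_cint f g : f =1 g -> cint f = cint g.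
Proof. by move=> /funext ->. Qed.

Lemma cintN f : cintegrable f -> cint (fun x => - f x) = - cint f.
Proof. by move=> h; rewrite -mulN1r -cintZ//; apply: eq_cint => x; rewrite mulN1r. Qed.

Lemma cintB f g : cintegrable f -> cintegrable g ->
  cint (fun x => f x - g x) = cint f - cint g.
Proof. by move=> hf hg; rewrite cintD ?cintN//; exact: cintegrableN. Qed.

Lemma cintJ f : cintegrable f -> cint (fun x => cj (f x)) = cj (cint f).
Proof.
move=> [f1 f2]; rewrite /cintegral; apply: complex_ext; rewrite ?ReJ ?ImJ /=.
  by apply: eq_Rintegral => x _; exact: ReJ.
rewrite -[RHS]mulN1r -RintegralZl//; apply: eq_Rintegral => x _.
by rewrite mulN1r; exact: ImJ.
Qed.

Lemma cint_real h : cint (fun x => (h x)%:C) = (\int[mu]_x h x)%:C.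
Proof.
apply: complex_ext => //=; rewrite -[LHS]/(\int[mu]_x 0).
by rewrite /Rintegral integral0.
Qed.

Lemma cint0 : cint (fun _ => 0) = 0.
Proof. by rewrite cint_real /Rintegral integral0. Qed.

Lemma cint_ae f g : cmeasurable f -> cmeasurable g ->
  (\forall x \ae mu, f x = g x) -> cint f = cint g.
Proof.
move=> [f1 f2] [g1 g2] fg; rewrite /cintegral /Rintegral.
congr (fine _ +i* fine _); apply: ae_eq_integral => //; try exact/measurable_EFinP;
  by apply: aeP fg => x /= -> _.
Qed.

(** Rotating the value of the integral onto the positive axis reduces the
    complex triangle inequality to the real one. *)
Lemma normc_cint_le f : cintegrable f -> ((normc (cint f))%:E <= \int[mu]_x (normc (f x))%:E)%E.
Proof.
move=> hf; set I := cint f.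
have [->|I0] := eqVneq I 0; first by rewrite normc0 integral_ge0// => x _; rewrite lee_fin normc_ge0.
pose c : C := cj I / (normc I)%:C.
have nI : normc I != 0 by apply: contra I0 => /eqP/eq0_normc ->.
have nIC : (normc I)%:C != 0 :> C by rewrite eq_complex/= (negbTE nI).
have cI : c * I = (normc I)%:C.
  apply: (mulIf nIC); rewrite /c mulrAC divfK// mulrC -normc_sqr_conj.
  by rewrite expr2 rmorphM.
have nc : normc c = 1.
  apply: (mulIf nI); rewrite mul1r -normcM cI normcR ger0_norm ?normc_ge0//.
have -> : normc I = \int[mu]_x complex.Re (c * f x).
  by have := cintZ c hf; rewrite -/I cI => /(congr1 (@complex.Re R)).
have [f1 _] := cintegrableZ c hf.
rewrite /Rintegral fineK; last exact: integrable_fin_num.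
apply: le_trans (lee_abs _) _; apply: (le_trans (le_abse_integral mu measurableT _)).
  by move/integrableP: f1 => [].
move/cintegrableP : (hf) => [mf _].
apply: ge0_le_integral => //.
- by apply: measurableT_comp => //; move/integrableP: f1 => [].
- by apply/measurable_EFinP; exact: measurable_normc.
- move=> x _; rewrite lee_fin -[leRHS]mul1r -nc -normcM; exact: Re_le_normc.
Qed.

Lemma L2_mul_integrable f g : is_L2 f -> is_L2 g -> cintegrable (fun x => f x * g x).
Proof.
move=> /is_L2P[mf lf] /is_L2P[mg lg]; apply/cintegrableP; split; first exact: cmeasurableM.
apply: (@le_lt_trans _ _ (\int[mu]_x ((normc (f x) ^+ 2)%:E + (normc (g x) ^+ 2)%:E))%E).
  apply: ge0_le_integral => //.
  - by move=> x _; rewrite lee_fin normc_ge0.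
  - by apply/measurable_EFinP; apply: measurable_normc; exact: cmeasurableM.
  - by apply: emeasurable_funD; exact: measurable_normc2.
  - move=> x _; rewrite lee_fin normcM; have := normc_ge0 (f x); have := normc_ge0 (g x).
    nra.
rewrite ge0_integralD//; try exact: measurable_normc2; try by move=> x _; rewrite lee_fin sqr_ge0.
exact: lte_add_pinfty.
Qed.

Lemma L2_sqr_integrable f : is_L2 f -> mu.-integrable setT (fun x => (normc (f x) ^+ 2)%:E).
Proof.
move=> /is_L2P[mf lf]; apply/integrableP; split; first exact: measurable_normc2.
by under eq_integral do rewrite abse_EFin ger0_norm ?sqr_ge0//.
Qed.

(** Fatou's lemma: a common bound of L2 norms passes to an almost everywhere
    limit. *)
Lemma sqn_fatou (h : nat -> R -> C) f (B : \bar R) : (forall n, cmeasurable (h n)) ->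
  cmeasurable f -> (\forall x \ae mu, (fun n => normc (h n x - f x)) @ \oo --> (0 : R)) ->
  (forall n, (sqn (h n) <= B)%E) -> (sqn f <= B)%E.
Proof.
move=> mh mf hf hB.
pose F n x := (normc (h n x) ^+ 2)%:E : \bar R.
have FE : (\forall x \ae mu, (normc (f x) ^+ 2)%:E = limn_einf (F^~ x)).
  apply: aeP hf => x hx; apply/esym.
  suff /cvg_limn_einf_sup[] : F^~ x @ \oo --> (normc (f x) ^+ 2)%:E by [].
  have n0 : (fun n => normc (h n x)) @ \oo --> normc (f x).
    apply/cvgrPdist_le => e e0; move/cvgrPdist_le : hx => /(_ e e0).
    apply: filterS => n; rewrite sub0r normrN ger0_norm ?normc_ge0// => hn.
    rewrite (le_trans _ hn)// ler_norml; apply/andP; split.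
      have := le_normcD (h n x - f x) (f x); rewrite subrK; lra.
    have := le_normcD (f x - h n x) (h n x); rewrite subrK normcBC; lra.
  apply: cvg_EFin; first exact: nearW.
  exact: (cvgM n0 n0).
have -> : sqn f = (\int[mu]_x limn_einf (F^~ x))%E.
  apply: ae_eq_integral => //.
  - exact: measurable_normc2.
  - rewrite (_ : (fun x => _) = (fun x => - limn_esup (fun n => - F n x))%E).
      apply: measurableT_comp => //; apply: measurable_fun_limn_esup => n.
      by apply: measurableT_comp => //; exact: measurable_normc2.
    by apply/funext => x; rewrite limn_esupN oppeK.
  - by apply: aeP FE => x ->.
apply: le_trans (fatou mu measurableT _ _) _.
- by move=> n; exact: measurable_normc2.
- by move=> n x _; rewrite lee_fin sqr_ge0.
rewrite limn_einf_lim; apply: lime_le; first exact: is_cvg_einfs.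
apply: nearW => n; apply: le_trans (hB n).
by apply: ereal_inf_lbound; exists n => /=.
Qed.

End ComplexIntegral.

(** * The Hilbert space of square integrable functions *)

Section L2Hilbert.
Context {R : realType}.
Local Notation mu := (@lebesgue_measure R).
Local Notation C := R[i].
Local Notation X := (L2space R).
Local Notation cint := (@cintegral R setT).
Implicit Types (f g : R -> C) (u v : X).

Lemma L2repr_meas u : cmeasurable (L2repr u).
Proof. exact: (L2reprP u).1. Qed.
Hint Resolve L2repr_meas : core.

Lemma eq_L2 u v : (\forall x \ae mu, L2repr u x = L2repr v x) -> u = v.
Proof.
move=> h; rewrite -[u](@reprK _ X) -[v](@reprK _ X).
by apply/L2_piP.
Qed.

Lemma L2classP f u : is_L2 f -> (\forall x \ae mu, f x = L2repr u x) -> L2class f = u.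
Proof.
by move=> hf fu; apply: eq_L2; apply: aeP2 (L2classK hf) fu => x -> ->.
Qed.

Lemma L2class_ae f g : is_L2 f -> is_L2 g -> (\forall x \ae mu, f x = g x) ->
  L2class f = L2class g.
Proof.
by move=> hf hg fg; apply: L2classP => //; apply: aeP2 fg (L2classK hg) => x -> ->.
Qed.

Lemma L2class_inj f g : is_L2 f -> is_L2 g -> L2class f = L2class g ->
  \forall x \ae mu, f x = g x.
Proof.
move=> hf hg fg; have := L2classK hf; rewrite fg => h.
by apply: aeP2 h (L2classK hg) => x <- ->.
Qed.

Lemma L2class_repr u : L2class (L2repr u) = u.
Proof. by apply: L2classP; [exact: L2reprP|exact: aeW]. Qed.

Lemma L2repr_lin a u v :
  \forall x \ae mu, L2repr (a *: u + v) x = a * L2repr u x + L2repr v x.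
Proof.
have hl : is_L2 (a *: L2repr u + L2repr v)%R by apply: is_L2_lin; exact: L2reprP.
have -> : a *: u + v = \pi_(X)%qT (a *: repr u + repr v).
  rewrite raddfD; congr (_ + _); exact: (esym (reprK _)).
exact: L2repr_pi.
Qed.

Lemma L2class_lin a f g : is_L2 f -> is_L2 g ->
  L2class (fun x => a * f x + g x) = a *: L2class f + L2class g.
Proof.
move=> hf hg; apply: L2classP; first exact: is_L2_lin.
apply: aeP2 (L2repr_lin a (L2class f) (L2class g)) (aeP2 (fun _ => pair) (L2classK hf) (L2classK hg)).
by move=> x -> [-> ->].
Qed.

Lemma L2classD f g : is_L2 f -> is_L2 g ->
  L2class (fun x => f x + g x) = L2class f + L2class g.
Proof.
move=> hf hg; have := L2class_lin 1 hf hg; rewrite scale1r => <-.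
by congr L2class; apply/funext => x; rewrite mul1r.
Qed.

Lemma L2classZ a f : is_L2 f -> L2class (fun x => a * f x) = a *: L2class f.
Proof.
move=> hf; have := L2class_lin a hf is_L2_0.
have -> : L2class (fun _ : R => 0 : C) = 0.
  have := L2class_lin (-1) is_L2_0 is_L2_0; rewrite scaleN1r addNr => <-.
  by congr L2class; apply/funext => x; rewrite mulr0 addr0.
by rewrite addr0 => <-; congr L2class; apply/funext => x; rewrite addr0.
Qed.

Lemma L2classN f : is_L2 f -> L2class (fun x => - f x) = - L2class f.
Proof.
move=> hf; rewrite -scaleN1r -L2classZ//.
by congr L2class; apply/funext => x; rewrite mulN1r.
Qed.

Lemma L2classB f g : is_L2 f -> is_L2 g ->
  L2class (fun x => f x - g x) = L2class f - L2class g.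
Proof. by move=> hf hg; rewrite L2classD ?L2classN//; exact: is_L2N. Qed.

Lemma nrm_L2norm u : (nrm u)%:E = L2norm (L2repr u).
Proof. by rewrite -[RHS]fineK ?L2norm_fin. Qed.

Lemma nrm_sqn u : ((nrm u) ^+ 2)%:E = sqn (L2repr u).
Proof.
rewrite -L2norm_sqn -nrm_L2norm poweR_EFin powR_mulrn// -lee_fin nrm_L2norm.
exact: L2norm_ge0.
Qed.

Lemma nrm_class_sqn f : is_L2 f -> ((nrm (L2class f)) ^+ 2)%:E = sqn f.
Proof.
move=> hf; rewrite nrm_sqn; apply: sqn_ae => //; first exact: hf.1.
exact: L2classK.
Qed.

Lemma nrm_class_le f (B : R) : is_L2 f -> 0 <= B -> (sqn f <= (B ^+ 2)%:E)%E -> nrm (L2class f) <= B.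
Proof.
move=> hf B0; rewrite -nrm_class_sqn// lee_fin => h.
by rewrite -(@ler_pXn2r _ 2) ?nnegrE ?nrm_ge0.
Qed.

Lemma sqn_le_nrm f (B : R) : is_L2 f -> nrm (L2class f) <= B -> (sqn f <= (B ^+ 2)%:E)%E.
Proof.
move=> hf h; rewrite -nrm_class_sqn// lee_fin lerXn2r ?nnegrE ?nrm_ge0//.
by rewrite (le_trans _ h) ?nrm_ge0.
Qed.

Definition ip u v : C := cint (fun x => L2repr u x * cj (L2repr v x)).

Lemma ip_integrable f g : is_L2 f -> is_L2 g -> cintegrable (fun x => f x * cj (g x)).
Proof. by move=> hf hg; apply: L2_mul_integrable => //; exact: is_L2J. Qed.

Lemma ip_class f g : is_L2 f -> is_L2 g ->
  ip (L2class f) (L2class g) = cint (fun x => f x * cj (g x)).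
Proof.
move=> hf hg; apply: cint_ae.
- by apply: cmeasurableM => //; exact: cmeasurableJ.
- by apply: cmeasurableM; [exact: hf.1|apply: cmeasurableJ; exact: hg.1].
- by apply: aeP2 (L2classK hf) (L2classK hg) => x -> ->.
Qed.

Lemma ip_lin a u v w : ip (a *: u + v) w = a * ip u w + ip v w.
Proof.
rewrite /ip -cintZ; last by apply: ip_integrable; exact: L2reprP.
rewrite -cintD; last 2 first.
- by apply: cintegrableZ; apply: ip_integrable; exact: L2reprP.
- by apply: ip_integrable; exact: L2reprP.
apply: cint_ae.
- by apply: cmeasurableM => //; exact: cmeasurableJ.
- apply: cmeasurableD; last by apply: cmeasurableM => //; exact: cmeasurableJ.
  apply: cmeasurableM; first exact: cmeasurable_cst.
  by apply: cmeasurableM => //; exact: cmeasurableJ.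
- by apply: aeP (L2repr_lin a u v) => x ->; rewrite mulrDl mulrA.
Qed.

Lemma ipC u v : ip u v = cj (ip v u).
Proof.
rewrite /ip -cintJ; last by apply: ip_integrable; exact: L2reprP.
by apply: eq_cint => x; rewrite conjM conjK mulrC.
Qed.

Lemma ip0l w : ip 0 w = 0.
Proof. by have := ip_lin (-1) 0 0 w; rewrite scaleN1r addr0 mulN1r addNr oppr0. Qed.
Lemma ipDl u v w : ip (u + v) w = ip u w + ip v w.
Proof. by have := ip_lin 1 u v w; rewrite scale1r mul1r. Qed.
Lemma ipZl a u w : ip (a *: u) w = a * ip u w.
Proof. by have := ip_lin a u 0 w; rewrite !addr0 ip0l addr0. Qed.
Lemma ipNl u w : ip (- u) w = - ip u w.
Proof. by rewrite -scaleN1r ipZl mulN1r. Qed.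
Lemma ipBl u v w : ip (u - v) w = ip u w - ip v w.
Proof. by rewrite ipDl ipNl. Qed.
Lemma ipDr u v w : ip w (u + v) = ip w u + ip w v.
Proof. by rewrite ipC ipDl conjD -!ipC. Qed.
Lemma ipZr a u w : ip w (a *: u) = cj a * ip w u.
Proof. by rewrite ipC ipZl conjM -!ipC. Qed.
Lemma ipBr u v w : ip w (u - v) = ip w u - ip w v.
Proof. by rewrite ipC ipBl conjD conjN -!ipC. Qed.

Lemma ip_nrm u : ip u u = (nrm u ^+ 2)%:C.
Proof.
have := nrm_sqn u => h.
rewrite /ip -(eq_cint (f := fun x => (normc (L2repr u x) ^+ 2)%:C)); last first.
  by move=> x; exact: normc_sqr_conj.
by rewrite cint_real; congr (_ %:C); rewrite /Rintegral -/(sqn _) -h.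
Qed.

Lemma nrm_sqrD u v :
  nrm (u + v) ^+ 2 = nrm u ^+ 2 + 2 * complex.Re (ip u v) + nrm v ^+ 2.
Proof.
apply: (@complexI R); rewrite -ip_nrm ipDl !ipDr !ip_nrm [ip v u]ipC !rmorphD /=.
rewrite -!addrA; congr (_ + _); rewrite !addrA; congr (_ + _).
by apply: complex_ext; rewrite ?ReD ?ImD ?ReJ ?ImJ /=; [ring|rewrite subrr].
Qed.

(** The square norm of [u + t v] is nonnegative at the [t] that minimizes it. *)
Lemma cauchy_schwarz u v : normc (ip u v) <= nrm u * nrm v.
Proof.
have [v0|v0] := eqVneq (nrm v) 0.
  by rewrite (nrm_eq0 (x := v)) ?v0// ipC ip0l conj0 normc0 mulr_ge0 ?nrm_ge0.
have nv : 0 < nrm v by rewrite lt_neqAle eq_sym v0 nrm_ge0.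
set a := ip u v; pose t : C := - a / (nrm v ^+ 2)%:C.
have := sqr_ge0 (nrm (u + t *: v)); rewrite nrm_sqrD nrmZ.
have -> : complex.Re (ip u (t *: v)) = - (normc a ^+ 2 / nrm v ^+ 2).
  rewrite ipZr -/a /t -fmorphV conjM conjN conjR mulNr mulNr mulrAC.
  have -> : cj a * a = (normc a ^+ 2)%:C by rewrite mulrC -normc_sqr_conj.
  by rewrite -rmorphM -rmorphN.
have -> : normc t = normc a / nrm v ^+ 2.
  by rewrite /t mulNr normc_opp normcM normcV normcR ger0_norm ?sqr_ge0.
move=> h; rewrite -(@ler_pXn2r _ 2) ?nnegrE ?normc_ge0 ?mulr_ge0 ?nrm_ge0//.
rewrite exprMn -ler_pdivrMr ?exprn_gt0//.
have E : (normc a / nrm v ^+ 2 * nrm v) ^+ 2 = normc a ^+ 2 / nrm v ^+ 2.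
  by field.
by move: h; rewrite E; set q := _ / _ ; lra.
Qed.

Lemma ip_bfun v : bfun (fun u => ip u v).
Proof.
split; first by move=> a x y; exact: ip_lin.
by exists (nrm v) => [|x]; [exact: nrm_ge0|rewrite mulrC cauchy_schwarz].
Qed.

Lemma ip_sumr n (F : 'I_n -> X) u : ip u (\sum_i F i) = \sum_i ip u (F i).
Proof.
elim/big_rec2: _ => [|i a b _ <-]; first by rewrite ipC ip0l conj0.
exact: ipDr.
Qed.

(** The Gram matrix of an independent family is invertible, and its inverse
    turns the products with the [e j] into the dual family. *)
Lemma dual_family n (e : 'I_n -> X) :
  (forall a : 'I_n -> C, \sum_i a i *: e i = 0 -> forall i, a i = 0) ->
  exists phi : 'I_n -> X -> C, (forall i, bfun (phi i)) /\
    forall i j, phi i (e j) = (i == j)%:R.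
Proof.
move=> ind; pose G : 'M[C]_n := \matrix_(i, j) ip (e i) (e j).
have gG : row_free G.
  rewrite -kermx_eq0; apply/eqP/row_matrixP => i; rewrite row0.
  have h : row i (kermx G) *m G = 0 by rewrite -row_mul mulmx_ker row0.
  set a := row i (kermx G) in h *; apply/rowP => j; rewrite [RHS]mxE.
  apply: (ind (fun j => a 0 j)).
  apply: nrm_eq0; set x := \sum_i _.
  have : ip x x = 0.
    rewrite {2}/x ip_sumr big1// => k _; rewrite ipZr.
    have -> : ip x (e k) = (a *m G) 0 k.
      rewrite /x (bfun_sum (ip_bfun (e k))) !mxE; apply: eq_bigr => l _.
      by rewrite ipZl !mxE.
    by rewrite h [X in _ * X]mxE mulr0.
  rewrite ip_nrm => /(@complexI R _ 0)/eqP; rewrite expf_eq0/= => /eqP ->.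
  exact: lexx.
have uG : G \in unitmx by rewrite -row_free_unit.
exists (fun i x => (coefs (fun j => ip^~ (e j)) x *m invmx G) 0 i); split.
  by move=> i; apply: bfun_mulmx => j; exact: ip_bfun.
move=> i j; have -> : coefs (fun j => ip^~ (e j)) (e j) = row j G.
  by apply/rowP => k; rewrite !mxE.
by rewrite -row_mul mulmxV// !mxE eq_sym.
Qed.

Lemma geometric_bound_cvg (a : nat -> R) (K q : R) : 0 <= K -> 0 <= q -> q < 1 ->
  (forall n, `|a n.+1 - a n| <= K * q ^+ n) -> cvgn a.
Proof.
move=> K0 q0 q1 h.
have hs : cvgn (series (fun n => a n.+1 - a n)).
  apply: normed_cvg; apply: (series_le_cvg (v_ := geometric K q)) => //.
  - by move=> n /=.
  - by move=> n /=; rewrite mulr_ge0 ?exprn_ge0.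
  - by apply: is_cvg_geometric_series; rewrite ger0_norm.
have E : series (fun n => a n.+1 - a n) = (fun n => a n - a 0%N).
  by apply/funext => n; rewrite /series /= telescope_sumr.
move: hs; rewrite E => hs.
move: hs => /cvg_ex[l hl]; apply/cvg_ex; exists (l + a 0%N).
apply: cvg_trans (cvgD hl (cvg_cst (a 0%N))); apply: near_eq_cvg; apply: nearW => n /=.
by rewrite -[LHS]/(a n - a 0%N + a 0%N) subrK.
Qed.

Lemma cvg_fine_limn_esup (a : nat -> R) : cvgn a ->
  a @ \oo --> fine (limn_esup (fun n => (a n)%:E)).
Proof.
move=> h; have hE : (fun n => (a n)%:E) @ \oo --> (limn a)%:E.
  by apply: cvg_EFin; [exact: nearW|exact: h].
by rewrite (cvg_limn_einf_sup hE).2.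
Qed.

(** The series of the integrals of [(9/4)^n |u_(n+1) - u_n|^2] converges,
    since [9/4 * 4^-1 < 1]; hence almost everywhere the increments are at most
    a multiple of [(2/3)^n] and the sequence converges pointwise. By Fatou's
    lemma the pointwise limit is the limit in norm. *)
Lemma L2_rapidly_complete : @rapidly_complete R X.
Proof.
move=> K u K0 hu; pose f n := L2repr (u n).
have mf n : cmeasurable (f n) by exact: L2repr_meas.
have mfd n : cmeasurable (fun x => f n.+1 x - f n x) by exact: cmeasurableB.
have sqd n m : sqn (fun x => f n x - f m x) = (nrm (u n - u m) ^+ 2)%:E.
  rewrite nrm_sqn; apply: sqn_ae => //; first exact: cmeasurableB.
  rewrite [u n - u m]addrC -scaleN1r; apply: aeP (L2repr_lin (-1) (u m) (u n)) => x ->.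
  by rewrite mulN1r addrC.
pose w n x : \bar R := (((9 / 4) ^+ n) * (normc (f n.+1 x - f n x) ^+ 2))%:E.
have w0 n x : (0 <= w n x)%E.
  by rewrite /w lee_fin mulr_ge0 ?sqr_ge0// exprn_ge0//; lra.
have mw n : measurable_fun [set: R] (w n).
  apply/measurable_EFinP; apply: measurable_funM; first exact: measurable_cst.
  by apply: measurable_funX; exact: (measurable_normc (mfd n)).
have iw n : (\int[mu]_x w n x <= (K ^+ 2 * (9 / 16) ^+ n)%:E)%E.
  rewrite /w; under eq_integral do rewrite EFinM.
  rewrite ge0_integralZl//; last 2 first.
  - exact: (measurable_normc2 (mfd n)).
  - by move=> x _; rewrite lee_fin sqr_ge0.
  rewrite -[X in (_ * X)%E]/(sqn (fun x => f n.+1 x - f n x)) sqd -EFinM lee_fin.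
  have -> : K ^+ 2 * (9 / 16) ^+ n = (9 / 4) ^+ n * (K * 2^-1 ^+ n) ^+ 2 :> R.
    have e16 : 9 / 16 = 9 / 4 * 2^-1 ^+ 2 :> R by field.
    by rewrite e16 [in LHS]exprMn [X in _ = _ * X]exprMn -!exprM mulnC mulrCA.
  by rewrite ler_wpM2l ?exprn_ge0// lerXn2r ?nnegrE ?nrm_ge0// mulr_ge0 ?exprn_ge0.
have iW : (\int[mu]_x (\sum_(0 <= n <oo) w n x) < +oo)%E.
  rewrite integral_nneseries//.
  apply: (@le_lt_trans _ _ (\sum_(0 <= n <oo) (K ^+ 2 * (9 / 16) ^+ n)%:E)%E).
    apply: lee_nneseries => // n _ _; exact: integral_ge0.
  have h : cvgn (series (geometric (K ^+ 2) (9 / 16 : R))).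
    by apply: is_cvg_geometric_series; rewrite ger0_norm//; lra.
  have -> : (\sum_(0 <= n <oo) (K ^+ 2 * (9 / 16) ^+ n)%:E)%E =
      (limn (series (geometric (K ^+ 2) (9 / 16 : R))))%:E.
    rewrite -EFin_lim//; congr (limn _); apply/funext => n /=.
    by rewrite /series /= sumEFin.
  exact: ltry.
have aeW : \forall x \ae mu, (\sum_(0 <= n <oo) w n x)%E \is a fin_num.
  have : mu.-integrable setT (fun x => \sum_(0 <= n <oo) w n x)%E.
    apply/integrableP; split.
      by apply: ge0_emeasurable_sum => [k x _ _|k _]; [exact: w0|exact: mw].
    by under eq_integral do rewrite gee0_abs ?nneseries_ge0//.
  by move=> /(integrable_ae measurableT); apply: aeP => x; apply.
have bx : \forall x \ae mu, exists2 B : R, 0 <= B &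
    forall n, normc (f n.+1 x - f n x) <= B * (2 / 3) ^+ n.
  apply: aeP aeW => x hx; pose B2 := fine (\sum_(0 <= n <oo) w n x).
  have wB n : (9 / 4) ^+ n * (normc (f n.+1 x - f n x) ^+ 2) <= B2.
    rewrite -lee_fin /B2 fineK//.
    have := @nneseries_lim_ge R (fun n => w n x) xpredT 0%N n.+1 (fun n _ _ => w0 n x).
    apply: le_trans; rewrite big_mkcond big_nat_recr//= leeDr// sume_ge0//.
  exists (Num.sqrt B2); first exact: sqrtr_ge0.
  have B0 : 0 <= B2 by apply: le_trans (wB 0%N); rewrite mulr_ge0 ?sqr_ge0.
  move=> n; rewrite -(@ler_pXn2r _ 2) ?nnegrE ?normc_ge0 ?mulr_ge0 ?sqrtr_ge0 ?exprn_ge0//.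
  rewrite exprMn sqr_sqrtr// -exprM mulnC exprM.
  have -> : (2 / 3) ^+ 2 = (9 / 4)^-1 :> R by field.
  by rewrite exprVn ler_pdivlMr ?exprn_gt0// mulrC.
(* upper limits are measurable whether or not the sequence converges *)
pose lr x := fine (limn_esup (fun n => (complex.Re (f n x))%:E)).
pose li x := fine (limn_esup (fun n => (complex.Im (f n x))%:E)).
pose l x : C := lr x +i* li x.
have ml : cmeasurable l.
  split.
    apply: (measurableT_comp (f := fine)); first exact: fine_measurable.
    apply: measurable_fun_limn_esup => n; apply/measurable_EFinP; exact: (mf n).1.
  apply: (measurableT_comp (f := fine)); first exact: fine_measurable.
  apply: measurable_fun_limn_esup => n; apply/measurable_EFinP; exact: (mf n).2.
have cl : \forall x \ae mu, (fun n => normc (f n x - l x)) @ \oo --> (0 : R).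
  apply: aeP bx => x [B B0 hB].
  have q1 : 2 / 3 < 1 :> R by lra.
  have q0 : 0 <= 2 / 3 :> R by lra.
  have cR : (fun n => complex.Re (f n x)) @ \oo --> lr x.
    apply: cvg_fine_limn_esup.
      apply: (geometric_bound_cvg B0 q0 q1) => n; apply: le_trans (hB n).
      by rewrite -ReN -ReD Re_le_normc.
  have cI : (fun n => complex.Im (f n x)) @ \oo --> li x.
    apply: cvg_fine_limn_esup.
      apply: (geometric_bound_cvg B0 q0 q1) => n; apply: le_trans (hB n).
      by rewrite -ImN -ImD Im_le_normc.
  have c0 : (fun n => `|complex.Re (f n x) - lr x| + `|complex.Im (f n x) - li x|) @ \oo --> (0 : R).
    have -> : 0 = `|lr x - lr x| + `|li x - li x| :> R by rewrite !subrr normr0 addr0.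
    by apply: cvgD; apply: cvg_norm; apply: cvgB => //; exact: cvg_cst.
  apply: (squeeze_cvgr _ (cvg_cst 0) c0); apply: nearW => n; rewrite normc_ge0/=.
  by rewrite (le_trans (normc_ReIm _))// ReD ImD ReN ImN.
have tail n m : nrm (u (m + n)%N - u n) <= 2 * K * 2^-1 ^+ n.
  have : nrm (u (m + n)%N - u n) <= 2 * K * 2^-1 ^+ n - 2 * K * 2^-1 ^+ (m + n).
    elim: m => [|m IH]; first by rewrite add0n !subrr nrm0.
    apply: (le_trans (nrm_tri (u (m + n)%N) _ _)).
    apply: (le_trans (lerD (hu _) IH)); rewrite addSn exprS.
    by set q := _ ^+ (m + n); lra.
  move=> /le_trans; apply; rewrite gerBl !mulr_ge0 ?exprn_ge0//.
have lB n : (sqn (fun x => (f n x - l x)%R) <= ((2 * K * 2^-1 ^+ n) ^+ 2)%:E)%E.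
  apply: (@sqn_fatou R (fun m x => f n x - f (m + n)%N x)).
  - by move=> m; exact: cmeasurableB.
  - exact: cmeasurableB.
  - apply: aeP cl => x; rewrite -(cvg_shiftn n) => hx; apply: cvg_trans hx.
    apply: near_eq_cvg; apply: nearW => m /=.
    by rewrite -normc_opp; congr normc; ring.
  - move=> m; rewrite sqd lee_fin lerXn2r ?nnegrE ?nrm_ge0 ?mulr_ge0 ?exprn_ge0//.
    by rewrite nrmB.
have hd n : is_L2 (fun x => f n x - l x).
  apply/is_L2P; split; first exact: cmeasurableB.
  by rewrite (le_lt_trans (lB n))// ltry.
have hl : is_L2 l.
  have := is_L2B (L2reprP (u 0%N)) (hd 0%N); congr is_L2.
  by apply/funext => x; rewrite /f subKr.
exists (L2class l) => n.
have -> : u n - L2class l = L2class (fun x => f n x - l x).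
  by rewrite L2classB ?L2class_repr//; exact: L2reprP.
by apply: nrm_class_le (hd n) _ (lB n); rewrite !mulr_ge0 ?exprn_ge0.
Qed.

End L2Hilbert.

(** * Fubini's theorem and invariance of the Lebesgue integral *)

Section PlaneIntegrals.
Context {R : realType}.
Local Notation mu := (@lebesgue_measure R).
Local Notation C := R[i].
Local Notation cint := (@cintegral R setT).
Implicit Types (f g : R -> C) (F k : R -> R -> C).

Definition cmeas2 F :=
  measurable_fun [set: measurableTypeR R * measurableTypeR R] (fun z => complex.Re (F z.1 z.2)) /\
  measurable_fun [set: measurableTypeR R * measurableTypeR R] (fun z => complex.Im (F z.1 z.2)).

Lemma cmeas2M F k : cmeas2 F -> cmeas2 k -> cmeas2 (fun x y => F x y * k x y).
Proof.
move=> [f1 f2] [g1 g2]; split.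
  under eq_fun do rewrite ReM.
  by apply: measurable_funB; apply: measurable_funM.
under eq_fun do rewrite ImM.
by apply: measurable_funD; apply: measurable_funM.
Qed.

Lemma cmeas2_1 f : cmeasurable f -> cmeas2 (fun x _ => f x).
Proof.
move=> [f1 f2]; split.
  exact: (measurableT_comp f1 measurable_fst).
exact: (measurableT_comp f2 measurable_fst).
Qed.

Lemma cmeas2_2 f : cmeasurable f -> cmeas2 (fun _ y => f y).
Proof.
move=> [f1 f2]; split.
  exact: (measurableT_comp f1 measurable_snd).
exact: (measurableT_comp f2 measurable_snd).
Qed.

Lemma cmeas2_comp f (h : R -> R -> R) : cmeasurable f ->
  measurable_fun [set: measurableTypeR R * measurableTypeR R] (fun z => h z.1 z.2) ->
  cmeas2 (fun x y => f (h x y)).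
Proof.
move=> [f1 f2] mh; split.
  exact: (measurableT_comp f1 mh).
exact: (measurableT_comp f2 mh).
Qed.

Lemma cmeas2_sec1 F x : cmeas2 F -> cmeasurable (F x).
Proof.
move=> mk; split; first exact: (measurableT_comp mk.1 (measurable_pair1 x)).
exact: (measurableT_comp mk.2 (measurable_pair1 x)).
Qed.

Lemma cmeas2_sec2 F y : cmeas2 F -> cmeasurable (F^~ y).
Proof.
move=> mk; split; first exact: (measurableT_comp mk.1 (measurable_pair2 y)).
exact: (measurableT_comp mk.2 (measurable_pair2 y)).
Qed.

Lemma cmeas2_real (h : R -> R -> R) :
  measurable_fun [set: measurableTypeR R * measurableTypeR R] (fun z => h z.1 z.2) ->
  cmeas2 (fun x y => (h x y)%:C).
Proof. by move=> mh; split => //; exact: measurable_cst. Qed.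

Lemma measurable_normc2_plane F : cmeas2 F ->
  measurable_fun [set: measurableTypeR R * measurableTypeR R] (fun z => normc (F z.1 z.2)).
Proof.
move=> [f1 f2].
have -> : (fun z : R * R => normc (F z.1 z.2)) = @Num.sqrt R \o
    (fun z => complex.Re (F z.1 z.2) ^+ 2 + complex.Im (F z.1 z.2) ^+ 2).
  by apply/funext => z /=; rewrite -normc_sqr sqrtr_sqr ger0_norm ?normc_ge0.
apply: measurableT_comp.
  by apply: continuous_measurable_fun; exact: sqrt_continuous.
by apply: measurable_funD; apply: measurable_funX.
Qed.

Lemma measurable_cexpi : cmeasurable (@cexpi R).
Proof.
by split; apply: continuous_measurable_fun; [exact: continuous_cos|exact: continuous_sin].
Qed.

Lemma normc_cexpi (t : R) : normc (cexpi t) = 1.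
Proof. by rewrite /cexpi /= cos2Dsin2 sqrtr1. Qed.

Lemma cexpiD (s t : R) : cexpi (s + t) = cexpi s * cexpi t.
Proof. by apply: complex_ext; rewrite ?ReM ?ImM /= ?cosD ?sinD; ring. Qed.

Lemma cj_cexpi (t : R) : cj (cexpi t) = cexpi (- t).
Proof. by rewrite /cj /cexpi /= cosN sinN. Qed.

Lemma cexpi0 : cexpi (0 : R) = 1.
Proof. by rewrite /cexpi cos0 sin0. Qed.

Lemma cmeas2_fourier : cmeas2 (fun x y : R => cexpi (- (x * y))).
Proof.
apply: (cmeas2_comp (f := @cexpi R) (h := fun x y => - (x * y))); first exact: measurable_cexpi.
by apply: measurable_funN; apply: measurable_funM.
Qed.

Lemma measurable_section_int (h : R * R -> \bar R) :
  measurable_fun [set: measurableTypeR R * measurableTypeR R] h -> (forall z, (0 <= h z)%E) ->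
  measurable_fun [set: R] (fun x => \int[mu]_y h (x, y))%E.
Proof.
exact: (@measurable_fun_fubini_tonelli_F _ _ (measurableTypeR R) (measurableTypeR R) R mu h).
Qed.

(** The real and imaginary parts are integrable on the plane by Tonelli's
    theorem. As all sections are assumed integrable, the iterated integrals
    are meaningful everywhere and not only almost everywhere. *)
Lemma complex_fubini F : cmeas2 F ->
  (\int[mu]_x \int[mu]_y (normc (F x y))%:E < +oo)%E ->
  (forall x, cintegrable (F x)) -> (forall y, cintegrable (F^~ y)) ->
  [/\ cintegrable (fun x => cint (F x)), cintegrable (fun y => cint (F^~ y)) &
      cint (fun x => cint (F x)) = cint (fun y => cint (F^~ y))].
Proof.
move=> [m1 m2] fin s1 s2.
have main (P : C -> R) : (forall a, `|P a| <= normc a) ->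
    measurable_fun [set: measurableTypeR R * measurableTypeR R] (fun z => P (F z.1 z.2)) ->
    (mu \x mu)%E.-integrable setT (fun z => (P (F z.1 z.2))%:E).
  move=> hP mP; apply/integrable12ltyP; first exact/measurable_EFinP.
  apply: le_lt_trans fin; apply: ge0_le_integral => //.
  - by move=> x _; apply: integral_ge0.
  - apply: (measurable_section_int (h := fun z => `|(P (F z.1 z.2))%:E|%E)) => //.
    by apply/measurable_EFinP; exact: measurableT_comp.
  - apply: (measurable_section_int (h := fun z => (normc (F z.1 z.2))%:E)) => //.
    + by apply/measurable_EFinP; exact: measurable_normc2_plane.
    + by move=> z; rewrite lee_fin normc_ge0.
  - move=> x _; apply: ge0_le_integral => //.
    + apply/measurable_EFinP; apply: measurableT_comp => //.
      exact: (measurableT_comp mP (measurable_pair1 x)).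
    + apply/measurable_EFinP; apply: measurable_normc.
      by case/cintegrableP: (s1 x).
    + by move=> y _; rewrite lee_fin.
have iR := main _ Re_le_normc m1.
have iI := main _ Im_le_normc m2.
have intG (P : C -> R) : measurable_fun [set: measurableTypeR R * measurableTypeR R]
      (fun z => P (F z.1 z.2)) ->
    (mu \x mu)%E.-integrable setT (fun z => (P (F z.1 z.2))%:E) ->
    mu.-integrable setT (fun y => \int[mu]_x (P (F x y))%:E)%E.
  move=> mP iP; have mP' := measurable_int _ iP.
  apply/integrableP; split; first exact: (measurable_fubini_G iP).
  have fin2 := (integrable21ltyP _ _ mP').1 iP.
  apply: (le_lt_trans _ fin2); apply: ge0_le_integral => //.
  - by apply: measurableT_comp => //; exact: (measurable_fubini_G iP).
  - apply: (@measurable_fun_fubini_tonelli_G _ _ (measurableTypeR R) (measurableTypeR R) R mu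
      (fun z => `|(P (F z.1 z.2))%:E|%E)) => //.
    by apply/measurable_EFinP; exact: measurableT_comp.
  - move=> y _; apply: le_abse_integral => //; apply/measurable_EFinP.
    exact: (measurableT_comp mP (measurable_pair2 y)).
have R1 x : (complex.Re (cint (F x)))%:E = (\int[mu]_y (complex.Re (F x y))%:E)%E.
  by rewrite /= fineK//; apply: integrable_fin_num => //; exact: (s1 x).1.
have I1 x : (complex.Im (cint (F x)))%:E = (\int[mu]_y (complex.Im (F x y))%:E)%E.
  by rewrite /= fineK//; apply: integrable_fin_num => //; exact: (s1 x).2.
have R2 y : (complex.Re (cint (F^~ y)))%:E = (\int[mu]_x (complex.Re (F x y))%:E)%E.
  by rewrite /= fineK//; apply: integrable_fin_num => //; exact: (s2 y).1.
have I2 y : (complex.Im (cint (F^~ y)))%:E = (\int[mu]_x (complex.Im (F x y))%:E)%E.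
  by rewrite /= fineK//; apply: integrable_fin_num => //; exact: (s2 y).2.
split.
- split.
    have := integrable_fubini_F iR; congr (_.-integrable _ _).
    by apply/funext => x; rewrite /= R1.
  have := integrable_fubini_F iI; congr (_.-integrable _ _).
  by apply/funext => x; rewrite /= I1.
- split.
    have := intG _ m1 iR; congr (_.-integrable _ _).
    by apply/funext => x; rewrite /= R2.
  have := intG _ m2 iI; congr (_.-integrable _ _).
  by apply/funext => x; rewrite /= I2.
- apply: complex_ext; rewrite /= /Rintegral; congr fine.
    under eq_integral do rewrite R1.
    rewrite (Fubini iR); apply: eq_integral => y _; exact/esym/R2.
  under eq_integral do rewrite I1.
  rewrite (Fubini iI); apply: eq_integral => y _; exact/esym/I2.
Qed.

(** The exchange of integrals for the kernels met below, which are all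
    bounded: Fourier exponentials, indicators of windows and triangle
    functions. *)
Lemma bounded_kernel_swap k f g (M : R) : cmeas2 k -> (forall x y, normc (k x y) <= M) ->
  cintegrable f -> cintegrable g ->
  [/\ cintegrable (fun x => f x * cint (fun y => k x y * g y)),
      cintegrable (fun y => g y * cint (fun x => k x y * f x)) &
   cint (fun x => f x * cint (fun y => k x y * g y)) =
   cint (fun y => g y * cint (fun x => k x y * f x))].
Proof.
move=> mk kM jf jg.
have [mf lf] := (cintegrableP f).1 jf; have [mg lg] := (cintegrableP g).1 jg.
have M0 : 0 <= M by rewrite (le_trans (normc_ge0 _) (kM 0 0)).
have mkx x : cmeasurable (k x) by exact: cmeas2_sec1.
have mky y : cmeasurable (k^~ y) by exact: cmeas2_sec2.
have ig x : cintegrable (fun y => k x y * g y) by exact: cintegrable_bound (mkx x) jg (kM x).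
have ik y : cintegrable (fun x => k x y * f x).
  by apply: (@cintegrable_bound R (k^~ y) f M) => // x.
pose F x y := f x * (k x y * g y).
have FE y : F^~ y = fun x => g y * (k x y * f x) by apply/funext => x; rewrite /F; ring.
have [||||h1 h2 h3] := @complex_fubini F.
- by apply: cmeas2M (cmeas2_1 mf) (cmeas2M mk (cmeas2_2 mg)).
- apply: (@le_lt_trans _ _ (\int[mu]_x ((normc (f x))%:E * (M%:E * \int[mu]_y (normc (g y))%:E)))%E).
    apply: ge0_le_integral => //.
    + by move=> x _; apply: integral_ge0 => y _; rewrite lee_fin normc_ge0.
    + apply: (measurable_section_int (h := fun z => (normc (F z.1 z.2))%:E)) => //.
        apply/measurable_EFinP; apply: measurable_normc2_plane.
        exact: cmeas2M (cmeas2_1 mf) (cmeas2M mk (cmeas2_2 mg)).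
      by move=> z; rewrite lee_fin normc_ge0.
    + by apply: emeasurable_funM; [apply/measurable_EFinP; exact: measurable_normc|exact: measurable_cst].
    + move=> x _; rewrite -ge0_integralZl//; last 2 first.
      * by apply/measurable_EFinP; exact: measurable_normc.
      * by move=> y _; rewrite lee_fin normc_ge0.
      rewrite -ge0_integralZl//; last 3 first.
      * by apply: measurable_funeM; apply/measurable_EFinP; exact: measurable_normc.
      * by move=> y _; rewrite mule_ge0// lee_fin// normc_ge0.
      * by rewrite lee_fin normc_ge0.
      apply: ge0_le_integral => //.
      * by move=> y _; rewrite lee_fin normc_ge0.
      * apply/measurable_EFinP; apply: measurable_normc; apply: cmeasurableM; first exact: cmeasurable_cst.
        exact: cmeasurableM.
      * apply: measurable_funeM; apply: measurable_funeM.
        by apply/measurable_EFinP; exact: measurable_normc.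
      * move=> y _; rewrite -!EFinM lee_fin !normcM ler_wpM2l ?normc_ge0//.
        by rewrite ler_wpM2r ?normc_ge0.
  under eq_integral do rewrite muleC.
  have fg : (M%:E * \int[mu]_y (normc (g y))%:E < +oo)%E by rewrite lte_mul_pinfty// lee_fin.
  have g0 : (0 <= M%:E * \int[mu]_y (normc (g y))%:E)%E.
    by rewrite mule_ge0// ?lee_fin// integral_ge0// => y _; rewrite lee_fin normc_ge0.
  rewrite ge0_integralZl//; last 2 first.
  + by apply/measurable_EFinP; exact: measurable_normc.
  + by move=> x _; rewrite lee_fin normc_ge0.
  by rewrite lte_mul_pinfty// ge0_fin_numE.
- by move=> x; apply: cintegrableZ.
- by move=> y; rewrite FE; apply: cintegrableZ.
have E1 : (fun x => cint (F x)) = (fun x => f x * cint (fun y => k x y * g y)).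
  by apply/funext => x; rewrite -cintZ.
have E2 : (fun y => cint (F^~ y)) = (fun y => g y * cint (fun x => k x y * f x)).
  by apply/funext => y; rewrite FE -cintZ.
split; [exact: (eq_ind _ cintegrable h1 _ E1)|exact: (eq_ind _ cintegrable h2 _ E2)|].
exact: (etrans (congr1 cint (esym E1)) (etrans h3 (congr1 cint E2))).
Qed.

(** Lebesgue measure is determined by its values on intervals, hence equal to
    its image under such a map. *)
Lemma lebesgue_isometry_invariance (phi : R -> R) (f : R -> \bar R) :
  measurable_fun [set: R] phi ->
  (forall a b, a <= b -> mu (phi @^-1` `]a, b]) = (b - a)%:E) ->
  measurable_fun [set: R] f -> (forall x, (0 <= f x)%E) ->
  (\int[mu]_x f (phi x) = \int[mu]_x f x)%E.
Proof.
move=> mphi hphi mf f0.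
have mphi' : @measurable_fun _ _ (measurableTypeR R) (measurableTypeR R) setT phi by exact: mphi.
pose phim : {mfun measurableTypeR R >-> measurableTypeR R} :=
  HB.pack phi (isMeasurableFun.Build _ _ _ _ _ mphi').
transitivity (\int[pushforward mu phim]_x f x)%E; last first.
  apply: eq_measure_integral => A mA _; apply/esym.
  apply: lebesgue_measure_unique => // X [[a b] /= ab <-].
  have [{}ab|ba] := leP a b; last first.
    by rewrite /pushforward set_itv_ge ?preimage_set0 ?measure0// bnd_simp -leNgt ltW.
  rewrite lebesgue_measure_itv/= lte_fin /pushforward hphi//.
  case: ltP => // ba; have -> : a = b by apply/eqP; rewrite eq_le ab.
  by rewrite subrr.
by rewrite ge0_integral_pushforward.
Qed.

Lemma ge0_integral_shift (f : R -> \bar R) (h : R) :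
  measurable_fun [set: R] f -> (forall x, (0 <= f x)%E) ->
  (\int[mu]_x f (x + h)%R = \int[mu]_x f x)%E.
Proof.
move=> mf f0; apply: (@lebesgue_isometry_invariance (fun x => x + h)) => //.
  by apply: measurable_funD => //; exact: measurable_cst.
move=> a b ab; rewrite (_ : _ @^-1` _ = `]a - h, b - h]%classic).
  rewrite lebesgue_measure_itv/= lte_fin ltrD2r -EFinD.
  case: ltP => [_|ba]; first by congr EFin; ring.
  have -> : a = b by apply/eqP; rewrite eq_le ab.
  by rewrite subrr.
by apply/seteqP; split => x /=; rewrite !in_itv/= ltrBlDr lerBrDr.
Qed.

Lemma ge0_integral_opp (f : R -> \bar R) :
  measurable_fun [set: R] f -> (forall x, (0 <= f x)%E) ->
  (\int[mu]_x f (- x)%R = \int[mu]_x f x)%E.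
Proof.
move=> mf f0; apply: (@lebesgue_isometry_invariance (fun x => - x)) => //.
  exact: measurable_funN.
move=> a b ab; rewrite (_ : _ @^-1` _ = `[- b, - a[%classic).
  rewrite lebesgue_measure_itv/= lte_fin ltrN2 -EFinD.
  case: ltP => [_|ba]; first by congr EFin; ring.
  have -> : a = b by apply/eqP; rewrite eq_le ab.
  by rewrite subrr.
by apply/seteqP; split => x /=; rewrite !in_itv/= ltrNr lerNl andbC.
Qed.

Lemma Rintegral_odd (f : R -> R) : mu.-integrable setT (EFin \o f) ->
  (forall x, f (- x) = - f x) -> \int[mu]_x f x = 0.
Proof.
move=> fi fo; have mf : measurable_fun [set: R] f.
  by apply/measurable_EFinP; case/integrableP: fi.
have pos : (\int[mu]_x (EFin \o f)^\+ x = \int[mu]_x (EFin \o f)^\- x)%E.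
  rewrite -[RHS]ge0_integral_opp//; last by apply: measurable_funeneg; exact/measurable_EFinP.
  by apply: eq_integral => x _; rewrite funeposE funenegE /= fo opprK.
rewrite /Rintegral integralE pos subee//.
have := integrable_neg_fin_num _ fi; exact.
Qed.

End PlaneIntegrals.

(** * The integral of the Fejer weight *)

Section FejerIntegral.
Context {R : realType}.
Local Notation mu := (@lebesgue_measure R).

Lemma setint_indic (D : set R) (g : R -> R) :
  (\int[mu]_(x in D) (g x)%:E = \int[mu]_x ((\1_D x : R) * g x)%:E)%E.
Proof.
rewrite integral_mkcond; apply: eq_integral => x _; rewrite patchE indicE.
by case: ifP => _; rewrite ?mul1r ?mul0r.
Qed.

Lemma cvg_expRN (y : R) : 0 < y -> expR (- (y * x)) @[x --> +oo] --> (0 : R).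
Proof.
move=> y0; have h : (y * x : R) @[x --> +oo] --> +oo.
  by apply: gt0_cvgMry => //; exact: cvg_cst.
exact: cvg_comp h (@cvgr_expR R).
Qed.

Lemma derivable_continuous (f : R -> R) : (forall x, derivable f x 1) -> continuous f.
Proof. by move=> h x; apply/differentiable_continuous/derivable1_diffP. Qed.

Lemma integral_linear_exp (x : R) : 0 < x ->
  (\int[mu]_(y in `[(0:R)%R, +oo[) (y * expR (- (x * y)))%:E = (x ^- 2)%:E)%E.
Proof.
move=> x0; pose F y : R := - (y / x + x ^- 2) * expR (- (x * y)).
have xn0 : x != 0 by rewrite gt_eqF.
have dF (y : R) : is_derive y (1 : R) F (y * expR (- (x * y))).
  rewrite /F; apply: is_derive_eq.
  by rewrite /GRing.scale /=; field.
rewrite (@ge0_continuous_FTC2y R _ F 0 0).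
- by rewrite -EFinB /F mulr0 oppr0 expR0; congr EFin; field.
- by move=> y y0; rewrite mulr_ge0// expR_ge0.
- apply: continuous_subspaceT; apply: derivable_continuous => y; exact: ex_derive.
- have hb : (fun y : R => (2 / x ^+ 2) * expR (- (x / 2 * y)) + x ^- 2 * expR (- (x * y))) @ +oo --> (0 : R).
    have -> : 0 = 2 / x ^+ 2 * 0 + x ^- 2 * 0 :> R by rewrite !mulr0 addr0.
    by apply: cvgD; apply: cvgM; try exact: cvg_cst; apply: cvg_expRN => //; rewrite divr_gt0.
  have hb' : (fun y : R => - ((2 / x ^+ 2) * expR (- (x / 2 * y)) + x ^- 2 * expR (- (x * y)))) @ +oo --> (0 : R).
    by rewrite -oppr0; exact: cvgN.
  apply: (squeeze_cvgr _ hb' hb); near=> y.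
  have y0 : 0 <= y by near: y; exact: nbhs_pinfty_ge.
  have e0 := expR_gt0 (- (x * y)); have e1 := expR_gt0 (- (x / 2 * y)).
  (* half of the exponential absorbs the linear factor *)
  have h : y / x * expR (- (x * y)) <= 2 / x ^+ 2 * expR (- (x / 2 * y)).
    have E : expR (- (x * y)) = expR (- (x / 2 * y)) * expR (- (x / 2 * y)).
      by rewrite -expRD; congr expR; field.
    have k : x / 2 * y * expR (- (x / 2 * y)) <= 1.
      rewrite expRN ler_pdivrMr ?expR_gt0// mul1r.
      by have := expR_ge1Dx (x / 2 * y); lra.
    rewrite E mulrA ler_wpM2r ?(ltW e1)//.
    have -> : y / x * expR (- (x / 2 * y)) = 2 / x ^+ 2 * (x / 2 * y * expR (- (x / 2 * y))) by field.
    by rewrite -[leRHS]mulr1 ler_wpM2l// divr_ge0// sqr_ge0.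
  rewrite /F mulNr lerN2 mulrDl lerD2r h /=.
  rewrite (le_trans (y := 0))//.
    by rewrite oppr_le0 addr_ge0// mulr_ge0 ?(ltW e0)// ?divr_ge0 ?invr_ge0 ?sqr_ge0// ltW.
  by rewrite addr_ge0// mulr_ge0 ?(ltW e1) ?(ltW e0)// ?divr_ge0 ?invr_ge0 ?sqr_ge0.
- by move=> y _; apply: ex_derive.
- by apply: cvg_at_right_filter; apply: derivable_continuous => z; exact: ex_derive.
- by move=> y _; rewrite derive1E; exact: derive_val.
Unshelve. all: by end_near. Qed.

Lemma integral_exp_1cos (t y : R) : 0 < y ->
  (\int[mu]_(x in `[(0:R)%R, +oo[) (expR (- (y * x)) * (1 - cos (t * x)))%:E =
   (y^-1 - y / (y ^+ 2 + t ^+ 2))%:E)%E.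
Proof.
move=> y0; pose q := y ^+ 2 + t ^+ 2.
have q0 : 0 < q by rewrite ltr_pwDl ?exprn_gt0 ?sqr_ge0.
have yn0 : y != 0 by rewrite gt_eqF.
have qn0 : q != 0 by rewrite gt_eqF.
pose F x : R := expR (- (y * x)) * ((y * cos (t * x) - t * sin (t * x)) / q - y^-1).
have dF (x : R) : is_derive x (1 : R) F (expR (- (y * x)) * (1 - cos (t * x))).
  rewrite /F; apply: is_derive_eq.
  rewrite /GRing.scale /=; move: qn0; rewrite /q => qn0.
  by field; apply/andP.
rewrite (@ge0_continuous_FTC2y R _ F 0 0).
- by rewrite /F !mulr0 oppr0 expR0 cos0 sin0 -EFinB; congr EFin; rewrite !mulr0 mulr1 mul1r; ring.
- by move=> x _; rewrite mulr_ge0 ?expR_ge0// subr_ge0 cos_le1.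
- apply: continuous_subspaceT; apply: derivable_continuous => x; exact: ex_derive.
- pose K := (`|y| + `|t|) / q + `|y^-1|.
  have hb : (fun x : R => expR (- (y * x)) * K) @ +oo --> (0 : R).
    by rewrite -(mul0r K); apply: cvgMl; exact: cvg_expRN.
  have hb' : (fun x : R => - (expR (- (y * x)) * K)) @ +oo --> (0 : R).
    by rewrite -oppr0; exact: cvgN.
  apply: (squeeze_cvgr _ hb' hb); apply: nearW => x.
  rewrite -ler_norml /F normrM ger0_norm ?expR_ge0// ler_wpM2l ?expR_ge0//.
  rewrite /K (le_trans (ler_normB _ _))// lerD2r normrM (ger0_norm (x := q^-1)) ?invr_ge0 ?(ltW q0)//.
  rewrite ler_wpM2r ?invr_ge0 ?(ltW q0)// (le_trans (ler_normB _ _))// !normrM.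
  by rewrite lerD// ler_piMr// ler_norml ?cos_geN1 ?cos_le1 ?sin_geN1 ?sin_le1.
- by move=> x _; apply: ex_derive.
- by apply: cvg_at_right_filter; apply: derivable_continuous => z; exact: ex_derive.
- by move=> x _; rewrite derive1E; exact: derive_val.
Qed.

Lemma continuous_lorentzian (t : R) : 0 < t ->
  continuous (fun y : R => t ^+ 2 / (y ^+ 2 + t ^+ 2)).
Proof.
move=> t0 y; apply: cvgM; first exact: cvg_cst.
apply: cvgV; first by rewrite gt_eqF// ltr_wpDl ?exprn_gt0 ?sqr_ge0.
by apply: cvgD; [exact: exprn_continuous|exact: cvg_cst].
Qed.

Lemma integral_lorentzian (t : R) : 0 < t ->
  (\int[mu]_(y in `[(0:R)%R, +oo[) (t ^+ 2 / (y ^+ 2 + t ^+ 2))%:E = (t * (pi / 2))%:E)%E.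
Proof.
move=> t0; have tn0 : t != 0 by rewrite gt_eqF.
pose F y : R := t * atan (y / t).
have q0 y : 0 < y ^+ 2 + t ^+ 2 by rewrite ltr_wpDl ?exprn_gt0 ?sqr_ge0.
have dF (y : R) : is_derive y (1 : R) F (t ^+ 2 / (y ^+ 2 + t ^+ 2)).
  rewrite /F; apply: is_derive_eq.
  rewrite /GRing.scale /=; have := q0 y => h.
  by field; rewrite tn0 gt_eqF//= addrC gt_eqF.
rewrite (@ge0_continuous_FTC2y R _ F 0 (t * (pi / 2))).
- by rewrite /F mul0r atan0 mulr0 -EFinB subr0.
- by move=> y _; rewrite divr_ge0 ?sqr_ge0// ltW.
- by apply: continuous_subspaceT; exact: continuous_lorentzian.
- apply: cvgM; first exact: cvg_cst.
  apply: (cvg_comp _ _ _ (@cvgy_atan R)).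
  by apply: gt0_cvgMly; [rewrite invr_gt0|exact: cvg_id].
- by move=> x _; apply: ex_derive.
- by apply: cvg_at_right_filter; apply: derivable_continuous => z; exact: ex_derive.
- by move=> x _; rewrite derive1E; exact: derive_val.
Qed.

(** [1 / x^2] is the integral of [y * exp (- x y)] over [y > 0]. After an
    exchange of integrals there remain the Laplace transform of [1 - cos (t
    x)] and the integral of a Lorentzian. *)
Lemma half_fejer_integral (t : R) : 0 < t ->
  (\int[mu]_(x in `](0:R)%R, +oo[) ((1 - cos (t * x)) / x ^+ 2)%:E = (t * (pi / 2))%:E)%E.
Proof.
move=> t0; pose D : set R := `]0, +oo[%classic.
pose F (z : R * R) : R := \1_D z.1 * (\1_D z.2 * (z.2 * (expR (- (z.1 * z.2)) * (1 - cos (t * z.1))))).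
have mD : measurable D by exact: measurable_itv.
have mF : measurable_fun [set: measurableTypeR R * measurableTypeR R] (fun z => (F z)%:E).
  apply/measurable_EFinP; apply: measurable_funM.
    exact: (measurableT_comp (measurable_indic mD) measurable_fst).
  apply: measurable_funM; first exact: (measurableT_comp (measurable_indic mD) measurable_snd).
  apply: measurable_funM; first exact: measurable_snd.
  apply: measurable_funM.
    apply: measurableT_comp; first exact: measurable_expR.
    by apply: measurable_funN; apply: measurable_funM; [exact: measurable_fst|exact: measurable_snd].
  apply: measurable_funB; first exact: measurable_cst.
  apply: (measurableT_comp (continuous_measurable_fun (@continuous_cos R))).
  by apply: measurable_funM; [exact: measurable_cst|exact: measurable_fst].
have F0 z : (0 <= (F z)%:E)%E.
  rewrite lee_fin /F; apply: mulr_ge0; first by rewrite indicE ler0n.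
  rewrite indicE; case: (boolP (z.2 \in D)); rewrite ?mul0r// => /set_mem.
  rewrite /D /= in_itv/= andbT => z2; rewrite mul1r.
  apply: mulr_ge0; first exact: ltW.
  by apply: mulr_ge0; [exact: expR_ge0|rewrite subr_ge0 cos_le1].
have cc (g : R -> R) : measurable_fun [set: R] g ->
    (\int[mu]_(x in D) (g x)%:E = \int[mu]_(x in `[(0:R)%R, +oo[) (g x)%:E)%E.
  by move=> mg; rewrite /D integral_itv_obnd_cbnd//; exact/measurable_EFinP/measurable_funTS.
have mexp (x : R) : measurable_fun [set: R] (fun y => expR (- (x * y))).
  apply: measurableT_comp; first exact: measurable_expR.
  by apply: measurable_funN; apply: measurable_funM.
have mcos : measurable_fun [set: R] (fun x => 1 - cos (t * x)).
  apply: measurable_funB; first exact: measurable_cst.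
  apply: (measurableT_comp (continuous_measurable_fun (@continuous_cos R))).
  by apply: measurable_funM.
have := @fubini_tonelli _ _ (measurableTypeR R) (measurableTypeR R) R mu mu _ mF F0.
have -> : (\int[mu]_x \int[mu]_y (F (x, y))%:E =
    \int[mu]_(x in D) ((1 - cos (t * x)) / x ^+ 2)%:E)%E.
  rewrite setint_indic; apply: eq_integral => x _; rewrite /F /=.
  case: (boolP (x \in D)) => xD; last first.
    by rewrite indicE (negbTE xD) !mul0r; under eq_integral do rewrite mul0r; rewrite integral0.
  have x0 : 0 < x by move/set_mem: xD; rewrite /D /= in_itv/= andbT.
  rewrite indicE xD mul1r; under eq_integral do rewrite mul1r.
  rewrite -setint_indic.
  under eq_integral do rewrite mulrA EFinM muleC.
  rewrite ge0_integralZl//.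
  - rewrite cc; last by apply: measurable_funM.
    by rewrite integral_linear_exp.
  - apply/measurable_EFinP; apply: measurable_funTS; apply: measurable_funM; first exact: measurable_id.
    exact: mexp.
  - by move=> y; rewrite /D /= in_itv/= andbT => y0; rewrite lee_fin mulr_ge0 ?expR_ge0// ltW.
move=> ->.
rewrite -integral_lorentzian// -cc; last first.
  by apply: continuous_measurable_fun; exact: continuous_lorentzian.
rewrite setint_indic; apply: eq_integral => y _; rewrite /F /=.
case: (boolP (y \in D)) => yD; last first.
  rewrite indicE (negbTE yD) !mul0r; under eq_integral do rewrite mul0r mulr0.
  by rewrite integral0.
have y0 : 0 < y by move/set_mem: yD; rewrite /D /= in_itv/= andbT.
rewrite indicE yD mul1r; under eq_integral do rewrite mul1r.
rewrite -setint_indic.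
under eq_integral do rewrite EFinM.
rewrite ge0_integralZl//.
- rewrite cc; last by apply: measurable_funM => //; have := mexp y; congr measurable_fun; apply/funext => x; rewrite mulrC.
  under eq_integral do rewrite [_ * y]mulrC.
  rewrite integral_exp_1cos// -EFinM; congr EFin.
  by field; rewrite !gt_eqF// ltr_wpDl ?exprn_gt0 ?sqr_ge0.
- apply/measurable_EFinP; apply: measurable_funTS; apply: measurable_funM => //.
  by have := mexp y; congr measurable_fun; apply/funext => x; rewrite mulrC.
- by rewrite lee_fin ltW.
Qed.

End FejerIntegral.

(** * The Fourier integral *)

Section Plancherel.
Context {R : realType}.
Local Notation mu := (@lebesgue_measure R).
Local Notation C := R[i].
Local Notation cint := (@cintegral R setT).
Implicit Types (f g : R -> C).

Lemma measurable_param_int (F : R -> R -> C) : cmeas2 F -> cmeasurable (fun y => cint (F^~ y)).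
Proof.
move=> [m1 m2].
have main (P : C -> R) : measurable_fun [set: measurableTypeR R * measurableTypeR R]
    (fun z => P (F z.1 z.2)) -> measurable_fun [set: R] (fun y => \int[mu]_x P (F x y)).
  move=> mP; apply: (measurableT_comp (f := fine)); first exact: fine_measurable.
  have mP' : measurable_fun [set: measurableTypeR R * measurableTypeR R]
    (fun z => (P (F z.1 z.2))%:E) by exact/measurable_EFinP.
  under eq_fun do rewrite integralE.
  apply: emeasurable_funB.
    have := @measurable_fun_fubini_tonelli_G _ _ (measurableTypeR R) (measurableTypeR R) R mu
      (fun z => (P (F z.1 z.2))%:E)^\+%E (measurable_funepos mP') (funepos_ge0 _).
    congr measurable_fun; apply/funext => y; apply: eq_integral => x _.
    by rewrite !funeposE.
  have := @measurable_fun_fubini_tonelli_G _ _ (measurableTypeR R) (measurableTypeR R) R mu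
      (fun z => (P (F z.1 z.2))%:E)^\-%E (measurable_funeneg mP') (funeneg_ge0 _).
  congr measurable_fun; apply/funext => y; apply: eq_integral => x _.
  by rewrite !funenegE.
by split; [exact: (main _ m1)|exact: (main _ m2)].
Qed.

Definition s2pi : R := Num.sqrt (2 * pi).
(** The constant of the unitary Fourier transform. *)
Definition c0 : C := (s2pi^-1)%:C.

Lemma s2pi_sqr : s2pi ^+ 2 = 2 * pi.
Proof. by rewrite sqr_sqrtr// mulr_ge0// pi_ge0. Qed.

Definition ft f : R -> C := fun xi => c0 * cint (fun x => cexpi (- (x * xi)) * f x).

Lemma cmeasurable_cexpi_lin (t : R) : cmeasurable (fun x => cexpi (t * x)).
Proof.
by apply: (cmeasurable_comp (f := @cexpi R)); [exact: measurable_cexpi|exact: measurable_funM].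
Qed.

Lemma cmeasurable_cexpiN (t : R) : cmeasurable (fun x => cexpi (- (x * t))).
Proof.
by have := cmeasurable_cexpi_lin (- t); congr cmeasurable; apply/funext => x; congr cexpi; ring.
Qed.

Lemma cintegrable_ftk f xi : cintegrable f -> cintegrable (fun x => cexpi (- (x * xi)) * f x).
Proof.
move=> hf; apply: (cintegrable_bound (M := 1)) => //; first exact: cmeasurable_cexpiN.
by move=> x; rewrite normc_cexpi.
Qed.

Lemma cmeasurable_ft f : cmeasurable f -> cmeasurable (ft f).
Proof.
move=> mf; apply: cmeasurableM; first exact: cmeasurable_cst.
apply: (measurable_param_int (F := fun x xi => cexpi (- (x * xi)) * f x)).
by apply: cmeas2M; [exact: cmeas2_fourier|exact: cmeas2_1].
Qed.

Lemma ft_lin (a : C) f g xi : cintegrable f -> cintegrable g ->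
  ft (fun x => a * f x + g x) xi = a * ft f xi + ft g xi.
Proof.
move=> hf hg; rewrite /ft mulrCA -mulrDr; congr (_ * _).
rewrite -cintZ; last exact: cintegrable_ftk.
rewrite -cintD; [|by apply: cintegrableZ; exact: cintegrable_ftk|exact: cintegrable_ftk].
by apply: eq_cint => x; ring.
Qed.

Lemma ft_bounded f : cintegrable f -> exists M : R, forall xi, normc (ft f xi) <= M.
Proof.
move=> hf; exists (normc c0 * fine (\int[mu]_x (normc (f x))%:E)%E) => xi.
rewrite normcM ler_wpM2l ?normc_ge0// -lee_fin fineK; last first.
  exact: integrable_fin_num (cintegrable_normc hf).
apply: (le_trans (normc_cint_le (cintegrable_ftk xi hf))).
by under eq_integral do rewrite normcM normc_cexpi mul1r.
Qed.

(** The multiplication formula, by Fubini's theorem. It yields the adjoint of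
    the transform on L2, and it enters twice in the Fejer identity
    [ft_square_fejer]. *)
Lemma ft_swap f g : cintegrable f -> cintegrable g ->
  cint (fun x => ft f x * g x) = cint (fun x => f x * ft g x).
Proof.
move=> hf hg.
have [|h1 h2 h3] := bounded_kernel_swap (M := 1) cmeas2_fourier _ hf hg.
  by move=> x y; rewrite normc_cexpi.
transitivity (c0 * cint (fun y => g y * cint (fun x => cexpi (- (x * y)) * f x))).
  apply: etrans (cintZ c0 h2); apply: eq_cint => x; rewrite /ft.
  by rewrite -mulrA; congr (_ * _); exact: mulrC.
apply: etrans (congr1 (fun z => c0 * z) (esym h3)) _.
apply: etrans (esym (cintZ c0 h1)) _; apply: eq_cint => x; rewrite /ft mulrCA.
congr (_ * (_ * _)); apply: eq_cint => y; congr (cexpi (- _) * _); exact: mulrC.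
Qed.

Lemma cexpi_modulation f t xi : ft (fun x => cexpi (t * x) * f x) xi = ft f (xi - t).
Proof.
rewrite /ft; congr (_ * _); apply: eq_cint => x.
by rewrite mulrA -cexpiD; congr (cexpi _ * _); ring.
Qed.

(** Up to constants the square of [sinc] ([sinc_fejer]), that is of the
    transform of the indicator of an interval. *)
Definition fejer (t x : R) : R := (1 - cos (t * x)) / x ^+ 2.

Lemma fejer_ge0 t x : 0 <= fejer t x.
Proof. by rewrite divr_ge0 ?sqr_ge0// subr_ge0 cos_le1. Qed.

Lemma fejer_even t x : fejer t (- x) = fejer t x.
Proof. by rewrite /fejer mulrN cosN sqrrN. Qed.

Lemma measurable_inv : measurable_fun [set: R] (fun x : R => x^-1).
Proof.
rewrite (_ : [set: R] = [set x : R | x != 0] `|` [set 0]); last first.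
  by apply/seteqP; split => x //= _; have [->|] := eqVneq x 0; [right|left].
apply/measurable_funU.
- by apply: open_measurable; exact: open_neq.
- exact: measurable_set1.
- split; last exact: measurable_fun_set1.
  apply: open_continuous_measurable_fun; first exact: open_neq.
  by move=> x; rewrite inE /= => x0; exact: inv_continuous.
Qed.

Lemma measurable_fejer t : measurable_fun [set: R] (fejer t).
Proof.
apply: measurable_funM.
  apply: measurable_funB; first exact: measurable_cst.
  apply: (measurableT_comp (continuous_measurable_fun (@continuous_cos R))).
  by apply: measurable_funM.
apply: (measurableT_comp measurable_inv).
exact: measurable_funX.
Qed.

Lemma fejer_integral (t : R) : (\int[mu]_x (fejer t x)%:E = (`|t| * pi)%:E)%E.
Proof.
wlog t0 : t / 0 < t.
  move=> h; have [->|] := eqVneq t 0.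
    rewrite normr0 mul0r; under eq_integral do rewrite /fejer mul0r cos0 subrr mul0r.
    exact: integral0.
  rewrite neq_lt => /orP[t0|]; last exact: h.
  rewrite -normrN -h ?oppr_gt0//; apply: eq_integral => x _.
  by rewrite /fejer mulNr cosN.
pose D : set R := `]0, +oo[%classic.
have mD : measurable D by exact: measurable_itv.
pose G x := (\1_D x * fejer t x : R).
have mG : measurable_fun [set: R] (fun x => (G x)%:E).
  apply/measurable_EFinP; apply: measurable_funM; [exact: measurable_indic|exact: measurable_fejer].
have G0 x : (0 <= (G x)%:E)%E by rewrite lee_fin mulr_ge0 ?fejer_ge0// indicE ler0n.
have E x : (fejer t x)%:E = ((G x)%:E + (G (- x))%:E)%E.
  rewrite -EFinD; congr EFin; rewrite /G fejer_even -mulrDl !indicE.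
  have [->|x0] := eqVneq x 0; first by rewrite /fejer expr0n/= invr0 !mulr0.
  have -> : (x \in D) = (0 < x).
    by apply/idP/idP => [/set_mem|h]; [|apply/mem_set]; rewrite /D /= in_itv/= andbT.
  have -> : (- x \in D) = (x < 0).
    by apply/idP/idP => [/set_mem|h]; [|apply/mem_set]; rewrite /D /= in_itv/= andbT oppr_gt0.
  by move: x0; rewrite neq_lt => /orP[] x0; rewrite x0 ltNge (ltW x0)/= ?(add0r, addr0) mul1r.
under eq_integral do rewrite E.
rewrite ge0_integralD//; last first.
  by apply: (measurableT_comp mG); exact: measurable_funN.
rewrite (ge0_integral_opp mG)//.
have -> : (\int[mu]_x (G x)%:E = (t * (pi / 2))%:E)%E.
  exact: etrans (esym (setint_indic D (fejer t))) (half_fejer_integral t0).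
by rewrite gtr0_norm// -EFinD; congr EFin; field.
Qed.

Lemma fejer_integrable (t : R) : mu.-integrable setT (EFin \o fejer t).
Proof.
apply/integrableP; split; first by apply/measurable_EFinP; exact: measurable_fejer.
under eq_integral do rewrite /= ger0_norm ?fejer_ge0//.
by rewrite fejer_integral ltry.
Qed.

Definition triangle (h x : R) : R := Num.max 0 (h - `|x|).

Lemma fejer_cintegrable t : cintegrable (fun x => (fejer t x)%:C).
Proof.
split; first exact: fejer_integrable.
by rewrite (_ : _ \o _ = cst 0%E)//; exact: integrable0.
Qed.

(** The product of [cos (x xi)] and [1 - cos (h xi)] is a combination of three
    terms [1 - cos], so that the integral of the Fejer weight gives its
    transform, a combination of absolute values. *)
Lemma ft_fejer (h x : R) : 0 < h ->
  cint (fun xi => cexpi (- (xi * x)) * (fejer h xi)%:C) = (pi * triangle h x)%:C.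
Proof.
move=> h0; apply: complex_ext => /=.
- have iF t c : mu.-integrable setT (EFin \o (fun xi => c * fejer t xi)).
    by have := integrableZl measurableT c (fejer_integrable t); congr (_.-integrable _ _).
  transitivity (\int[mu]_xi (2^-1 * fejer (x + h) xi + 2^-1 * fejer (x - h) xi - 1 * fejer x xi)).
    apply: eq_Rintegral => xi _; rewrite mulr0 subr0 cosN /fejer.
    have -> : (x + h) * xi = xi * x + h * xi by ring.
    have -> : (x - h) * xi = xi * x - h * xi by ring.
    rewrite cosD cosB [x * xi]mulrC mulrA !mulrA -!mulrDl -mulrBl; congr (_ / _).
    by field.
  have iD : mu.-integrable setT (EFin \o (fun xi => 2^-1 * fejer (x + h) xi + 2^-1 * fejer (x - h) xi)).
    by have := integrableD measurableT (iF (x + h) 2^-1) (iF (x - h) 2^-1); congr (_.-integrable _ _).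
  rewrite RintegralB//; rewrite RintegralD// !RintegralZl//; try exact: fejer_integrable.
  have I t : \int[mu]_xi fejer t xi = `|t| * pi by rewrite /Rintegral fejer_integral.
  rewrite !I mul1r /triangle.
  have [x0|x0] := leP 0 x; have [hx|hx] := leP h `|x|; rewrite ?(ger0_norm x0) ?(ltr0_norm x0) in hx *.
  + rewrite max_l ?subr_le0// (ger0_norm (x := x + h)) ?(ger0_norm (x := x - h)) ?subr_ge0//; last lra.
    by field.
  + rewrite max_r ?subr_ge0 ?(ltW hx)// (ger0_norm (x := x + h)) ?(ltr0_norm (x := x - h)) ?subr_lt0//; last lra.
    by field.
  + rewrite max_l ?subr_le0// (ler0_norm (x := x + h)) ?(ltr0_norm (x := x - h)); [by field|lra|lra].
  + rewrite max_r ?subr_ge0 ?(ltW hx)// (gtr0_norm (x := x + h)) ?(ltr0_norm (x := x - h)); [by field|lra|lra].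
- apply: Rintegral_odd.
    have : cintegrable (fun xi => cexpi (- (xi * x)) * (fejer h xi)%:C).
      exact: cintegrable_ftk (fejer_cintegrable h).
    by case.
  by move=> xi; rewrite /= fejer_even mulNr opprK cosN sinN; ring.
Qed.

Lemma cmeas2_triangle h : cmeas2 (fun x y => (triangle h (y - x))%:C : C).
Proof.
apply: cmeas2_real; apply: measurable_maxr; first exact: measurable_cst.
apply: measurable_funB; first exact: measurable_cst.
apply: measurableT_comp => //.
by apply: measurable_funB; [exact: measurable_snd|exact: measurable_fst].
Qed.

Lemma triangle_ge0 h x : 0 <= triangle h x. Proof. by rewrite le_max lexx. Qed.

Lemma triangle_le h x : 0 <= h -> triangle h x <= h.
Proof. by move=> h0; rewrite ge_max h0 gerBl normr_ge0. Qed.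

Lemma normc_triangle h x : 0 <= h -> normc (triangle h x)%:C <= h.
Proof. by move=> h0; rewrite normcR ger0_norm ?triangle_ge0 ?triangle_le. Qed.

Lemma fourier_const_sqr : c0 ^+ 2 * (pi : R)%:C = (2^-1 : R)%:C.
Proof.
rewrite /c0 -rmorphXn -rmorphM; congr (_%:C).
by rewrite exprVn s2pi_sqr invfM -mulrA mulVf ?mulr1// lt0r_neq0// pi_gt0.
Qed.

(** Plancherel's identity with a Fejer weight: the weight makes all integrals
    absolutely convergent, so that the multiplication formula can be applied
    to [ft f] and to the weight. *)
Lemma ft_square_fejer f (h : R) : 0 < h -> cintegrable f ->
  cint (fun xi => (fejer h xi)%:C * (ft f xi * cj (ft f xi))) =
  (2^-1 : R)%:C * cint (fun x => f x * cint (fun y => (triangle h (y - x))%:C * cj (f y))).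
Proof.
move=> h0 hf; have [M hM] := ft_bounded hf.
have mft : cmeasurable (ft f) by apply: cmeasurable_ft; case/cintegrableP: hf.
pose G xi : C := (fejer h xi)%:C * cj (ft f xi).
have hG : cintegrable G.
  have := cintegrable_bound (cmeasurableJ mft) (fejer_cintegrable h) (M := M).
  have -> : G = (fun x => cj (ft f x) * (fejer h x)%:C) by apply/funext => x; rewrite /G mulrC.
  by apply => x; rewrite normcJ.
transitivity (cint (fun xi => ft f xi * G xi)); first by apply: eq_cint => x; rewrite /G mulrCA.
apply: etrans (ft_swap hf hG) _.
have [|h1 _ _] := bounded_kernel_swap (M := h) (cmeas2_triangle h) _ hf (cintegrableJ hf).
  by move=> x y; apply: normc_triangle; exact: ltW.
apply: (etrans _ (cintZ _ h1)); apply: eq_cint => x; rewrite [RHS]mulrCA; congr (f x * _).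
apply: (can_inj conjK).
have htri : cintegrable (fun y => (triangle h (y - x))%:C * f y).
  apply: (cintegrable_bound (M := h)) (cmeas2_sec1 x (cmeas2_triangle h)) hf _.
  by move=> y; apply: normc_triangle; exact: ltW.
have -> : cj ((2^-1 : R)%:C * cint (fun y => (triangle h (y - x))%:C * cj (f y))) =
    (2^-1 : R)%:C * cint (fun y => (triangle h (y - x))%:C * f y).
  rewrite conjM conjR -(conjK (cint (fun y => (triangle h (y - x))%:C * f y))) -(cintJ htri).
  by congr (_ * cj _); apply: eq_cint => y; rewrite conjM conjR.
pose F xi : C := cexpi (x * xi) * (fejer h xi)%:C.
have hF : cintegrable F.
  apply: (cintegrable_bound (M := 1)) (fejer_cintegrable h) _ => //.
    exact: cmeasurable_cexpi_lin.
  by move=> y; rewrite normc_cexpi.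
transitivity (c0 * cint (fun xi => ft f xi * F xi)).
  rewrite /ft conjM conjR -(cintJ (cintegrable_ftk x hG)).
  congr (_ * _); apply: eq_cint => xi; rewrite /G !conjM conjK conjR cj_cexpi opprK /F.
  rewrite conjK [xi * x]mulrC mulrA; exact: mulrC.
rewrite (ft_swap hf hF).
transitivity (c0 * cint (fun y => (c0 * pi%:C) * ((triangle h (y - x))%:C * f y))).
  congr (_ * _); apply: eq_cint => y; rewrite /F (cexpi_modulation (fun xi => (fejer h xi)%:C)).
  by rewrite /ft ft_fejer// rmorphM mulrC -!mulrA.
by rewrite (cintZ _ htri) !mulrA -expr2 fourier_const_sqr.
Qed.

End Plancherel.

(** * Window integrals and Lebesgue differentiation *)

Section Averages.
Context {R : realType}.
Local Notation mu := (@lebesgue_measure R).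
Local Notation C := R[i].
Local Notation cint := (@cintegral R setT).
Implicit Types (f g : R -> C).

Definition box (h t : R) : R := \1_`[(0:R), h] t.

Lemma boxE (h x z : R) : box h (x - z) = \1_`[z, z + h] x.
Proof.
rewrite /box !indicE; congr (_%:R); congr nat_of_bool.
by apply/idP/idP => /set_mem hx; apply/mem_set; move: hx;
  rewrite /= !in_itv/= subr_ge0 lerBlDl.
Qed.

Lemma boxE2 (h x z : R) : box h (x - z) = \1_`[x - h, x] z.
Proof.
rewrite /box !indicE; congr (_%:R); congr nat_of_bool.
by apply/idP/idP => /set_mem hx; apply/mem_set; move: hx;
  rewrite /= !in_itv/= subr_ge0 [_ - h <= _]lerBlDr lerBlDl andbC.
Qed.

Lemma box_ge0 (h t : R) : 0 <= box h t. Proof. by rewrite /box indicE ler0n. Qed.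

Lemma box_le1 (h t : R) : box h t <= 1.
Proof. by rewrite /box indicE; case: (_ \in _). Qed.

Lemma box_idem (h t : R) : box h t * box h t = box h t.
Proof. by rewrite /box indicE -natrM mulnb andbb. Qed.

Lemma measurable_box h : measurable_fun [set: R] (box h).
Proof. exact: measurable_indic. Qed.

Lemma measurable_box2 h :
  measurable_fun [set: measurableTypeR R * measurableTypeR R] (fun z => box h (z.2 - z.1)).
Proof.
apply: (measurableT_comp (measurable_box h)).
by apply: measurable_funB; [exact: measurable_snd|exact: measurable_fst].
Qed.

Lemma integral_indic_itv (a b : R) : a <= b -> (\int[mu]_x (\1_`[a, b] x)%:E = (b - a)%:E)%E.
Proof.
move=> ab; rewrite (integral_indic mu measurableT (measurable_itv `[a, b])) setIT.
rewrite [LHS](lebesgue_measure_itv `[a, b])/= lte_fin -EFinD.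
case: ltP => // ba; have -> : a = b by apply/eqP; rewrite eq_le ab.
by rewrite subrr.
Qed.

Lemma integral_box1 (h z : R) : 0 <= h -> (\int[mu]_x (box h (x - z))%:E = h%:E)%E.
Proof.
move=> h0; under eq_integral do rewrite boxE.
by rewrite integral_indic_itv ?lerDl//; congr EFin; ring.
Qed.

Lemma integral_box2 (h x : R) : 0 <= h -> (\int[mu]_z (box h (x - z))%:E = h%:E)%E.
Proof.
move=> h0; under eq_integral do rewrite boxE2.
by rewrite integral_indic_itv ?gerBl//; congr EFin; ring.
Qed.

Lemma integral_box_box (h x y : R) : 0 <= h ->
  \int[mu]_z (box h (x - z) * box h (y - z)) = triangle h (y - x).
Proof.
move=> h0; rewrite /Rintegral.
have E z : box h (x - z) * box h (y - z) = \1_(`[Num.max (x - h) (y - h), Num.min x y]) z.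
  rewrite !boxE2 !indicE -natrM mulnb; congr (_%:R); congr nat_of_bool.
  apply/andP/idP => [[/set_mem + /set_mem]|/set_mem].
    rewrite /= !in_itv/= => /andP[a b] /andP[c d]; apply/mem_set.
    by rewrite /= in_itv/= ge_max le_min a b c d.
  rewrite /= in_itv/= ge_max le_min => /andP[/andP[a b] /andP[c d]].
  by split; apply/mem_set; rewrite /= in_itv/= ?a ?b ?c ?d.
under eq_integral do rewrite E.
rewrite /triangle.
have -> : Num.max (x - h) (y - h) = Num.max x y - h.
  by case: (leP x y) => xy; [rewrite max_r|rewrite max_l]; rewrite ?lerD2r// ltW.
have -> : `|y - x| = Num.max x y - Num.min x y.
  by case: (leP x y) => xy; [rewrite ger0_norm ?subr_ge0|rewrite ler0_norm ?subr_le0 ?opprB// ltW].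
have [hx|hx] := leP (Num.max x y - h) (Num.min x y).
  rewrite (integral_indic_itv hx) [Num.max 0 _]max_r; last first.
  by rewrite subr_ge0 lerBlDr addrC -lerBlDr.
  by rewrite /= !opprB addrCA.
rewrite set_itv_ge ?bnd_simp -?ltNge//; under eq_integral do rewrite indic0.
by rewrite integral0 [Num.max 0 _]max_l//= subr_le0 lerBrDr addrC -lerBrDr ltW.
Qed.

(** The integral of [f] over [z, z + h], as an integral against a kernel in
    order to use the plane integrals. *)
Definition window h f : R -> C := fun z => cint (fun x => (box h (x - z))%:C * f x).

Lemma tonelli_box (h : R) (g : R -> R) : 0 <= h -> measurable_fun [set: R] g -> (forall x, 0 <= g x) ->
  (\int[mu]_z \int[mu]_x (box h (x - z) * g x)%:E = h%:E * \int[mu]_x (g x)%:E)%E.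
Proof.
move=> h0 mg g0; pose F (z : R * R) := ((box h (z.2 - z.1) * g z.2)%:E : \bar R).
have mF : measurable_fun [set: measurableTypeR R * measurableTypeR R] F.
  apply/measurable_EFinP; apply: measurable_funM; first exact: measurable_box2.
  exact: (measurableT_comp mg measurable_snd).
have F0 z : (0 <= F z)%E by rewrite lee_fin mulr_ge0 ?box_ge0.
have := @fubini_tonelli _ _ (measurableTypeR R) (measurableTypeR R) R mu mu F mF F0.
rewrite /F /= => ->; rewrite -ge0_integralZl//.
- apply: eq_integral => x _.
  under eq_integral do rewrite mulrC EFinM.
  rewrite ge0_integralZl//.
  + by rewrite integral_box2// muleC.
  + apply/measurable_EFinP; apply: (measurableT_comp (measurable_box h)).
    by apply: measurable_funB => //; exact: measurable_cst.
  + by move=> z _; rewrite lee_fin box_ge0.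
  + by rewrite lee_fin.
- exact/measurable_EFinP.
- by move=> x _; rewrite lee_fin.
Qed.

Lemma cmeas2_box h : cmeas2 (fun z x => (box h (x - z))%:C : C).
Proof. by apply: cmeas2_real; exact: measurable_box2. Qed.

Lemma normc_box h t : normc (box h t)%:C <= 1.
Proof. by rewrite normcR ger0_norm ?box_ge0 ?box_le1. Qed.

Lemma cintegrable_window h f z : cintegrable f -> cintegrable (fun x => (box h (x - z))%:C * f x).
Proof.
move=> hf; apply: (cintegrable_bound (M := 1)) (cmeas2_sec1 z (cmeas2_box h)) hf _.
by move=> x; exact: normc_box.
Qed.

Lemma cmeasurable_window h f : cmeasurable f -> cmeasurable (window h f).
Proof.
move=> mf; apply: (measurable_param_int (F := fun x z => (box h (x - z))%:C * f x)).
apply: cmeas2M; last exact: cmeas2_1.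
apply: cmeas2_real; apply: (measurableT_comp (measurable_box h)).
by apply: measurable_funB; [exact: measurable_fst|exact: measurable_snd].
Qed.

Lemma window_integrable h f : 0 <= h -> cintegrable f -> cintegrable (window h f).
Proof.
move=> h0 hf; have [mf lf] := (cintegrableP f).1 hf.
apply/cintegrableP; split; first exact: cmeasurable_window.
apply: (@le_lt_trans _ _ (\int[mu]_z \int[mu]_x (box h (x - z) * normc (f x))%:E)%E); last first.
  rewrite tonelli_box//; [|exact: measurable_normc|by move=> x; exact: normc_ge0].
  by rewrite lte_mul_pinfty// lee_fin.
apply: ge0_le_integral => //.
- by move=> x _; rewrite lee_fin normc_ge0.
- by apply/measurable_EFinP; apply: measurable_normc; exact: cmeasurable_window.
- apply: (measurable_section_int (h := fun z => (box h (z.2 - z.1) * normc (f z.2))%:E)).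
    apply/measurable_EFinP; apply: measurable_funM; first exact: measurable_box2.
    exact: (measurableT_comp (measurable_normc mf) measurable_snd).
  by move=> z; rewrite lee_fin mulr_ge0 ?box_ge0 ?normc_ge0.
- move=> z _; apply: (le_trans (normc_cint_le (cintegrable_window h z hf))).
  under eq_integral do rewrite normcM normcR ger0_norm ?box_ge0//.
  exact: lexx.
Qed.

Lemma is_L2_box (h z : R) : 0 <= h -> is_L2 (fun x => (box h (x - z))%:C : C) /\
  sqn (fun x => (box h (x - z))%:C : C) = h%:E.
Proof.
move=> h0; have E : sqn (fun x => (box h (x - z))%:C : C) = h%:E.
  rewrite -(integral_box1 z h0); apply: eq_integral => x _.
  by rewrite normcR ger0_norm ?box_ge0// expr2 box_idem.
split=> //; apply/is_L2P; split; last by rewrite E ltry.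
exact: cmeas2_sec1 z (cmeas2_box h).
Qed.

Lemma cint_cauchy_schwarz f g : is_L2 f -> is_L2 g ->
  ((normc (cint (fun x => f x * g x)) ^+ 2)%:E <= sqn f * sqn g)%E.
Proof.
move=> hf hg; have hg' := is_L2J hg.
have := cauchy_schwarz (L2class f) (L2class (fun x => cj (g x))).
rewrite ip_class// => cs.
have -> : cint (fun x => f x * g x) = cint (fun x => f x * cj (cj (g x))).
  by apply: eq_cint => x; rewrite conjK.
have -> : sqn g = sqn (fun x => cj (g x)) by apply: eq_integral => x _; rewrite normcJ.
rewrite -!nrm_class_sqn// -EFinM lee_fin -exprMn.
by rewrite lerXn2r ?nnegrE ?normc_ge0 ?mulr_ge0 ?nrm_ge0.
Qed.

(** The Cauchy-Schwarz inequality on each window, followed by Tonelli's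
    theorem. *)
Lemma sqn_window h f : 0 <= h -> is_L2 f -> (sqn (window h f) <= (h ^+ 2)%:E * sqn f)%E.
Proof.
move=> h0 hf; have mf := hf.1.
apply: (@le_trans _ _ (\int[mu]_z (h%:E * \int[mu]_x (box h (x - z) * normc (f x) ^+ 2)%:E))%E).
  have mi : measurable_fun [set: R] (fun z => \int[mu]_x (box h (x - z) * normc (f x) ^+ 2)%:E)%E.
    apply: (measurable_section_int (h := fun z => (box h (z.2 - z.1) * normc (f z.2) ^+ 2)%:E)).
      apply/measurable_EFinP; apply: measurable_funM; first exact: measurable_box2.
      apply: measurable_funX.
      exact: (measurableT_comp (measurable_normc mf) measurable_snd).
    by move=> z; rewrite lee_fin mulr_ge0 ?box_ge0 ?sqr_ge0.
  apply: ge0_le_integral => //.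
  - by move=> x _; rewrite lee_fin sqr_ge0.
  - by apply: measurable_normc2; exact: cmeasurable_window.
  - exact: measurable_funeM.
  - move=> z _; have [b2 bE] := is_L2_box z h0.
    have hbf : is_L2 (fun x => (box h (x - z))%:C * f x).
      by apply: (is_L2_bound (M := 1)) => //; [exact: b2.1|move=> x; exact: normc_box].
    have := cint_cauchy_schwarz b2 hbf; rewrite bE.
    have -> : sqn (fun x => (box h (x - z))%:C * f x) =
        (\int[mu]_x (box h (x - z) * normc (f x) ^+ 2)%:E)%E.
      apply: eq_integral => x _; rewrite normcM exprMn normcR ger0_norm ?box_ge0//.
      by rewrite expr2 box_idem.
    rewrite (_ : cint _ = window h f z)//; apply: eq_cint => x.
    by rewrite mulrA -rmorphM box_idem.
rewrite ge0_integralZl//; last 2 first.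
- apply: (measurable_section_int (h := fun z => (box h (z.2 - z.1) * normc (f z.2) ^+ 2)%:E)).
    apply/measurable_EFinP; apply: measurable_funM; first exact: measurable_box2.
    apply: measurable_funX.
    exact: (measurableT_comp (measurable_normc mf) measurable_snd).
  by move=> z; rewrite lee_fin mulr_ge0 ?box_ge0 ?sqr_ge0.
- by move=> z _; apply: integral_ge0 => x _; rewrite lee_fin mulr_ge0 ?box_ge0 ?sqr_ge0.
rewrite tonelli_box//.
- by rewrite muleA -EFinM -expr2.
- by apply: measurable_funX; exact: measurable_normc.
- by move=> x; exact: sqr_ge0.
Qed.

Lemma is_L2_window h f : 0 <= h -> is_L2 f -> is_L2 (window h f).
Proof.
move=> h0 hf; apply/is_L2P; split; first exact: cmeasurable_window hf.1.
apply: (le_lt_trans (sqn_window h0 hf)).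
by rewrite lte_mul_pinfty ?lee_fin ?sqr_ge0//; case/is_L2P: hf.
Qed.

Lemma cint_normc2 f : is_L2 f -> (cint (fun x => f x * cj (f x))) = (fine (sqn f))%:C.
Proof.
move=> hf; rewrite -cint_real; apply: eq_cint => x.
by rewrite -normc_sqr_conj.
Qed.

Lemma cintegrable_box2 h y : 0 <= h -> cintegrable (fun z => (box h (y - z))%:C : C).
Proof.
move=> h0; apply/cintegrableP; split.
  apply: cmeasurable_real; apply: (measurableT_comp (measurable_box h)).
  by apply: measurable_funB => //; exact: measurable_cst.
apply: (@le_lt_trans _ _ h%:E); last exact: ltry.
rewrite -(integral_box2 y h0) le_eqVlt; apply/orP; left; apply/eqP.
by apply: eq_integral => z _; rewrite normcR ger0_norm ?box_ge0.
Qed.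

Lemma cint_box_box h x y : 0 <= h ->
  cint (fun z => (box h (x - z))%:C * (box h (y - z))%:C) = (triangle h (y - x))%:C.
Proof.
move=> h0; rewrite -integral_box_box//.
apply: (etrans _ (cint_real _)); apply: eq_cint => z.
by rewrite rmorphM.
Qed.

(** The correlation of the indicator of an interval with itself is the
    triangle function, which up to a constant is the transform of the Fejer
    weight. *)
Lemma window_correlation h f : 0 < h -> cintegrable f -> is_L2 f ->
  cint (fun x => f x * cint (fun y => (triangle h (y - x))%:C * cj (f y))) =
  (fine (sqn (window h f)))%:C.
Proof.
move=> h0 hf h2; have h0' := ltW h0.
have hw := window_integrable h0' hf; have hfJ := cintegrableJ hf.
rewrite -cint_normc2; last exact: is_L2_window.
have [|_ _ E1] := bounded_kernel_swap (M := h) (cmeas2_triangle h) _ hf hfJ.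
  by move=> x y; apply: normc_triangle.
apply: (etrans E1).
have [|_ _ E2] := bounded_kernel_swap (M := 1) (cmeas2_box h) _ hw hfJ.
  by move=> x y; apply: normc_box.
apply: (@etrans _ _ (cint (fun z => window h f z * cint (fun y => (box h (y - z))%:C * cj (f y))))); last first.
  apply: eq_cint => z; congr (_ * _); apply: (etrans _ (cintJ (cintegrable_window h z hf))).
  by apply: eq_cint => y; rewrite conjM conjR.
apply: (etrans _ (esym E2)); apply: eq_cint => y; congr (_ * _).
have hb := cintegrable_box2 y h0'.
have [|_ _ E3] := bounded_kernel_swap (M := 1) (cmeas2_box h) _ hb hf.
  by move=> z x; exact: normc_box.
apply: (etrans _ (esym E3)); apply: eq_cint => x; rewrite mulrC; congr (_ * _).
exact: esym (cint_box_box x y h0').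
Qed.

Lemma locally_integrable_box (g : R -> R) (h z : R) : locally_integrable setT g ->
  mu.-integrable setT (EFin \o (fun y => box h (y - z) * g y)).
Proof.
move=> [mg _ ig]; apply/integrableP; split.
  apply/measurable_EFinP; apply: measurable_funM => //.
  apply: (measurableT_comp (measurable_box h)).
  by apply: measurable_funB => //; exact: measurable_cst.
have := ig `[z, z + h]%classic (@subsetT _ _) (@segment_compact _ _ _).
rewrite setint_indic; congr (_ < _)%E; apply: eq_integral => y _.
by rewrite /= normrM boxE ger0_norm// indicE ler0n.
Qed.

Lemma compact_sub_box (K : set R) : compact K -> exists M : R, 0 <= M /\ forall x, K x -> box (M + M) (x + M) = 1.
Proof.
move=> /compact_bounded[N [_ N1x]].
exists (`|N| + 1); split=> [|x Kx]; first by rewrite addr_ge0.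
have : `|x| <= `|N| + 1 by apply: N1x => //; rewrite ltr_pwDr// ler_norm.
rewrite ler_norml => /andP[a b].
by rewrite -[X in x + X]opprK boxE indicE mem_set//= in_itv/= a addrC addrK b.
Qed.

(** Windows are the only compact sets on which integrability has to be tested
    below. *)
Lemma locally_integrableCP f : locally_integrableC f <->
  cmeasurable f /\ forall h z, cintegrable (fun x => (box h (x - z))%:C * f x).
Proof.
split=> [[l1 l2]|[mf hf]].
  split=> [|h z]; first by split; [case: l1|case: l2].
  split.
    have := locally_integrable_box h z l1; congr (_.-integrable _ _).
    by apply/funext => x; rewrite /= ReM /= mul0r subr0.
  have := locally_integrable_box h z l2; congr (_.-integrable _ _).
  by apply/funext => x; rewrite /= ImM /= mul0r addr0.
have main (P : C -> R) : (forall a, `|P a| <= normc a) -> measurable_fun setT (P \o f) ->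
    locally_integrable setT (P \o f).
  move=> hP mP; split=> //; first exact: openT.
  move=> K _ cK; have mK := compact_measurable cK.
  have [M [M0 hM]] := compact_sub_box cK.
  have [_ fin] := (cintegrableP _).1 (hf (M + M) (- M)).
  apply: (le_lt_trans _ fin); rewrite setint_indic; apply: ge0_le_integral => //.
  - apply/measurable_EFinP; apply: measurable_funM; first exact: measurable_indic.
    exact: measurableT_comp.
  - apply/measurable_EFinP; apply: measurable_normc.
    apply: cmeasurableM mf; exact: (cmeas2_sec1 (- M) (cmeas2_box (M + M))).
  - move=> x _; rewrite lee_fin normcM normcR (ger0_norm (box_ge0 _ _)) opprK indicE.
    have [/set_mem xK|_] := boolP (x \in K); first by rewrite hM// !mul1r hP.
    by rewrite mul0r mulr_ge0 ?box_ge0 ?normc_ge0.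
by split; [apply: main Re_le_normc mf.1|apply: main Im_le_normc mf.2].
Qed.

(** The one-sided windows [x, x + 1/(n+1)] shrink nicely to [x]. *)
Lemma locally_integrable_differentiation (g : R -> R) : locally_integrable setT g ->
  \forall x \ae mu,
    (n.+1%:R * \int[mu]_y (box (n.+1%:R^-1) (y - x) * g y)) @[n --> \oo] --> g x.
Proof.
move=> lg; have := lebesgue_differentiation lg; apply: aeP => x px.
pose E (x : R) (n : nat) : set R := `[x, x + n.+1%:R^-1]%classic.
have muE z n : mu (E z n) = (n.+1%:R^-1)%:E.
  rewrite (lebesgue_measure_itv `[z, _])/= lte_fin ltrDl invr_gt0 ltr0n/= -EFinD.
  by congr EFin; ring.
have hE z : nicely_shrinking z (E z).
  split; first by move=> n; exact: measurable_itv.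
  exists (4, fun n => PosNum (divr_gt0 (ltr0Sn R 1) (ltr0Sn R n))); split => //=.
  - by rewrite -[0](mulr0 2); apply: cvgM; [exact: cvg_cst|exact: cvg_harmonic].
  - move=> n y; rewrite /E /= in_itv/= => /andP[zy yz].
    rewrite /ball/= ler0_norm ?subr_le0// opprB ltrBlDl (le_lt_trans yz)// ltrD2l.
    by rewrite ltr_pMl ?invr_gt0// ltr1n.
  - move=> n; rewrite lebesgue_measure_ball// muE -EFinM lee_fin le_eqVlt; apply/orP; left; apply/eqP.
    by rewrite -mulrnAl; congr (_ / _); rewrite -mulr_natr -natrM.
have := nice_lebesgue_differentiation hE lg px.
move=> /fine_cvgP[_]; apply: cvg_trans; apply: near_eq_cvg; apply: nearW => n /=.
rewrite muE inver gt_eqF ?invr_gt0 ?ltr0n// invrK.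
rewrite /Rintegral.
have fi : (\int[mu]_(y in E x n) (g y)%:E = \int[mu]_y (box (n.+1%:R^-1) (y - x) * g y)%:E)%E.
  by rewrite setint_indic; apply: eq_integral => y _; rewrite boxE.
rewrite fi fineM//; apply: integrable_fin_num => //.
exact: locally_integrable_box.
Qed.

Lemma cintegrable0 : cintegrable (fun _ : R => 0 : C).
Proof.
have := L2_mul_integrable (@is_L2_0 R) (@is_L2_0 R); congr cintegrable.
by apply/funext => x; rewrite mul0r.
Qed.

Lemma is_L2_locally_integrable f : is_L2 f -> locally_integrableC f.
Proof.
move=> hf; apply/locally_integrableCP; split; first exact: hf.1.
move=> h z; have [h0|h0] := leP 0 h.
  by apply: L2_mul_integrable hf; exact: (is_L2_box z h0).1.
suff -> : (fun x => (box h (x - z))%:C * f x) = (fun _ => 0) by exact: cintegrable0.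
apply/funext => x; rewrite boxE indicE set_itv_ge ?in_set0 ?mul0r//.
by rewrite bnd_simp -ltNge gtrDl.
Qed.

Lemma cvg_normc (u : nat -> C) (l : C) :
  (fun n => complex.Re (u n)) @ \oo --> complex.Re l ->
  (fun n => complex.Im (u n)) @ \oo --> complex.Im l ->
  (fun n => normc (u n - l)) @ \oo --> (0 : R).
Proof.
move=> h1 h2.
apply: (@squeeze_cvgr _ _ _ _ (fun _ => 0) (fun n => `|complex.Re (u n) - complex.Re l| + `|complex.Im (u n) - complex.Im l|)).
- apply: nearW => n; rewrite normc_ge0/= (le_trans (normc_ReIm _))//.
  by rewrite ReD ImD ReN ImN.
- exact: cvg_cst.
- rewrite -[0](addr0 (0 : R)); apply: cvgD.
    by apply/norm_cvg0P/subr_cvg0.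
  by apply/norm_cvg0P/subr_cvg0.
Qed.

Lemma window_differentiation f : locally_integrableC f ->
  \forall x \ae mu, (fun n => normc ((n.+1%:R : R)%:C * window (n.+1%:R^-1) f x - f x)) @ \oo --> (0 : R).
Proof.
move=> lf; have [l1 l2] := lf; have [_ hw] := (locally_integrableCP f).1 lf.
have := locally_integrable_differentiation l2.
have := locally_integrable_differentiation l1.
apply: aeP2 => x h1 h2; apply: cvg_normc.
- apply: cvg_trans h1; apply: near_eq_cvg; apply: nearW => n /=.
  rewrite mul0r subr0; congr (_ * _); apply: eq_Rintegral => y _.
  by rewrite ReM /= mul0r subr0.
- apply: cvg_trans h2; apply: near_eq_cvg; apply: nearW => n /=.
  rewrite mul0r addr0; congr (_ * _); apply: eq_Rintegral => y _.
  by rewrite ImM /= mul0r addr0.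
Qed.

End Averages.

(** * Plancherel's identity *)

Section PlancherelIdentity.
Context {R : realType}.
Local Notation mu := (@lebesgue_measure R).
Local Notation C := R[i].
Local Notation cint := (@cintegral R setT).
Implicit Types (f g : R -> C).

Lemma derivative_lipschitz (u du : R -> R) (K : R) : (forall x, is_derive x (1 : R) u (du x)) ->
  (forall x, `|du x| <= K) -> forall a b, `|u a - u b| <= K * `|a - b|.
Proof.
move=> hu hK a b; wlog ab : a b / a <= b.
  move=> h; have [ab|/ltW ab] := leP a b; first exact: h.
  by rewrite distrC [X in _ * X]distrC; exact: h.
have cu : {within `[a, b], continuous u}.
  apply: continuous_subspaceT; apply: derivable_continuous => x.
  exact: ex_derive.
have [c _ E] := MVT_segment ab (fun x _ => hu x) cu.
by rewrite distrC E normrM [X in _ <= _ * X]distrC ler_wpM2r.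
Qed.

Lemma sin_lipschitz (a b : R) : `|sin a - sin b| <= `|a - b|.
Proof.
rewrite -[X in _ <= X]mul1r; apply: (derivative_lipschitz (du := cos)).
by move=> x; rewrite ler_norml cos_geN1 cos_le1.
Qed.

Lemma cos_lipschitz (a b : R) : `|cos a - cos b| <= `|a - b|.
Proof.
rewrite -[X in _ <= X]mul1r; apply: (derivative_lipschitz (du := fun x => - sin x)).
by move=> x; rewrite normrN ler_norml sin_geN1 sin_le1.
Qed.

Definition sinc (t : R) : R := sin t / t.

Lemma sinc_le1 t : `|sinc t| <= 1.
Proof.
have [->|t0] := eqVneq t 0; first by rewrite /sinc invr0 mulr0 normr0.
rewrite normrM normfV ler_pdivrMr ?normr_gt0// mul1r.
by have := sin_lipschitz t 0; rewrite sin0 !subr0.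
Qed.

Lemma measurable_sinc : measurable_fun [set: R] sinc.
Proof.
apply: measurable_funM; last exact: measurable_inv.
exact: continuous_measurable_fun (@continuous_sin R).
Qed.

Lemma cvg_sinc (u : nat -> R) : u @ \oo --> (0 : R) -> (forall n, u n != 0) ->
  sinc (u n) @[n --> \oo] --> (1 : R).
Proof.
move=> u0 un0.
have d := is_derive_sin (0 : R).
have h : (fun h : R => h^-1 *: (sin (h *: (1 : R) + 0) - sin 0)) @ 0^' --> (cos (0 : R)).
  by rewrite -(@derive_val _ _ _ _ _ _ _ d); exact: (@ex_derive _ _ _ _ _ _ _ d).
rewrite cos0 in h.
have hu : u @ \oo --> (0 : R)^'.
  move=> A [e /= e0 eA]; have := u0 _ (nbhsx_ballx 0 e e0); rewrite !near_simpl.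
  by apply: filterS => n un; apply: eA.
apply: cvg_trans (cvg_comp _ _ hu h); apply: near_eq_cvg; apply: nearW => n /=.
by rewrite sin0 subr0 addr0 /GRing.scale /= mulr1 mulrC.
Qed.

Lemma sinc_fejer (h x : R) : h != 0 -> sinc (h * x / 2) ^+ 2 = 2 / h ^+ 2 * fejer h x.
Proof.
move=> h0; have [->|x0] := eqVneq x 0.
  by rewrite /sinc /fejer mulr0 mul0r sin0 mul0r expr0n/= cos0 subrr mul0r mulr0.
rewrite /fejer /sinc; have -> : cos (h * x) = 1 - 2 * sin (h * x / 2) ^+ 2.
  rewrite [in LHS](_ : h * x = h * x / 2 + h * x / 2); last by field.
  by have e := cos2Dsin2 (h * x / 2); rewrite cosD -!expr2; lra.
by field; rewrite h0 x0.
Qed.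

(** Plancherel's identity for the average of [f] over windows of length [h],
    whose transform is [ft f] times a function of modulus [|sinc (h xi / 2)|]. *)
Lemma sqn_sinc_ft f (h : R) : 0 < h -> cintegrable f -> is_L2 f ->
  sqn (fun xi => (sinc (h * xi / 2))%:C * ft f xi) = sqn (fun z => (h^-1)%:C * window h f z).
Proof.
move=> h0 hf h2; have [M hM] := ft_bounded hf.
have mf : cmeasurable (ft f) by apply: cmeasurable_ft; case/cintegrableP: hf.
pose F xi := fejer h xi * normc (ft f xi) ^+ 2.
have mF : measurable_fun [set: R] F.
  apply: measurable_funM; first exact: measurable_fejer.
  by apply: measurable_funX; exact: measurable_normc.
have F0 xi : 0 <= F xi by rewrite mulr_ge0 ?fejer_ge0 ?sqr_ge0.
have iF : mu.-integrable setT (EFin \o F).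
  apply: (le_integrable _ _ _ (integrableZl measurableT (M ^+ 2) (fejer_integrable h))) => //.
    exact/measurable_EFinP.
  move=> xi _; change ((`|F xi|)%:E <= (`|M ^+ 2 * fejer h xi|)%:E)%E.
  rewrite lee_fin (ger0_norm (F0 xi)) (ger0_norm (mulr_ge0 (sqr_ge0 M) (fejer_ge0 h xi))) /F mulrC.
  rewrite ler_wpM2r ?fejer_ge0// lerXn2r ?nnegrE ?normc_ge0//.
  by rewrite (le_trans (normc_ge0 _) (hM 0)).
have hw := is_L2_window (ltW h0) h2.
have key : \int[mu]_xi F xi = 2^-1 * fine (sqn (window h f)).
  have E := ft_square_fejer h0 hf.
  have E' : (2^-1 : R)%:C * (fine (sqn (window h f)))%:C = (2^-1 * fine (sqn (window h f)))%:C.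
    by rewrite rmorphM.
  apply: (@complexI R); rewrite -E' -(window_correlation h0 hf h2) -E.
  apply: (etrans (esym (cint_real F))); apply: eq_cint => xi.
  by rewrite -normc_sqr_conj -rmorphM.
rewrite sqnZ; last exact: hw.1.
have fw : sqn (window h f) \is a fin_num.
  by rewrite ge0_fin_numE ?sqn_ge0//; case/is_L2P: hw.
transitivity (\int[mu]_xi ((2 / h ^+ 2)%:E * (F xi)%:E))%E.
  apply: eq_integral => xi _; rewrite normcM exprMn normcR real_normK ?num_real//.
  rewrite (sinc_fejer xi (lt0r_neq0 h0)) -EFinM.
  by congr EFin; rewrite /F [RHS]mulrA.
rewrite ge0_integralZl//; last first.
- by rewrite lee_fin divr_ge0 ?sqr_ge0.
- by move=> xi _; rewrite lee_fin.
- exact/measurable_EFinP.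
have -> : (\int[mu]_xi (F xi)%:E = (2^-1 * fine (sqn (window h f)))%:E)%E.
  by rewrite -key /Rintegral fineK// integrable_fin_num.
rewrite -[in RHS](fineK fw) -!EFinM; congr EFin.
rewrite normcR ger0_norm ?invr_ge0 ?(ltW h0)// exprVn mulrA; congr (_ * _).
by field; rewrite gt_eqF.
Qed.

(** Both sides are limits of the identity for averages, and Fatou's lemma
    gives each of the two inequalities: averages have at most the norm of [f],
    and [|sinc| <= 1]. *)
Lemma plancherel_L1L2 f : cintegrable f -> is_L2 f -> is_L2 (ft f) /\ sqn (ft f) = sqn f.
Proof.
move=> hf h2; have mf : cmeasurable (ft f) by apply: cmeasurable_ft; case/cintegrableP: hf.
pose h n : R := n.+1%:R^-1.
have h0 n : 0 < h n by rewrite invr_gt0 ltr0n.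
pose S n xi : C := (sinc (h n * xi / 2))%:C * ft f xi.
pose A n z : C := (n.+1%:R : R)%:C * window (h n) f z.
have SA n : sqn (S n) = sqn (A n).
  by rewrite /S (sqn_sinc_ft (h0 n) hf h2) /A /h invrK.
have mS n : cmeasurable (S n).
  apply: cmeasurableM mf; apply: cmeasurable_real; apply: (measurableT_comp measurable_sinc).
  by do 2 apply: measurable_funM => //.
have mA n : cmeasurable (A n).
  by apply: cmeasurableM; [exact: cmeasurable_cst|exact: cmeasurable_window h2.1].
have h1 : (sqn (ft f) <= sqn f)%E.
  apply: (sqn_fatou (h := S)) => //.
  - have z0 : \forall x \ae mu, (x : R) <> 0.
      exists [set 0]; split; [exact: measurable_set1|exact: lebesgue_measure_set1|].
      by move=> x /= /contrapT.
    apply: aeP z0 => xi /eqP xi0.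
    have -> : (fun n => normc (S n xi - ft f xi)) =
        (fun n => `|sinc (h n * xi / 2) - 1| * normc (ft f xi)).
      apply/funext => n; rewrite /S -normcR -normcM; congr normc.
      by rewrite rmorphB mulrBl mul1r.
    rewrite -[X in _ --> X](mul0r (normc (ft f xi))); apply: cvgM; last exact: cvg_cst.
    apply/norm_cvg0P; rewrite -[X in _ --> X](subrr (1 : R)); apply: cvgB; last exact: cvg_cst.
    apply: cvg_sinc => [|n]; last first.
      by rewrite !mulf_neq0 ?invr_eq0// gt_eqF// h0.
    rewrite -[X in _ --> X](mul0r (xi / 2)).
    under eq_fun do rewrite -mulrA.
    by apply: cvgM; [exact: cvg_harmonic|exact: cvg_cst].
  - move=> n; rewrite SA sqnZ; last exact: cmeasurable_window h2.1.
    apply: (le_trans (lee_wpmul2l _ (sqn_window (ltW (h0 n)) h2))).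
      by rewrite lee_fin sqr_ge0.
    rewrite muleA -EFinM normcR ger0_norm// -exprMn mulfV ?pnatr_eq0//.
    by rewrite expr1n mul1e.
split; first by apply/is_L2P; split => //; apply: (le_lt_trans h1); case/is_L2P: h2.
have h3 : (sqn f <= sqn (ft f))%E.
  apply: (@sqn_fatou R A f (sqn (ft f)) mA h2.1).
    exact: window_differentiation (is_L2_locally_integrable h2).
  move=> n; rewrite -SA; apply: sqn_le => // xi.
  by rewrite normcM normcR ler_piMl ?normc_ge0 ?sinc_le1.
by apply: le_anti; rewrite h1 h3.
Qed.

End PlancherelIdentity.

(** * The Fourier transform on square integrable functions *)

Section FourierL2.
Context {R : realType}.
Local Notation mu := (@lebesgue_measure R).
Local Notation C := R[i].
Local Notation X := (L2space R).
Local Notation cint := (@cintegral R setT).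
Implicit Types (f g : R -> C) (u v w : X).

Lemma sqn_dominated (h : nat -> R -> C) g : (forall n, cmeasurable (h n)) -> is_L2 g ->
  (forall n x, normc (h n x) <= normc (g x)) ->
  (\forall x \ae mu, (fun n => normc (h n x)) @ \oo --> (0 : R)) ->
  (fun n => sqn (h n)) @ \oo --> 0%E.
Proof.
move=> mh hg hle h0.
have := @dominated_convergence _ (measurableTypeR R) R mu setT measurableT
  (fun n x => (normc (h n x) ^+ 2)%:E) (fun _ => 0%E) (fun x => (normc (g x) ^+ 2)%:E).
case.
- by move=> n; apply: measurable_normc2.
- exact: measurable_cst.
- apply: aeP h0 => x hx _; apply/fine_cvgP; split; first exact: nearW.
  have hq : (fun n => normc (h n x) * normc (h n x)) @ \oo --> (0 * 0 : R) by exact: cvgM.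
  rewrite mulr0 in hq; apply: cvg_trans hq; apply: near_eq_cvg; apply: nearW => n.
  by rewrite /= expr2.
- exact: L2_sqr_integrable.
- apply: aeW => x n _; rewrite abse_EFin lee_fin ger0_norm ?sqr_ge0//.
  by rewrite lerXn2r ?nnegrE ?normc_ge0.
- by move=> _ _; rewrite integral0.
Qed.

(** Convergence in norm, as the convergence of a real sequence. *)
Definition cvgX (u : nat -> X) (l : X) := (fun n => nrm (u n - l)) @ \oo --> (0 : R).

Lemma cvgXP (u : nat -> X) l : cvgX u l <->
  forall e : R, 0 < e -> exists N, forall n, (N <= n)%N -> nrm (u n - l) <= e.
Proof.
split=> [h e e0|h].
  have /cvgr0Pnorm_le h' := h; have [N _ hN] := h' e e0.
  by exists N => n Nn; have := hN n Nn; rewrite /= ger0_norm ?nrm_ge0.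
apply/cvgr0Pnorm_le => e e0; have [N hN] := h e e0.
by exists N => // n Nn; rewrite /= ger0_norm ?nrm_ge0 ?hN.
Qed.

Lemma cvgX_unique (u : nat -> X) l m : cvgX u l -> cvgX u m -> l = m.
Proof.
move=> /cvgXP h1 /cvgXP h2; apply/eqP; rewrite -subr_eq0; apply/eqP; apply: nrm_eq0.
apply/ler_addgt0Pr => e e0; rewrite add0r.
have e2 : 0 < e / 2 by rewrite divr_gt0.
have [N hN] := h1 _ e2; have [M hM] := h2 _ e2.
apply: (le_trans (nrm_tri (u (maxn N M)) _ _)); rewrite nrmB [e]splitr lerD//.
  by rewrite hN ?leq_maxl.
by rewrite hM ?leq_maxr.
Qed.

Lemma cvgX_squeeze (u : nat -> X) l (a : nat -> R) : a @ \oo --> (0 : R) ->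
  (forall n, nrm (u n - l) <= a n) -> cvgX u l.
Proof.
move=> ha hu; apply: (@squeeze_cvgr _ _ _ _ (fun _ => 0) a) => //.
  by apply: nearW => n; rewrite nrm_ge0 hu.
exact: cvg_cst.
Qed.

Lemma cvgX_blin (T : X -> X) (u : nat -> X) l : blin T -> cvgX u l -> cvgX (fun n => T (u n)) (T l).
Proof.
move=> [lT [M M0 hM]] hu; apply: (@cvgX_squeeze _ _ (fun n => M * nrm (u n - l))).
  by rewrite -[0](mulr0 M); apply: cvgM => //; exact: cvg_cst.
by move=> n; rewrite -(linB lT).
Qed.

Lemma cvgX_lin (a : C) (u v : nat -> X) l m : cvgX u l -> cvgX v m ->
  cvgX (fun n => a *: u n + v n) (a *: l + m).
Proof.
move=> hu hv; apply: (@cvgX_squeeze _ _ (fun n => normc a * nrm (u n - l) + nrm (v n - m))).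
  rewrite -[0](addr0 (0 : R)); apply: cvgD => //; rewrite -[0](mulr0 (normc a)).
  by apply: cvgM => //; exact: cvg_cst.
move=> n; rewrite -nrmZ; apply: le_trans (nrmD _ _).
by rewrite scalerBr opprD addrACA.
Qed.

Lemma cvgXD (f1 f2 : nat -> X) l m : cvgX f1 l -> cvgX f2 m -> cvgX (fun n => f1 n + f2 n) (l + m).
Proof.
move=> h1 h2; have := cvgX_lin 1 h1 h2; rewrite scale1r; congr cvgX.
by apply/funext => n; rewrite scale1r.
Qed.

Lemma cvgX_nrm (u : nat -> X) l : cvgX u l -> (fun n => nrm (u n)) @ \oo --> nrm l.
Proof.
move=> hu; apply/subr_cvg0; apply/norm_cvg0P.
apply: (@squeeze_cvgr _ _ _ _ (fun _ => 0) (fun n => nrm (u n - l))) => //; last exact: cvg_cst.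
apply: nearW => n; rewrite normr_ge0/= ler_norml; apply/andP; split.
  rewrite lerNl opprB lerBlDr; have := nrm_tri (u n) l 0; rewrite !subr0 => /le_trans; apply.
  by rewrite nrmB.
by rewrite lerBlDr; have := nrm_tri l (u n) 0; rewrite !subr0.
Qed.

Lemma cvgX_ip (u v : nat -> X) l m : cvgX u l -> cvgX v m ->
  (fun n => normc (ip (u n) (v n) - ip l m)) @ \oo --> (0 : R).
Proof.
move=> hu hv.
apply: (@squeeze_cvgr _ _ _ _ (fun _ => 0)
  (fun n => nrm (u n - l) * nrm (v n) + nrm l * nrm (v n - m))).
- apply: nearW => n; rewrite normc_ge0 andTb.
  have -> : ip (u n) (v n) - ip l m = ip (u n - l) (v n) + ip l (v n - m).
    by rewrite ipBl ipBr; zmodule.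
  by rewrite (le_trans (le_normcD _ _))// lerD// cauchy_schwarz.
- exact: cvg_cst.
- rewrite -[0](addr0 (0 : R)) -[X in _ --> X + _](mul0r (nrm m)) -[X in _ --> _ + X](mulr0 (nrm l)).
  by apply: cvgD; apply: cvgM => //; [exact: cvgX_nrm|exact: cvg_cst].
Qed.

Lemma normc_cvg_unique (z : nat -> C) a b : (fun n => normc (z n - a)) @ \oo --> (0 : R) ->
  (fun n => normc (z n - b)) @ \oo --> (0 : R) -> a = b.
Proof.
move=> h1 h2; apply/eqP; rewrite -subr_eq0; apply/eqP; apply: eq0_normc.
apply/eqP; rewrite eq_le normc_ge0 andbT.
have h : (fun n => normc (z n - a) + normc (z n - b)) @ \oo --> (0 + 0 : R) by exact: cvgD.
rewrite addr0 in h.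
have h0 : (fun _ : nat => normc (a - b)) @ \oo --> (0 : R).
  apply: (@squeeze_cvgr _ _ _ _ (fun _ => 0) (fun n => normc (z n - a) + normc (z n - b))) => //.
    apply: nearW => n; rewrite normc_ge0 andTb -[X in _ <= X + _]normc_opp opprB.
    by apply: le_trans (le_normcD _ _); rewrite addrA subrK.
  exact: cvg_cst.
have h2' : (fun _ : nat => normc (a - b)) @ \oo --> normc (a - b) by exact: cvg_cst.
by rewrite (cvg_unique (@Rhausdorff R) h2' h0).
Qed.

Lemma nested_choice (P : nat -> nat -> Prop) : (forall k N, exists n, (N <= n)%N /\ P k n) ->
  exists phi : nat -> nat, (forall k, (phi k <= phi k.+1)%N) /\ (forall k, P k (phi k)).
Proof.
move=> h; have [g hg] : exists g : nat -> nat -> nat, forall k N, (N <= g k N)%N /\ P k (g k N).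
  have /choice[g hg] : forall kN : nat * nat, exists n, (kN.2 <= n)%N /\ P kN.1 n.
    by move=> [k N]; exact: h.
  by exists (fun k N => g (k, N)) => k N; exact: (hg (k, N)).
pose phi := fix phi k := if k is k'.+1 then g k'.+1 (phi k') else g 0 0.
exists phi; split=> [k|[|k]] /=; [exact: (hg _ _).1|exact: (hg _ _).2|exact: (hg _ _).2].
Qed.

(** A subsequence with increments at most [2^-k] converges by
    [L2_rapidly_complete]. *)
Lemma cauchy_cvgX (u : nat -> X) :
  (forall e : R, 0 < e -> exists N, forall n m, (N <= n)%N -> (N <= m)%N -> nrm (u n - u m) <= e) ->
  exists l, cvgX u l.
Proof.
move=> hu.
have [phi [phiS hphi]] : exists phi : nat -> nat, (forall k, (phi k <= phi k.+1)%N) /\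
    (forall k m, (phi k <= m)%N -> nrm (u m - u (phi k)) <= 2^-1 ^+ k).
  apply: (@nested_choice (fun k n => forall m, (n <= m)%N -> nrm (u m - u n) <= 2^-1 ^+ k)).
  move=> k N; have [|N' hN'] := hu (2^-1 ^+ k); first by rewrite exprn_gt0// invr_gt0.
  exists (maxn N N'); split=> [|m hm]; first exact: leq_maxl.
  by apply: hN'; rewrite ?leq_maxr// (leq_trans (leq_maxr _ _) hm).
have [|l hl] := @L2_rapidly_complete R 1 (u \o phi) ler01.
  by move=> k; rewrite mul1r; exact: hphi (phiS k).
exists l; apply/cvgXP => e e0.
have [k hk] := @half_exp_lt R 3 e (ler0n _ 3) e0.
exists (phi k) => n hn; apply: le_trans (ltW hk).
apply: (le_trans (nrm_tri (u (phi k)) _ _)).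
by have := lerD (hphi k n hn) (hl k); move/le_trans; apply; rewrite /=; lra.
Qed.

Definition seg (n : nat) (x : R) : C := (box (n%:R + n%:R) (x - - n%:R))%:C.

Definition trunc n f : R -> C := fun x => seg n x * f x.

Lemma segE n x : seg n x = (\1_`[- n%:R, n%:R] x : R)%:C.
Proof. by rewrite /seg boxE; congr ((\1_ _ _)%:C); congr ([set` Interval _ (BRight _)]); rewrite addrA addNr add0r. Qed.

Lemma is_L2_seg n : is_L2 (seg n).
Proof. by apply: (is_L2_box (- n%:R) _).1; rewrite addr_ge0. Qed.

Lemma normc_seg n x : normc (seg n x) <= 1.
Proof. exact: normc_box. Qed.

Lemma is_L2_trunc n f : is_L2 f -> is_L2 (trunc n f).
Proof.
move=> hf; apply: (is_L2_bound (M := 1)) => //; first exact: (is_L2_seg n).1.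
exact: normc_seg.
Qed.

Lemma cintegrable_trunc n f : is_L2 f -> cintegrable (trunc n f).
Proof. by move=> hf; apply: L2_mul_integrable => //; exact: is_L2_seg. Qed.

Lemma normc_trunc_le n f x : normc (trunc n f x) <= normc (f x).
Proof. by rewrite normcM ler_piMl ?normc_ge0 ?normc_seg. Qed.

Lemma truncated_fourierE n f : truncated_fourier n f = ft (trunc n f).
Proof.
apply/funext => xi; rewrite /truncated_fourier /ft; congr (_ * _).
apply: complex_ext; rewrite /= /Rintegral setint_indic; congr fine; apply: eq_integral => x _;
  rewrite /trunc segE !(ReM, ImM) /=; congr EFin; ring.
Qed.

Lemma seg_eventually (x : R) : exists N, forall n, (N <= n)%N -> seg n x = 1.
Proof.
exists (Num.truncn `|x|).+1 => n hn; rewrite segE indicE mem_set//= in_itv/= -ler_norml.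
have := truncnS_gt `|x| => /ltW /le_trans; apply.
by rewrite ler_nat.
Qed.

Lemma trunc_cvgX f : is_L2 f -> cvgX (fun n => L2class (trunc n f)) (L2class f).
Proof.
move=> hf.
pose h n x := trunc n f x - f x.
have h2 n : is_L2 (h n) by apply: is_L2B => //; exact: is_L2_trunc.
have hc : (fun n => sqn (h n)) @ \oo --> 0%E.
  apply: (@sqn_dominated h (fun x => (2 : R)%:C * f x)).
  - by move=> n; exact: (h2 n).1.
  - exact: is_L2Z.
  - move=> n x; rewrite /h normcM normcR ger0_norm//.
    apply: (le_trans (le_normcD _ _)); rewrite normc_opp mulr_natl mulr2n lerD//.
    exact: normc_trunc_le.
  - apply: aeW => x; have [N hN] := seg_eventually x.
    apply: (@cvg_trans _ ((fun _ : nat => 0 : R) @ \oo)); last exact: cvg_cst.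
    apply: near_eq_cvg; exists N => // n Nn.
    by rewrite /h /trunc hN// mul1r subrr normc0.
have hq : (fun n => nrm (L2class (h n)) ^+ 2) @ \oo --> (0 : R).
  have : (fun n => (nrm (L2class (h n)) ^+ 2)%:E) @ \oo --> 0%E.
    by apply: cvg_trans hc; apply: near_eq_cvg; apply: nearW => n; rewrite nrm_class_sqn.
  by move/fine_cvgP => [].
apply/cvgXP => e e0; have /cvgr0Pnorm_le hq' := hq.
have [N _ hN] := hq' (e ^+ 2) (exprn_gt0 _ e0).
exists N => n Nn; have := hN n Nn; rewrite /= ger0_norm ?sqr_ge0// => hh.
rewrite -L2classB//; last exact: is_L2_trunc.
by rewrite -(@ler_pXn2r _ 2) ?nnegrE ?nrm_ge0 ?(ltW e0).
Qed.

Lemma ftB f g xi : cintegrable f -> cintegrable g ->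
  ft (fun x => f x - g x) xi = ft f xi - ft g xi.
Proof.
move=> hf hg.
have e : (fun x => f x - g x) = (fun x => -1 * g x + f x).
  by apply/funext => x; rewrite mulN1r addrC.
apply: (etrans (congr1 (fun h => ft h xi) e)); apply: (etrans (ft_lin (-1) xi hg hf)).
by rewrite mulN1r addrC.
Qed.

Lemma nrm_ftB f g : cintegrable f -> cintegrable g -> is_L2 f -> is_L2 g ->
  nrm (L2class (ft f) - L2class (ft g)) = nrm (L2class f - L2class g).
Proof.
move=> hf hg h2 g2; have [hf2 _] := plancherel_L1L2 hf h2; have [hg2 _] := plancherel_L1L2 hg g2.
have [h3 e] := plancherel_L1L2 (cintegrableB hf hg) (is_L2B h2 g2).
rewrite -!L2classB//.
have -> : (fun x => ft f x - ft g x) = ft (fun x => f x - g x).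
  by apply/funext => xi; rewrite ftB.
apply/eqP; rewrite -(eqrXn2 (n := 2)) ?nrm_ge0//; apply/eqP.
apply: EFin_inj; rewrite nrm_class_sqn// nrm_class_sqn//; exact: is_L2B.
Qed.

Lemma cvgX_sqn (h : nat -> R -> C) g : (forall n, is_L2 (h n)) -> is_L2 g ->
  cvgX (fun n => L2class (h n)) (L2class g) <-> (fun n => L2norm (h n - g)) @ \oo --> 0%E.
Proof.
move=> hh hg; have E n : L2norm (h n - g) = (nrm (L2class (h n) - L2class g))%:E.
  rewrite -L2classB// nrm_L2norm; apply: L2norm_ae.
  - by have := is_L2B (hh n) hg => -[].
  - exact: L2repr_meas.
  - by have := L2classK (is_L2B (hh n) hg); apply: aeP => x ->.
rewrite /cvgX (_ : (fun n => L2norm (h n - g)) = (fun n => (nrm (L2class (h n) - L2class g))%:E)).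
  by split=> [h0|/fine_cvgP[]//]; apply/fine_cvgP; split; first exact: nearW.
exact/funext.
Qed.

Lemma is_fourier_cvgX f g : is_fourier f g <->
  [/\ is_L2 f, is_L2 g & cvgX (fun n => L2class (ft (trunc n f))) (L2class g)].
Proof.
have H (hf : is_L2 f) n : is_L2 (ft (trunc n f)).
  by apply: (plancherel_L1L2 (cintegrable_trunc n hf) (is_L2_trunc n hf)).1.
split=> -[hf hg h]; split => //.
  apply/cvgX_sqn => //; first exact: H.
  by under eq_fun do rewrite -truncated_fourierE.
under eq_fun do rewrite truncated_fourierE.
by apply/cvgX_sqn => //; exact: H.
Qed.

(** By Plancherel's identity the transforms of the truncations form a Cauchy
    sequence. *)
Lemma fourier_exists f : is_L2 f -> is_fourier f (fourier f).
Proof.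
move=> hf; rewrite /fourier; apply: (@xgetPex _ _ [set g | is_fourier f g]).
have [l hl] : exists l, cvgX (fun n => L2class (ft (trunc n f))) l.
  apply: cauchy_cvgX => e e0; have /cvgXP/(_ (e / 2) _)[|N hN] := trunc_cvgX hf.
    by rewrite divr_gt0.
  exists N => n m hn hm; rewrite nrm_ftB; try exact: cintegrable_trunc; try exact: is_L2_trunc.
  rewrite (le_trans (nrm_tri (L2class f) _ _))// [e]splitr lerD ?hN//.
  by rewrite nrmB hN.
exists (L2repr l); apply/is_fourier_cvgX; split => //; first exact: L2reprP.
by rewrite L2class_repr.
Qed.

(** The transform on classes, where it is a linear isometry. *)
Definition FT u : X := L2class (fourier (L2repr u)).

Lemma is_L2_fourier f : is_L2 f -> is_L2 (fourier f).
Proof. by move=> /fourier_exists[]. Qed.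

Lemma ft_trunc_ae n f g : is_L2 f -> is_L2 g -> (\forall x \ae mu, f x = g x) ->
  ft (trunc n f) = ft (trunc n g).
Proof.
move=> hf hg fg; apply/funext => xi; rewrite /ft; congr (_ * _); apply: cint_ae.
- by apply: cmeasurableM; [exact: cmeasurable_cexpiN|exact: (is_L2_trunc n hf).1].
- by apply: cmeasurableM; [exact: cmeasurable_cexpiN|exact: (is_L2_trunc n hg).1].
- by apply: aeP fg => x; rewrite /trunc => ->.
Qed.

Lemma FT_cvg f : is_L2 f -> cvgX (fun n => L2class (ft (trunc n f))) (FT (L2class f)).
Proof.
move=> hf; have /is_fourier_cvgX[h1 h2 h3] := fourier_exists (L2reprP (L2class f)).
suff -> : (fun n => L2class (ft (trunc n f))) =
  (fun n => L2class (ft (trunc n (L2repr (L2class f))))) by exact: h3.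
apply/funext => n; rewrite (@ft_trunc_ae n f (L2repr (L2class f)))//.
by have := L2classK hf; apply: aeP => x ->.
Qed.

Lemma is_fourierE f g : is_fourier f g <-> [/\ is_L2 f, is_L2 g & FT (L2class f) = L2class g].
Proof.
split=> [/is_fourier_cvgX[hf hg h]|[hf hg E]].
  by split=> //; apply: cvgX_unique (FT_cvg hf) h.
by apply/is_fourier_cvgX; split=> //; rewrite -E; exact: FT_cvg.
Qed.

Lemma FT_class f : is_L2 f -> FT (L2class f) = L2class (fourier f).
Proof. by move=> hf; have /is_fourierE[_ _ ->] := fourier_exists hf. Qed.

(** Plancherel's identity applied to the differences of [f] and its
    truncations. *)
Lemma FT_L1L2 f : cintegrable f -> is_L2 f -> FT (L2class f) = L2class (ft f).
Proof.
move=> hf h2; apply: cvgX_unique (FT_cvg h2) _.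
apply: cvgX_squeeze (trunc_cvgX h2) _ => n.
by rewrite nrm_ftB//; [exact: cintegrable_trunc|exact: is_L2_trunc].
Qed.

Lemma nrm_FT u : nrm (FT u) = nrm u.
Proof.
rewrite -[u]L2class_repr; have hf := L2reprP u; set f := L2repr u.
have h1 := cvgX_nrm (FT_cvg hf); have h2 := cvgX_nrm (trunc_cvgX hf).
apply: (@cvg_unique _ (@Rhausdorff R) _ _ _ _ h1).
apply: cvg_trans h2; apply: near_eq_cvg; apply: nearW => n.
have hi := cintegrable_trunc n hf; have ht := is_L2_trunc n hf.
have [h3 e] := plancherel_L1L2 hi ht.
apply/eqP; rewrite -(eqrXn2 (n := 2)) ?nrm_ge0//; apply/eqP.
by apply: EFin_inj; rewrite nrm_class_sqn// nrm_class_sqn.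
Qed.

Lemma FT_lin : lin FT.
Proof.
move=> a u v; rewrite -[u]L2class_repr -[v]L2class_repr.
have hu := L2reprP u; have hv := L2reprP v; set f := L2repr u; set g := L2repr v.
rewrite -L2class_lin//.
have h := FT_cvg (is_L2_lin a hu hv).
apply: cvgX_unique h _.
have := cvgX_lin a (FT_cvg hu) (FT_cvg hv).
rewrite /cvgX; apply: cvg_trans; apply: near_eq_cvg; apply: nearW => n.
congr (nrm (_ - _)).
have i1 := cintegrable_trunc n hu; have i2 := cintegrable_trunc n hv.
have [l1 _] := plancherel_L1L2 i1 (is_L2_trunc n hu).
have [l2 _] := plancherel_L1L2 i2 (is_L2_trunc n hv).
rewrite -L2class_lin//; congr L2class; apply/funext => xi.
apply: (etrans (esym (ft_lin a xi i1 i2))); apply: (congr1 (fun h => ft h xi)).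
by apply/funext => x; rewrite /trunc [RHS]mulrDr mulrCA.
Qed.

Lemma FT_blin : blin FT.
Proof. by split; [exact: FT_lin|exists 1 => // u; rewrite nrm_FT mul1r]. Qed.

Definition conjX u : X := L2class (fun x => cj (L2repr u x)).

Lemma conjX_class f : is_L2 f -> conjX (L2class f) = L2class (fun x => cj (f x)).
Proof.
move=> hf; apply: L2class_ae; [exact: is_L2J (L2reprP _)|exact: is_L2J|].
by have := L2classK hf; apply: aeP => x ->.
Qed.

Lemma conjX_lin (a : C) u v : conjX (a *: u + v) = cj a *: conjX u + conjX v.
Proof.
have hu := L2reprP u; have hv := L2reprP v.
rewrite -L2class_lin; [|exact: is_L2J|exact: is_L2J].
apply: L2class_ae; [exact: is_L2J (L2reprP _)|by apply: is_L2D; [apply: is_L2Z|]; exact: is_L2J|].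
have := L2repr_lin a u v; apply: aeP => x ->.
by rewrite conjD conjM.
Qed.

Lemma nrm_conjX u : nrm (conjX u) = nrm u.
Proof.
have hu := L2reprP u; apply/eqP; rewrite -(eqrXn2 (n := 2)) ?nrm_ge0//; apply/eqP.
apply: EFin_inj; rewrite nrm_class_sqn; last exact: is_L2J.
by rewrite nrm_sqn; apply: eq_integral => x _; rewrite normcJ.
Qed.

(** The transform conjugated by complex conjugation, which is its inverse by
    [FTK] and [FTiK]. *)
Definition FTi u : X := conjX (FT (conjX u)).

Lemma FTi_lin : lin FTi.
Proof. by move=> a u v; rewrite /FTi conjX_lin FT_lin conjX_lin conjK. Qed.

Lemma nrm_FTi u : nrm (FTi u) = nrm u.
Proof. by rewrite /FTi nrm_conjX nrm_FT nrm_conjX. Qed.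

Lemma FTi_blin : blin FTi.
Proof. by split; [exact: FTi_lin|exists 1 => // u; rewrite nrm_FTi mul1r]. Qed.

Lemma cvgX_conjX (u : nat -> X) l : cvgX u l -> cvgX (fun n => conjX (u n)) (conjX l).
Proof.
apply: cvg_trans; apply: near_eq_cvg; apply: nearW => n /=.
rewrite -nrm_conjX; congr nrm.
have := conjX_lin (-1) l (u n); rewrite !scaleN1r addrC => ->.
have -> : cj (-1) = -1 :> C by rewrite conjN (conjR 1).
by rewrite scaleN1r addrC.
Qed.

(** The multiplication formula for the truncations, in the limit. *)
Lemma FT_adjoint u v : ip (FT u) v = ip u (FTi v).
Proof.
rewrite -[u]L2class_repr -[v]L2class_repr.
have hu := L2reprP u; have hv := L2reprP v; set f := L2repr u; set g := L2repr v.
pose gj x := cj (g x).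
have hgj : is_L2 gj by exact: is_L2J.
have h1 := cvgX_ip (FT_cvg hu) (trunc_cvgX hv).
have hgc : cvgX (fun n => conjX (L2class (ft (trunc n gj)))) (FTi (L2class g)).
  by apply: cvgX_conjX; rewrite conjX_class//; exact: FT_cvg.
have h2 := cvgX_ip (trunc_cvgX hu) hgc.
apply: (normc_cvg_unique h1); apply: cvg_trans h2; apply: near_eq_cvg; apply: nearW => n.
congr (normc (_ - _)).
have i1 := cintegrable_trunc n hu; have i2 := cintegrable_trunc n hgj.
have l1 := is_L2_trunc n hu; have l2 := is_L2_trunc n hv.
have [l3 _] := plancherel_L1L2 i1 l1.
have [l4 _] := plancherel_L1L2 i2 (is_L2_trunc n hgj).
rewrite conjX_class// ip_class//; last exact: is_L2J.
rewrite ip_class//.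
have -> : (fun x => trunc n f x * cj (cj (ft (trunc n gj) x))) =
    (fun x => trunc n f x * ft (trunc n gj) x) by apply/funext => x; rewrite conjK.
rewrite -(ft_swap i1 i2); apply: eq_cint => x; congr (_ * _).
by rewrite /trunc /gj conjM /seg conjR.
Qed.

Lemma FTi_adjoint u v : ip (FTi u) v = ip u (FT v).
Proof. by rewrite ipC -FT_adjoint -ipC. Qed.

(** Polarization. *)
Lemma isometry_ip (T : X -> X) : lin T -> (forall u, nrm (T u) = nrm u) ->
  forall u v, ip (T u) (T v) = ip u v.
Proof.
move=> lT hT.
have re u v : complex.Re (ip (T u) (T v)) = complex.Re (ip u v).
  have := nrm_sqrD (T u) (T v); rewrite -(linD lT) !hT nrm_sqrD; lra.
move=> u v; apply: complex_ext; first exact: re.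
have im (a b : X) : complex.Im (ip a b) = - complex.Re (ip ('i *: a) b).
  by rewrite ipZl ReM /= mul0r mul1r sub0r opprK.
by rewrite !im -(linZ lT) re.
Qed.

Lemma ip_eq u v : (forall w, ip w u = ip w v) -> u = v.
Proof.
move=> h; apply/eqP; rewrite -subr_eq0; apply/eqP; apply: nrm_eq0.
have : ip (u - v) (u - v) = 0 by rewrite ipBr h subrr.
rewrite ip_nrm => /(@complexI R _ 0) /eqP; rewrite sqrf_eq0 => /eqP ->.
exact: lexx.
Qed.

(** A linear isometry is left inverted by its adjoint. In [FTiK] the same
    holds for the adjoint, which is an isometry as well; so the surjectivity
    of the transform needs no density argument. *)
Lemma FTK : cancel FT FTi.
Proof.
move=> v; apply: ip_eq => w; rewrite -FT_adjoint.
exact: isometry_ip FT_lin nrm_FT _ _.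
Qed.

Lemma FTiK : cancel FTi FT.
Proof.
move=> v; apply: ip_eq => w; rewrite -FTi_adjoint.
exact: isometry_ip FTi_lin nrm_FTi _ _.
Qed.

Lemma parseval u v : ip (FT u) (FT v) = ip u v.
Proof. exact: isometry_ip FT_lin nrm_FT _ _. Qed.

End FourierL2.

(** * Second differences and test functions *)

Section WeakDerivatives.
Context {R : realType}.
Local Notation mu := (@lebesgue_measure R).
Local Notation C := R[i].
Local Notation X := (L2space R).
Local Notation cint := (@cintegral R setT).
Implicit Types (f g u v : R -> C).

Lemma ae_forall_nat (P : nat -> R -> Prop) : (forall n, \forall x \ae mu, P n x) ->
  \forall x \ae mu, forall n, P n x.
Proof.
move=> h; have : mu.-negligible (\bigcup_n [set x | ~ P n x]).
  by apply: negligible_bigcup => n; exact: h.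
apply: negligibleS => x /= /existsNP[n nP]; by exists n.
Qed.

Lemma Rintegral_shift (f : R -> R) (h : R) : measurable_fun [set: R] f ->
  \int[mu]_x f (x + h) = \int[mu]_x f x.
Proof.
move=> mf; have mf' : measurable_fun [set: R] (EFin \o f) by exact/measurable_EFinP.
rewrite /Rintegral integralE [in RHS]integralE; congr (fine (_ - _)).
  have := @ge0_integral_shift R (EFin \o f)^\+%E h (measurable_funepos mf') (fun x => funepos_ge0 _ x).
  by move=> <-; apply: eq_integral => x _; rewrite !funeposE.
have := @ge0_integral_shift R (EFin \o f)^\-%E h (measurable_funeneg mf') (fun x => funeneg_ge0 _ x).
by move=> <-; apply: eq_integral => x _; rewrite !funenegE.
Qed.

Lemma cint_shift f (h : R) : cmeasurable f -> cint (fun x => f (x + h)) = cint f.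
Proof.
by move=> [m1 m2]; apply: complex_ext; rewrite /=;
  [rewrite -(Rintegral_shift h m1)|rewrite -(Rintegral_shift h m2)].
Qed.

Lemma cmeasurable_shift f (h : R) : cmeasurable f -> cmeasurable (fun x => f (x + h)).
Proof.
by move=> mf; apply: cmeasurable_comp => //; apply: measurable_funD => //; exact: measurable_cst.
Qed.

Lemma cintegrable_shift f (h : R) : cintegrable f -> cintegrable (fun x => f (x + h)).
Proof.
move=> /cintegrableP[mf lf]; apply/cintegrableP; split; first exact: cmeasurable_shift.
rewrite (@ge0_integral_shift R (fun x => (normc (f x))%:E) h)//.
  by apply/measurable_EFinP; exact: measurable_normc.
by move=> x; rewrite lee_fin normc_ge0.
Qed.

Lemma sqn_shift f (h : R) : cmeasurable f -> sqn (fun x => f (x + h)) = sqn f.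
Proof.
move=> mf; apply: (@ge0_integral_shift R (fun x => (normc (f x) ^+ 2)%:E) h).
  exact: measurable_normc2.
by move=> x; rewrite lee_fin sqr_ge0.
Qed.

Lemma is_L2_shift f (h : R) : is_L2 f -> is_L2 (fun x => f (x + h)).
Proof.
move=> /is_L2P[mf lf]; apply/is_L2P; split; first exact: cmeasurable_shift.
by rewrite sqn_shift.
Qed.

Lemma quadratic_is_derive (F : R -> R) (x d K : R) :
  (forall h, `|F (x + h) - F x - d * h| <= K * h ^+ 2) -> is_derive x (1 : R) F d.
Proof.
move=> hF; have K0 : 0 <= K by have := hF 1; rewrite expr1n !mulr1 => /(le_trans (normr_ge0 _)).
have lim : (fun h : R => h^-1 *: (F (h *: (1 : R) + x) - F x)) @ 0^' --> d.
  apply/subr_cvg0; apply/norm_cvg0P.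
  apply: (@squeeze_cvgr _ _ _ _ (fun _ => 0) (fun h => K * `|h|)).
  - near=> h; have h0 : h != 0 by near: h; exact: nbhs_dnbhs_neq.
    rewrite normr_ge0/= /GRing.scale/= mulr1 [h + x]addrC.
    have -> : h^-1 * (F (x + h) - F x) - d = h^-1 * (F (x + h) - F x - d * h) by field.
    rewrite normrM normfV ler_pdivrMl ?normr_gt0//.
    by apply: (le_trans (hF h)); rewrite -(real_normK (num_real h)) [X in _ <= X]mulrCA expr2.
  - exact: cvg_cst.
  - rewrite -[X in _ --> X](mulr0 K); apply: cvgM; first exact: cvg_cst.
    have hn : `|h| @[h --> (0 : R)] --> `|0 : R| by exact: norm_continuous.
    by rewrite normr0 in hn; apply: cvg_trans hn; apply: cvg_app; exact: cvg_within.
apply: DeriveDef; first by apply/cvg_ex; exists d.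
exact: (cvg_lim (@Rhausdorff R)) lim.
Unshelve. all: by end_near.
Qed.

Definition ramp (t : R) : R := Num.max 0 t.

Lemma ramp_sq_taylor (x h : R) : `|ramp (x + h) ^+ 2 - ramp x ^+ 2 - 2 * ramp x * h| <= h ^+ 2.
Proof.
rewrite /ramp ler_norml.
by case: (leP 0 x) => hx; case: (leP 0 (x + h)) => hh; apply/andP; split; nra.
Qed.

Lemma continuous_ramp : continuous ramp.
Proof.
have -> : ramp = (fun t => 2^-1 * (t + `|t|)).
  by apply/funext => t; rewrite /ramp; case: (leP 0 t) => ht; [rewrite ger0_norm//|rewrite ltr0_norm//]; lra.
move=> t; apply: cvgM; first exact: cvg_cst.
by apply: cvgD; [exact: cvg_id|exact: norm_continuous].
Qed.

(** Mixed second differences. Applied to [ramp] and to half of its square they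
    give the twofold and the threefold convolution of indicators of intervals,
    see [integral_box_box2] and [box_diff2_ramp]. *)
Definition diff2 (F : R -> R) (j k t : R) : R := F t - F (t - j) - F (t - k) + F (t - j - k).

Lemma diff2_ramp0 j k t : 0 <= j -> 0 <= k -> t <= 0 \/ j + k <= t -> diff2 ramp j k t = 0.
Proof.
move=> j0 k0; rewrite /diff2 /ramp.
by case: (leP 0 t) => h1; case: (leP 0 (t - j)) => h2; case: (leP 0 (t - k)) => h3;
  case: (leP 0 (t - j - k)) => h4 [] h; lra.
Qed.

Lemma diff2_ramp_sq0 j k t : 0 <= j -> 0 <= k -> t <= 0 -> diff2 (fun t => ramp t ^+ 2) j k t = 0.
Proof. by move=> j0 k0 t0; rewrite /diff2 /ramp !max_l ?expr0n/=; lra. Qed.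

Lemma diff2_ramp_sq_const j k t : 0 <= j -> 0 <= k -> j + k <= t ->
  diff2 (fun t => ramp t ^+ 2) j k t = 2 * j * k.
Proof.
move=> j0 k0 t0; rewrite /diff2 /ramp !max_r; last by lra.
- by ring.
- by lra.
- by lra.
- by lra.
Qed.

Lemma diff2_ramp_sq_derive j k a (x : R) :
  is_derive x (1 : R) (fun x => diff2 (fun t => ramp t ^+ 2) j k (x - a)) (2 * diff2 ramp j k (x - a)).
Proof.
apply: (@quadratic_is_derive _ _ _ 4) => h; rewrite /diff2 !(addrAC x h).
have := ramp_sq_taylor (x - a) h; have := ramp_sq_taylor (x - a - j) h.
have := ramp_sq_taylor (x - a - k) h; have := ramp_sq_taylor (x - a - j - k) h.
rewrite !(addrAC _ h) !ler_norml => /andP[? ?] /andP[? ?] /andP[? ?] /andP[? ?].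
by apply/andP; split; lra.
Qed.

Lemma continuous_diff2_ramp j k a : continuous (fun x => diff2 ramp j k (x - a)).
Proof.
have h c : continuous (fun x : R => ramp (x - c)).
  move=> x; apply: (@cvg_comp _ _ _ (fun x => x - c) ramp _ (nbhs (x - c))); last exact: continuous_ramp.
  by apply: cvgB; [exact: cvg_id|exact: cvg_cst].
have h2 c d : continuous (fun x : R => ramp (x - c - d)).
  rewrite (_ : (fun x => _) = (fun x => ramp (x - (c + d)))); first exact: h.
  by apply/funext => x; rewrite opprD addrA.
have h3 c d e : continuous (fun x : R => ramp (x - c - d - e)).
  rewrite (_ : (fun x => _) = (fun x => ramp (x - (c + d) - e))); first exact: h2.
  by apply/funext => x; rewrite opprD addrA.
move=> x; apply: cvgD; last exact: h3.
by apply: cvgB; [apply: cvgB; [exact: h|exact: h2]|exact: h2].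
Qed.

(** The threefold convolution of indicators of intervals of lengths [j], [k]
    and [h]: a test function of class C^1 whose integral against [f] is a
    threefold window integral of [f]. *)
Definition bump j k h a (x : R) : R :=
  2^-1 * (diff2 (fun t => ramp t ^+ 2) j k (x - a) - diff2 (fun t => ramp t ^+ 2) j k (x - (a + h))).

Lemma bump_derive j k h a (x : R) : is_derive x (1 : R) (bump j k h a)
  (diff2 ramp j k (x - a) - diff2 ramp j k (x - (a + h))).
Proof.
have d1 := diff2_ramp_sq_derive j k a x; have d2 := diff2_ramp_sq_derive j k (a + h) x.
apply: is_derive_eq; rewrite /GRing.scale /=; lra.
Qed.

Lemma bump_test j k h a : 0 < j -> 0 < k -> 0 < h -> test_function (bump j k h a) /\
  forall x, derive1 (bump j k h a) x = diff2 ramp j k (x - a) - diff2 ramp j k (x - (a + h)).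
Proof.
move=> j0 k0 h0.
have D x : derive1 (bump j k h a) x = diff2 ramp j k (x - a) - diff2 ramp j k (x - (a + h)).
  by rewrite derive1E; exact: (@derive_val _ _ _ _ _ _ _ (bump_derive j k h a x)).
split; last exact: D.
split.
- by move=> x; exact: (@ex_derive _ _ _ _ _ _ _ (bump_derive j k h a x)).
- rewrite (_ : derive1 _ = (fun x => diff2 ramp j k (x - a) - diff2 ramp j k (x - (a + h)))); last exact/funext.
  by move=> x; apply: cvgB; exact: continuous_diff2_ramp.
- exists (`|a| + j + k + h) => x hx; rewrite /bump.
  have [x0|x0] := leP 0 x.
    rewrite (ger0_norm x0) in hx; have := ler_norm a => ha.
    by rewrite !diff2_ramp_sq_const ?subrr ?mulr0//; lra.
  rewrite (ltr0_norm x0) in hx; have := ler_norm (- a); rewrite normrN => ha.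
  by rewrite !diff2_ramp_sq0 ?subrr ?mulr0//; lra.
Qed.

Lemma box_diff2_ramp (j k h a x : R) : 0 < j -> 0 < k -> 0 < h ->
  \int[mu]_z (box h (x - z) * diff2 ramp j k (z - a)) = bump j k h a x.
Proof.
move=> j0 k0 h0.
pose F z := 2^-1 * diff2 (fun t => ramp t ^+ 2) j k (z - a).
have dF (z : R) : is_derive z (1 : R) F (diff2 ramp j k (z - a)).
  have d1 := diff2_ramp_sq_derive j k a z.
  by apply: is_derive_eq; rewrite /GRing.scale /=; lra.
have cF : continuous F by apply: derivable_continuous => z; exact: (@ex_derive _ _ _ _ _ _ _ (dF z)).
have E : (\int[mu]_(z in `[(x - h)%R, x]) (diff2 ramp j k (z - a)%R)%:E = (F x)%:E - (F (x - h)%R)%:E)%E.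
  apply: continuous_FTC2.
  - by rewrite gtrBl.
  - apply: continuous_subspaceT; exact: continuous_diff2_ramp.
  - split.
    + by move=> z _; exact: (@ex_derive _ _ _ _ _ _ _ (dF z)).
    + exact: cvg_at_right_filter (cF _).
    + exact: cvg_at_left_filter (cF _).
  - by move=> z _; rewrite derive1E; exact: (@derive_val _ _ _ _ _ _ _ (dF z)).
rewrite /Rintegral; under eq_integral do rewrite boxE2.
rewrite -setint_indic E /= /F /bump -mulrBr; congr (_ * (_ - diff2 _ _ _ _)).
by rewrite opprD addrA addrAC.
Qed.

Lemma integral_box_box2 (j k a z : R) : 0 < j -> 0 < k ->
  \int[mu]_y (box j (y - a) * box k (z - y)) = diff2 ramp j k (z - a).
Proof.
move=> j0 k0; rewrite /Rintegral.
have E y : box j (y - a) * box k (z - y) = \1_(`[Num.max a (z - k), Num.min (a + j) z]) y.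
  rewrite (boxE j y a) (boxE2 k z y) !indicE -natrM mulnb; congr (_%:R); congr nat_of_bool.
  apply/andP/idP => [[/set_mem + /set_mem]|/set_mem].
    rewrite /= !in_itv/= => /andP[b c] /andP[d e]; apply/mem_set.
    by rewrite /= in_itv/= ge_max le_min b c d e.
  rewrite /= in_itv/= ge_max le_min => /andP[/andP[b c] /andP[d e]].
  by split; apply/mem_set; rewrite /= in_itv/= ?b ?c ?d ?e.
under eq_integral do rewrite E.
transitivity (Num.max 0 (Num.min (a + j) z - Num.max a (z - k))).
  have [hx|hx] := leP (Num.max a (z - k)) (Num.min (a + j) z).
    by rewrite (integral_indic_itv hx) [Num.max 0 _]max_r// subr_ge0.
  rewrite set_itv_ge ?bnd_simp -?ltNge//; under eq_integral do rewrite indic0.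
  by rewrite integral0 [Num.max 0 _]max_l//= subr_le0 ltW.
rewrite /diff2 /ramp.
case: (leP (a + j) z) => h1; case: (leP a (z - k)) => h2;
  do ?[case: (leP 0 _) => ?]; lra.
Qed.

End WeakDerivatives.

(** * Increments of weakly differentiable functions *)

Section WeakDerivativeWindows.
Context {R : realType}.
Local Notation mu := (@lebesgue_measure R).
Local Notation C := R[i].
Local Notation cint := (@cintegral R setT).
Implicit Types (f g u v : R -> C).

Lemma box_if (h t : R) : box h t = if 0 <= t <= h then 1 else 0.
Proof.
rewrite /box indicE; case: ifP => ht; first by rewrite mem_set//= in_itv.
by rewrite memNset//= in_itv/= ht.
Qed.

Lemma cintegrable_box1 (h z : R) : 0 <= h -> cintegrable (fun x => (box h (x - z))%:C : C).
Proof.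
move=> h0; have [b2 _] := is_L2_box z h0.
have := L2_mul_integrable b2 b2; congr cintegrable.
by apply/funext => x; rewrite -rmorphM box_idem.
Qed.

Lemma locint_cmeas f : locally_integrableC f -> cmeasurable f.
Proof. by move/locally_integrableCP => []. Qed.

Lemma locint_box f (h z : R) : locally_integrableC f -> cintegrable (fun x => (box h (x - z))%:C * f x).
Proof. by move/locally_integrableCP => [_]; exact. Qed.

Lemma locint_shift f (h : R) : locally_integrableC f -> locally_integrableC (fun x => f (x + h)).
Proof.
move=> lf; apply/locally_integrableCP; split; first exact: cmeasurable_shift (locint_cmeas lf).
move=> l z; have := cintegrable_shift h (locint_box l (z + h) lf); congr cintegrable.
by apply/funext => x; congr ((box _ _)%:C * _); ring.
Qed.

Lemma locintB f g : locally_integrableC f -> locally_integrableC g ->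
  locally_integrableC (fun x => f x - g x).
Proof.
move=> lf lg; apply/locally_integrableCP; split; first exact: cmeasurableB (locint_cmeas lf) (locint_cmeas lg).
move=> l z; have := cintegrableB (locint_box l z lf) (locint_box l z lg); congr cintegrable.
by apply/funext => x; rewrite mulrBr.
Qed.

(** For [z] in a bounded interval only the values of [f] on a bounded interval
    matter, which reduces statements on locally integrable functions to
    integrable ones. *)
Lemma window_local f (h l z c : R) : 0 <= h -> 0 <= z - c <= l ->
  window h f z = window h (fun x => (box (l + h) (x - c))%:C * f x) z.
Proof.
move=> h0 hz; apply: eq_cint => x; rewrite mulrA -rmorphM; congr (_%:C * _).
rewrite !box_if; case: ifP => hx; last by rewrite mul0r.
by rewrite (_ : 0 <= x - c <= l + h) ?mul1r//; lra.
Qed.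

Lemma locint_window f (h : R) : 0 <= h -> locally_integrableC f -> locally_integrableC (window h f).
Proof.
move=> h0 lf; apply/locally_integrableCP; split; first exact: cmeasurable_window (locint_cmeas lf).
move=> l c.
have hi := window_integrable h0 (locint_box (l + h) c lf).
have := cintegrable_window l c hi; congr cintegrable; apply/funext => z.
rewrite box_if; case: ifP => hz; last by rewrite !mul0r.
by rewrite (@window_local f h l z c).
Qed.

Lemma ramp_lipschitz (s t : R) : `|ramp s - ramp t| <= `|s - t|.
Proof.
rewrite /ramp; have := ler_norm (s - t); have := ler_norm (t - s); rewrite distrC => h1 h2.
rewrite ler_norml; case: (leP 0 s) => hs; case: (leP 0 t) => ht; apply/andP; split; lra.
Qed.

Lemma diff2_ramp_bound (j k t : R) : 0 <= j -> `|diff2 ramp j k t| <= j + j.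
Proof.
move=> j0; have := ramp_lipschitz t (t - j); have := ramp_lipschitz (t - k) (t - j - k).
have -> : t - (t - j) = j by ring.
have -> : t - k - (t - j - k) = j by ring.
rewrite (ger0_norm j0) /diff2 !ler_norml => /andP[? ?] /andP[? ?]; apply/andP; split; lra.
Qed.

Lemma measurable_diff2_ramp (j k a : R) : measurable_fun [set: R] (fun x => diff2 ramp j k (x - a)).
Proof. exact: continuous_measurable_fun (@continuous_diff2_ramp _ j k a). Qed.

Lemma diff2_ramp_box (j k a x : R) : 0 <= j -> 0 <= k ->
  diff2 ramp j k (x - a) = diff2 ramp j k (x - a) * box (j + k) (x - a).
Proof.
move=> j0 k0; rewrite box_if; case: ifP => hx; first by rewrite mulr1.
rewrite mulr0 diff2_ramp0//; have [h|h] := leP (x - a) 0; first by left.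
by right; move: hx; rewrite (ltW h)/= => /negbT; rewrite -ltNge => /ltW.
Qed.

Lemma locint_diff2 f (j k a : R) : 0 <= j -> 0 <= k -> locally_integrableC f ->
  cintegrable (fun x => (diff2 ramp j k (x - a))%:C * f x).
Proof.
move=> j0 k0 lf.
have := cintegrable_bound (M := j + j) (cmeasurable_real (measurable_diff2_ramp j k a)) (locint_box (j + k) a lf).
move=> /(_ _)/wrap[]; first by move=> x; rewrite normcR diff2_ramp_bound.
congr cintegrable; apply/funext => x.
by rewrite mulrA -rmorphM -diff2_ramp_box.
Qed.

Lemma cintegrable_diff2 (j k a : R) : 0 <= j -> 0 <= k ->
  cintegrable (fun x => (diff2 ramp j k (x - a))%:C : C).
Proof.
move=> j0 k0.
have := cintegrable_bound (M := j + j) (cmeasurable_real (measurable_diff2_ramp j k a))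
  (cintegrable_box1 a (addr_ge0 j0 k0)).
move=> /(_ _)/wrap[]; first by move=> x; rewrite normcR diff2_ramp_bound.
congr cintegrable; apply/funext => x.
by rewrite -rmorphM -diff2_ramp_box.
Qed.

Lemma window_window_diff2 f (j k a : R) : 0 < j -> 0 < k -> locally_integrableC f ->
  cint (fun z => (diff2 ramp j k (z - a))%:C * f z) = window j (window k f) a.
Proof.
move=> j0 k0 lf; have [j0' k0'] := (ltW j0, ltW k0).
pose g z := (box (j + k) (z - a))%:C * f z.
have ig : cintegrable g by exact: locint_box.
have [|_ _ E] := bounded_kernel_swap (M := 1) (cmeas2_box k) _ (cintegrable_box1 a j0') ig.
  by move=> x y; apply: normc_box.
transitivity (cint (fun y => (box j (y - a))%:C * cint (fun z => (box k (z - y))%:C * g z))); last first.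
  apply: eq_cint => y; rewrite box_if; case: ifP => hy; last by rewrite !mul0r.
  by congr (_ * _); rewrite (@window_local f k j y a).
apply: (etrans _ (esym E)); apply: eq_cint => z.
have -> : cint (fun y => (box k (z - y))%:C * (box j (y - a))%:C) = (diff2 ramp j k (z - a))%:C.
  rewrite -(integral_box_box2 a z j0 k0); apply: (etrans _ (cint_real _)); apply: eq_cint => y.
  by rewrite rmorphM mulrC.
rewrite /g mulrAC -rmorphM [box _ _ * _]mulrC -(diff2_ramp_box a z j0' k0'); reflexivity.
Qed.

Lemma bump0 (j k h a x : R) : 0 <= j -> 0 <= k -> 0 <= h -> x <= a \/ a + j + k + h <= x ->
  bump j k h a x = 0.
Proof.
move=> j0 k0 h0 [hx|hx]; rewrite /bump.
  by rewrite !diff2_ramp_sq0 ?subrr ?mulr0//; lra.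
by rewrite !diff2_ramp_sq_const ?subrr ?mulr0//; lra.
Qed.

Lemma bump_window f (j k h a : R) : 0 < j -> 0 < k -> 0 < h -> locally_integrableC f ->
  cint (fun x => f x * (bump j k h a x)%:C) = cint (fun z => (diff2 ramp j k (z - a))%:C * window h f z).
Proof.
move=> j0 k0 h0 lf; have [j0' k0'] := (ltW j0, ltW k0); have h0' := ltW h0.
pose g z := (box (j + k + h) (z - a))%:C * f z.
have ig : cintegrable g by exact: locint_box.
have [|_ _ E] := bounded_kernel_swap (M := 1) (cmeas2_box h) _ (cintegrable_diff2 a j0' k0') ig.
  by move=> x y; apply: normc_box.
transitivity (cint (fun z => (diff2 ramp j k (z - a))%:C * cint (fun x => (box h (x - z))%:C * g x))); last first.
  apply: eq_cint => z; rewrite (diff2_ramp_box a z j0' k0') box_if.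
  case: ifP => hz; last by rewrite mulr0 !mul0r.
  by congr (_ * _); rewrite (@window_local f h (j + k) z a).
apply: (etrans _ (esym E)); apply: eq_cint => x.
have -> : cint (fun z => (box h (x - z))%:C * (diff2 ramp j k (z - a))%:C) = (bump j k h a x)%:C.
  rewrite -(box_diff2_ramp a x j0 k0 h0); apply: (etrans _ (cint_real _)); apply: eq_cint => z.
  by rewrite rmorphM.
rewrite /g box_if; case: ifP => hx; first by rewrite mul1r.
rewrite bump0 ?mulr0 //; have [hx'|hx'] := leP x a; first by left.
by right; move: hx; rewrite subr_ge0 (ltW hx')/= => /negbT; rewrite -ltNge; lra.
Qed.

(** Lebesgue's differentiation theorem recovers a function from its windows. *)
Lemma window_zero f : locally_integrableC f ->
  (forall n, \forall z \ae mu, window (n.+1%:R^-1) f z = 0) -> \forall z \ae mu, f z = 0.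
Proof.
move=> lf h; have := window_differentiation lf; have := ae_forall_nat h.
apply: aeP2 => z hz hl.
have e : (fun n => normc ((n.+1%:R : R)%:C * window (n.+1%:R^-1) f z - f z)) = (fun _ => normc (f z)).
  by apply/funext => n; rewrite hz mulr0 sub0r normc_opp.
rewrite e in hl.
have h2 : (fun _ : nat => normc (f z)) @ \oo --> normc (f z) by exact: cvg_cst.
by apply: eq0_normc; rewrite (cvg_unique (@Rhausdorff R) h2 hl).
Qed.

(** Tested against [bump], whose derivative is a difference of two translates
    of the twofold convolution, the definition of the weak derivative says
    that all twofold windows of the difference [G] of both sides vanish.
    Differentiating twice gives [G = 0]. *)
Theorem weak_derivative_window u v (h : R) : is_weak_derivative u v -> 0 < h ->
  \forall z \ae mu, u (z + h) - u z = window h v z.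
Proof.
move=> [lu lv wd] h0.
pose G z := u (z + h) - u z - window h v z.
have lG : locally_integrableC G.
  by apply: locintB; [apply: locintB => //; exact: locint_shift|exact: locint_window (ltW h0) lv].
have H j k a : 0 < j -> 0 < k -> window j (window k G) a = 0.
  move=> j0 k0; have [j0' k0'] := (ltW j0, ltW k0); rewrite -window_window_diff2//.
  have [tb db] := bump_test a j0 k0 h0.
  have := wd _ tb; rewrite bump_window//.
  have i1 := locint_diff2 a j0' k0' lu; have i2 := locint_diff2 (a + h) j0' k0' lu.
  have i3 := locint_diff2 a j0' k0' (locint_shift h lu).
  have i4 := locint_diff2 a j0' k0' (locint_window (ltW h0) lv).
  have -> : cint (fun x => u x * (derive1 (bump j k h a) x)%:C) =
      cint (fun x => (diff2 ramp j k (x - a))%:C * u x) -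
      cint (fun x => (diff2 ramp j k (x - a))%:C * u (x + h)).
    rewrite -[X in _ = _ - X](cint_shift (- h)); last by case/cintegrableP: i3.
    have -> : (fun x => (diff2 ramp j k (x - h - a))%:C * u (x - h + h)) =
        (fun x => (diff2 ramp j k (x - (a + h)))%:C * u x).
      by apply/funext => x; congr ((diff2 _ _ _ _)%:C * u _); ring.
    rewrite -cintB//; apply: eq_cint => x.
    by rewrite db rmorphB mulrC mulrBl.
  move=> E.
  have -> : cint (fun z => (diff2 ramp j k (z - a))%:C * G z) =
     cint (fun z => (diff2 ramp j k (z - a))%:C * u (z + h)) -
     cint (fun z => (diff2 ramp j k (z - a))%:C * u z) -
     cint (fun z => (diff2 ramp j k (z - a))%:C * window h v z).
    rewrite -cintB// -cintB//; last exact: cintegrableB.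
    by apply: eq_cint => z; rewrite /G !mulrBr.
  by have E2 := congr1 -%R E; rewrite opprK opprB in E2; rewrite E2 subrr.
suff : \forall z \ae mu, G z = 0 by apply: aeP => z /eqP; rewrite subr_eq0 => /eqP.
have n0 (n : nat) : 0 < (n.+1%:R^-1 : R) by rewrite invr_gt0.
apply: (window_zero lG) => n; apply: window_zero; first exact: locint_window (ltW (n0 n)) lG.
by move=> m; apply: aeW => z; exact: H.
Qed.

(** The increments of [u] determine all windows of its weak derivative. *)
Theorem weak_derivative_unique u v1 v2 : is_weak_derivative u v1 -> is_weak_derivative u v2 ->
  \forall z \ae mu, v1 z = v2 z.
Proof.
move=> w1 w2; have [_ l1 _] := w1; have [_ l2 _] := w2.
have n0 (n : nat) : 0 < (n.+1%:R^-1 : R) by rewrite invr_gt0.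
suff : \forall z \ae mu, v1 z - v2 z = 0 by apply: aeP => z /eqP; rewrite subr_eq0 => /eqP.
apply: window_zero; first exact: locintB.
move=> n; apply: aeP2 (weak_derivative_window w1 (n0 n)) (weak_derivative_window w2 (n0 n)) => z e1 e2.
have -> : window (n.+1%:R^-1) (fun x => v1 x - v2 x) z = window (n.+1%:R^-1) v1 z - window (n.+1%:R^-1) v2 z.
  by rewrite /window -cintB; [apply: eq_cint => x; rewrite mulrBr|exact: locint_box|exact: locint_box].
by rewrite -e1 -e2 subrr.
Qed.

End WeakDerivativeWindows.

(** * Multipliers, translations and strong differentiation *)

Section Multipliers.
Context {R : realType}.
Local Notation mu := (@lebesgue_measure R).
Local Notation C := R[i].
Local Notation X := (L2space R).
Local Notation cint := (@cintegral R setT).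
Implicit Types (f g : R -> C) (u v w : X).

Definition bounded_symbol f := cmeasurable f /\ exists M : R, forall x, normc (f x) <= M.

Definition mult f u : X := L2class (fun x => f x * L2repr u x).

Lemma bounded_symbol_L2 m f : bounded_symbol m -> is_L2 f -> is_L2 (fun x => m x * f x).
Proof. by move=> [mm [M hM]] hf; exact: is_L2_bound hM. Qed.

Lemma mult_class m f : bounded_symbol m -> is_L2 f -> mult m (L2class f) = L2class (fun x => m x * f x).
Proof.
move=> bm hf; apply: L2class_ae; [exact: bounded_symbol_L2 (L2reprP _)|exact: bounded_symbol_L2|].
by have := L2classK hf; apply: aeP => x ->.
Qed.

Lemma mult_lin m : bounded_symbol m -> lin (mult m).
Proof.
move=> bm a u v; have hu := bounded_symbol_L2 bm (L2reprP u); have hv := bounded_symbol_L2 bm (L2reprP v).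
rewrite -L2class_lin//; apply: L2class_ae; [exact: bounded_symbol_L2 (L2reprP _)| |].
  by apply: is_L2D => //; exact: is_L2Z.
by have := L2repr_lin a u v; apply: aeP => x ->; rewrite mulrDr mulrCA.
Qed.

Lemma nrm_mult m u (M : R) : cmeasurable m -> (forall x, normc (m x) <= M) -> nrm (mult m u) <= M * nrm u.
Proof.
move=> mm hM; have M0 : 0 <= M by exact: le_trans (normc_ge0 _) (hM 0).
apply: nrm_class_le.
- by apply: bounded_symbol_L2 (L2reprP u); split=> //; exists M.
- by rewrite mulr_ge0 ?nrm_ge0.
- rewrite exprMn EFinM nrm_sqn.
  have -> : ((M ^+ 2)%:E * sqn (L2repr u) = sqn (fun x => (M%:C * L2repr u x)%R))%E.
    by rewrite sqnZ ?normcR ?ger0_norm//; exact: (L2reprP u).1.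
  apply: sqn_le.
  + exact: cmeasurableM mm (L2reprP u).1.
  + exact: cmeasurableM (cmeasurable_cst _) (L2reprP u).1.
  + by move=> x; rewrite !normcM normcR (ger0_norm M0) ler_wpM2r ?normc_ge0.
Qed.

Lemma mult_blin m : bounded_symbol m -> blin (mult m).
Proof.
move=> bm; split; first exact: mult_lin.
have [mm [M hM]] := bm; exists M => [|u]; first exact: le_trans (normc_ge0 _) (hM 0).
exact: nrm_mult.
Qed.

Lemma mult_comp m n u : bounded_symbol m -> bounded_symbol n ->
  mult m (mult n u) = mult (fun x => m x * n x) u.
Proof.
move=> bm bn; rewrite mult_class//; last exact: bounded_symbol_L2 (L2reprP u).
by congr L2class; apply/funext => x; rewrite mulrA.
Qed.

Lemma bounded_symbolM m n : bounded_symbol m -> bounded_symbol n -> bounded_symbol (fun x => m x * n x).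
Proof.
move=> [mm [M hM]] [mn [N hN]]; split; first exact: cmeasurableM.
exists (M * N) => x; rewrite normcM ler_pM ?normc_ge0//.
Qed.

Lemma bounded_symbol_cexpi (h : R) : bounded_symbol (fun xi => cexpi (h * xi)).
Proof. by split; [exact: cmeasurable_cexpi_lin|exists 1 => x; rewrite normc_cexpi]. Qed.

Definition shift (h : R) u : X := L2class (fun x => L2repr u (x + h)).

Lemma shift_class h f : is_L2 f -> shift h (L2class f) = L2class (fun x => f (x + h)).
Proof.
move=> hf; have hr := L2reprP (L2class f).
apply/eqP; rewrite -subr_eq0 /shift -L2classB; try exact: is_L2_shift.
apply/eqP; apply: nrm_eq0; apply: nrm_class_le => //.
  by apply: is_L2B; exact: is_L2_shift.
rewrite (@sqn_shift R (fun x => L2repr (L2class f) x - f x)); last exact: (is_L2B hr hf).1.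
by rewrite -nrm_class_sqn ?L2classB ?L2class_repr ?subrr ?nrm0//; exact: is_L2B.
Qed.

Lemma nrm_shift h u : nrm (shift h u) = nrm u.
Proof.
have hu := L2reprP u; apply/eqP; rewrite -(eqrXn2 (n := 2)) ?nrm_ge0//; apply/eqP.
apply: EFin_inj; rewrite nrm_class_sqn; last exact: is_L2_shift.
by rewrite nrm_sqn sqn_shift//; exact: hu.1.
Qed.

Lemma shift_lin h : lin (shift h).
Proof.
move=> a u v; have hu := L2reprP u; have hv := L2reprP v.
rewrite -[in LHS](L2class_repr u) -[in LHS](L2class_repr v) -L2class_lin// shift_class; last first.
  by apply: is_L2D => //; exact: is_L2Z.
by rewrite L2class_lin//; exact: is_L2_shift.
Qed.

Lemma shift_blin h : blin (shift h).
Proof. by split; [exact: shift_lin|exists 1 => // u; rewrite nrm_shift mul1r]. Qed.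

Lemma ft_shift f (h xi : R) : cintegrable f ->
  ft (fun x => f (x + h)) xi = cexpi (h * xi) * ft f xi.
Proof.
move=> hf; have hF := cintegrable_ftk xi hf.
rewrite /ft mulrCA; congr (_ * _).
apply: (etrans _ (cintZ (cexpi (h * xi)) hF)).
have hF' := cintegrableZ (cexpi (h * xi)) hF.
apply: (etrans _ (cint_shift h ((cintegrableP _).1 hF').1)).
apply: eq_cint => x; rewrite mulrA -cexpiD; congr (cexpi _ * _); ring.
Qed.

Lemma FT_shift h u : FT (shift h u) = mult (fun xi => cexpi (h * xi)) (FT u).
Proof.
rewrite -[u]L2class_repr; have hu := L2reprP u; set f := L2repr u.
have bm := bounded_symbol_cexpi h.
have c1 := cvgX_blin (blin_comp FT_blin (shift_blin h)) (trunc_cvgX hu).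
have c2 := cvgX_blin (mult_blin bm) (FT_cvg hu).
apply: cvgX_unique c1 _; apply: cvg_trans c2; apply: near_eq_cvg; apply: nearW => n.
have i1 := cintegrable_trunc n hu; have l1 := is_L2_trunc n hu.
have [l2 _] := plancherel_L1L2 i1 l1.
congr (nrm (_ - _)); rewrite /= shift_class// mult_class// FT_L1L2.
- by congr L2class; apply/funext => xi; rewrite ft_shift.
- exact: cintegrable_shift.
- exact: is_L2_shift.
Qed.

Lemma nrm_parallelogram u v : nrm (u + v) ^+ 2 + nrm (u - v) ^+ 2 = 2 * nrm u ^+ 2 + 2 * nrm v ^+ 2.
Proof.
have ipNr a b : ip a (- b) = - ip a b.
  by rewrite -[- b]add0r ipBr ipC ip0l conj0 sub0r.
by rewrite !nrm_sqrD nrmN ipNr ReN; ring.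
Qed.

(** A difference of arbitrarily small norm vanishes almost everywhere. *)
Lemma sqn_norm_eq0 u f : cmeasurable f -> (forall e : R, 0 < e -> (sqn (fun x => (L2repr u x - f x)%R) <= (e ^+ 2)%:E)%E) ->
  \forall x \ae mu, L2repr u x = f x.
Proof.
move=> mf h; pose g x := L2repr u x - f x.
have mg : cmeasurable g by apply: cmeasurableB => //; exact: (L2reprP u).1.
have hg : is_L2 g.
  by apply/is_L2P; split => //; apply: (le_lt_trans (h 1 ltr01)); rewrite ltry.
have g0 : nrm (L2class g) <= 0.
  by apply/ler_addgt0Pr => e e0; rewrite add0r; apply: nrm_class_le => //; [exact: ltW|exact: h].
have := nrm_eq0 g0; rewrite (_ : 0 = L2class (fun _ => 0)); last first.
  by apply/esym/nrm_eq0/nrm_class_le; [exact: is_L2_0|by []|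
    rewrite /sqn; under eq_integral do rewrite normc0 expr0n; rewrite integral0 lee_fin sqr_ge0].
move=> /(L2class_inj hg (@is_L2_0 R)); apply: aeP => x /eqP; rewrite subr_eq0 => /eqP; exact.
Qed.

Lemma cvgX_ae (h : nat -> R -> C) u f : (forall n, is_L2 (h n)) -> cmeasurable f ->
  cvgX (fun n => L2class (h n)) u ->
  (\forall x \ae mu, (fun n => normc (h n x - f x)) @ \oo --> (0 : R)) ->
  \forall x \ae mu, L2repr u x = f x.
Proof.
move=> hh mf /cvgXP hu hf; apply: sqn_norm_eq0 => // e e0.
have [N hN] := hu e e0; have hr := L2reprP u.
apply: (@sqn_fatou R (fun n x => L2repr u x - h (n + N)%N x)).
- by move=> n; exact: (is_L2B hr (hh _)).1.
- by apply: cmeasurableB => //; exact: hr.1.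
- apply: aeP hf => x hx.
  have e1 : (fun n => normc (L2repr u x - h (n + N)%N x - (L2repr u x - f x))) =
      (fun n => normc (h (n + N)%N x - f x)).
    by apply/funext => n; rewrite -normc_opp; congr normc; ring.
  by move: hx; rewrite -(cvg_shiftn N) e1; exact.
- move=> n; have hd := is_L2B hr (hh (n + N)%N).
  apply: (sqn_le_nrm hd); rewrite L2classB// L2class_repr nrmB; exact/hN/leq_addl.
Qed.

Definition mesh (n : nat) : R := n.+1%:R^-1.

Lemma mesh_gt0 n : 0 < mesh n. Proof. by rewrite invr_gt0. Qed.

Lemma mesh_le1 n : mesh n <= 1. Proof. by rewrite invf_le1 ?ltr0n// ler1n. Qed.

Lemma mesh_cvg : mesh @ \oo --> (0 : R). Proof. exact: cvg_harmonic. Qed.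

Definition average n f : R -> C := fun z => ((mesh n)^-1)%:C * window (mesh n) f z.

Lemma is_L2_average n f : is_L2 f -> is_L2 (average n f).
Proof. by move=> hf; apply: is_L2Z; apply: is_L2_window => //; exact/ltW/mesh_gt0. Qed.

Lemma nrm_average n f : is_L2 f -> nrm (L2class (average n f)) <= nrm (L2class f).
Proof.
move=> hf; have m0 := mesh_gt0 n; apply: nrm_class_le; [exact: is_L2_average|exact: nrm_ge0|].
rewrite nrm_class_sqn// sqnZ; last exact: (is_L2_window (ltW m0) hf).1.
apply: (le_trans (lee_wpmul2l _ (sqn_window (ltW m0) hf))); first by rewrite lee_fin sqr_ge0.
rewrite muleA -EFinM normcR ger0_norm ?invr_ge0 ?(ltW m0)// -exprMn mulVf ?gt_eqF//.
by rewrite expr1n mul1e.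
Qed.

Lemma average_ae f : locally_integrableC f ->
  \forall x \ae mu, (fun n => normc (average n f x - f x)) @ \oo --> (0 : R).
Proof.
move=> lf; have := window_differentiation lf; apply: aeP => x; rewrite /average /mesh.
by under [X in _ -> X @ _ --> _]eq_fun do rewrite invrK.
Qed.

(** The averages of [f] have at most the norm of [f] and converge to [f]
    almost everywhere, which in a Hilbert space forces convergence in norm: by
    the parallelogram identity a distance of at least [e] would bound the
    square norm of [average + f] by [4 |f|^2 - e^2], against Fatou's lemma. *)
Lemma average_cvgX f : is_L2 f -> cvgX (fun n => L2class (average n f)) (L2class f).
Proof.
move=> hf; set F := L2class f; apply/cvgXP => e e0; apply: contrapT => hN.
have hN' N : exists n, (N <= n)%N /\ e < nrm (L2class (average n f) - F).
  apply: contrapT => h; apply: hN; exists N => n Nn; rewrite leNgt; apply/negP => h'.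
  by apply: h; exists n.
have [phi hphi] := choice hN'.
have big k : nrm (L2class (average (phi k) f) + F) ^+ 2 <= 4 * nrm F ^+ 2 - e ^+ 2.
  have := nrm_parallelogram (L2class (average (phi k) f)) F.
  have h1 : nrm (L2class (average (phi k) f)) ^+ 2 <= nrm F ^+ 2.
    by rewrite lerXn2r ?nnegrE ?nrm_ge0 ?nrm_average.
  have h2 : e ^+ 2 <= nrm (L2class (average (phi k) f) - F) ^+ 2.
    by rewrite lerXn2r ?nnegrE ?nrm_ge0 ?(ltW e0)// ltW//; exact: (hphi k).2.
  by move=> E; lra.
have hs k : is_L2 (fun x => average (phi k) f x + f x) by apply: is_L2D => //; exact: is_L2_average.
have : (sqn (fun x => (f x + f x)%R) <= (4 * nrm F ^+ 2 - e ^+ 2)%:E)%E.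
  apply: (@sqn_fatou R (fun k x => average (phi k) f x + f x)).
  - by move=> k; exact: (hs k).1.
  - exact: (is_L2D hf hf).1.
  - apply: aeP (average_ae (is_L2_locally_integrable hf)) => x hx.
    have phioo : phi @ \oo --> \oo.
      by move=> A [N _ hA]; exists N => // k /= Nk; apply: hA; rewrite /= (leq_trans Nk)//; exact: (hphi k).1.
    have := cvg_comp _ _ phioo hx; apply: cvg_trans; apply: near_eq_cvg; apply: nearW => k /=.
    by rewrite opprD addrACA subrr addr0.
  - move=> k; rewrite -nrm_class_sqn// lee_fin L2classD//; exact: is_L2_average.
have -> : (fun x => f x + f x) = (fun x => (2 : R)%:C * f x).
  by apply/funext => x; apply: complex_ext; rewrite ?(ReD, ImD, ReM, ImM)/=; ring.
rewrite sqnZ; last exact: hf.1.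
rewrite -nrm_class_sqn// -EFinM lee_fin normcR ger0_norm//.
have : 0 < e ^+ 2 by rewrite exprn_gt0.
by rewrite -/F; lra.
Qed.

Lemma cexpi_quotient (xi : R) :
  (fun n => normc ((mesh n)^-1%:C * (cexpi (mesh n * xi) - 1) - 'i * xi%:C)) @ \oo --> (0 : R).
Proof.
have [->|x0] := eqVneq xi 0.
  rewrite (_ : (fun n => _) = fun _ => 0); first exact: cvg_cst.
  by apply/funext => n; rewrite mulr0 cexpi0 subrr !mulr0 subrr normc0.
have m0 n : mesh n != 0 by rewrite gt_eqF ?mesh_gt0.
apply: cvg_normc.
- rewrite (_ : (fun n => _) = fun n => - (xi ^+ 2 / 2) * (mesh n * sinc (mesh n * xi / 2) ^+ 2)); last first.
    apply/funext => n; rewrite sinc_fejer// /fejer ReM /= mul0r subr0; field.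
    by rewrite m0 x0.
  rewrite ReM /= mul0r mul1r subrr -[X in _ --> X](mulr0 (- (xi ^+ 2 / 2))).
  apply: cvgM; first exact: cvg_cst.
  apply: (@squeeze_cvgr _ _ _ _ (fun _ => 0) mesh); [|exact: cvg_cst|exact: mesh_cvg].
  apply: nearW => n; rewrite mulr_ge0 ?sqr_ge0 ?(ltW (mesh_gt0 n))//= ler_piMr ?(ltW (mesh_gt0 n))//.
  by rewrite -real_normK ?num_real// exprn_ile1 ?normr_ge0// sinc_le1.
- rewrite (_ : (fun n => _) = fun n => xi * sinc (mesh n * xi)); last first.
    apply/funext => n; rewrite /sinc ImM /= mul0r addr0 subr0; field.
    by rewrite m0 x0.
  rewrite ImM /= mul0r add0r mul1r -[X in _ --> X]mulr1.
  apply: cvgM; first exact: cvg_cst.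
  apply: cvg_sinc => [|n]; last by rewrite mulf_neq0.
  by rewrite -[X in _ --> X](mul0r xi); apply: cvgM; [exact: mesh_cvg|exact: cvg_cst].
Qed.

(** The averages of [g] are difference quotients of [f], with transforms
    [(cexpi (h xi) - 1) / h] times that of [f]. As [h] tends to 0 the factor
    tends to [i xi]. *)
Theorem FT_of_windows f g : is_L2 f -> is_L2 g ->
  (forall n, \forall z \ae mu, f (z + mesh n) - f z = window (mesh n) g z) ->
  \forall xi \ae mu, L2repr (FT (L2class g)) xi = 'i * xi%:C * L2repr (FT (L2class f)) xi.
Proof.
move=> hf hg hw; pose F := L2repr (FT (L2class f)).
have hF : is_L2 F by exact: L2reprP.
pose q n xi : C := (mesh n)^-1%:C * (cexpi (mesh n * xi) - 1).
have bq n : bounded_symbol (q n).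
  split.
    apply: cmeasurableM; first exact: cmeasurable_cst.
    by apply: cmeasurableB; [exact: cmeasurable_cexpi_lin|exact: cmeasurable_cst].
  exists (normc ((mesh n)^-1%:C) * 2) => xi; rewrite normcM ler_wpM2l ?normc_ge0//.
  by rewrite (le_trans (le_normcD _ _))// normc_opp normc_cexpi (normcR 1) normr1.
have c1 := cvgX_blin FT_blin (average_cvgX hg).
have E n : FT (L2class (average n g)) = L2class (fun xi => q n xi * F xi).
  have -> : L2class (average n g) = (mesh n)^-1%:C *: (shift (mesh n) (L2class f) - L2class f).
    rewrite shift_class// -L2classB//; last exact: is_L2_shift.
    rewrite -L2classZ; last by apply: is_L2B => //; exact: is_L2_shift.
    apply: L2class_ae; [exact: is_L2_average| |].
      by apply: is_L2Z; apply: is_L2B => //; exact: is_L2_shift.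
    by apply: aeP (hw n) => x ex; rewrite /average -ex.
  rewrite (linZ FT_lin) (linB FT_lin) FT_shift -[X in _ *: (_ - X)]L2class_repr.
  have bm := bounded_symbol_cexpi (mesh n).
  rewrite -L2classB//; last exact: bounded_symbol_L2.
  rewrite -L2classZ; last by apply: is_L2B => //; exact: bounded_symbol_L2.
  by congr L2class; apply/funext => xi; rewrite /q -mulrA mulrBl mul1r.
rewrite (_ : (fun n => FT _) = fun n => L2class (fun xi => q n xi * F xi)) in c1; last exact/funext.
apply: (cvgX_ae _ _ c1).
- by move=> n; exact: bounded_symbol_L2.
- apply: cmeasurableM hF.1; apply: cmeasurableM; first exact: cmeasurable_cst.
  by apply: cmeasurable_real; exact: measurable_id.
- apply: aeW => xi; have hq := cexpi_quotient xi.
  rewrite (_ : (fun n => _) = fun n => normc (q n xi - 'i * xi%:C) * normc (F xi)); last first.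
    by apply/funext => n; rewrite -normcM mulrBl.
  rewrite -[X in _ --> X](mul0r (normc (F xi))); apply: cvgM hq _; exact: cvg_cst.
Qed.

End Multipliers.

(** * Sobolev functions and the half-Laplacian on the Fourier side *)

Section SobolevFourier.
Context {R : realType}.
Local Notation mu := (@lebesgue_measure R).
Local Notation C := R[i].
Local Notation X := (L2space R).
Local Notation cint := (@cintegral R setT).
Implicit Types (f g u v : R -> C) (phi : R -> R).

Lemma compact_support_L2 (psi : R -> R) : continuous psi ->
  (exists M : R, forall x, M < `|x| -> psi x = 0) -> is_L2 (fun x => (psi x)%:C : C).
Proof.
move=> cpsi [M hM]; pose N := Num.max M 0.
have N0 : 0 <= N by rewrite le_max lexx orbT.
have NN : - N <= N by lra.
have cn : continuous (fun x => `|psi x|).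
  by move=> x; apply: (@cvg_comp _ _ _ psi Num.norm); [exact: cpsi|exact: norm_continuous].
have [c _ hc] := EVT_max NN (@continuous_subspaceT _ _ _ _ cn).
have [b2 _] := is_L2_box (- N) (addr_ge0 N0 N0).
apply: (is_L2_le _ (is_L2Z (`|psi c|)%:C b2)).
  by apply: cmeasurable_real; exact: continuous_measurable_fun.
move=> x; rewrite normcM !normcR normr_id box_if opprK.
have [hx|hx] := leP `|x| N.
  move: (hx); rewrite ler_norml => /andP[h1 h2].
  rewrite (_ : 0 <= x + N <= N + N); last by lra.
  by rewrite normr1 mulr1 hc// in_itv/= h1.
rewrite hM ?normr0 ?mulr_ge0//; apply: le_lt_trans hx.
by rewrite le_max lexx.
Qed.

Lemma test_function_L2 phi : test_function phi ->
  is_L2 (fun x => (phi x)%:C : C) /\ is_L2 (fun x => (derive1 phi x)%:C : C).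
Proof.
move=> [dphi cphi [M hM]]; split; apply: compact_support_L2.
- exact (derivable_continuous dphi).
- by exists M.
- exact: cphi.
- exists M => x hx; rewrite derive1E.
  transitivity ('D_1 (cst 0 : R -> R) x); last by rewrite derive_cst.
  apply: near_eq_derive.
  have op : open [set y : R | M < `|y|].
    rewrite (_ : [set _ | _] = Num.norm @^-1` [set z | M < z])//.
    by apply: open_comp; [move=> y _; exact: norm_continuous|exact: open_gt].
  by apply: filterS (open_nbhs_nbhs (conj op hx)) => y /= hy; rewrite hM.
Qed.

Lemma test_function_window phi (h z : R) : test_function phi -> 0 < h ->
  (phi (z + h))%:C - (phi z)%:C = window h (fun x => (derive1 phi x)%:C) z.
Proof.
move=> [dphi cphi _] h0.
have cF := derivable_continuous dphi.
have E : (\int[mu]_(x in `[z, (z + h)%R]) (derive1 phi x)%:E = (phi (z + h)%R)%:E - (phi z)%:E)%E.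
  apply: continuous_FTC2.
  - by rewrite ltrDl.
  - exact: continuous_subspaceT cphi.
  - split.
    + by move=> x _; exact: dphi.
    + exact: cvg_at_right_filter (cF _).
    + exact: cvg_at_left_filter (cF _).
  - by [].
rewrite -rmorphB; apply: etrans (esym (etrans _ (cint_real _))).
2: { apply: eq_cint => x; exact: esym (rmorphM _ _ _). }
congr (_%:C); rewrite /Rintegral.
have -> : (\int[mu]_x (box h (x - z) * derive1 phi x)%:E = (phi (z + h)%R)%:E - (phi z)%:E)%E.
  by apply: (etrans _ E); rewrite [RHS]setint_indic; apply: eq_integral => x _; rewrite boxE.
by [].
Qed.

Lemma weak_derivative_spec u v : is_weak_derivative u v -> is_weak_derivative u (weak_derivative u).
Proof. by move=> h; rewrite /weak_derivative; apply: (@xgetPex _ _ [set v | is_weak_derivative u v]); exists v. Qed.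

Lemma weak_derivative_ae u u' v : is_weak_derivative u v -> locally_integrableC u' ->
  (\forall x \ae mu, u x = u' x) -> is_weak_derivative u' v.
Proof.
move=> [lu lv h] lu' uu'; split=> // phi tphi; rewrite -h//.
have md : cmeasurable (fun x => (derive1 phi x)%:C : C) by exact: (test_function_L2 tphi).2.1.
apply: cint_ae; [exact: cmeasurableM (locint_cmeas lu') md|exact: cmeasurableM (locint_cmeas lu) md|].
by apply: aeP uu' => x ->.
Qed.

(** A representative of the transform that inherits the properties of [FT]; it
    agrees with [fourier] almost everywhere. *)
Definition hat f : R -> C := L2repr (FT (L2class f)).

Lemma is_L2_hat f : is_L2 (hat f). Proof. exact: L2reprP. Qed.

Lemma hat_fourier f : is_L2 f -> \forall xi \ae mu, hat f xi = fourier f xi.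
Proof. by move=> hf; rewrite /hat FT_class//; exact: L2classK (is_L2_fourier hf). Qed.

Lemma cmeasurable_mulI : cmeasurable (fun xi : R => 'i * xi%:C : C).
Proof.
apply: cmeasurableM; first exact: cmeasurable_cst.
by apply: cmeasurable_real; exact: measurable_id.
Qed.

(** A weak derivative has the increments required by [FT_of_windows].
    Conversely, test functions and their derivatives are square integrable,
    and Parseval's identity reduces the integration by parts to the fact that
    [i xi] is conjugate to its opposite. *)
Theorem weak_derivative_hatP f g : is_L2 f -> is_L2 g -> is_weak_derivative f g <->
  \forall xi \ae mu, hat g xi = 'i * xi%:C * hat f xi.
Proof.
move=> hf hg; split=> [w|E].
  by apply: FT_of_windows => // n; exact: weak_derivative_window w (mesh_gt0 n).
split; [exact: is_L2_locally_integrable|exact: is_L2_locally_integrable|].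
move=> phi tphi; have [p2 d2] := test_function_L2 tphi.
set p : R -> C := fun x => (phi x)%:C; set d : R -> C := fun x => (derive1 phi x)%:C.
have Ep : \forall xi \ae mu, hat d xi = 'i * xi%:C * hat p xi.
  by apply: FT_of_windows => // n; apply: aeW => z; exact: test_function_window (mesh_gt0 n).
transitivity (ip (L2class f) (L2class d)).
  by rewrite ip_class//; apply: eq_cint => x; rewrite /d conjR.
rewrite -parseval.
transitivity (- ip (FT (L2class g)) (FT (L2class p))); last first.
  by rewrite parseval ip_class//; congr (- _); apply: eq_cint => x; rewrite /p conjR.
have ig : cintegrable (fun x => hat g x * cj (hat p x)).
  by apply: ip_integrable; exact: is_L2_hat.
apply: (etrans _ (cintN ig)); apply: cint_ae.
- by apply: cmeasurableM; [exact: (is_L2_hat f).1|apply: cmeasurableJ; exact: (is_L2_hat d).1].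
- by apply: cmeasurableN; case/cintegrableP: ig.
- have ji : cj 'i = - 'i :> C by apply: complex_ext; rewrite ?ReJ ?ImJ/= ?oppr0.
  apply: aeP2 E Ep => xi e1 e2.
  apply: (etrans (congr1 (fun z => hat f xi * cj z) e2)).
  apply: (etrans _ (congr1 (fun z => - (z * cj (hat p xi))) (esym e1))).
  move: (hat f xi) (hat p xi) => a b.
  by rewrite !conjM conjR ji; ring.
Qed.

Definition invhat f : R -> C := L2repr (FTi (L2class f)).

Lemma is_L2_invhat f : is_L2 (invhat f). Proof. exact: L2reprP. Qed.

Lemma hat_invhat f : is_L2 f -> \forall xi \ae mu, hat (invhat f) xi = f xi.
Proof. by move=> hf; rewrite /hat /invhat L2class_repr FTiK; exact: L2classK. Qed.

Lemma cmeasurable_power n : cmeasurable (fun xi : R => (xi ^+ n)%:C : C).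
Proof. by apply: cmeasurable_real; exact: measurable_funX. Qed.

Lemma weight_L2 (m : R -> C) f : cmeasurable m -> (forall xi : R, normc (m xi) <= 1 + xi ^+ 2) ->
  is_L2 f -> is_L2 (fun xi : R => (xi ^+ 2)%:C * f xi) -> is_L2 (fun xi => m xi * f xi).
Proof.
move=> mm hm hf h2.
apply: (@is_L2_le _ _ (fun xi => (1 + xi ^+ 2)%:C * f xi)).
- exact: cmeasurableM mm hf.1.
- have := is_L2D hf h2; congr is_L2; apply/funext => xi.
  by rewrite rmorphD mulrDl mul1r.
- by move=> xi; rewrite !normcM normcR ler_wpM2r ?normc_ge0// (le_trans (hm xi))// ler_norm.
Qed.

Lemma normc_i : normc ('i : C) = 1.
Proof. by rewrite /= expr0n expr1n add0r sqrtr1. Qed.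

Lemma mulI_twice (xi : R) (z : C) : 'i * xi%:C * ('i * xi%:C * z) = - ((xi ^+ 2)%:C * z).
Proof.
have i2 : 'i * 'i = -1 :> C by apply: complex_ext; rewrite ?ReM ?ImM/=; ring.
rewrite mulrA [_ * _ * ('i * _)]mulrACA i2 mulN1r -rmorphM -expr2; exact: mulNr.
Qed.

(** The weight [|xi|] of the first derivative is dominated by [1 + xi^2]. *)
Theorem sobolev2P f : is_L2 f -> sobolev 2 f <-> is_L2 (fun xi : R => (xi ^+ 2)%:C * hat f xi).
Proof.
move=> hf; split=> [[_ [v wv [hv [w ww [hw _]]]]]|h2].
  have Ev := (weak_derivative_hatP hf hv).1 wv; have Ew := (weak_derivative_hatP hv hw).1 ww.
  apply: (is_L2_ae _ _ (is_L2N (is_L2_hat w))).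
    by apply: cmeasurableM; [exact: cmeasurable_power|exact: (is_L2_hat f).1].
  by apply: aeP2 Ev Ew => xi ev ->; rewrite ev mulI_twice opprK.
have h1 : is_L2 (fun xi : R => 'i * xi%:C * hat f xi).
  apply: weight_L2 h2; [exact: cmeasurable_mulI| |exact: is_L2_hat].
  move=> xi; rewrite normcM normc_i normcR mul1r.
  have := sqr_ge0 (`|xi| - 1); rewrite sqrrB1 real_normK ?num_real//.
  have := normr_ge0 xi; lra.
pose v := invhat (fun xi => 'i * xi%:C * hat f xi).
pose w := invhat (fun xi => - ((xi ^+ 2)%:C * hat f xi)).
have hv : is_L2 v by exact: is_L2_invhat.
have hw : is_L2 w by exact: is_L2_invhat.
have Ev : \forall xi \ae mu, hat v xi = 'i * xi%:C * hat f xi := hat_invhat h1.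
have Ew : \forall xi \ae mu, hat w xi = - ((xi ^+ 2)%:C * hat f xi) := hat_invhat (is_L2N h2).
clearbody v w.
split=> //; exists v.
  by apply/(weak_derivative_hatP hf hv).
split=> //; exists w => //.
apply/(weak_derivative_hatP hv hw).
by apply: aeP2 Ev Ew => xi -> ->; rewrite mulI_twice.
Qed.

(** The chosen weak derivatives are compared with those given by [sobolev], by
    uniqueness. *)
Lemma second_derivative f : sobolev 2 f ->
  let w := weak_derivative (weak_derivative f) in
  is_L2 w /\ \forall xi \ae mu, hat w xi = - ((xi ^+ 2)%:C * hat f xi).
Proof.
move=> [hf [v wv [hv [w ww [hw _]]]]] /=.
have wv' := weak_derivative_spec wv.
have vv' := weak_derivative_unique wv wv'.
have lv' : locally_integrableC (weak_derivative f) by case: wv'.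
have ww1 := weak_derivative_ae ww lv' vv'.
have ww2 := weak_derivative_spec ww1.
have E := weak_derivative_unique ww1 ww2.
have hw' : is_L2 (weak_derivative (weak_derivative f)).
  by apply: (is_L2_ae _ E hw); case: ww2 => _ l _; exact: locint_cmeas.
split=> //.
have hE : hat (weak_derivative (weak_derivative f)) = hat w.
  by congr (L2repr (FT _)); apply: L2class_ae => //; apply: aeP E => x ->.
rewrite hE.
have Ev := (weak_derivative_hatP hf hv).1 wv; have Ew := (weak_derivative_hatP hv hw).1 ww.
by apply: aeP2 Ev Ew => xi ev ->; rewrite ev mulI_twice.
Qed.

(** Also when the half-Laplacian does not exist, because the default value is
    0. *)
Lemma half_laplacian_L2 f : is_L2 (half_laplacian f).
Proof.
rewrite /half_laplacian; case: xgetP => [v _ [] //|_].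
exact: is_L2_0.
Qed.

Lemma cmeasurable_abs : cmeasurable (fun xi : R => `|xi|%:C : C).
Proof. by apply: cmeasurable_real; exact: continuous_measurable_fun (@norm_continuous _ _). Qed.

Lemma half_laplacian_hat f : is_L2 f -> is_L2 (fun xi => `|xi|%:C * hat f xi) ->
  FT (L2class (half_laplacian f)) = L2class (fun xi => `|xi|%:C * hat f xi).
Proof.
move=> hf h1; have E := hat_fourier hf.
have h1' : is_L2 (fun xi => `|xi|%:C * fourier f xi).
  apply: (is_L2_ae _ _ h1); first by apply: cmeasurableM; [exact: cmeasurable_abs|exact: (is_L2_fourier hf).1].
  by apply: aeP E => xi ->.
have : is_fourier (half_laplacian f) (fun xi => `|xi|%:C * fourier f xi).
  rewrite /half_laplacian; apply: (@xgetPex _ _ [set v | is_fourier v (fun xi => `|xi|%:C * fourier f xi)]).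
  exists (invhat (fun xi => `|xi|%:C * fourier f xi)); apply/is_fourierE; split => //.
    exact: is_L2_invhat.
  by rewrite /invhat L2class_repr FTiK.
move=> /is_fourierE[_ _ ->]; apply: L2class_ae => //.
by apply: aeP E => xi ->.
Qed.

End SobolevFourier.

(** * Hilbert-Schmidt operators *)

Section MultiplierCompactness.
Context {R : realType}.
Local Notation mu := (@lebesgue_measure R).
Local Notation C := R[i].
Local Notation X := (L2space R).
Local Notation cint := (@cintegral R setT).
Implicit Types (f g a m : R -> C) (u v w : X).

Definition ift f : R -> C := fun x => c0 * cint (fun xi => cexpi (x * xi) * f xi).

Lemma iftE f x : cintegrable f -> ift f x = cj (ft (fun xi => cj (f xi)) x).
Proof.
move=> hf; rewrite /ift /ft conjM conjR; congr (_ * _).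
apply: (etrans _ (cintJ (cintegrable_ftk x (cintegrableJ hf)))); apply: eq_cint => xi.
by rewrite conjM conjK cj_cexpi opprK mulrC [xi * x]mulrC mulrC.
Qed.

Lemma is_L2_ift f : cintegrable f -> is_L2 f -> is_L2 (ift f).
Proof.
move=> hf h2; have := is_L2J (plancherel_L1L2 (cintegrableJ hf) (is_L2J h2)).1.
by congr is_L2; apply/funext => x; rewrite iftE.
Qed.

Lemma FTi_L1L2 f : cintegrable f -> is_L2 f -> FTi (L2class f) = L2class (ift f).
Proof.
move=> hf h2; rewrite /FTi conjX_class// FT_L1L2; [|exact: cintegrableJ|exact: is_L2J].
rewrite conjX_class; last by apply: (plancherel_L1L2 (cintegrableJ hf) (is_L2J h2)).1.
by congr L2class; apply/funext => x; rewrite iftE.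
Qed.

Lemma normc_cexpiB (s t : R) : normc (cexpi s - cexpi t) <= 2 * `|s - t|.
Proof.
apply: le_trans (normc_ReIm _) _; rewrite ReD ImD ReN ImN /= mulr_natl mulr2n.
by rewrite lerD ?cos_lipschitz ?sin_lipschitz.
Qed.

(** The Cauchy-Schwarz inequality with a factor [k] that is bounded by [M]
    where [f] does not vanish, as for differences of exponentials against
    truncated functions. *)
Lemma cint_weighted_bound (k f g : R -> C) (M : R) : cmeasurable k -> is_L2 f -> is_L2 g -> 0 <= M ->
  (forall x, normc (k x * f x) <= M * normc (f x)) ->
  cintegrable (fun x => k x * (f x * g x)) /\
  normc (cint (fun x => k x * (f x * g x))) <= M * nrm (L2class f) * nrm (L2class g).
Proof.
move=> mk hf hg M0 hk.
have hM : is_L2 (fun x => M%:C * f x) by exact: is_L2Z.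
have hkf : is_L2 (fun x => k x * f x).
  apply: is_L2_le hM _; first exact: cmeasurableM mk hf.1.
  by move=> x; rewrite [X in _ <= X]normcM normcR (ger0_norm M0).
have e : (fun x => k x * (f x * g x)) = (fun x => k x * f x * g x).
  by apply/funext => x; rewrite mulrA.
split; first by rewrite e; exact: L2_mul_integrable.
have -> : cint (fun x => k x * (f x * g x)) = ip (L2class (fun x => k x * f x)) (L2class (fun x => cj (g x))).
  by rewrite ip_class//; [apply: eq_cint => x; rewrite conjK mulrA|exact: is_L2J].
apply: (le_trans (cauchy_schwarz _ _)); rewrite -conjX_class// nrm_conjX ler_wpM2r ?nrm_ge0//.
rewrite -(ger0_norm M0) -normcR -nrmZ -L2classZ//.
apply: nrm_class_le => //; first exact: nrm_ge0.
rewrite nrm_class_sqn//; apply: sqn_le; [exact: hkf.1|exact: hM.1|].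
by move=> x; rewrite [X in _ <= X]normcM normcR (ger0_norm M0).
Qed.

(** The multiplication by [a] after the Fourier multiplier with symbol [m],
    both square integrable. The inverse Fourier integral is defined at each
    point, which makes the values at points available. *)
Definition window_op a m w : X := L2class (fun x => a x * ift (fun xi => m xi * L2repr w xi) x).

(** For square integrable [m] the values at points are bounded functionals of
    [w]. *)
Lemma ift_bound m w x : is_L2 m -> normc (ift (fun xi => m xi * L2repr w xi) x) <=
  normc (c0 : C) * nrm (L2class m) * nrm w.
Proof.
move=> hm; rewrite normcM -mulrA ler_wpM2l ?normc_ge0//.
have [|_] := cint_weighted_bound (cmeasurable_cexpi_lin x) hm (L2reprP w) ler01.
  by move=> xi; rewrite normcM normc_cexpi.
by rewrite mul1r L2class_repr.
Qed.

Lemma cmeasurable_ift f : cmeasurable f -> cmeasurable (ift f).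
Proof.
move=> mf; apply: cmeasurableM; first exact: cmeasurable_cst.
apply: (measurable_param_int (F := fun xi x => cexpi (x * xi) * f xi)).
apply: cmeas2M; last exact: cmeas2_1.
apply: (cmeas2_comp (f := @cexpi R) (h := fun x y => y * x)); first exact: measurable_cexpi.
by apply: measurable_funM.
Qed.

Lemma window_op_L2 a m w : is_L2 a -> is_L2 m ->
  is_L2 (fun x => a x * ift (fun xi => m xi * L2repr w xi) x).
Proof.
move=> ha hm; have := is_L2_bound (cmeasurable_ift (cmeasurableM hm.1 (L2reprP w).1)) ha
  (fun x => ift_bound w x hm).
by congr is_L2; apply/funext => x; rewrite mulrC.
Qed.

Lemma nrm_window_op a m w : is_L2 a -> is_L2 m ->
  nrm (window_op a m w) <= normc (c0 : C) * nrm (L2class m) * nrm (L2class a) * nrm w.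
Proof.
move=> ha hm; have hw := window_op_L2 w ha hm; set K : R := normc (c0 : C) * nrm (L2class m) * nrm w.
have K0 : 0 <= K by rewrite !mulr_ge0 ?normc_ge0 ?nrm_ge0.
have -> : normc (c0 : C) * nrm (L2class m) * nrm (L2class a) * nrm w = nrm (L2class (fun x => K%:C * a x)).
  by rewrite L2classZ// nrmZ normcR (ger0_norm K0) /K mulrAC.
have hK : is_L2 (fun x => K%:C * a x) by exact: is_L2Z.
apply: nrm_class_le => //; first exact: nrm_ge0.
rewrite nrm_class_sqn//; apply: sqn_le; [exact: hw.1|exact: hK.1|] => x.
rewrite normcM [X in _ <= X]normcM normcR (ger0_norm K0) mulrC ler_wpM2r ?normc_ge0//.
exact: ift_bound.
Qed.

Lemma ift_lin (c : C) f g x : cintegrable f -> cintegrable g ->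
  ift (fun xi => c * f xi + g xi) x = c * ift f x + ift g x.
Proof.
move=> hf hg; rewrite !iftE//; last by apply: cintegrableD => //; exact: cintegrableZ.
have -> : (fun xi => cj (c * f xi + g xi)) = (fun xi => cj c * cj (f xi) + cj (g xi)).
  by apply/funext => xi; rewrite conjD conjM.
by rewrite (ft_lin (cj c) x (cintegrableJ hf) (cintegrableJ hg)) conjD conjM conjK.
Qed.

Lemma ift_ae f g x : cmeasurable f -> cmeasurable g -> (\forall xi \ae mu, f xi = g xi) -> ift f x = ift g x.
Proof.
move=> mf mg fg; congr (_ * _); apply: cint_ae.
- exact: cmeasurableM (cmeasurable_cexpi_lin x) mf.
- exact: cmeasurableM (cmeasurable_cexpi_lin x) mg.
- by apply: aeP fg => xi ->.
Qed.

Lemma ift_bfun m x : is_L2 m -> bfun (fun w => ift (fun xi => m xi * L2repr w xi) x).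
Proof.
move=> hm; split=> [c u v|]; last first.
  exists (normc (c0 : C) * nrm (L2class m)); first by rewrite mulr_ge0 ?normc_ge0 ?nrm_ge0.
  by move=> w; exact: ift_bound.
have hu := L2reprP u; have hv := L2reprP v.
have iu := L2_mul_integrable hm hu; have iv := L2_mul_integrable hm hv.
apply: (etrans _ (ift_lin c x iu iv)); apply: ift_ae.
- exact: cmeasurableM hm.1 (L2reprP _).1.
- apply: cmeasurableD; last exact: cmeasurableM hm.1 hv.1.
  exact: cmeasurableM (cmeasurable_cst c) (cmeasurableM hm.1 hu.1).
- by have := L2repr_lin c u v; apply: aeP => xi ->; rewrite mulrDr mulrCA.
Qed.

Lemma window_op_lin a m : is_L2 a -> is_L2 m -> lin (window_op a m).
Proof.
move=> ha hm c u v.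
rewrite /window_op -(L2class_lin c (window_op_L2 u ha hm) (window_op_L2 v ha hm)).
congr L2class; apply/funext => x.
by rewrite (ift_bfun x hm).1 mulrDr mulrCA.
Qed.

Lemma window_opB_l a a' m w : is_L2 a -> is_L2 a' -> is_L2 m ->
  window_op a m w - window_op a' m w = window_op (fun x => a x - a' x) m w.
Proof.
move=> ha ha' hm; rewrite -L2classB; [|exact: window_op_L2|exact: window_op_L2].
by congr L2class; apply/funext => x; rewrite mulrBl.
Qed.

Lemma window_opB_r a m m' w : is_L2 a -> is_L2 m -> is_L2 m' ->
  window_op a m w - window_op a m' w = window_op a (fun x => m x - m' x) w.
Proof.
move=> ha hm hm'; have hw := L2reprP w; rewrite -L2classB; [|exact: window_op_L2|exact: window_op_L2].
congr L2class; apply/funext => x; rewrite -mulrBr; congr (_ * _).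
have := ift_lin (-1) x (L2_mul_integrable hm' hw) (L2_mul_integrable hm hw).
rewrite mulN1r addrC => <-; congr (ift _ x); apply/funext => xi.
by rewrite mulN1r mulrBl addrC.
Qed.

Lemma L2class_sum n (F : 'I_n -> R -> C) : (forall i, is_L2 (F i)) ->
  is_L2 (fun x => \sum_i F i x) /\ L2class (fun x => \sum_i F i x) = \sum_i L2class (F i).
Proof.
elim: n F => [|n IH] F hF.
  have -> : (fun x => \sum_(i < 0) F i x) = (fun _ => 0) by apply/funext => x; rewrite big_ord0.
  split; first exact: is_L2_0.
  rewrite big_ord0; have h0 := @is_L2_0 R.
  apply: (etrans _ (etrans (L2classB h0 h0) (subrr _))).
  by congr L2class; apply/funext => x; rewrite subrr.
have [h1 h2] := IH (fun i => F (lift ord0 i)) (fun i => hF _).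
have -> : (fun x => \sum_i F i x) = (fun x => F ord0 x + \sum_i F (lift ord0 i) x).
  by apply/funext => x; rewrite big_ord_recl.
by split; [exact: is_L2D|rewrite L2classD// h2 big_ord_recl].
Qed.

(** The indicator of the cell number [j] of the subdivision of [- N, N] with
    step [1 / M]. *)
Definition cell (N M j : nat) (x : R) : R := \1_`[(j%:R : R), j.+1%:R[ ((x + N%:R) * M%:R).

Lemma measurable_cell N M j : measurable_fun [set: R] (cell N M j).
Proof.
have mi : measurable_fun [set: R] (\1_`[(j%:R : R), j.+1%:R[ : R -> R) by exact: measurable_indic.
apply: (measurableT_comp mi).
by apply: measurable_funM => //; apply: measurable_funD => //; exact: measurable_cst.
Qed.

Lemma sum_cell (N M K : nat) (x : R) (F : nat -> C) : 0 <= (x + N%:R) * M%:R < K%:R ->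
  \sum_(j < K) (cell N M j x)%:C * F j = F (Num.truncn ((x + N%:R) * M%:R)).
Proof.
set y := _ * _ => /andP[y0 yK].
have cellE j : cell N M j x = (j == Num.truncn y)%:R.
  rewrite /cell -/y indicE; congr (nat_of_bool _)%:R; apply/idP/eqP => [/set_mem|->].
    rewrite /= in_itv/= => h; apply/esym/eqP; rewrite truncn_eq//.
  by apply/mem_set; rewrite /= in_itv/= truncn_itv.
have tK : (Num.truncn y < K)%N.
  by rewrite -(ltr_nat R); apply: le_lt_trans yK; rewrite truncn_le.
rewrite (bigD1 (Ordinal tK))//= cellE eqxx mul1r big1 ?addr0// => j jt.
by rewrite cellE (_ : (nat_of_ord j == _) = false) ?mul0r//; apply/negbTE.
Qed.

(** After truncation to [- N, N] in both variables, the exponential [cexpi (x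
    * xi)] changes by at most [2 N / M] when [x] moves within a cell of length
    [1 / M]. Freezing [x] at the nodes leaves finitely many functionals of
    [w]. *)
Lemma window_op_step a m (N M : nat) : is_L2 a -> is_L2 m -> (0 < M)%N ->
  exists2 S : X -> X, finrank S & forall w,
    nrm (window_op (trunc N a) (trunc N m) w - S w) <=
    normc (c0 : C) * (2 * N%:R / M%:R) * nrm (L2class (trunc N m)) * nrm (L2class (trunc N a)) * nrm w.
Proof.
move=> ha hm M0; have haN := is_L2_trunc N ha; have hmN := is_L2_trunc N hm.
have M0' : 0 < M%:R :> R by rewrite ltr0n.
set aN := trunc N a; set mN := trunc N m.
pose K := ((N + N) * M).+1.
pose t (j : nat) : R := j%:R / M%:R - N%:R.
pose phi (j : nat) w : C := ift (fun xi => mN xi * L2repr w xi) (t j).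
pose f (j : nat) x : C := (cell N M j x)%:C * aN x.
have hf j : is_L2 (f j).
  apply: (is_L2_bound (M := 1)) => //; first by apply: cmeasurable_real; exact: measurable_cell.
  by move=> x; rewrite normcR /cell indicE; case: (_ \in _); rewrite ?normr1 ?normr0.
exists (fun w => \sum_(j < K) phi j w *: L2class (f j)).
  by exists K, (fun j => phi j), (fun j => L2class (f j)); split=> // j; exact: ift_bfun.
move=> w.
have hs := L2class_sum (F := fun (j : 'I_K) x => phi j w * f j x) (fun j => is_L2Z _ (hf j)).
have -> : \sum_(j < K) phi j w *: L2class (f j) = L2class (fun x => \sum_(j < K) phi j w * f j x).
  by rewrite hs.2; apply: eq_bigr => j _; rewrite L2classZ.
have hw := window_op_L2 w haN hmN.
rewrite /window_op -L2classB//; last exact: hs.1.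
set D : R := normc (c0 : C) * (2 * N%:R / M%:R) * nrm (L2class mN) * nrm w.
have D0 : 0 <= D by rewrite !mulr_ge0 ?normc_ge0 ?nrm_ge0 ?invr_ge0 ?ler0n.
have -> : normc (c0 : C) * (2 * N%:R / M%:R) * nrm (L2class mN) * nrm (L2class aN) * nrm w =
   nrm (L2class (fun x => D%:C * aN x)).
  by rewrite L2classZ// nrmZ normcR (ger0_norm D0) /D mulrAC.
have hD : is_L2 (fun x => D%:C * aN x) by exact: is_L2Z.
have hd := is_L2B hw hs.1.
apply: nrm_class_le => //; first exact: nrm_ge0.
rewrite nrm_class_sqn//; apply: sqn_le; [exact: hd.1|exact: hD.1|] => x.
rewrite [X in _ <= X]normcM normcR (ger0_norm D0).
have [xN|xN] := leP `|x| N%:R; last first.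
  have aN0 : aN x = 0.
    rewrite /aN /trunc segE indicE memNset ?mul0r//= in_itv/= -ler_norml.
    by apply/negP; rewrite -ltNge.
  rewrite aN0 mul0r big1 ?subr0 ?normc0 ?mulr0// => j _.
  by rewrite /f aN0 !mulr0.
have /andP[x1 x2] : - N%:R <= x <= N%:R by rewrite -ler_norml.
set y := (x + N%:R) * M%:R.
have y0 : 0 <= y by rewrite mulr_ge0 ?ler0n//; lra.
have yK : y < K%:R.
  rewrite /K -natr1 natrM natrD; apply: (@le_lt_trans _ _ ((N%:R + N%:R) * M%:R)); last by rewrite ltrDl.
  by rewrite ler_wpM2r// lerD2r.
set J := Num.truncn y.
have -> : \sum_(j < K) phi j w * f j x = aN x * phi J w.
  rewrite [RHS]mulrC -(@sum_cell N M K x (fun j => phi j w * aN x)) ?y0//.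
  by apply: eq_bigr => j _; rewrite /f mulrCA.
have xt : `|x - t J| <= M%:R^-1.
  have /andP[J1 J2] : J%:R <= y < J.+1%:R by exact: truncn_itv.
  have -> : x - t J = (y - J%:R) / M%:R by rewrite /t /y; field; rewrite gt_eqF.
  rewrite normrM normfV (ger0_norm (ltW M0')) ler_piMl ?invr_ge0 ?(ltW M0')//.
  by rewrite ger0_norm ?subr_ge0// lerBlDl natr1 ltW.
rewrite -mulrBr normcM mulrC ler_wpM2r ?normc_ge0//.
have hww := L2reprP w.
have iw := L2_mul_integrable hmN hww.
have [||ik bk] := @cint_weighted_bound (fun xi => cexpi (x * xi) - cexpi (t J * xi)) mN (L2repr w)
    (2 * N%:R / M%:R) (cmeasurableB (cmeasurable_cexpi_lin x) (cmeasurable_cexpi_lin (t J))) hmN hww.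
- by rewrite !mulr_ge0 ?invr_ge0 ?ler0n.
- move=> xi; rewrite normcM.
  have [xiN|xiN] := leP `|xi| N%:R; last first.
    have -> : mN xi = 0; last by rewrite normc0 !mulr0.
    rewrite /mN /trunc segE indicE memNset ?mul0r//= in_itv/= -ler_norml.
    by apply/negP; rewrite -ltNge.
  rewrite ler_wpM2r ?normc_ge0// (le_trans (normc_cexpiB _ _))// -mulrBl normrM -mulrA ler_wpM2l//.
  by rewrite mulrC ler_pM.
have -> : D = normc (c0 : C) * (2 * N%:R / M%:R * nrm (L2class mN) * nrm w) by rewrite /D !mulrA.
rewrite /phi /ift -mulrBr normcM ler_wpM2l ?normc_ge0//.
have b1 : forall z, normc (cexpi z : C) <= 1 by move=> z; rewrite normc_cexpi.
have i1 := cintegrable_bound (cmeasurable_cexpi_lin x) iw (fun z => b1 _).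
have i2 := cintegrable_bound (cmeasurable_cexpi_lin (t J)) iw (fun z => b1 _).
rewrite -(cintB i1 i2).
rewrite (_ : cint _ = cint (fun xi => (cexpi (x * xi) - cexpi (t J * xi)) * (mN xi * L2repr w xi))); last first.
  by apply: eq_cint => xi; exact: esym (mulrBl _ _ _).
by move: bk; rewrite L2class_repr.
Qed.

Lemma nrm_trunc n f : is_L2 f -> nrm (L2class (trunc n f)) <= nrm (L2class f).
Proof.
move=> hf; apply: nrm_class_le; [exact: is_L2_trunc|exact: nrm_ge0|].
rewrite nrm_class_sqn//; apply: sqn_le; [exact: (is_L2_trunc n hf).1|exact: hf.1|].
by move=> x; exact: normc_trunc_le.
Qed.

(** The truncations of [a] and [m] converge in L2, so the operators converge
    in operator norm by [nrm_window_op], and the truncated ones are covered by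
    [window_op_step]. *)
Theorem window_op_approx a m : is_L2 a -> is_L2 m -> approx_finrank (window_op a m).
Proof.
move=> ha hm; split=> [|e e0]; first exact: window_op_lin.
set c := normc (c0 : C); set A := nrm (L2class a); set B := nrm (L2class m).
have c_ge0 : 0 <= c by exact: normc_ge0.
have A0 : 0 <= A by exact: nrm_ge0.
have B0 : 0 <= B by exact: nrm_ge0.
pose k := c * B + c * A + 1.
have k0 : 0 < k by rewrite ltr_wpDl// addr_ge0 ?mulr_ge0.
pose d := e / (2 * k).
have d0 : 0 < d by rewrite divr_gt0// mulr_gt0.
have [N1 h1] := (cvgXP _ _).1 (trunc_cvgX ha) d d0.
have [N2 h2] := (cvgXP _ _).1 (trunc_cvgX hm) d d0.
pose N := maxn N1 N2.
have hA := h1 N (leq_maxl _ _); have hB := h2 N (leq_maxr _ _).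
pose M := (Num.truncn (c * (2 * N%:R) * B * A * 2 / e)).+1.
have [S fS hS] := window_op_step N ha hm (ltn0Sn (Num.truncn (c * (2 * N%:R) * B * A * 2 / e))).
exists S => // w.
have haN := is_L2_trunc N ha; have hmN := is_L2_trunc N hm.
apply: (le_trans (nrm_tri (window_op (trunc N a) (trunc N m) w) _ _)).
have p1 : nrm (window_op a m w - window_op (trunc N a) (trunc N m) w) <= (c * B * d + c * d * A) * nrm w.
  apply: (le_trans (nrm_tri (window_op (trunc N a) m w) _ _)); rewrite mulrDl lerD//.
    rewrite window_opB_l//; apply: (le_trans (nrm_window_op w (is_L2B ha haN) hm)).
    rewrite ler_wpM2r ?nrm_ge0// ler_wpM2l ?mulr_ge0// L2classB// nrmB; exact: hA.
  rewrite window_opB_r//; apply: (le_trans (nrm_window_op w haN (is_L2B hm hmN))).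
  rewrite ler_wpM2r ?nrm_ge0// ler_pM ?mulr_ge0 ?nrm_ge0//; last exact: nrm_trunc.
  rewrite ler_wpM2l// L2classB// nrmB; exact: hB.
have p2 : c * (2 * N%:R / M%:R) * nrm (L2class (trunc N m)) * nrm (L2class (trunc N a)) <= e / 2.
  apply: (@le_trans _ _ (c * (2 * N%:R / M%:R) * B * A)).
    by rewrite ler_pM ?mulr_ge0 ?nrm_ge0 ?invr_ge0//; [rewrite ler_wpM2l ?mulr_ge0 ?invr_ge0//; exact: nrm_trunc|exact: nrm_trunc].
  have -> : c * (2 * N%:R / M%:R) * B * A = c * (2 * N%:R) * B * A / M%:R by ring.
  rewrite ler_pdivrMr ?ltr0n// [X in _ <= X]mulrC -ler_pdivrMr ?divr_gt0//.
  have -> : c * (2 * N%:R) * B * A / (e / 2) = c * (2 * N%:R) * B * A * 2 / e by field; rewrite gt_eqF.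
  exact/ltW/truncnS_gt.
have dk : d * k = e / 2 by rewrite /d; field; rewrite gt_eqF.
apply: (le_trans (lerD p1 (le_trans (hS w) (ler_wpM2r (nrm_ge0 w) p2)))).
rewrite -mulrDl ler_wpM2r ?nrm_ge0// [X in _ <= X]splitr lerD2r -dk /k.
by rewrite mulrDr mulr1; have := ltW d0; nra.
Qed.

End MultiplierCompactness.

(** * The resolvent of the constant coefficient operator *)

Section Resolvent.
Context {R : realType}.
Local Notation mu := (@lebesgue_measure R).
Local Notation C := R[i].
Local Notation X := (L2space R).
Local Notation cint := (@cintegral R setT).
Implicit Types (f g m : R -> C) (u v w : X).

(** The symbol of the constant coefficient operator. *)
Definition Linfty_symbol (xi : R) : R := 1 + `|xi| + xi ^+ 2.

Lemma Linfty_symbol_ge xi : 1 + xi ^+ 2 <= Linfty_symbol xi.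
Proof. by rewrite /Linfty_symbol lerD2r lerDl. Qed.

Lemma Linfty_symbol_gt0 xi : 0 < Linfty_symbol xi.
Proof. by apply: lt_le_trans (Linfty_symbol_ge xi); rewrite ltr_pwDl// sqr_ge0. Qed.

Lemma measurable_Linfty_symbol : measurable_fun [set: R] Linfty_symbol.
Proof.
apply: measurable_funD; last exact: measurable_funX.
apply: measurable_funD; first exact: measurable_cst.
exact: continuous_measurable_fun (@norm_continuous _ _).
Qed.

(** The resolvent is [(lambda - L_infty)^-1], whence the sign at [lambda = 0]. *)
Definition resolvent_symbol (xi : R) : C := (- (Linfty_symbol xi)^-1)%:C.

Lemma cmeasurable_resolvent_symbol : cmeasurable resolvent_symbol.
Proof.
apply: cmeasurable_real; apply: measurable_funN.
exact: (measurableT_comp measurable_inv measurable_Linfty_symbol).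
Qed.

Lemma normc_resolvent_symbol xi : normc (resolvent_symbol xi) = (Linfty_symbol xi)^-1.
Proof. by rewrite normcR normrN ger0_norm// invr_ge0 ltW// Linfty_symbol_gt0. Qed.

Lemma normc_resolvent_symbol_le1 xi : normc (resolvent_symbol xi) <= 1.
Proof.
rewrite normc_resolvent_symbol invf_le1 ?Linfty_symbol_gt0//; apply: le_trans (Linfty_symbol_ge xi).
by rewrite lerDl sqr_ge0.
Qed.

Lemma weight_resolvent_bounded m : cmeasurable m -> (forall xi : R, normc (m xi) <= Linfty_symbol xi) ->
  bounded_symbol (fun xi => m xi * resolvent_symbol xi).
Proof.
move=> mm hm; split; first exact: cmeasurableM cmeasurable_resolvent_symbol.
by exists 1 => xi; rewrite normcM normc_resolvent_symbol ler_pdivrMr ?Linfty_symbol_gt0// mul1r.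
Qed.

Lemma bounded_resolvent_symbol : bounded_symbol resolvent_symbol.
Proof. by split; [exact: cmeasurable_resolvent_symbol|exists 1 => xi; exact: normc_resolvent_symbol_le1]. Qed.

Lemma integral_lorentzian_fin : (\int[mu]_x ((x ^+ 2 + 1)^-1)%:E < +oo)%E.
Proof.
pose F (x : R) : R := 1 ^+ 2 / (x ^+ 2 + 1 ^+ 2).
pose G (x : R) : R := \1_`[(0 : R), +oo[ x * F x.
have F0 x : 0 <= F x by rewrite divr_ge0 ?addr_ge0 ?sqr_ge0.
have mF : measurable_fun [set: R] F.
  by apply: continuous_measurable_fun; exact: continuous_lorentzian.
have mG : measurable_fun [set: R] (fun x => (G x)%:E).
  by apply/measurable_EFinP; apply: measurable_funM => //; exact: measurable_indic.
have G0 x : (0 <= (G x)%:E)%E by rewrite lee_fin mulr_ge0// indicE ler0n.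
have mG' : measurable_fun [set: R] (fun x => (G (- x))%:E).
  by apply: (measurableT_comp mG); exact: measurable_funN.
have GE : (\int[mu]_x (G x)%:E = (1 * (pi / 2))%:E)%E.
  exact: etrans (esym (setint_indic _ _)) (integral_lorentzian ltr01).
apply: (@le_lt_trans _ _ (\int[mu]_x ((G x)%:E + (G (- x))%:E))%E); last first.
  by rewrite ge0_integralD// (ge0_integral_opp mG)// GE -EFinD ltry.
apply: ge0_le_integral => //.
- by move=> x _; rewrite lee_fin invr_ge0 addr_ge0 ?sqr_ge0.
- apply/measurable_EFinP; apply: (measurableT_comp measurable_inv).
  by apply: measurable_funD.
- exact: emeasurable_funD.
- move=> x _; rewrite -EFinD lee_fin /G /F sqrrN expr1n mul1r !indicE.
  have [x0|x0] := leP 0 x.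
    rewrite mem_set ?mul1r/= ?in_itv/= ?x0//.
    by rewrite lerDl mulr_ge0 ?ler0n// invr_ge0 addr_ge0 ?sqr_ge0.
  rewrite [(- x) \in _]mem_set ?mul1r/= ?in_itv/= ?oppr_ge0 ?(ltW x0)//.
  by rewrite lerDr mulr_ge0 ?ler0n// invr_ge0 addr_ge0 ?sqr_ge0.
Qed.

(** The square of [m] is dominated by a Lorentzian. *)
Lemma decay_L2 m : cmeasurable m -> (forall xi : R, normc (m xi) <= (1 + `|xi|) / Linfty_symbol xi) -> is_L2 m.
Proof.
move=> mm hm; apply/is_L2P; split => //.
have mL : measurable_fun [set: R] (fun x : R => ((x ^+ 2 + 1)^-1)%:E).
  apply/measurable_EFinP; apply: (measurableT_comp measurable_inv).
  by apply: measurable_funD.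
apply: (@le_lt_trans _ _ (\int[mu]_x (2%:E * ((x ^+ 2 + 1)^-1)%:E))%E); last first.
  rewrite ge0_integralZl//; last by move=> x _; rewrite lee_fin invr_ge0 addr_ge0 ?sqr_ge0.
  by rewrite lte_mul_pinfty// integral_lorentzian_fin.
apply: ge0_le_integral => //.
- by move=> x _; rewrite lee_fin sqr_ge0.
- exact: measurable_normc2.
- exact: measurable_funeM.
- move=> x _; rewrite -EFinM lee_fin.
  have p1 : 0 < x ^+ 2 + 1 by rewrite ltr_wpDl ?sqr_ge0.
  have w0 := Linfty_symbol_gt0 x.
  apply: (@le_trans _ _ (((1 + `|x|) / Linfty_symbol x) ^+ 2)).
    have a0 : 0 <= (1 + `|x|) / Linfty_symbol x by rewrite mulr_ge0 ?invr_ge0 ?(ltW w0)// addr_ge0.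
    by apply: lerXn2r; rewrite ?nnegrE ?normc_ge0 ?hm.
  rewrite exprMn exprVn ler_pdivrMr ?exprn_gt0// mulrAC ler_pdivlMr//.
  have h1 : (1 + `|x|) ^+ 2 <= 2 * (x ^+ 2 + 1).
    rewrite -(real_normK (num_real x)); have := sqr_ge0 (`|x| - 1); rewrite !expr2; lra.
  have h2 : x ^+ 2 + 1 <= Linfty_symbol x by rewrite addrC Linfty_symbol_ge.
  apply: (@le_trans _ _ (2 * (x ^+ 2 + 1) * (x ^+ 2 + 1))); first by rewrite ler_wpM2r// ltW.
  by rewrite -!mulrA ler_wpM2l// expr2 ler_pM// ltW.
Qed.

Lemma resolvent_symbol_L2 : is_L2 resolvent_symbol.
Proof.
apply: decay_L2; first exact: cmeasurable_resolvent_symbol.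
move=> xi; rewrite normc_resolvent_symbol -[X in X <= _]mul1r ler_wpM2r ?invr_ge0 ?(ltW (Linfty_symbol_gt0 _))//.
by rewrite lerDl.
Qed.

Definition abs_symbol (xi : R) : C := `|xi|%:C.

Definition abs_resolvent_symbol (xi : R) : C := abs_symbol xi * resolvent_symbol xi.

Lemma abs_le_Linfty_symbol xi : normc (abs_symbol xi) <= Linfty_symbol xi.
Proof. by rewrite normcR normr_id /Linfty_symbol -addrA addrCA lerDl addr_ge0 ?sqr_ge0. Qed.

Lemma abs_resolvent_symbol_L2 : is_L2 abs_resolvent_symbol.
Proof.
apply: decay_L2; first by apply: cmeasurableM; [exact: cmeasurable_abs|exact: cmeasurable_resolvent_symbol].
move=> xi; rewrite normcM normcR normr_id normc_resolvent_symbol ler_wpM2r ?invr_ge0 ?(ltW (Linfty_symbol_gt0 _))//.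
by rewrite lerDr.
Qed.

Lemma bounded_abs_resolvent_symbol : bounded_symbol abs_resolvent_symbol.
Proof. by apply: weight_resolvent_bounded; [exact: cmeasurable_abs|exact: abs_le_Linfty_symbol]. Qed.

Definition resolvent0 v : X := FTi (mult resolvent_symbol (FT v)).

Lemma resolvent0_blin : blin resolvent0.
Proof. exact: blin_comp FTi_blin (blin_comp (mult_blin bounded_resolvent_symbol) FT_blin). Qed.

Lemma nrm_resolvent0 v : nrm (resolvent0 v) <= nrm v.
Proof.
rewrite nrm_FTi; apply: (le_trans (nrm_mult _ cmeasurable_resolvent_symbol normc_resolvent_symbol_le1)).
by rewrite mul1r nrm_FT.
Qed.

Lemma hat_resolvent0 v : \forall xi \ae mu, hat (L2repr (resolvent0 v)) xi = resolvent_symbol xi * L2repr (FT v) xi.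
Proof.
rewrite /hat L2class_repr /resolvent0 FTiK; apply: L2classK.
exact: bounded_symbol_L2 bounded_resolvent_symbol (L2reprP _).
Qed.

Lemma resolvent0_inj : injective resolvent0.
Proof.
move=> u v E.
have b w := bounded_symbol_L2 bounded_resolvent_symbol (L2reprP (FT w)).
have h := L2class_inj (b u) (b v) (can_inj (@FTiK R) E).
apply: (can_inj (@FTK R)); apply: eq_L2; apply: aeP h => xi.
apply: mulfI; rewrite /resolvent_symbol rmorphN oppr_eq0; apply/eqP => /(@complexI R _ 0) /eqP.
by rewrite invr_eq0 gt_eqF ?Linfty_symbol_gt0.
Qed.

Lemma weight_hat_resolvent0 m v : cmeasurable m -> (forall xi : R, normc (m xi) <= Linfty_symbol xi) ->
  is_L2 (fun xi => m xi * hat (L2repr (resolvent0 v)) xi) /\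
  L2class (fun xi => m xi * hat (L2repr (resolvent0 v)) xi) = mult (fun xi => m xi * resolvent_symbol xi) (FT v).
Proof.
move=> mm hm; have bm := weight_resolvent_bounded mm hm.
have h2 := bounded_symbol_L2 bm (L2reprP (FT v)).
have h1 : is_L2 (fun xi => m xi * hat (L2repr (resolvent0 v)) xi).
  apply: (is_L2_ae _ _ h2); first exact: cmeasurableM mm (is_L2_hat _).1.
  by apply: aeP (hat_resolvent0 v) => xi ->; rewrite mulrA.
split; first exact: h1.
apply: L2class_ae; [exact: h1|exact: h2|].
by apply: aeP (hat_resolvent0 v) => xi ->; rewrite mulrA.
Qed.

Lemma sqr_le_Linfty_symbol (xi : R) : normc ((xi ^+ 2)%:C : C) <= Linfty_symbol xi.
Proof. by rewrite normcR ger0_norm ?sqr_ge0// /Linfty_symbol lerDr addr_ge0. Qed.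

Lemma resolvent0_H2 v : @H2_domain R (resolvent0 v).
Proof.
apply/(sobolev2P (L2reprP _)).
exact: (weight_hat_resolvent0 v (cmeasurable_power 2) sqr_le_Linfty_symbol).1.
Qed.

Lemma H2_resolvent0 u : @H2_domain R u -> exists v, u = resolvent0 v.
Proof.
move=> /(sobolev2P (L2reprP _)) h2; set f := L2repr u in h2.
have mw : cmeasurable (fun xi => (Linfty_symbol xi)%:C : C) by apply: cmeasurable_real; exact: measurable_Linfty_symbol.
(* half of the symbol is below 1 + xi^2 *)
have hw : is_L2 (fun xi => (2^-1 * Linfty_symbol xi)%:C * hat f xi).
  apply: weight_L2 h2; [|move=> xi|exact: is_L2_hat].
    by apply: cmeasurable_real; apply: measurable_funM; [exact: measurable_cst|exact: measurable_Linfty_symbol].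
  rewrite normcR ger0_norm; last by rewrite mulr_ge0// ltW// Linfty_symbol_gt0.
  have := sqr_ge0 (`|xi| - 1); rewrite sqrrB1 real_normK ?num_real// /Linfty_symbol; have := sqr_ge0 xi; lra.
have hw' : is_L2 (fun xi => - ((Linfty_symbol xi)%:C * hat f xi)).
  apply: is_L2N; have := is_L2Z (2 : R)%:C hw; congr is_L2; apply/funext => xi.
  by rewrite mulrA -rmorphM mulrA mulfV ?mul1r ?pnatr_eq0.
exists (FTi (L2class (fun xi => - ((Linfty_symbol xi)%:C * hat f xi)))).
apply: (can_inj (@FTK R)); rewrite /resolvent0 !FTiK.
rewrite (mult_class bounded_resolvent_symbol hw').
have e : (fun xi => resolvent_symbol xi * - ((Linfty_symbol xi)%:C * hat f xi)) = hat f.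
  apply/funext => xi; rewrite mulrN -mulNr mulrA /resolvent_symbol -rmorphN opprK -rmorphM mulVf ?mul1r//.
  by rewrite gt_eqF ?Linfty_symbol_gt0.
by rewrite e /hat L2class_repr /f L2class_repr.
Qed.

Definition half_laplacian_resolvent v : X := FTi (mult abs_resolvent_symbol (FT v)).

Lemma FT_resolvent0 v : FT (resolvent0 v) = mult resolvent_symbol (FT v). Proof. exact: FTiK. Qed.

Lemma FT_half_laplacian_resolvent v : FT (half_laplacian_resolvent v) = mult abs_resolvent_symbol (FT v). Proof. exact: FTiK. Qed.

Lemma half_laplacian_resolvent0 v : L2class (half_laplacian (L2repr (resolvent0 v))) = half_laplacian_resolvent v.
Proof.
have [h1 h2] := weight_hat_resolvent0 v cmeasurable_abs abs_le_Linfty_symbol.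
apply: (can_inj (@FTK R)); rewrite FTiK -h2; exact: half_laplacian_hat (L2reprP _) h1.
Qed.

(** For the resolvent symbol [r] one has [- xi^2 * r = 1 + r + |xi| * r]. *)
Lemma second_derivative_resolvent0 v :
  let w := weak_derivative (weak_derivative (L2repr (resolvent0 v))) in
  is_L2 w /\ L2class w = v + resolvent0 v + half_laplacian_resolvent v.
Proof.
move=> w; have [hw E] := second_derivative (resolvent0_H2 v : sobolev 2 (L2repr (resolvent0 v))).
split; first exact: hw.
apply: (can_inj (@FTK R)).
have eR := etrans (linD FT_lin (v + resolvent0 v) (half_laplacian_resolvent v))
  (congr2 +%R (etrans (linD FT_lin v (resolvent0 v)) (congr1 (+%R (FT v)) (FT_resolvent0 v))) (FT_half_laplacian_resolvent v)).
apply: (etrans _ (esym eR)).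
have hv := L2reprP (FT v).
have b1 := bounded_symbol_L2 bounded_resolvent_symbol hv; have b2 := bounded_symbol_L2 bounded_abs_resolvent_symbol hv.
have -> : FT v + mult resolvent_symbol (FT v) + mult abs_resolvent_symbol (FT v) =
    L2class (fun xi => L2repr (FT v) xi + resolvent_symbol xi * L2repr (FT v) xi + abs_resolvent_symbol xi * L2repr (FT v) xi).
  by rewrite (L2classD (is_L2D hv b1) b2) (L2classD hv b1) L2class_repr.
apply: (etrans (esym (L2class_repr _))); apply: L2class_ae; [exact: L2reprP|exact: is_L2D (is_L2D hv b1) b2|].
apply: aeP2 E (hat_resolvent0 v) => xi e1 e2; apply: (etrans e1); rewrite e2.
move: (L2repr (FT v) xi) => z; rewrite /abs_resolvent_symbol /abs_symbol.
have rw : resolvent_symbol xi * (Linfty_symbol xi)%:C = -1.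
  by rewrite /resolvent_symbol -rmorphM mulNr mulVf ?gt_eqF ?Linfty_symbol_gt0// rmorphN.
have e : (Linfty_symbol xi)%:C = 1 + `|xi|%:C + (xi ^+ 2)%:C :> C by rewrite /Linfty_symbol !rmorphD.
have e3 : (xi ^+ 2)%:C * resolvent_symbol xi = - 1 - resolvent_symbol xi - `|xi|%:C * resolvent_symbol xi.
  by rewrite -rw e; ring.
by rewrite mulrA e3; ring.
Qed.

Lemma Linfty_resolvent0 v : op_fun (op_Linfty R) (resolvent0 v) = - v.
Proof.
have [hw Ew] := second_derivative_resolvent0 v.
set f := L2repr (resolvent0 v) in hw Ew *; set w := weak_derivative (weak_derivative f) in hw Ew *.
have hf : is_L2 f by exact: L2reprP.
have hl := half_laplacian_L2 f.
change (L2class (fun x => - w x + (f x + half_laplacian f x)) = - v).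
rewrite (L2classD (is_L2N hw) (is_L2D hf hl)) (L2classN hw) (L2classD hf hl).
rewrite Ew half_laplacian_resolvent0 /f L2class_repr; zmodule.
Qed.

Lemma zero_in_resolvent_set : resolvent_set (op_Linfty R) 0 /\ forall v, resolvent (op_Linfty R) 0 v = resolvent0 v.
Proof.
have sol v u : @H2_domain R u /\ 0 *: u - op_fun (op_Linfty R) u = v <-> u = resolvent0 v.
  split=> [[/H2_resolvent0[v' ->]]|->].
    by rewrite scale0r sub0r Linfty_resolvent0 opprK => ->.
  by split; [exact: resolvent0_H2|rewrite scale0r sub0r Linfty_resolvent0 opprK].
split.
  split=> [v|].
    exists (resolvent0 v); split; first exact/sol.
    by move=> u /sol ->.
  exists 1 => u /H2_resolvent0[v ->]; rewrite scale0r sub0r Linfty_resolvent0 opprK mul1r !nrmE lecR.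
  exact: nrm_resolvent0.
move=> v; rewrite /resolvent; case: xgetP => [u _ /sol //|].
by move=> /(_ (resolvent0 v)) []; exact/sol.
Qed.

End Resolvent.

(** * Commutators with the half-Laplacian *)

Section Commutator.
Context {R : realType}.
Local Notation mu := (@lebesgue_measure R).
Local Notation C := R[i].
Local Notation X := (L2space R).
Local Notation cint := (@cintegral R setT).
Implicit Types (f g : R -> C) (u v w : X).

(** The convolution theorem for a product with an inverse Fourier integral. *)
Lemma ft_mul_ift g f xi : cintegrable g -> cintegrable f ->
  ft (fun x => g x * ift f x) xi = c0 * cint (fun eta => ft g (xi - eta) * f eta).
Proof.
move=> hg hf; have hg' := cintegrable_ftk xi hg.
have mk : cmeas2 (fun x eta : R => cexpi (x * eta)).
  apply: (cmeas2_comp (f := @cexpi R) (h := fun x y => x * y)); first exact: measurable_cexpi.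
  exact: measurable_funM.
have [|h1 h2 h3] := bounded_kernel_swap (M := 1) mk _ hg' hf.
  by move=> x y; rewrite normc_cexpi.
apply: (congr1 (fun z => c0 * z)).
apply: (@etrans _ _ (cint (fun x => c0 * (cexpi (- (x * xi)) * g x * cint (fun eta => cexpi (x * eta) * f eta))))).
  by apply: eq_cint => x; rewrite /ift mulrA mulrCA.
apply: (etrans (cintZ c0 h1)); apply: (etrans (congr1 (fun z => c0 * z) h3)).
apply: (etrans (esym (cintZ c0 h2))); apply: eq_cint => eta.
rewrite /ft mulrCA [RHS]mulrC; congr (_ * (_ * _)).
by apply: eq_cint => x; rewrite mulrA -cexpiD; congr (cexpi _ * _); ring.
Qed.

Lemma cmeasurable_reflect f (x : R) : cmeasurable f -> cmeasurable (fun y => f (x - y)).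
Proof. by move=> mf; apply: cmeasurable_comp => //; apply: measurable_funB => //; exact: measurable_cst. Qed.

Lemma ge0_integral_reflect (h : R -> \bar R) (x : R) : measurable_fun [set: R] h -> (forall y, (0 <= h y)%E) ->
  (\int[mu]_y h (x - y)%R = \int[mu]_y h y)%E.
Proof.
move=> mh h0; rewrite -(ge0_integral_shift x mh h0).
rewrite -(@ge0_integral_opp R (fun y => h (y + x)%R)).
- by apply: eq_integral => y _; congr h; rewrite addrC.
- by apply: (measurableT_comp mh); apply: measurable_funD => //; exact: measurable_cst.
- by move=> y; exact: h0.
Qed.

Definition freq g (xi : R) : C := xi%:C * ft g xi.

(** Integrable functions in the Sobolev space of order 1, described by [freq]
    on the Fourier side. *)
Definition tame g := [/\ cintegrable g, is_L2 g & is_L2 (freq g)].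

(** The kernel, on the Fourier side, of the commutator of the half-Laplacian
    and [g] composed with the resolvent. *)
Definition comm_kernel g (xi eta : R) : C := (`|xi| - `|eta|)%:C * ft g (xi - eta) * resolvent_symbol eta.

Definition comm_int g w (xi : R) : C := c0 * cint (fun eta => comm_kernel g xi eta * L2repr w eta).

Lemma cmeas2_comm_kernel g : cmeasurable g -> cmeas2 (fun eta xi => comm_kernel g xi eta).
Proof.
move=> mg; apply: cmeas2M; last exact: cmeas2_1 cmeasurable_resolvent_symbol.
apply: cmeas2M.
  apply: (cmeas2_real (h := fun eta xi => `|xi| - `|eta|)); apply: measurable_funB.
    exact: measurableT_comp (continuous_measurable_fun (@norm_continuous _ R)) measurable_snd.
  exact: measurableT_comp (continuous_measurable_fun (@norm_continuous _ R)) measurable_fst.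
apply: (cmeas2_comp (f := ft g) (h := fun eta xi => xi - eta)); first exact: cmeasurable_ft.
by apply: measurable_funB; [exact: measurable_snd|exact: measurable_fst].
Qed.

Lemma cmeasurable_comm_int g w : cmeasurable g -> cmeasurable (comm_int g w).
Proof.
move=> mg; apply: cmeasurableM; first exact: cmeasurable_cst.
apply: (measurable_param_int (F := fun eta xi => comm_kernel g xi eta * L2repr w eta)).
by apply: cmeas2M; [exact: cmeas2_comm_kernel|exact: cmeas2_1 (L2reprP w).1].
Qed.

(** As [||xi| - |eta|| <= |xi - eta|], the half-Laplacian costs one derivative
    of [g]. *)
Lemma normc_comm_kernel g xi eta : normc (comm_kernel g xi eta) <= normc (freq g (xi - eta)) * normc (resolvent_symbol eta).
Proof.
rewrite normcM ler_wpM2r ?normc_ge0// /freq [X in X <= _]normcM [X in _ <= X]normcM.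
rewrite ler_wpM2r ?normc_ge0// !normcR; exact: ler_dist_dist.
Qed.

Definition comm_sq g (xi : R) : \bar R :=
  (\int[mu]_eta (normc (freq g (xi - eta)%R) ^+ 2 * normc (resolvent_symbol eta) ^+ 2)%:E)%E.

Lemma measurable_comm_sq_kernel g : cmeasurable g ->
  measurable_fun [set: measurableTypeR R * measurableTypeR R]
    (fun z => (normc (freq g (z.1 - z.2)) ^+ 2 * normc (resolvent_symbol z.2) ^+ 2)%:E).
Proof.
move=> mg; apply/measurable_EFinP.
have mfr : cmeasurable (freq g).
  apply: cmeasurableM; last exact: cmeasurable_ft.
  by apply: cmeasurable_real; exact: measurable_id.
apply: measurable_funM; apply: measurable_funX.
  apply: (measurableT_comp (measurable_normc mfr)).
  by apply: measurable_funB; [exact: measurable_fst|exact: measurable_snd].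
exact: (measurableT_comp (measurable_normc cmeasurable_resolvent_symbol) measurable_snd).
Qed.

Lemma comm_sq_ge0 g xi : (0 <= comm_sq g xi)%E.
Proof. by apply: integral_ge0 => eta _; rewrite lee_fin mulr_ge0 ?sqr_ge0. Qed.

Lemma measurable_comm_sq g : cmeasurable g -> measurable_fun [set: R] (comm_sq g).
Proof.
move=> mg; apply: (measurable_section_int (h := fun z => (normc (freq g (z.1 - z.2)) ^+ 2 * normc (resolvent_symbol z.2) ^+ 2)%:E)).
  exact: measurable_comm_sq_kernel.
by move=> z; rewrite lee_fin mulr_ge0 ?sqr_ge0.
Qed.

Lemma integral_convolution (a b : R -> R) : measurable_fun [set: R] a -> measurable_fun [set: R] b ->
  (forall x, 0 <= a x) -> (forall x, 0 <= b x) ->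
  (\int[mu]_xi \int[mu]_eta (a (xi - eta) * b eta)%:E = (\int[mu]_x (a x)%:E) * \int[mu]_x (b x)%:E)%E.
Proof.
move=> ma mb a0 b0.
pose F (z : R * R) := ((a (z.1 - z.2) * b z.2)%:E : \bar R).
have mF : measurable_fun [set: measurableTypeR R * measurableTypeR R] F.
  apply/measurable_EFinP; apply: measurable_funM; last exact: (measurableT_comp mb measurable_snd).
  apply: (measurableT_comp ma).
  by apply: measurable_funB; [exact: measurable_fst|exact: measurable_snd].
have F0 z : (0 <= F z)%E by rewrite lee_fin mulr_ge0.
have := @fubini_tonelli _ _ (measurableTypeR R) (measurableTypeR R) R mu mu F mF F0.
rewrite /F /= => E; apply: (etrans E).
have ia : (0 <= \int[mu]_x (a x)%:E)%E by apply: integral_ge0 => x _; rewrite lee_fin.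
rewrite -ge0_integralZl//; last 2 first.
- exact/measurable_EFinP.
- by move=> x _; rewrite lee_fin.
apply: eq_integral => eta _.
under eq_integral do rewrite mulrC EFinM.
rewrite ge0_integralZl//.
- rewrite muleC; congr (_ * _)%E.
  rewrite (@ge0_integral_shift R (fun xi => (a xi)%:E) (- eta))//; first exact/measurable_EFinP.
- apply/measurable_EFinP; apply: (measurableT_comp ma).
  by apply: measurable_funB => //; exact: measurable_cst.
- by move=> xi _; rewrite lee_fin.
- by rewrite lee_fin.
Qed.

Lemma integral_comm_sq g : is_L2 g -> is_L2 (freq g) ->
  (\int[mu]_xi comm_sq g xi = sqn (freq g) * sqn (@resolvent_symbol R))%E.
Proof.
move=> hg hE.
apply: (@integral_convolution (fun x => normc (freq g x) ^+ 2) (fun x => normc (resolvent_symbol x) ^+ 2)).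
- by apply: measurable_funX; exact: measurable_normc hE.1.
- by apply: measurable_funX; exact: measurable_normc (@cmeasurable_resolvent_symbol R).
- by move=> x; exact: sqr_ge0.
- by move=> x; exact: sqr_ge0.
Qed.

Lemma comm_sq_fin g xi : is_L2 g -> is_L2 (freq g) -> comm_sq g xi \is a fin_num.
Proof.
move=> hg hE; rewrite ge0_fin_numE ?comm_sq_ge0//.
have /is_L2P[mE lE] := hE.
have mn2 : measurable_fun [set: R] (fun y => (normc (freq g y) ^+ 2)%:E) by exact: measurable_normc2.
apply: (@le_lt_trans _ _ (\int[mu]_eta (normc (freq g (xi - eta)%R) ^+ 2)%:E)%E); last first.
  rewrite (@ge0_integral_reflect (fun y => (normc (freq g y) ^+ 2)%:E))//.
  by move=> y; rewrite lee_fin sqr_ge0.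
apply: ge0_le_integral => //.
- by move=> eta _; rewrite lee_fin mulr_ge0 ?sqr_ge0.
- exact: (measurableT_comp (measurable_comm_sq_kernel hg.1) (measurable_pair1 xi)).
- apply: (@measurable_normc2 R (fun y => freq g (xi - y))); exact: cmeasurable_reflect.
- move=> eta _; rewrite lee_fin ler_piMr ?sqr_ge0// exprn_ile1 ?normc_ge0//.
  exact: normc_resolvent_symbol_le1.
Qed.

(** A bound for the L2 norms of the rows of the kernel; it is square
    integrable and dominates [comm_int] pointwise, uniformly for [w] in a
    ball. *)
Definition comm_weight g (xi : R) : C := (Num.sqrt (fine (comm_sq g xi)))%:C.

Lemma comm_weight_sq g xi : is_L2 g -> is_L2 (freq g) ->
  (normc (comm_weight g xi) ^+ 2)%:E = comm_sq g xi.
Proof.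
move=> hg hE; rewrite normcR ger0_norm ?sqrtr_ge0// sqr_sqrtr; last exact/fine_ge0/comm_sq_ge0.
by rewrite fineK//; exact: comm_sq_fin.
Qed.

Lemma comm_weight_L2 g : is_L2 g -> is_L2 (freq g) -> is_L2 (comm_weight g) /\
  nrm (L2class (comm_weight g)) = nrm (L2class (freq g)) * nrm (L2class (@resolvent_symbol R)).
Proof.
move=> hg hE; have hr := @resolvent_symbol_L2 R.
have E : sqn (comm_weight g) = (sqn (freq g) * sqn (@resolvent_symbol R))%E.
  by rewrite -integral_comm_sq//; apply: eq_integral => xi _; exact: comm_weight_sq.
have h : is_L2 (comm_weight g).
  apply/is_L2P; split.
    apply: cmeasurable_real; apply: measurableT_comp.
      by apply: continuous_measurable_fun; exact: sqrt_continuous.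
    by apply: (measurableT_comp (f := fine)); [exact: fine_measurable|exact: measurable_comm_sq hg.1].
  rewrite E lte_mul_pinfty ?sqn_ge0//; last by case/is_L2P: hr.
  by rewrite ge0_fin_numE ?sqn_ge0//; case/is_L2P: hE.
split; first exact: h.
apply/eqP; rewrite -(eqrXn2 (n := 2)) ?mulr_ge0 ?nrm_ge0//; apply/eqP.
apply: EFin_inj; apply: (etrans (nrm_class_sqn h)); apply: (etrans E).
by rewrite exprMn (EFinM (nrm _ ^+ 2)) (nrm_class_sqn hE) (nrm_class_sqn hr).
Qed.

Lemma comm_kernel_L2 g xi : is_L2 g -> is_L2 (freq g) -> is_L2 (comm_kernel g xi) /\
  (sqn (comm_kernel g xi) <= comm_sq g xi)%E.
Proof.
move=> hg hE; have mk : cmeasurable (comm_kernel g xi) by exact: cmeas2_sec2 xi (cmeas2_comm_kernel hg.1).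
have le : (sqn (comm_kernel g xi) <= comm_sq g xi)%E.
  apply: ge0_le_integral => //.
  - by move=> eta _; rewrite lee_fin sqr_ge0.
  - exact: measurable_normc2.
  - exact: (measurableT_comp (measurable_comm_sq_kernel hg.1) (measurable_pair1 xi)).
  - move=> eta _; rewrite lee_fin -exprMn lerXn2r ?nnegrE ?mulr_ge0 ?normc_ge0//.
    exact: normc_comm_kernel.
split; last exact: le.
apply/is_L2P; split; first exact: mk.
by apply: (le_lt_trans le); rewrite -ge0_fin_numE ?comm_sq_ge0// comm_sq_fin.
Qed.

Lemma comm_int_bound g w xi : is_L2 g -> is_L2 (freq g) ->
  normc (comm_int g w xi) <= normc (c0 : C) * nrm w * normc (comm_weight g xi).
Proof.
move=> hg hE; have [h1 h2] := comm_kernel_L2 xi hg hE.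
rewrite normcM -mulrA ler_wpM2l ?normc_ge0//.
rewrite -(@ler_pXn2r _ 2) ?nnegrE ?mulr_ge0 ?normc_ge0 ?nrm_ge0//.
rewrite -lee_fin exprMn (EFinM (nrm w ^+ 2)) (comm_weight_sq xi hg hE) nrm_sqn muleC.
apply: (le_trans (cint_cauchy_schwarz h1 (L2reprP w))).
by rewrite lee_wpmul2r// sqn_ge0.
Qed.

Lemma comm_int_L2 g w : is_L2 g -> is_L2 (freq g) -> is_L2 (comm_int g w) /\
  nrm (L2class (comm_int g w)) <= normc (c0 : C) * nrm (L2class (freq g)) * nrm (L2class (@resolvent_symbol R)) * nrm w.
Proof.
move=> hg hE; have [hW eW] := comm_weight_L2 hg hE.
set K : R := normc (c0 : C) * nrm w.
have K0 : 0 <= K by rewrite mulr_ge0 ?normc_ge0 ?nrm_ge0.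
have hK : is_L2 (fun x => K%:C * comm_weight g x) by exact: is_L2Z.
have mc : cmeasurable (comm_int g w) by exact: cmeasurable_comm_int hg.1.
have le x : normc (comm_int g w x) <= normc (K%:C * comm_weight g x).
  by rewrite [X in _ <= X]normcM normcR (ger0_norm K0); exact: comm_int_bound.
have hc : is_L2 (comm_int g w) by exact: is_L2_le mc hK le.
split; first exact: hc.
have -> : normc (c0 : C) * nrm (L2class (freq g)) * nrm (L2class (@resolvent_symbol R)) * nrm w =
    nrm (L2class (fun x => K%:C * comm_weight g x)).
  by rewrite (L2classZ _ hW) nrmZ normcR (ger0_norm K0) eW /K; ring.
apply: nrm_class_le; [exact: hc|exact: nrm_ge0|].
by rewrite (nrm_class_sqn hK); apply: sqn_le; [exact: mc|exact: hK.1|exact: le].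
Qed.

(** By the convolution theorem [comm_int g] is the transform of the commutator
    applied to the resolvent. *)
Lemma comm_intE g w xi : cintegrable g ->
  comm_int g w xi = abs_symbol xi * ft (fun x => g x * ift (fun eta => resolvent_symbol eta * L2repr w eta) x) xi
    - ft (fun x => g x * ift (fun eta => abs_resolvent_symbol eta * L2repr w eta) x) xi.
Proof.
move=> hg; have hw := L2reprP w; have [M hM] := ft_bounded hg.
have i1 := L2_mul_integrable (@resolvent_symbol_L2 R) hw; have i2 := L2_mul_integrable (@abs_resolvent_symbol_L2 R) hw.
rewrite (ft_mul_ift xi hg i1) (ft_mul_ift xi hg i2).
have mg : cmeasurable (fun eta => ft g (xi - eta)).
  by apply: cmeasurable_reflect; apply: cmeasurable_ft; case/cintegrableP: hg.
have j1 := cintegrable_bound mg i1 (fun eta => hM _).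
have j2 := cintegrable_bound mg i2 (fun eta => hM _).
rewrite mulrCA -mulrBr; congr (_ * _).
apply: (etrans _ (esym (congr1 (fun z => z - _) (esym (cintZ (abs_symbol xi) j1))))).
apply: (etrans _ (cintB (cintegrableZ (abs_symbol xi) j1) j2)); apply: eq_cint => eta.
rewrite /comm_kernel /abs_resolvent_symbol /abs_symbol rmorphB; move: (ft g _) (resolvent_symbol _) (L2repr w _) => a b c; ring.
Qed.

Lemma comm_int_lin g : is_L2 g -> is_L2 (freq g) -> lin (fun w => L2class (comm_int g w)).
Proof.
move=> hg hE c u v.
rewrite -(L2class_lin c (comm_int_L2 u hg hE).1 (comm_int_L2 v hg hE).1).
congr L2class; apply/funext => xi.
have [hk _] := comm_kernel_L2 xi hg hE.
have iu := L2_mul_integrable hk (L2reprP u); have iv := L2_mul_integrable hk (L2reprP v).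
rewrite /comm_int mulrCA -mulrDr; congr (_ * _).
apply: (etrans _ (congr1 (fun z => z + _) (cintZ c iu))).
apply: (etrans _ (cintD (cintegrableZ c iu) iv)); apply: cint_ae.
- exact: cmeasurableM hk.1 (L2reprP _).1.
- apply: cmeasurableD; last by case/cintegrableP: iv.
  by apply: cmeasurableM; [exact: cmeasurable_cst|case/cintegrableP: iu].
- by have := L2repr_lin c u v; apply: aeP => eta ->; rewrite mulrDr mulrCA.
Qed.

Lemma mul_ift_integrable g m w : cintegrable g -> is_L2 m ->
  cintegrable (fun x => g x * ift (fun eta => m eta * L2repr w eta) x).
Proof.
move=> hg hm; have := cintegrable_bound (cmeasurable_ift (cmeasurableM hm.1 (L2reprP w).1)) hg
  (fun x => ift_bound w x hm).
by congr cintegrable; apply/funext => x; rewrite mulrC.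
Qed.

Lemma FT_window_op g m w : cintegrable g -> is_L2 g -> is_L2 m ->
  is_L2 (ft (fun x => g x * ift (fun eta => m eta * L2repr w eta) x)) /\
  FT (window_op g m w) = L2class (ft (fun x => g x * ift (fun eta => m eta * L2repr w eta) x)).
Proof.
move=> hg h2 hm; have i := mul_ift_integrable w hg hm; have l := window_op_L2 w h2 hm.
by split; [exact: (plancherel_L1L2 i l).1|exact: FT_L1L2 i l].
Qed.

Lemma bounded_seg n : bounded_symbol (@seg R n).
Proof. by split; [exact: (is_L2_seg n).1|exists 1 => x; exact: normc_seg]. Qed.

Lemma bounded_seg_abs n : bounded_symbol (fun xi => @seg R n xi * abs_symbol xi).
Proof.
split; first by apply: cmeasurableM; [exact: (is_L2_seg n).1|exact: cmeasurable_abs].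
exists n%:R => xi; rewrite normcM segE indicE !normcR normr_id.
have [/set_mem|_] := boolP (xi \in _); last by rewrite normr0 mul0r.
by rewrite /= in_itv/= -ler_norml normr1 mul1r.
Qed.

Lemma seg_comm_int g w n : tame g ->
  mult (seg n) (L2class (comm_int g w)) =
  mult (fun xi => seg n xi * abs_symbol xi) (FT (window_op g (@resolvent_symbol R) w)) -
  mult (seg n) (FT (window_op g (@abs_resolvent_symbol R) w)).
Proof.
move=> [hg h2 hE].
have [l1 e1] := FT_window_op w hg h2 (@resolvent_symbol_L2 R); have [l2 e2] := FT_window_op w hg h2 (@abs_resolvent_symbol_L2 R).
rewrite e1 e2 (mult_class (bounded_seg n) (comm_int_L2 w h2 hE).1) (mult_class (bounded_seg_abs n) l1)
  (mult_class (bounded_seg n) l2).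
rewrite -(L2classB (bounded_symbol_L2 (bounded_seg_abs n) l1) (bounded_symbol_L2 (bounded_seg n) l2)).
congr L2class; apply/funext => xi; rewrite (comm_intE w xi hg) mulrBr mulrA; reflexivity.
Qed.

(** Truncated in frequency, the commutator is a difference of two operators
    [window_op] followed by bounded ones. The tails are small in operator norm
    because [comm_weight g] is square integrable. *)
Theorem comm_int_approx g : tame g -> approx_finrank (fun w => L2class (comm_int g w)).
Proof.
move=> tg; have [hg h2 hE] := tg; have [hW _] := comm_weight_L2 h2 hE.
apply: approx_finrank_closed; first exact: comm_int_lin.
move=> e e0; set c := normc (c0 : C).
have c_ge0 : 0 <= c by exact: normc_ge0.
have d0 : 0 < e / (c + 1) by rewrite divr_gt0// ltr_wpDl.
have [N hN] := (cvgXP _ _).1 (trunc_cvgX hW) _ d0.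
exists (fun w => mult (seg N) (L2class (comm_int g w))).
  rewrite (_ : (fun w => _) = (fun w =>
    mult (fun xi => seg N xi * abs_symbol xi) (FT (window_op g (@resolvent_symbol R) w)) -
    mult (seg N) (FT (window_op g (@abs_resolvent_symbol R) w)))); last first.
    by apply/funext => w; exact: seg_comm_int.
  apply: approx_finrankB.
    apply: (approx_finrank_compl (blin_comp (mult_blin (bounded_seg_abs N)) FT_blin)).
    exact: window_op_approx h2 (@resolvent_symbol_L2 R).
  apply: (approx_finrank_compl (blin_comp (mult_blin (bounded_seg N)) FT_blin)).
  exact: window_op_approx h2 (@abs_resolvent_symbol_L2 R).
move=> w; have [hc _] := comm_int_L2 w h2 hE.
have hs := bounded_symbol_L2 (bounded_seg N) hc.
rewrite (mult_class (bounded_seg N) hc) -(L2classB hc hs).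
set K : R := c * nrm w.
have K0 : 0 <= K by rewrite mulr_ge0 ?nrm_ge0.
have ht := is_L2_trunc N hW; have hd := is_L2B ht hW.
have hK : is_L2 (fun x => K%:C * (trunc N (comm_weight g) x - comm_weight g x)) by exact: is_L2Z.
apply: (@le_trans _ _ (nrm (L2class (fun x => K%:C * (trunc N (comm_weight g) x - comm_weight g x))))); last first.
  rewrite (L2classZ _ hd) nrmZ normcR (ger0_norm K0) (L2classB ht hW) /K -mulrA mulrCA mulrC.
  rewrite ler_wpM2r ?nrm_ge0//; apply: (le_trans (ler_wpM2l c_ge0 (hN N (leqnn N)))).
  by rewrite mulrCA ler_piMr ?(ltW e0)// ler_pdivrMr ?ltr_wpDl// mul1r lerDl.
apply: nrm_class_le; [exact: is_L2B|exact: nrm_ge0|].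
rewrite (nrm_class_sqn hK); apply: sqn_le; [exact: (is_L2B hc hs).1|exact: hK.1|] => xi.
have -> : comm_int g w xi - seg N xi * comm_int g w xi = (1 - seg N xi) * comm_int g w xi.
  by rewrite mulrBl mul1r.
have -> : trunc N (comm_weight g) xi - comm_weight g xi = - ((1 - seg N xi) * comm_weight g xi).
  by rewrite mulrBl mul1r opprB.
have -> : K%:C * - ((1 - seg N xi) * comm_weight g xi) = - ((1 - seg N xi) * (K%:C * comm_weight g xi)).
  by rewrite (mulrN K%:C) [X in - X]mulrCA.
rewrite normc_opp normcM [X in _ <= X]normcM ler_wpM2l ?normc_ge0//.
rewrite [X in _ <= X]normcM normcR (ger0_norm K0).
exact: comm_int_bound.
Qed.

(** The graph of the half-Laplacian on L2 classes. It can be passed to limits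
    without a discussion of domains. *)
Definition half_laplacian_graph u w := \forall xi \ae mu, L2repr (FT w) xi = abs_symbol xi * L2repr (FT u) xi.

(** Truncated in frequency, membership in the graph becomes an equality
    between bounded operators, which is stable under limits. *)
Lemma half_laplacian_graph_segP u w : half_laplacian_graph u w <->
  forall n, mult (fun xi => seg n xi * abs_symbol xi) (FT u) = mult (seg n) (FT w).
Proof.
have hu := L2reprP (FT u); have hw := L2reprP (FT w).
have b1 n := bounded_symbol_L2 (bounded_seg_abs n) hu; have b2 n := bounded_symbol_L2 (bounded_seg n) hw.
split=> [E n|E].
  apply: L2class_ae; [exact: b1|exact: b2|].
  apply: aeP E => xi e; apply: (etrans (esym (mulrA _ _ _))).
  exact: (congr1 (fun z : C => seg n xi * z) (esym e)).
have := ae_forall_nat (fun n => L2class_inj (b1 n) (b2 n) (E n)).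
apply: aeP => xi h; have [N hN] := seg_eventually xi.
by have := h N; rewrite (hN N (leqnn N)) !mul1r; exact: esym.
Qed.

Lemma half_laplacian_graph_closed (u w : nat -> X) l m : (forall n, half_laplacian_graph (u n) (w n)) ->
  cvgX u l -> cvgX w m -> half_laplacian_graph l m.
Proof.
move=> h hu hw; apply/half_laplacian_graph_segP => n.
have c1 := cvgX_blin (blin_comp (mult_blin (bounded_seg_abs n)) FT_blin) hu.
have c2 := cvgX_blin (blin_comp (mult_blin (bounded_seg n)) FT_blin) hw.
have e : (fun k => mult (fun xi => seg n xi * abs_symbol xi) (FT (u k))) = (fun k => mult (seg n) (FT (w k))).
  by apply/funext => k; exact: ((half_laplacian_graph_segP _ _).1 (h k) n).
apply: (cvgX_unique (u := fun k => mult (seg n) (FT (w k)))) _ c2.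
exact: (eq_ind _ (fun z => cvgX z _) c1 _ e).
Qed.

(** [Lam (g v) = [Lam, g] v + g (Lam v)] for [v] in the range of the
    resolvent. *)
Lemma commutator_graph g w : tame g ->
  half_laplacian_graph (window_op g (@resolvent_symbol R) w) (FTi (L2class (comm_int g w)) + window_op g (@abs_resolvent_symbol R) w).
Proof.
move=> tg; apply/half_laplacian_graph_segP => n.
pose A := L2class (comm_int g w); pose B := window_op g (@abs_resolvent_symbol R) w.
have eR : FT (FTi A + B) = A + FT B := etrans (linD FT_lin _ _) (congr1 (fun z => z + _) (FTiK _)).
apply: (etrans _ (esym (congr1 (mult (seg n)) eR))).
apply: (etrans _ (esym (linD (mult_lin (bounded_seg n)) _ _))).
apply: (etrans _ (esym (congr1 (fun z => z + _) (seg_comm_int w n tg)))).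
exact: esym (subrK _ _).
Qed.

End Commutator.

(** * Fourier bounds for increments *)

Section CommutatorLimit.
Context {R : realType}.
Local Notation mu := (@lebesgue_measure R).
Local Notation C := R[i].
Local Notation X := (L2space R).
Local Notation cint := (@cintegral R setT).
Implicit Types (f g : R -> C) (u v w : X).

Lemma nrm_le_ae f g : is_L2 f -> is_L2 g -> (\forall x \ae mu, normc (f x) <= normc (g x)) ->
  nrm (L2class f) <= nrm (L2class g).
Proof.
move=> hf hg h; apply: nrm_class_le; [exact: hf|exact: nrm_ge0|].
rewrite (nrm_class_sqn hg); apply: ae_ge0_le_integral => //.
- by move=> x _; rewrite lee_fin sqr_ge0.
- exact: measurable_normc2 hf.1.
- by move=> x _; rewrite lee_fin sqr_ge0.
- exact: measurable_normc2 hg.1.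
- by apply: aeP h => x hx _; rewrite lee_fin lerXn2r ?nnegrE ?normc_ge0.
Qed.

(** The increments of [g] have the transforms [cexpi (h xi) - 1] times [ft g];
    divided by [h], their norms are bounded by [B], and Fatou's lemma applies
    as [h] tends to 0. *)
Lemma freq_L2 g (B : R) : cintegrable g -> is_L2 g -> 0 <= B ->
  (forall n, nrm (L2class (fun x => g (x + mesh n) - g x)) <= mesh n * B) ->
  is_L2 (freq g) /\ nrm (L2class (freq g)) <= B.
Proof.
move=> hg h2 B0 hB.
pose q n xi : C := (mesh n)^-1%:C * (cexpi (mesh n * xi) - 1).
have mft : cmeasurable (ft g) by apply: cmeasurable_ft; case/cintegrableP: hg.
have mfr : cmeasurable (freq g).
  by apply: cmeasurableM mft; apply: cmeasurable_real; exact: measurable_id.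
have S n : (sqn (fun xi => (q n xi * ft g xi)%R) <= (B ^+ 2)%:E)%E.
  pose d x := (mesh n)^-1%:C * (g (x + mesh n) - g x).
  have hs := cintegrable_shift (mesh n) hg; have hs2 := is_L2_shift (mesh n) h2.
  have hd : cintegrable d by apply: cintegrableZ; exact: cintegrableB.
  have hd2 : is_L2 d by apply: is_L2Z; exact: is_L2B.
  have e xi : ft d xi = q n xi * ft g xi.
    have e1 := ftB xi hs hg; rewrite (ft_shift _ _ hg) in e1.
    have e0 := ft_lin (mesh n)^-1%:C xi (cintegrableB hs hg) (@cintegrable0 R).
    have z0 : ft (fun _ => 0) xi = 0.
      by rewrite /ft (_ : (fun x => _) = fun _ => 0) ?cint0 ?mulr0//; apply/funext => x; rewrite mulr0.
    rewrite z0 addr0 e1 in e0.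
    apply: (etrans _ (etrans e0 _)); last by rewrite /q -mulrA mulrBl mul1r.
    by apply: (congr1 (fun h => ft h xi)); apply/funext => x; rewrite addr0.
  have [_ pl] := plancherel_L1L2 hd hd2.
  have -> : (fun xi => q n xi * ft g xi) = ft d by apply/funext => xi; rewrite e.
  rewrite pl; apply: (sqn_le_nrm hd2); rewrite (L2classZ _ (is_L2B hs2 h2)) nrmZ normcR.
  rewrite ger0_norm ?invr_ge0 ?(ltW (mesh_gt0 n))// ler_pdivrMl ?mesh_gt0//.
have F : (sqn (fun xi => 'i * freq g xi)%R <= (B ^+ 2)%:E)%E.
  apply: (@sqn_fatou R (fun n xi => q n xi * ft g xi)) => //.
  - move=> n; apply: cmeasurableM mft; apply: cmeasurableM; first exact: cmeasurable_cst.
    by apply: cmeasurableB; [exact: cmeasurable_cexpi_lin|exact: cmeasurable_cst].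
  - by apply: cmeasurableM; [exact: cmeasurable_cst|exact: mfr].
  - apply: aeW => xi; have hq := cexpi_quotient xi.
    rewrite (_ : (fun n => _) = fun n => normc (q n xi - 'i * xi%:C) * normc (ft g xi)); last first.
      apply/funext => n; rewrite -normcM; apply: (congr1 (@normc R)).
      rewrite (mulrBl (ft g xi) (q n xi)); congr (_ - _); exact: mulrA.
    rewrite -[X in _ --> X](mul0r (normc (ft g xi))); apply: cvgM hq _; exact: cvg_cst.
rewrite (sqnZ _ mfr) normc_i expr1n mul1e in F.
have h : is_L2 (freq g) by apply/is_L2P; split; [exact: mfr|apply: (le_lt_trans F); rewrite ltry].
by split; [exact: h|exact: nrm_class_le].
Qed.

(** * Commutators with bounded functions *)

(** Equal to 1 up to 1 and to 0 from 2 on, with slope -1 in between. *)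
Definition cut (t : R) : R := Num.max 0 (Num.min 1 (2 - t)).

Lemma cut_ge0 t : 0 <= cut t. Proof. by rewrite le_max lexx. Qed.
Lemma cut_le1 t : cut t <= 1. Proof. by rewrite ge_max ler01 ge_min lexx. Qed.

Lemma cut_lipschitz (s t : R) : `|cut s - cut t| <= `|s - t|.
Proof.
rewrite /cut; have := ler_norm (s - t); have := ler_norm (t - s); rewrite distrC => h1 h2.
rewrite ler_norml; case: (leP 1 (2 - s)) => a; case: (leP 1 (2 - t)) => b;
  rewrite ?(max_r ler01);
  do ?[case: (leP 0 (2 - _)) => ?]; apply/andP; split; lra.
Qed.

Lemma cut1 t : t <= 1 -> cut t = 1.
Proof. by move=> h; rewrite /cut min_l ?max_r//; lra. Qed.

Lemma cut0 t : 2 <= t -> cut t = 0.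
Proof. by move=> h; rewrite /cut min_r ?max_l//; lra. Qed.

Lemma continuous_cut : continuous cut.
Proof.
move=> t; apply/cvgrPdist_le => e e0; near=> s.
apply: (le_trans (cut_lipschitz t s)).
by near: s; apply: cvgr_dist_le.
Unshelve. all: by end_near.
Qed.

Definition chi (n : nat) (x : R) : R := cut (`|x| / n.+1%:R).

Lemma chi_bound n x : `|chi n x| <= 1.
Proof. by rewrite ger0_norm ?cut_ge0// cut_le1. Qed.

Lemma chi1 n x : `|x| <= n.+1%:R -> chi n x = 1.
Proof. by move=> h; apply: cut1; rewrite ler_pdivrMr ?mul1r. Qed.

Lemma chi0 n x : 2 * n.+1%:R <= `|x| -> chi n x = 0.
Proof. by move=> h; apply: cut0; rewrite ler_pdivlMr. Qed.

Lemma continuous_chi n : continuous (chi n).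
Proof.
move=> x; apply: (@cvg_comp _ _ _ (fun x => `|x| / n.+1%:R) cut); last exact: continuous_cut.
by apply: cvgM; [exact: norm_continuous|exact: cvg_cst].
Qed.

Lemma measurable_chi n : measurable_fun [set: R] (chi n).
Proof. exact: continuous_measurable_fun (@continuous_chi n). Qed.

(** The derivative of [chi n] is at most [1 / (n+1)] and vanishes outside an
    interval of length [6 (n+1)] that also contains the increments of length
    at most 1; this bounds its L2 norm. *)
Definition rho (n : nat) : R := Num.sqrt (6 / n.+1%:R).

Lemma rho_ge0 n : 0 <= rho n. Proof. exact: sqrtr_ge0. Qed.

Lemma chi_L2 n : is_L2 (fun x => (chi n x)%:C : C).
Proof.
apply: compact_support_L2; first exact: continuous_chi.
by exists (2 * n.+1%:R) => x /ltW; exact: chi0.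
Qed.

Lemma chi_increment n (h : R) : 0 < h -> h <= 1 ->
  nrm (L2class (fun x => (chi n (x + h))%:C - (chi n x)%:C : C)) <= h * rho n.
Proof.
move=> h0 h1; have hc := chi_L2 n; have hs := is_L2_shift h hc.
have hd := is_L2B hs hc.
have n0 : 0 < n.+1%:R :> R by rewrite ltr0n.
have n1 : 1 <= n.+1%:R :> R by rewrite ler1n.
(* an increment of length at most 1 of a function supported in |x| <= 2 (n+1) *)
pose L : R := 3 * n.+1%:R.
have L0 : 0 <= L by rewrite mulr_ge0.
have [b2 bE] := is_L2_box (- L) (addr_ge0 L0 L0).
pose k : R := h / n.+1%:R.
have k0 : 0 <= k by rewrite divr_ge0 ?ltW.
apply: nrm_class_le; [exact: hd|by rewrite mulr_ge0 ?rho_ge0 ?ltW|].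
apply: (@le_trans _ _ (sqn (fun x => k%:C * (box (L + L) (x - - L))%:C))).
  apply: sqn_le; [exact: hd.1|exact: (is_L2Z _ b2).1|] => x.
  rewrite -rmorphB normcM !normcR (ger0_norm k0) (ger0_norm (box_ge0 _ _)) box_if opprK.
  have [hx|hx] := leP `|x| L.
    move: (hx); rewrite ler_norml => /andP[x1 x2].
    rewrite (_ : 0 <= x + L <= L + L) ?mulr1; last by lra.
    apply: (le_trans (cut_lipschitz _ _)); rewrite -mulrBl normrM normfV (ger0_norm (ltW n0)).
    rewrite /k ler_wpM2r ?invr_ge0 ?(ltW n0)//; apply: (le_trans (ler_dist_dist _ _)).
    by rewrite addrAC subrr add0r gtr0_norm.
  have hx2 : 2 * n.+1%:R <= `|x| by apply: le_trans (ltW hx); rewrite /L; lra.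
  have hx3 : 2 * n.+1%:R <= `|x + h|.
    have := ler_normB (x + h) h; rewrite addrK (gtr0_norm h0) => t.
    have := le_trans (ltW hx) t; rewrite /L; lra.
  rewrite (chi0 hx2) (chi0 hx3) subrr normr0; case: ifP => _; first by rewrite mulr1.
  by rewrite mulr0.
rewrite sqnZ ?bE; last exact: b2.1.
rewrite -EFinM lee_fin normcR (ger0_norm k0) !exprMn sqr_sqrtr; last by rewrite divr_ge0.
rewrite le_eqVlt; apply/orP; left; apply/eqP.
by rewrite /k /L; field; rewrite gt_eqF.
Qed.

Lemma rho_cvg (e : R) : 0 < e -> exists N, forall n, (N <= n)%N -> rho n <= e.
Proof.
move=> e0; exists (Num.truncn (6 / e ^+ 2)) => n hn.
rewrite -(@ler_pXn2r _ 2) ?nnegrE ?rho_ge0 ?(ltW e0)// sqr_sqrtr; last by rewrite divr_ge0.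
rewrite ler_pdivrMr ?ltr0n// mulrC -ler_pdivrMr ?exprn_gt0//.
apply: (le_trans (ltW (truncnS_gt _))); by rewrite ler_nat.
Qed.

Variables (s : R -> R) (v : R -> C).
Hypothesis (ms : measurable_fun [set: R] s) (s1 : forall x, `|s x| <= 1) (hv : is_L2 v).
(* v plays the role of a derivative of s; only its windows at the mesh lengths
   matter *)
Hypothesis s_window : forall n, \forall z \ae mu, `|s (z + mesh n) - s z| <= normc (window (mesh n) v z).

Definition sC : R -> C := fun x => (s x)%:C.

Definition scut (n : nat) : R -> C := fun x => (chi n x)%:C * sC x.

Lemma sC_bounded : bounded_symbol sC.
Proof. by split; [exact: cmeasurable_real|exists 1 => x; rewrite normcR]. Qed.

Lemma scut_L2 n : is_L2 (scut n).
Proof.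
have := bounded_symbol_L2 sC_bounded (chi_L2 n); congr is_L2.
by apply/funext => x; rewrite mulrC.
Qed.

Lemma scut_integrable n : cintegrable (scut n).
Proof.
have L0 : 0 <= 2 * n.+1%:R :> R by rewrite mulr_ge0.
have [b2 _] := is_L2_box (- (2 * n.+1%:R)) (addr_ge0 L0 L0).
have := L2_mul_integrable b2 (scut_L2 n); congr cintegrable; apply/funext => x.
rewrite box_if opprK; case: ifP => hx; first by rewrite mul1r.
rewrite /scut chi0 ?mul0r ?mulr0//.
have [h|/ltW//] := leP (2 * n.+1%:R) `|x|; first by [].
rewrite ler_norml => /andP[a b]; move: hx.
by rewrite (_ : 0 <= x + 2 * n.+1%:R <= _)//; lra.
Qed.

Definition tail (N : nat) : R -> C := fun x => v x - trunc N v x.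

Lemma tail_L2 N : is_L2 (tail N).
Proof. by apply: is_L2B => //; exact: is_L2_trunc. Qed.

Lemma window_tail N (h z : R) : 0 < h -> h <= 1 -> N.+1%:R < `|z| -> window h v z = window h (tail N) z.
Proof.
move=> h0 h1 hz; apply: eq_cint => x; rewrite box_if; case: ifP => hx; last by rewrite !mul0r.
congr (_ * _); rewrite /tail /trunc segE indicE memNset ?mul0r ?subr0//= in_itv/= -ler_norml.
move=> hxN; move: hz; rewrite ltNge => /negP; apply.
have -> : z = x - (x - z) by ring.
apply: (le_trans (ler_normB _ _)); rewrite -natr1 lerD//.
by case/andP: hx => a b; rewrite ger0_norm// (le_trans b).
Qed.

(** The increment of the product splits into [psi] times an increment of [s]
    and [s] times an increment of [psi]. *)
Lemma scut_increment_bound (psi : R -> R) (w : R -> C) (h r : R) :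
  measurable_fun [set: R] psi -> is_L2 (fun x => (psi x)%:C : C) -> is_L2 w -> 0 < h ->
  (\forall z \ae mu, `|psi z * (s (z + h) - s z)| <= normc (window h w z)) ->
  nrm (L2class (fun x => (psi (x + h))%:C - (psi x)%:C : C)) <= h * r ->
  nrm (L2class (fun x => (psi (x + h))%:C * sC (x + h) - (psi x)%:C * sC x)) <=
  h * (nrm (L2class w) + r).
Proof.
move=> mpsi hpsi hw h0 hpt hr.
have hsh := is_L2_shift h hpsi.
have hd := is_L2B hsh hpsi.
have bs := sC_bounded.
have bsh : bounded_symbol (fun x => sC (x + h)).
  by split; [exact: cmeasurable_shift bs.1|exists 1 => x; rewrite normcR].
have h1 : is_L2 (fun x => (psi x * (s (x + h) - s x))%:C : C).
  have := is_L2B (bounded_symbol_L2 bsh hpsi) (bounded_symbol_L2 bs hpsi).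
  congr is_L2; apply/funext => x; rewrite /sC -!rmorphM -rmorphB; congr (_%:C); ring.
have h2 := bounded_symbol_L2 bsh hd.
have -> : L2class (fun x => (psi (x + h))%:C * sC (x + h) - (psi x)%:C * sC x) =
    L2class (fun x => (psi x * (s (x + h) - s x))%:C : C) +
    L2class (fun x => sC (x + h) * ((psi (x + h))%:C - (psi x)%:C)).
  rewrite -(L2classD h1 h2); congr L2class; apply/funext => x.
  rewrite /sC -!rmorphM -!rmorphB -rmorphM -rmorphD; congr (_%:C); ring.
apply: (le_trans (nrmD _ _)); rewrite mulrDr lerD//.
  have hW := is_L2_window (ltW h0) hw.
  apply: (@le_trans _ _ (nrm (L2class (window h w)))).
    by apply: (nrm_le_ae h1 hW); apply: aeP hpt => x; rewrite normcR.
  apply: nrm_class_le; [exact: hW|by rewrite mulr_ge0 ?nrm_ge0 ?ltW|].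
  by rewrite exprMn (EFinM (h ^+ 2)) (nrm_class_sqn hw); exact: sqn_window (ltW h0) hw.
apply: le_trans hr; apply: (nrm_le_ae h2 hd); apply: aeW => x.
by rewrite normcM ler_piMl ?normc_ge0// normcR.
Qed.

Lemma scut_tame n : tame (scut n).
Proof.
split; [exact: scut_integrable|exact: scut_L2|].
apply: (freq_L2 (scut_integrable n) (scut_L2 n) (B := nrm (L2class v) + rho n) _ _).1.
  by rewrite addr_ge0 ?nrm_ge0 ?rho_ge0.
move=> k; apply: (@scut_increment_bound (chi n) v (mesh k) (rho n)).
- exact: measurable_chi.
- exact: chi_L2.
- exact: hv.
- exact: mesh_gt0.
- apply: aeP (s_window k) => z hz; rewrite normrM; apply: le_trans hz.
  by rewrite ler_piMl// chi_bound.
- exact: chi_increment (mesh_gt0 k) (mesh_le1 k).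
Qed.

(** The difference [chi n - chi m] vanishes on [- N, N], so that only the tail
    of [v] and the small derivatives of the cutoffs contribute. *)
Lemma scutB_freq N n m : (N <= n)%N -> (N <= m)%N ->
  is_L2 (freq (fun x => scut n x - scut m x)) /\
  nrm (L2class (freq (fun x => scut n x - scut m x))) <= nrm (L2class (tail N)) + (rho n + rho m).
Proof.
move=> hn hm; pose psi x := chi n x - chi m x.
have hpsi : is_L2 (fun x => (psi x)%:C : C).
  have := is_L2B (chi_L2 n) (chi_L2 m); congr is_L2; apply/funext => x; rewrite -rmorphB; reflexivity.
have e : (fun x => scut n x - scut m x) = (fun x => (psi x)%:C * sC x).
  by apply/funext => x; rewrite /scut /psi rmorphB mulrBl.
have hi := cintegrableB (scut_integrable n) (scut_integrable m).
have h2 := is_L2B (scut_L2 n) (scut_L2 m).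
apply: (freq_L2 hi h2); first by rewrite !addr_ge0 ?nrm_ge0 ?rho_ge0.
move=> k; have k0 : 0 < mesh k :> R := mesh_gt0 k; have k1 : mesh k <= 1 :> R := mesh_le1 k.
have -> : (fun x => scut n (x + mesh k) - scut m (x + mesh k) - (scut n x - scut m x)) =
   (fun x => (psi (x + mesh k))%:C * sC (x + mesh k) - (psi x)%:C * sC x).
  apply/funext => x; have e1 := congr1 (fun h => h (x + mesh k)) e; have e2 := congr1 (fun h => h x) e.
  by rewrite -e1 -e2.
apply: (@scut_increment_bound psi (tail N) (mesh k) (rho n + rho m)).
- by apply: measurable_funB; exact: measurable_chi.
- exact: hpsi.
- exact: tail_L2.
- exact: k0.
- apply: aeP (s_window k) => z hz; rewrite normrM.
  have [zN|zN] := leP `|z| N.+1%:R.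
    rewrite /psi !chi1 ?subrr ?normr0 ?mul0r ?normc_ge0//; apply: (le_trans zN); by rewrite ler_nat.
  rewrite -(window_tail k0 k1 zN); apply: le_trans hz; rewrite ler_piMl// ler_norml /psi.
  have := cut_ge0 (`|z| / n.+1%:R); have := cut_le1 (`|z| / n.+1%:R).
  have := cut_ge0 (`|z| / m.+1%:R); have := cut_le1 (`|z| / m.+1%:R).
  by rewrite -/(chi n z) -/(chi m z) => ? ? ? ?; apply/andP; split; lra.
- have hA := is_L2B (is_L2_shift (mesh k) (chi_L2 n)) (chi_L2 n).
  have hB := is_L2B (is_L2_shift (mesh k) (chi_L2 m)) (chi_L2 m).
  have -> : L2class (fun x => (psi (x + mesh k))%:C - (psi x)%:C : C) =
     L2class (fun x => (chi n (x + mesh k))%:C - (chi n x)%:C : C) -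
     L2class (fun x => (chi m (x + mesh k))%:C - (chi m x)%:C : C).
    rewrite -(L2classB hA hB); congr L2class; apply/funext => x.
    by rewrite /psi -!rmorphB; congr (_%:C); ring.
  apply: (le_trans (nrmBD _ _)); rewrite mulrDr lerD//; exact: chi_increment.
Qed.

Lemma comm_intB g1 g2 w : tame g1 -> tame g2 -> is_L2 (freq (fun x => g1 x - g2 x)) ->
  L2class (comm_int g1 w) - L2class (comm_int g2 w) = L2class (comm_int (fun x => g1 x - g2 x) w).
Proof.
move=> [i1 l1 f1] [i2 l2 f2] f3.
rewrite -(L2classB (comm_int_L2 w l1 f1).1 (comm_int_L2 w l2 f2).1).
congr L2class; apply/funext => xi; rewrite /comm_int -mulrBr; congr (_ * _).
have [k1 _] := comm_kernel_L2 xi l1 f1; have [k2 _] := comm_kernel_L2 xi l2 f2.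
apply: (etrans (esym (cintB (L2_mul_integrable k1 (L2reprP w)) (L2_mul_integrable k2 (L2reprP w))))).
apply: eq_cint => eta; rewrite /comm_kernel (ftB _ i1 i2) -mulrBl; congr (_ * _).
by rewrite mulrBr mulrBl.
Qed.

Definition comm_n n w : X := L2class (comm_int (scut n) w).

Lemma comm_n_cauchy (e : R) : 0 < e -> exists N, forall n m w, (N <= n)%N -> (N <= m)%N ->
  nrm (comm_n n w - comm_n m w) <= e * nrm w.
Proof.
move=> e0; set c := normc (c0 : C); set r := nrm (L2class (@resolvent_symbol R)).
have c_ge0 : 0 <= c by exact: normc_ge0.
have r0 : 0 <= r by exact: nrm_ge0.
have k0 : 0 < c * r + 1 by rewrite ltr_wpDl// mulr_ge0.
(* one third for the tail of v and for each of the two cutoffs *)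
pose d := e / (3 * (c * r + 1)).
have d0 : 0 < d by rewrite divr_gt0// mulr_gt0.
have [N1 h1] := (cvgXP _ _).1 (trunc_cvgX hv) d d0.
have [N2 h2] := rho_cvg d0.
exists (maxn N1 N2) => n m w; rewrite !geq_max => /andP[n1 n2] /andP[m1 m2].
have [hf bf] := scutB_freq n1 m1.
have hi2 := is_L2B (scut_L2 n) (scut_L2 m).
rewrite /comm_n (comm_intB w (scut_tame n) (scut_tame m) hf).
apply: (le_trans (comm_int_L2 w hi2 hf).2); rewrite ler_wpM2r ?nrm_ge0// -/c -/r mulrAC.
have bt : nrm (L2class (tail N1)) <= d.
  by rewrite (L2classB hv (is_L2_trunc N1 hv)) nrmB; exact: h1.
have bb : nrm (L2class (freq (fun x => scut n x - scut m x))) <= 3 * d.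
  by apply: (le_trans bf); have := h2 n n2; have := h2 m m2; lra.
apply: (le_trans (ler_wpM2l (mulr_ge0 c_ge0 r0) bb)).
have -> : c * r * (3 * d) = e * ((c * r) / (c * r + 1)).
  by rewrite /d; field; rewrite gt_eqF.
by rewrite ler_piMr ?(ltW e0)// ler_pdivrMr// mul1r lerDl.
Qed.

Lemma scut_cvgX f : is_L2 f -> cvgX (fun n => L2class (fun x => scut n x * f x)) (L2class (fun x => sC x * f x)).
Proof.
move=> hf; have hs := bounded_symbol_L2 sC_bounded hf.
have hb n : bounded_symbol (scut n).
  split; first exact: (scut_L2 n).1.
  exists 1 => x; rewrite normcM !normcR -[X in _ <= X]mulr1 ler_pM ?normr_ge0 ?chi_bound//.
have hn n := bounded_symbol_L2 (hb n) hf.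
pose h n x := scut n x * f x - sC x * f x.
have h2 n : is_L2 (h n) by exact: is_L2B.
have hc : (fun n => sqn (h n)) @ \oo --> 0%E.
  apply: (@sqn_dominated _ h (fun x => (2 : R)%:C * f x)).
  - by move=> n; exact: (h2 n).1.
  - exact: is_L2Z.
  - move=> n x; rewrite /h -mulrBl !normcM ler_wpM2r ?normc_ge0// normcR ger0_norm//.
    apply: (le_trans (le_normcD _ _)); rewrite normc_opp.
    have [_ [M hM]] := hb n.
    rewrite normcM !normcR; have := chi_bound n x; have := s1 x; have := normr_ge0 (s x); nra.
  - apply: aeW => x.
    apply: (@cvg_trans _ ((fun _ : nat => 0 : R) @ \oo)); last exact: cvg_cst.
    apply: near_eq_cvg; exists (Num.truncn `|x|) => // n Nn.
    rewrite /h /scut chi1 ?mul1r ?subrr ?normc0//.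
    by apply: (le_trans (ltW (truncnS_gt _))); rewrite ler_nat.
have hq : (fun n => nrm (L2class (h n)) ^+ 2) @ \oo --> (0 : R).
  have : (fun n => (nrm (L2class (h n)) ^+ 2)%:E) @ \oo --> 0%E.
    by apply: cvg_trans hc; apply: near_eq_cvg; apply: nearW => n; rewrite nrm_class_sqn.
  by move/fine_cvgP => [].
apply/cvgXP => e e0; have /cvgr0Pnorm_le hq' := hq.
have [N _ hN] := hq' (e ^+ 2) (exprn_gt0 _ e0).
exists N => n Nn; have := hN n Nn; rewrite /= ger0_norm ?sqr_ge0// => hh.
rewrite -(L2classB (hn n) hs).
by rewrite -(@ler_pXn2r _ 2) ?nnegrE ?nrm_ge0 ?(ltW e0).
Qed.

(** The sine of a wall tends to 1 in modulus and is not square integrable, but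
    the commutators with its cutoffs form a Cauchy sequence in operator norm,
    because they are controlled by [freq]; their limit is the commutator with
    [s] since the graph of the half-Laplacian is closed. *)
Theorem commutator_limit : exists2 K : X -> X, approx_finrank K &
  forall u, half_laplacian_graph (mult sC (resolvent0 u)) (K u + mult sC (half_laplacian_resolvent u)).
Proof.
have hlim w : exists l, cvgX (fun n => comm_n n w) l.
  apply: cauchy_cvgX => e e0.
  have k0 : 0 < nrm w + 1 by rewrite ltr_wpDl ?nrm_ge0.
  have [N hN] := comm_n_cauchy (divr_gt0 e0 k0); exists N => n m hn hm.
  apply: (le_trans (hN n m w hn hm)).
  by rewrite mulrAC ler_pdivrMr// ler_wpM2l ?(ltW e0)// lerDl.
have [T hT] := choice hlim.
have lT : lin T.
  move=> a u w; apply: (cvgX_unique (hT _)).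
  have := cvgX_lin a (hT u) (hT w); rewrite /cvgX; apply: cvg_trans; apply: near_eq_cvg.
  apply: nearW => n; apply: (congr1 (fun z => nrm (z - (a *: T u + T w)))).
  have [_ l f] := scut_tame n; exact: esym (comm_int_lin l f a u w).
have aT : approx_finrank T.
  apply: approx_finrank_closed lT _ => e e0; have [N hN] := comm_n_cauchy e0.
  exists (comm_n N); first exact: comm_int_approx (scut_tame N).
  move=> w; apply/ler_addgt0Pr => d d0; have [M hM] := (cvgXP _ _).1 (hT w) d d0.
  apply: (le_trans (nrm_tri (comm_n (maxn N M) w) _ _)); rewrite addrC lerD//.
    by apply: hN; [exact: leq_maxl|exact: leqnn].
  by rewrite nrmB hM// leq_maxr.
exists (fun u => FTi (T (FT u))).
  exact: (approx_finrank_compl FTi_blin (approx_finrank_compr FT_blin aT)).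
move=> u; set w := FT u; have hw := L2reprP w.
have i1 := L2_mul_integrable (@resolvent_symbol_L2 R) hw; have i2 := L2_mul_integrable (@abs_resolvent_symbol_L2 R) hw.
have l1 := bounded_symbol_L2 (@bounded_resolvent_symbol R) hw; have l2 := bounded_symbol_L2 (@bounded_abs_resolvent_symbol R) hw.
have e1 : mult sC (resolvent0 u) = L2class (fun x => sC x * ift (fun xi => resolvent_symbol xi * L2repr w xi) x).
  by rewrite -(mult_class sC_bounded (is_L2_ift i1 l1)) -(FTi_L1L2 i1 l1).
have e2 : mult sC (half_laplacian_resolvent u) = L2class (fun x => sC x * ift (fun xi => abs_resolvent_symbol xi * L2repr w xi) x).
  by rewrite -(mult_class sC_bounded (is_L2_ift i2 l2)) -(FTi_L1L2 i2 l2).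
apply: (eq_ind_r (fun z => half_laplacian_graph z (FTi (T w) + mult sC (half_laplacian_resolvent u))) _ e1).
apply: (eq_ind_r (fun z => half_laplacian_graph _ (FTi (T w) + z)) _ e2).
apply: (half_laplacian_graph_closed (fun n => commutator_graph w (scut_tame n))).
  exact: (scut_cvgX (is_L2_ift i1 l1)).
exact: (cvgXD (cvgX_blin FTi_blin (hT w)) (scut_cvgX (is_L2_ift i2 l2))).
Qed.

End CommutatorLimit.

(** * The linearization at the wall *)

Section NeelWallOperators.
Context {R : realType}.
Local Notation mu := (@lebesgue_measure R).
Local Notation C := R[i].
Local Notation X := (L2space R).
Implicit Types (f g : R -> C) (u v w : X) (theta : R -> R).

(** The terms of the energy are nonnegative, hence all finite. *)
Lemma finite_energy theta : admissible_phase theta -> (energy theta < +oo)%E ->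
  is_L2 (cosC theta) /\ is_L2 (phase_derivative theta).
Proof.
move=> [_ ct [w wd] _ _] hE.
have mt : measurable_fun [set: R] theta by exact: continuous_measurable_fun.
have mc : cmeasurable (cosC theta).
  by apply: cmeasurable_real; apply: measurableT_comp mt; apply: continuous_measurable_fun;
    exact: continuous_cos.
have mp : cmeasurable (phase_derivative theta) by have [_ /locint_cmeas] := weak_derivative_spec wd.
have sq0 (x : \bar R) : (0 <= x -> 0 <= x ^+ 2)%E by move=> x0; exact: expe_ge0.
have p0 := sq0 _ (L2norm_ge0 (phase_derivative theta)).
have q0 := sq0 _ (L2norm_ge0 (cosC theta)).
have d0 := sq0 _ (L2norm_ge0 (fun xi => (Num.sqrt `|xi|)%:C * fourier (cosC theta) xi)).
have fin (x : \bar R) : (0 <= x -> x ^+ 2 < +oo -> x < +oo)%E.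
  by case: x => [r _ _|_|//]; rewrite ?ltry// expeS expe1 mulyy.
move: hE; rewrite /energy; set S := (_ + _)%E => hE.
have S0 : (0 <= S)%E by rewrite !adde_ge0.
have Sfin : (S < +oo)%E.
  case: S hE S0 => [r _ _|h _|//]; first exact: ltry.
  by move: h; rewrite gt0_muley ?ltxx// lte_fin invr_gt0.
split; split=> //; apply: fin; rewrite ?L2norm_ge0//; apply: (le_lt_trans _ Sfin).
- by rewrite /S leeDr// adde_ge0.
- by rewrite /S -addeA leeDl// adde_ge0.
Qed.

Lemma half_laplacian_of_graph f w : is_L2 f -> half_laplacian_graph (L2class f) w ->
  L2class (half_laplacian f) = w.
Proof.
move=> hf hw; apply: (can_inj (@FTK R)).
have h : is_L2 (fun xi => `|xi|%:C * hat f xi).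
  apply: (is_L2_ae _ _ (L2reprP (FT w))); last exact: hw.
  exact: cmeasurableM cmeasurable_abs (L2reprP _).1.
apply: (etrans (half_laplacian_hat hf h)); apply: L2classP h _.
by apply: aeP hw => xi ->.
Qed.

Lemma mult_FTi_window a m w : is_L2 a -> is_L2 m -> bounded_symbol m ->
  is_L2 (fun x => a x * L2repr (FTi (mult m w)) x) /\
  mult a (FTi (mult m w)) = window_op a m w.
Proof.
move=> ha hm bm; have hw := L2reprP w; have ho := window_op_L2 w ha hm.
have i := L2_mul_integrable hm hw; have l := bounded_symbol_L2 bm hw.
have e := L2classK (is_L2_ift i l); rewrite -(FTi_L1L2 i l) in e.
have h : is_L2 (fun x => a x * L2repr (FTi (mult m w)) x).
  apply: (is_L2_ae _ _ ho); first exact: cmeasurableM ha.1 (L2reprP _).1.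
  by apply: aeP e => x ->.
split; first exact: h.
by apply: (L2class_ae h ho); apply: aeP e => x ->.
Qed.

Section Phase.
Variable theta : R -> R.
Hypothesis adm : admissible_phase theta.
Hypothesis hE : (energy theta < +oo)%E.

Let mt : measurable_fun [set: R] theta.
Proof. by case: adm => _ ct _ _ _; exact: continuous_measurable_fun. Qed.

Let ms : measurable_fun [set: R] (fun x => sin (theta x)).
Proof. by apply: measurableT_comp mt; apply: continuous_measurable_fun; exact: continuous_sin. Qed.

Let mc : measurable_fun [set: R] (fun x => cos (theta x)).
Proof. by apply: measurableT_comp mt; apply: continuous_measurable_fun; exact: continuous_cos. Qed.

Let s1 x : `|sin (theta x)| <= 1.
Proof. by rewrite ler_norml sin_geN1 sin_le1. Qed.

Let bs : bounded_symbol (sinC theta).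
Proof. by split; [exact: cmeasurable_real ms|exists 1 => x; rewrite normcR]. Qed.

Let bc : bounded_symbol (cosC theta).
Proof.
split; [exact: cmeasurable_real mc|exists 1 => x]; rewrite normcR ler_norml.
by rewrite cos_geN1 cos_le1.
Qed.

(** The sine contracts the increments of [theta]. *)
Lemma sin_increment n : \forall z \ae mu,
  `|sin (theta (z + mesh n)) - sin (theta z)| <= normc (window (mesh n) (phase_derivative theta) z).
Proof.
have [_ _ [w wd] _ _] := adm.
have := weak_derivative_window (weak_derivative_spec wd) (mesh_gt0 n); apply: aeP => z e.
apply: (le_trans (sin_lipschitz _ _)); rewrite -normcR rmorphB.
rewrite le_eqVlt; apply/orP; left; apply/eqP; exact: (congr1 (@normc R) e).
Qed.

Lemma c_coef_L2 : is_L2 (c_coef theta).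
Proof.
have [hc _] := finite_energy adm hE.
exact: bounded_symbol_L2 bc (is_L2D hc (half_laplacian_L2 _)).
Qed.

(** By [c^2 + s^2 = 1] the operator [T] is [c^2 (1 + Lam) - s [Lam, s] +
    c_coef] after the resolvent; in the first and in the last term a square
    integrable function multiplies a Fourier multiplier with square integrable
    symbol, and [commutator_limit] covers the second. *)
Theorem Linfty_sub_L_approx_finrank : exists2 T : X -> X, approx_finrank T &
  forall v, op_fun (op_L theta) (resolvent0 v) = op_fun (op_Linfty R) (resolvent0 v) - T v.
Proof.
have [hc hp] := finite_energy adm hE.
have [K aK hK] := commutator_limit ms s1 hp sin_increment.
pose c := cosC theta; pose s := sinC theta; pose cc := c_coef theta.
have hcc : is_L2 cc by exact: c_coef_L2.
pose T v := mult c (window_op c (@resolvent_symbol R) (FT v) + window_op c (@abs_resolvent_symbol R) (FT v)) - mult s (K v)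
  + window_op cc (@resolvent_symbol R) (FT v).
exists T.
  apply: approx_finrankD; last exact: approx_finrank_compr FT_blin (window_op_approx hcc (@resolvent_symbol_L2 R)).
  apply: approx_finrankB; last exact: approx_finrank_compl (mult_blin bs) aK.
  apply: (approx_finrank_compl (mult_blin bc)).
  by apply: approx_finrankD; apply: (approx_finrank_compr FT_blin); apply: window_op_approx => //;
    [exact: resolvent_symbol_L2|exact: abs_resolvent_symbol_L2].
move=> v; rewrite Linfty_resolvent0.
have [hw Ew] := second_derivative_resolvent0 v.
set f := L2repr (resolvent0 v) in hw Ew *; set w := weak_derivative (weak_derivative f) in hw Ew *.
have hf : is_L2 f by exact: L2reprP.
pose fs : R -> C := fun x => f x * sinC theta x.
have efs : fs = fun x => sinC theta x * f x by apply/funext => x; exact: mulrC.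
have hfs : is_L2 fs by rewrite efs; exact: bounded_symbol_L2 bs hf.
have cfs : L2class fs = mult s (resolvent0 v) by exact: (congr1 (@L2class R) efs).
have hl := half_laplacian_L2 fs.
have el : L2class (half_laplacian fs) = K v + mult s (half_laplacian_resolvent v).
  by apply: (half_laplacian_of_graph hfs); apply: (eq_ind_r (fun z => half_laplacian_graph z _) (hK v) cfs).
have hg := is_L2D hfs hl.
have hsg := bounded_symbol_L2 bs hg.
have [hcf ecf] := mult_FTi_window (FT v) hcc (@resolvent_symbol_L2 R) (@bounded_resolvent_symbol R).
have [_ ewc1] := mult_FTi_window (FT v) hc (@resolvent_symbol_L2 R) (@bounded_resolvent_symbol R).
have [_ ewc2] := mult_FTi_window (FT v) hc (@abs_resolvent_symbol_L2 R) (@bounded_abs_resolvent_symbol R).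
have pyth u : mult s (mult s u) + mult c (mult c u) = u.
  rewrite (mult_comp u bs bs) (mult_comp u bc bc).
  have hu := L2reprP u.
  rewrite /mult -(L2classD (bounded_symbol_L2 (bounded_symbolM bs bs) hu) (bounded_symbol_L2 (bounded_symbolM bc bc) hu)).
  rewrite -[RHS]L2class_repr; congr L2class; apply/funext => x.
  rewrite -mulrDl /s /c /sinC /cosC -!rmorphM -rmorphD -!expr2 addrC cos2Dsin2 mul1r; reflexivity.
change (L2class (fun x => - w x + sinC theta x * (fs x + half_laplacian fs x) - cc x * f x) = - v - T v).
rewrite (L2classB (is_L2D (is_L2N hw) hsg) hcf) (L2classD (is_L2N hw) hsg) (L2classN hw) Ew.
have -> : L2class (fun x => cc x * f x) = window_op cc (@resolvent_symbol R) (FT v) by exact: ecf.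
rewrite -(mult_class bs hg) (L2classD hfs hl) cfs el /T -ewc1 -ewc2.
have alg (x r l s_r s_l c_r c_l k o : X) : s_r + c_r = r -> s_l + c_l = l ->
    - (x + r + l) + (s_r + (k + s_l)) - o = - x - (c_r + c_l - k + o).
  by move=> <- <-; zmodule.
have lins := mult_lin bs; have linc := mult_lin bc.
have e1 := pyth (resolvent0 v); have e2 := pyth (half_laplacian_resolvent v).
rewrite (linD lins (mult s (resolvent0 v))) (linD lins (K v)) (linD linc (mult c (resolvent0 v))).
exact: (alg _ _ _ _ _ _ _ _ _ e1 e2).
Qed.
End Phase.

Section SpectrumTransfer.
Variables (P S : operator X) (T : X -> X).
Hypotheses (domP : op_dom P = range (@resolvent0 R)) (domS : op_dom S = range (@resolvent0 R)).
Hypotheses (aT : approx_finrank T) (PR0 : forall v, op_fun P (resolvent0 v) = - v).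
Hypothesis (SR0 : forall v, op_fun S (resolvent0 v) = op_fun P (resolvent0 v) - T v).

(** After composition with [resolvent0] the two shifted operators differ by [T], and
    subtracting [T] or [- T] preserves the index 0. *)
Lemma essential_spectrum_finrank_perturbation : essential_spectrum S = essential_spectrum P.
Proof.
have iR := @resolvent0_inj R; have lR := (@resolvent0_blin R).1.
apply/funext => l; apply/propext.
pose F v : X := - v - l *: resolvent0 v.
have bF : blin F by exact: blinB (blinN blin_id) (blinZ l resolvent0_blin).
have bG : blin (fun v => F v - T v) by exact: blinB bF (approx_finrank_blin aT).
have eF : op_fun (op_shift P l) \o resolvent0 = F.
  by apply/funext => v /=; rewrite PR0.
have eG : op_fun (op_shift S l) \o resolvent0 = fun v => F v - T v.
  by apply/funext => v /=; rewrite SR0 PR0 /F addrAC.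
have hP := @essential_spectrum_index0 R X P (@resolvent0 R) l lR iR domP.
have hS := @essential_spectrum_index0 R X S (@resolvent0 R) l lR iR domS.
rewrite eF in hP; rewrite eG in hS.
have {}hP := hP bF.1; have {}hS := hS bG.1.
have back : F = fun v => (F v - T v) - - T v by apply/funext => v; rewrite opprK subrK.
have st := fredholm0_sub_approx_finrank (@L2_rapidly_complete R) (@dual_family R).
split=> h; apply: contrapT.
- by move/hP => k; move/hS: (st _ _ bF aT k); exact.
- move/hS => k; move: (st _ _ bG (approx_finrankN aT) k); rewrite -back => /hP; exact.
Qed.

End SpectrumTransfer.

End NeelWallOperators.

Theorem corollary4p18 (R : realType) (theta : R -> R)
    (theta_wall : static_neel_wall theta) :
  relatively_compact_perturbation (op_Linfty R) (op_L theta) /\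
  essential_spectrum (op_L theta) = essential_spectrum (op_Linfty R).
Proof.
case: theta_wall => adm hE _ _.
have [T aT hT] := Linfty_sub_L_approx_finrank adm hE.
have dom : @H2_domain R = range (@resolvent0 R).
  by apply/seteqP; split=> [u /H2_resolvent0[v ->]|_ [v _ <-]]; [exists v|exact: resolvent0_H2].
split.
  split; first by [].
  have [h0 hr] := @zero_in_resolvent_set R; exists 0; first exact: h0.
  have -> : (fun v => op_fun (op_Linfty R) (resolvent (op_Linfty R) 0 v) -
      op_fun (op_L theta) (resolvent (op_Linfty R) 0 v)) = T.
    by apply/funext => v; rewrite hr hT opprB addrC subrK.
  exact (approx_finrank_compact (@L2_rapidly_complete R) aT).
exact (@essential_spectrum_finrank_perturbation R (op_Linfty R) (op_L theta) T dom dom aT (@Linfty_resolvent0 R) hT).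
Qed.
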